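(* Let $\epsilon>0$, $g>0$ and the initial data $(h_{\rm init},\dot h_{\rm init})$ (real-valued functions on $\mathbb{S}^1$) be given. Assume that there exists $1<D<\infty$ such that $$h_{\rm init}(x_1)=\epsilon\sum_{|\ell|\le D}a_\ell\,e^{i\ell x_1},\qquad \dot h_{\rm init}(x_1)=\epsilon\sum_{|\ell|\le D,\ \ell\ne0}b_\ell\,e^{i\ell x_1},$$ with coefficients $a_\ell,b_\ell\in\mathbb{C}$. Denote by $(h^{ww},\omega^{ww})$ the local solution in $C([0,T(\epsilon)];X_1)$ of the full water waves problem starting from the initial data $h(\cdot,0)=h_{\rm init}$, $\partial_t h(\cdot,0)=\dot h_{\rm init}$, and let $h^{qm}$ denote the solution to the quadratic $h$-model $$\partial_t^2 h+g\Lambda h=-\Lambda\big(|H\partial_t h|^2\big)+g\Lambda(h\Lambda h)+g\,\partial_1(h\,\partial_1 h)$$ with the same initial data. Then, as long as both solutions exist (that is, for $T$ such that both solutions exist on $[0,T]$), $$\|h^{ww}-h^{qm}\|_{C([0,T];X_{0.5})}\le \mathcal{O}(\epsilon^{3}).$$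
   Context: $\mathbb{S}^1$ is identified with $[-\pi,\pi]$ (functions are $2\pi$-periodic in $x_1$); $\partial_j=\partial/\partial x_j$, $\Delta=\partial_1^2+\partial_2^2$. Fourier coefficients are $\hat f(k)=\frac1{2\pi}\int_{\mathbb{S}^1}f(x_1)e^{-ikx_1}\,dx_1$; $\widehat{Hf}(k)=-i\,\mathrm{sgn}(k)\hat f(k)$, $\widehat{\Lambda f}(k)=|k|\hat f(k)$. For $\tau>0$, $X_\tau=\{u:\mathbb{S}^1\to\mathbb{R}\ :\ \|u\|_{X_\tau}=\sum_{m\in\mathbb{Z}}e^{\tau|m|}|\hat u(m)|<\infty\}$. The parameter $\epsilon$ is the small steepness parameter; $\mathcal{O}(\epsilon^3)$ denotes a quantity bounded by a constant times $\epsilon^3$ as $\epsilon\to0$, the coefficients $a_\ell,b_\ell$, $D$ and $g$ being fixed. Full water waves problem (infinite depth, gravity, no surface tension): the free surface is the graph $x_2=h(x_1,t)$. On the reference domain $\mathcal{D}=\mathbb{S}^1\times(-\infty,0)$ the unknowns are the height $h(x_1,t)$, the tangential velocity $\omega(x_1,t)=\mathbf{u}(x_1,h(x_1,t),t)\cdot(1,\partial_1h)$ (with $\mathbf{u}$ the irrotational, incompressible fluid velocity), and the pulled-back stream function $\varphi(x_1,x_2,t)=\vartheta(x_1,x_2+h(x_1,t),t)$ where $\mathbf{u}=(-\partial_2\vartheta,\partial_1\vartheta)$. They satisfy $$\Delta\varphi=2\,\partial_1h\,\partial_1\partial_2\varphi+\partial_1^2h\,\partial_2\varphi-(\partial_1h)^2\partial_2^2\varphi\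 \text{ in }\mathcal{D},\qquad \partial_2\varphi=\frac{-\omega+\partial_1h\,\partial_1\varphi}{1+(\partial_1h)^2}\ \text{ on }\mathbb{S}^1\times\{0\},$$ (with velocity decaying as $x_2\to-\infty$), together with the evolution equations on $\mathbb{S}^1$ $$\partial_th=\partial_1\varphi|_{x_2=0},\qquad \partial_t\omega=-g\,\partial_1h+\tfrac12\,\partial_1\left[\frac{(\partial_th)^2-\omega^2+2\,\omega\,\partial_th\,\partial_1h}{1+(\partial_1h)^2}\right].$$
   Formalization: The constant in O(ε³) may depend on an arbitrary fixed upper bound for T, besides a_ℓ, b_ℓ, D and g; a constant uniform in T fails, since the phases of the two solutions drift apart by about ε³t while existence times grow as ε→0. *)

(* Defs.v *)
From Stdlib Require Import Reals ZArith.
From Coquelicot Require Import Coquelicot.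
Open Scope R_scope.

(** Functions on the circle are [2 * PI]-periodic functions [R -> R].
    Time-dependent functions take the time as their first argument. *)

Definition periodic (u : R -> R) : Prop := forall x, u (x + 2 * PI) = u x.

(** The symmetric sum of [f m] over the integers [|m| <= N]. *)
Definition Zsum {G : AbelianMonoid} (N : nat) (f : Z -> G) : G :=
  sum_n (fun n => f (Z.of_nat n - Z.of_nat N)%Z) (2 * N).

(** [e^{i y}] *)
Definition cis (y : R) : C := (cos y, sin y).

Definition fourier (u : R -> R) (k : Z) : C :=
  (RtoC (/ (2 * PI)) *
   RInt (V := C_R_CompleteNormedModule)
     (fun x => RtoC (u x) * cis (- (IZR k * x)))%C (- PI) PI)%C.

(** The Fourier multiplier with symbol [m], as the pointwise sum of its Fourier
    series.  Only symbols with [m (-k) = Cconj (m k)] are used, so the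
    symmetric partial sums are real and taking [Re] loses nothing. *)
Definition multiplier (m : Z -> C) (u : R -> R) (x : R) : R :=
  real (Lim_seq (fun N =>
    Re (Zsum N (fun k => (m k * fourier u k * cis (IZR k * x))%C)))).

Definition Hilbert : (R -> R) -> R -> R :=
  multiplier (fun k => (- Ci * RtoC (IZR (Z.sgn k)))%C).

Definition Lambda : (R -> R) -> R -> R :=
  multiplier (fun k => RtoC (IZR (Z.abs k))).

(** The partial sums are nondecreasing, so [Lim_seq] is their true limit,
    equal to [p_infty] when the series diverges. *)
Definition X_norm (tau : R) (u : R -> R) : Rbar :=
  Lim_seq (fun N =>
    Zsum (G := R_AbelianMonoid) N
      (fun m => exp (tau * IZR (Z.abs m)) * Cmod (fourier u m))).

(** Functions with summable Fourier coefficients agree almost everywhere with a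
    continuous function; asking for continuity selects that representative. *)
Definition in_X (tau : R) (u : R -> R) : Prop :=
  periodic u /\ (forall x, continuous u x) /\ Rbar_lt (X_norm tau u) p_infty.

Definition time_interval (T t : R) : Prop := 0 <= t <= T.

(** Membership in [C([0,T]; X_tau)]. *)
Definition in_CX (tau T : R) (u : R -> R -> R) : Prop :=
  forall t, time_interval T t ->
    in_X tau (u t) /\
    forall eta : posreal,
      within (time_interval T) (locally t)
        (fun s => Rbar_lt (X_norm tau (fun x => u s x - u t x)) eta).

Definition CX_norm (tau T : R) (u : R -> R -> R) : Rbar :=
  Rbar_lub (fun r => exists t, time_interval T t /\ r = X_norm tau (u t)).

(** [l] is the derivative at [t] of [f] restricted to [[0,T]]; it is one-sided
    at the endpoints. *)
Definition is_time_derive (T : R) (f : R -> R) (t l : R) : Prop :=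
  filterdiff (K := R_AbsRing) (U := R_NormedModule) (V := R_NormedModule)
    f (within (time_interval T) (locally t)) (fun s => s * l).

(** [F] extends continuously to the point [(x,0)] of the boundary of the lower
    half-plane, with value [l]. *)
Definition has_trace (F : R -> R -> R) (x l : R) : Prop :=
  filterlim (fun z : R * R => F (fst z) (snd z))
    (within (fun z : R * R => snd z < 0) (locally (x, 0))) (locally l).

(** [phi] is the pulled-back stream function of the fluid with height [h] and
    tangential velocity [w] at a fixed time, and [p] is the trace of
    [d_1 phi].  The last clause is the decay of the velocity
    [(- d_2 theta, d_1 theta)], with [theta] the stream function in the physical
    domain, expressed through [phi]; it is uniform in the horizontal variable. *)
Definition stream_function (h w : R -> R) (phi : R -> R -> R) (p : R -> R)
  : Prop :=
  let h1 := Derive h in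
  let h11 := Derive_n h 2 in
  let d1 := partial_derive 1 0 phi in
  let d2 := partial_derive 0 1 phi in
  let d11 := partial_derive 2 0 phi in
  let d12 := partial_derive 1 1 phi in
  let d22 := partial_derive 0 2 phi in
  (forall x y, y < 0 -> phi (x + 2 * PI) y = phi x y) /\
  (forall x y, y < 0 -> ex_diff_n phi 2 x y) /\
  (forall x y, y < 0 ->
     d11 x y + d22 x y
     = 2 * h1 x * d12 x y + h11 x * d2 x y - (h1 x) ^ 2 * d22 x y) /\
  (forall x, has_trace d1 x (p x)) /\
  (forall x, has_trace d2 x ((- w x + h1 x * p x) / (1 + (h1 x) ^ 2))) /\
  (forall eta : posreal, exists M : R, forall x y, y < 0 -> y < M ->
     Rabs (- d2 x y) < eta /\ Rabs (d1 x y - h1 x * d2 x y) < eta).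

(** [(h,w)] is a solution in [C([0,T]; X_1)] of the full water waves problem
    with [h(.,0) = hinit] and [d_t h(.,0) = hdot]. *)
Definition water_waves_solution (g : R) (hinit hdot : R -> R) (T : R)
  (h w : R -> R -> R) : Prop :=
  in_CX 1 T h /\ in_CX 1 T w /\
  exists (phi : R -> R -> R -> R) (ht : R -> R -> R),
    (forall t, time_interval T t ->
       let bracket := fun x =>
         ((ht t x) ^ 2 - (w t x) ^ 2 + 2 * w t x * ht t x * Derive (h t) x)
         / (1 + (Derive (h t) x) ^ 2) in
       stream_function (h t) (w t) (phi t) (ht t) /\
       forall x,
         is_time_derive T (fun s => h s x) t (ht t x) /\
         ex_derive bracket x /\
         is_time_derive T (fun s => w s x) t
           (- g * Derive (h t) x + 1 / 2 * Derive bracket x)) /\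
    (forall x, h 0 x = hinit x /\ ht 0 x = hdot x).

(** [h] solves the quadratic [h]-model, with [h] and [d_t h] in
    [C([0,T]; X_{1/2})], [h(.,0) = hinit] and [d_t h(.,0) = hdot]. *)
Definition quadratic_model_solution (g : R) (hinit hdot : R -> R) (T : R)
  (h : R -> R -> R) : Prop :=
  in_CX (1 / 2) T h /\
  exists ht htt : R -> R -> R,
    in_CX (1 / 2) T ht /\
    (forall t x, time_interval T t ->
       is_time_derive T (fun s => h s x) t (ht t x) /\
       is_time_derive T (fun s => ht s x) t (htt t x) /\
       htt t x + g * Lambda (h t) x
       = - Lambda (fun y => (Rabs (Hilbert (ht t) y)) ^ 2) x
         + g * Lambda (fun y => h t y * Lambda (h t) y) x
         + g * Derive (fun y => h t y * Derive (h t) y) x) /\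
    (forall x, h 0 x = hinit x /\ ht 0 x = hdot x).

(** The trigonometric sum of [c l * e^{i l x}] over the integers [|l| <= D],
    for a real bound [D >= 0] ([Int_part] is the floor). *)
Definition trig_sum (D : R) (c : Z -> C) (x : R) : C :=
  Zsum (Z.to_nat (Int_part D)) (fun l => (c l * cis (IZR l * x))%C).

(* Main.v *)
Require Import Defs.
From Stdlib Require Import Reals ZArith.
From Coquelicot Require Import Coquelicot.
From Stdlib Require Import List Lra Lia Psatz ClassicalEpsilon.
Import ListNotations.
Open Scope R_scope.

(** Let [gamma x = x + i h x] parametrize the surface and [E_k = e^{- i k gamma}].
    The complex velocity [u_1 - i u_2] is holomorphic below the curve and decays, as
    do the [e^{- i k z}] with [k > 0]; its trace times [gamma'] is [f = w - i d_t h].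
    By Cauchy's theorem the moments of [f] against [E_k], [k >= 0], vanish
    ([moments]), and nothing else about the flow is needed.  For a small [h] these
    relations determine [f] from [w], or from [d_t h], with analytic bounds
    ([elliptic]).  Sizes are measured by weighted sums of Fourier coefficients,
    [W rho].

    The full problem is almost linear in the moments, for [k > 0],
    [sigma_k = (1/pi) int E_k dx] and [G_k = (1/(2 pi)) int (conj f) E_k dx]:
    [sigma_k' = - i k G_k] and [G_k' = - i g sigma_k - i k Q_k], where [Q_k] are the
    moments of [(conj f)^2 / conj gamma'] ([sigma_dot], [G_dot]).  The curve exponentials
    are complete ([curve_complete]), so that [Q] is a series of convolutions of [G]
    and [sigma] ([nl_est]), quadratic but losing one derivative.  The data are
    analytic in a strip of any width, and weights that decrease in time at a rate
    proportional to [|k|] absorb this loss; as the solution is small, a rate of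
    order [1 / Tmax] suffices, and part of the strip is left on all of [0,Tmax]
    ([propagate_decay]).  The moments determine [h] and [f] ([recover_h],
    [recover_f]), and continuous induction in time yields a bound [O(eps)] in spaces
    of analytic functions as long as the solution exists ([ww_bound]).  The same
    argument applies to the quadratic model ([qm_bound]), thanks to a cancellation
    between its two terms quadratic in [h] ([qm_symbol]).

    To second order, [sigma_k] is [2 k h_k + k^2 (h^2)_k] and [G_k] is
    [2 i (d_t h)_k + 2 i k (h d_t h)_k].  The same expressions formed with the solution
    of the model satisfy the same linear system, with [- Q_k] replaced by
    [(Z^2)_k] up to a cubic term, where [Z = d_t h + i H d_t h] ([gq_dot]).  Hence the
    differences solve the linear system forced by [Q_k + (Z^2)_k + O(eps^3)].  Each
    term being [O(eps^2)], so are the differences ([stage1]); in particular [conj f]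
    and [i Z] differ by [O(eps^2)] ([trace_diff]), which makes [Q + Z^2], and then the
    difference of the heights, [O(eps^3)] ([force_cubic], [height2]).  Every step
    gives up a little of the decay of the coefficients. *)


(** * Unconditional sums over the integers *)

Notation zabs k := (IZR (Z.abs k)).
Ltac epos := left; apply exp_pos.

Definition lsum (l : list Z) (a : Z -> R) : R :=
  fold_right (fun k s => a k + s) 0 l.

Definition csum (l : list Z) (u : Z -> C) : C :=
  fold_right (fun k s => (u k + s)%C) (RtoC 0) l.

(** For nonnegative [a] this says that [a] is summable with sum at most [A].
    Quantifying over all finite sets makes the notion invariant under
    translations and reflections of the index. *)
Definition bnd (a : Z -> R) (A : R) : Prop :=
  forall l, NoDup l -> lsum l a <= A.

Fixpoint win (N : nat) : list Z :=
  match N with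
  | O => [0%Z]
  | S n => Z.of_nat (S n) :: (- Z.of_nat (S n))%Z :: win n
  end.

(** Symmetric partial sums, as in the definition of [multiplier]; being a total
    function, it needs [summable] to be meaningful. *)
Definition Zser (u : Z -> C) : C :=
  (real (Lim_seq (fun N => Re (csum (win N) u))),
   real (Lim_seq (fun N => Im (csum (win N) u)))).

Definition zlim (u : Z -> C) (s : C) : Prop :=
  forall eps, 0 < eps -> exists N0, forall N, (N0 <= N)%nat ->
    Cmod (csum (win N) u - s)%C <= eps.

Definition summable (u : Z -> C) : Prop := exists A, bnd (fun k => Cmod (u k)) A.

Lemma win_in : forall N k, In k (win N) <-> (Z.abs k <= Z.of_nat N)%Z.
Proof.
  induction N as [|N IH]; intros k; cbn [win In].
  - simpl. lia.
  - rewrite IH. lia.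
Qed.

Lemma win_NoDup : forall N, NoDup (win N).
Proof.
  induction N as [|N IH]; cbn [win].
  - constructor; [intros []|constructor].
  - constructor; [|constructor]; auto.
    + intros [H|H]; [lia|]. apply win_in in H. lia.
    + intros H. apply win_in in H. lia.
Qed.

Lemma lsum_le : forall l a b, (forall k, In k l -> a k <= b k) -> lsum l a <= lsum l b.
Proof.
  induction l as [|x l IH]; intros a b H; simpl; [lra|].
  apply Rplus_le_compat; [apply H; now left|apply IH; intros; apply H; now right].
Qed.

Lemma lsum_ext : forall l a b, (forall k, In k l -> a k = b k) -> lsum l a = lsum l b.
Proof.
  intros; apply Rle_antisym; apply lsum_le; intros k Hk; rewrite (H k Hk); lra.
Qed.

Lemma lsum_nonneg : forall l a, (forall k, 0 <= a k) -> 0 <= lsum l a.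
Proof.
  induction l as [|x l IH]; intros a H; simpl; [lra|].
  specialize (H x) as Hx. specialize (IH a H). lra.
Qed.

Lemma lsum_plus : forall l a b, lsum l (fun k => a k + b k) = lsum l a + lsum l b.
Proof. induction l as [|x l IH]; intros; simpl; [ring|rewrite IH; ring]. Qed.

Lemma lsum_scal : forall l c a, lsum l (fun k => c * a k) = c * lsum l a.
Proof. induction l as [|x l IH]; intros; simpl; [ring|rewrite IH; ring]. Qed.

Lemma lsum_app : forall l m a, lsum (l ++ m) a = lsum l a + lsum m a.
Proof. induction l as [|x l IH]; intros; simpl; [ring|rewrite IH; ring]. Qed.

Lemma lsum_map : forall l f a, lsum (map f l) a = lsum l (fun k => a (f k)).
Proof. induction l as [|x l IH]; intros; simpl; [ring|rewrite IH; ring]. Qed.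

Lemma lsum_swap : forall l m (F : Z -> Z -> R),
  lsum l (fun k => lsum m (fun j => F k j)) = lsum m (fun j => lsum l (fun k => F k j)).
Proof.
  induction l as [|x l IH]; intros m F; simpl.
  - induction m as [|y m IHm]; simpl; [ring|rewrite <- IHm; ring].
  - rewrite IH, <- lsum_plus. reflexivity.
Qed.

Lemma csum_plus : forall l u v, csum l (fun k => u k + v k)%C = (csum l u + csum l v)%C.
Proof. induction l as [|x l IH]; intros; simpl; [ring|rewrite IH; ring]. Qed.

Lemma csum_scal : forall l c u, csum l (fun k => c * u k)%C = (c * csum l u)%C.
Proof. induction l as [|x l IH]; intros; simpl; [ring|rewrite IH; ring]. Qed.

Lemma csum_ext : forall l u v, (forall k, In k l -> u k = v k) -> csum l u = csum l v.
Proof.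
  induction l as [|x l IH]; intros u v H; simpl; [reflexivity|].
  rewrite (H x) by (now left). f_equal. apply IH; intros; apply H; now right.
Qed.

Lemma csum_RtoC : forall l a, csum l (fun k => RtoC (a k)) = RtoC (lsum l a).
Proof.
  induction l as [|x l IH]; intros a; simpl; auto. rewrite IH, <- RtoC_plus. reflexivity.
Qed.

Lemma csum_Cmod : forall l u, Cmod (csum l u) <= lsum l (fun k => Cmod (u k)).
Proof.
  induction l as [|x l IH]; intros; simpl.
  - rewrite Cmod_0; lra.
  - eapply Rle_trans; [apply Cmod_triangle|]. specialize (IH u). lra.
Qed.

Lemma Zsum_S : forall (G : AbelianMonoid) N (f : Z -> G),
  Zsum (S N) f = plus (f (Z.of_nat (S N))) (plus (f (- Z.of_nat (S N))%Z) (Zsum N f)).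
Proof.
  intros G N f. unfold Zsum.
  replace (2 * S N)%nat with (S (S (2 * N))) by lia.
  rewrite sum_Sn, plus_comm. f_equal; [f_equal; lia|].
  unfold sum_n. rewrite sum_Sn_m by lia. f_equal.
  rewrite <- sum_n_m_S. apply sum_n_m_ext. intros; f_equal; lia.
Qed.

Lemma Zsum_csum : forall N (u : Z -> C), Zsum N u = csum (win N) u.
Proof.
  induction N as [|N IH]; intros u.
  - unfold Zsum. simpl. rewrite sum_O. simpl. rewrite Cplus_0_r. reflexivity.
  - rewrite Zsum_S, IH. reflexivity.
Qed.

Lemma Zsum_lsum : forall N (a : Z -> R), Zsum (G := R_AbelianMonoid) N a = lsum (win N) a.
Proof.
  induction N as [|N IH]; intros u.
  - unfold Zsum. simpl. rewrite sum_O. simpl. rewrite Rplus_0_r. reflexivity.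
  - rewrite Zsum_S, IH. reflexivity.
Qed.

Lemma lsum_incl : forall l m a, (forall k, 0 <= a k) -> NoDup l -> incl l m -> lsum l a <= lsum m a.
Proof.
  induction l as [|x l IH]; intros m a Ha Hl Hi; simpl.
  - now apply lsum_nonneg.
  - inversion Hl; subst.
    destruct (in_split x m) as (m1 & m2 & ->); [apply Hi; now left|].
    rewrite lsum_app; simpl.
    assert (lsum l a <= lsum (m1 ++ m2) a).
    { apply IH; auto. intros y Hy. specialize (Hi y (or_intror Hy)).
      apply in_app_iff in Hi. apply in_app_iff. destruct Hi as [Hi|[Hi|Hi]]; auto.
      subst; contradiction. }
    rewrite lsum_app in H. lra.
Qed.

Lemma list_in_win : forall l, exists N, incl l (win N).
Proof.
  induction l as [|x l [N HN]].
  - exists O. intros y [].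
  - exists (Nat.max N (Z.to_nat (Z.abs x))). intros y [<-|Hy]; apply win_in; [lia|].
    apply HN, win_in in Hy. lia.
Qed.

Lemma bnd_win : forall a A, (forall k, 0 <= a k) -> (forall N, lsum (win N) a <= A) -> bnd a A.
Proof.
  intros a A Ha H l Hl. destruct (list_in_win l) as [N HN].
  eapply Rle_trans; [apply (lsum_incl l (win N))|]; auto.
Qed.

Lemma bnd_nonneg : forall a A, bnd a A -> 0 <= A.
Proof. intros a A H. specialize (H [] (NoDup_nil _)). exact H. Qed.

Lemma bnd_le : forall a A B, bnd a A -> A <= B -> bnd a B.
Proof. intros a A B H HAB l Hl. specialize (H l Hl). lra. Qed.

Lemma bnd_mono : forall a b A, bnd b A -> (forall k, a k <= b k) -> bnd a A.
Proof.
  intros a b A H Hab l Hl. eapply Rle_trans; [apply lsum_le|apply H]; auto.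
Qed.

Lemma bnd_plus : forall a b A B, bnd a A -> bnd b B -> bnd (fun k => a k + b k) (A + B).
Proof. intros a b A B Ha Hb l Hl. rewrite lsum_plus. apply Rplus_le_compat; auto. Qed.

Lemma bnd_scal : forall a A c, 0 <= c -> bnd a A -> bnd (fun k => c * a k) (c * A).
Proof. intros a A c Hc Ha l Hl. rewrite lsum_scal. apply Rmult_le_compat_l; auto. Qed.

Lemma bnd_reindex : forall a A f, (forall i j, f i = f j -> i = j) -> bnd a A -> bnd (fun k => a (f k)) A.
Proof.
  intros a A f Hf H l Hl. rewrite <- lsum_map. apply H.
  clear H. induction Hl as [|x l Hx Hl IH]; simpl; constructor; auto.
  intros Hin. apply in_map_iff in Hin. destruct Hin as (y & Hy & Hyl).
  apply Hf in Hy. now subst.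
Qed.

Lemma bnd_shift : forall a A j, bnd a A -> bnd (fun k => a (k - j)%Z) A.
Proof. intros a A j. apply (bnd_reindex a A (fun k => (k - j)%Z)). intros; lia. Qed.

Lemma bnd_term : forall a A k, bnd a A -> a k <= A.
Proof.
  intros a A k H. specialize (H [k]). simpl in H. rewrite Rplus_0_r in H. apply H.
  constructor; [intros []|constructor].
Qed.

(** The least bound is the sum; absorbing a small multiple of the sum into
    itself only needs its existence. *)
Lemma bnd_least : forall a A, bnd a A -> exists S, bnd a S /\ (forall B, bnd a B -> S <= B).
Proof.
  intros a A H.
  destruct (completeness (fun x => exists l, NoDup l /\ x = lsum l a)) as [S [H1 H2]].
  - exists A. intros x (l & Hl & ->). auto.
  - exists 0, []. split; [constructor|reflexivity].
  - exists S. split.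
    + intros l Hl. apply H1. now exists l.
    + intros B HB. apply H2. intros x (l & Hl & ->). auto.
Qed.

Lemma bnd_tail : forall a A, bnd a A -> forall eps, 0 < eps ->
  exists N0, forall l, NoDup l -> (forall k, In k l -> ~ In k (win N0)) -> (forall k, 0 <= a k) ->
    lsum l a <= eps.
Proof.
  intros a A H eps Heps. destruct (bnd_least a A H) as (S & HS & Hmin).
  destruct (Classical_Prop.classic (exists l, NoDup l /\ S - eps < lsum l a)) as [(l0 & Hl0 & Hs)|Hn].
  - destruct (list_in_win l0) as [N0 HN0]. exists N0. intros l Hl Hd Hpos.
    assert (lsum (l0 ++ l) a <= S).
    { apply HS. apply NoDup_app; auto. intros k Hk Hk'. apply (Hd k Hk'), HN0, Hk. }
    rewrite lsum_app in H0. lra.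
  - exfalso. assert (S <= S - eps); [|lra]. apply Hmin. intros l Hl.
    destruct (Rle_or_lt (lsum l a) (S - eps)); auto. exfalso; apply Hn; eauto.
Qed.

Fixpoint ring_list (M n : nat) : list Z :=
  match n with
  | O => []
  | S n' => Z.of_nat (S (n' + M)) :: (- Z.of_nat (S (n' + M)))%Z :: ring_list M n'
  end.

Lemma ring_list_in : forall M n k, In k (ring_list M n) ->
  (Z.of_nat M < Z.abs k <= Z.of_nat (n + M))%Z.
Proof.
  intros M n k; induction n as [|n IH]; cbn [ring_list In]; [intros []|].
  intros [H|[H|H]]; [lia|lia|]. specialize (IH H). lia.
Qed.

Lemma ring_list_NoDup : forall M n, NoDup (ring_list M n).
Proof.
  induction n as [|n IH]; cbn [ring_list]; constructor; [|constructor]; auto.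
  - intros [H|H]; [lia|]. apply ring_list_in in H. lia.
  - intros H. apply ring_list_in in H. lia.
Qed.

Lemma csum_win_add : forall M n u,
  csum (win (n + M)) u = (csum (ring_list M n) u + csum (win M) u)%C.
Proof.
  induction n as [|n IH]; intros u.
  - symmetry. apply Cplus_0_l.
  - change (csum (win (S n + M)) u) with
      (u (Z.of_nat (S (n + M))) + (u (- Z.of_nat (S (n + M)))%Z + csum (win (n + M)) u))%C.
    change (csum (ring_list M (S n)) u) with
      (u (Z.of_nat (S (n + M))) + (u (- Z.of_nat (S (n + M)))%Z + csum (ring_list M n) u))%C.
    rewrite IH. ring.
Qed.

Lemma im_le_Cmod : forall z : C, Rabs (Im z) <= Cmod z.
Proof. intros z. eapply Rle_trans; [|apply Rmax_Cmod]. apply Rmax_r. Qed.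

Lemma zlim_unique : forall u s t, zlim u s -> zlim u t -> s = t.
Proof.
  intros u s t Hs Ht.
  assert (H : Cmod (s - t) <= 0).
  { apply Rnot_lt_le. intros H.
    destruct (Hs (Cmod (s - t) / 3)) as [N1 H1]; [lra|].
    destruct (Ht (Cmod (s - t) / 3)) as [N2 H2]; [lra|].
    specialize (H1 (Nat.max N1 N2) ltac:(lia)). specialize (H2 (Nat.max N1 N2) ltac:(lia)).
    set (x := csum _ _) in *.
    assert (Cmod (s - t) <= Cmod (x - s) + Cmod (x - t)); [|lra].
    rewrite <- (Cmod_opp (x - s)). replace (s - t)%C with (- (x - s) + (x - t))%C by ring.
    apply Cmod_triangle. }
  assert (s - t = 0)%C. { apply Cmod_eq_0. pose proof (Cmod_ge_0 (s - t)). lra. }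
  replace s with ((s - t) + t)%C by ring. rewrite H0. apply Cplus_0_l.
Qed.

Lemma zlim_Zser_eq : forall u s, zlim u s -> Zser u = s.
Proof.
  intros u s H.
  assert (forall p : C -> R, (forall z, Rabs (p z) <= Cmod z) -> (forall z w, p (z - w)%C = p z - p w) ->
     is_lim_seq (fun N => p (csum (win N) u)) (p s)).
  { intros p Hp Hm. apply is_lim_seq_spec. intros e. destruct (H (e / 2)) as [N0 HN].
    { destruct e; simpl; lra. }
    exists N0. intros n Hn. rewrite <- Hm. eapply Rle_lt_trans; [apply Hp|].
    eapply Rle_lt_trans; [apply HN, Hn|]. destruct e; simpl; lra. }
  unfold Zser. rewrite (is_lim_seq_unique _ _ (H0 Re re_le_Cmod (fun _ _ => eq_refl))),
    (is_lim_seq_unique _ _ (H0 Im im_le_Cmod (fun _ _ => eq_refl))).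
  now destruct s.
Qed.

Lemma summable_zlim : forall u, summable u -> zlim u (Zser u).
Proof.
  intros u [A HA].
  assert (HC : forall eps, 0 < eps -> exists N0, forall N M, (N0 <= N)%nat -> (N0 <= M)%nat ->
     Cmod (csum (win N) u - csum (win M) u) <= eps).
  { intros eps He. destruct (bnd_tail _ _ HA (eps / 2) ltac:(lra)) as [N0 HN0]. exists N0.
    assert (forall N, (N0 <= N)%nat -> Cmod (csum (win N) u - csum (win N0) u) <= eps / 2).
    { intros N HN. replace N with ((N - N0) + N0)%nat by lia. rewrite csum_win_add.
      match goal with |- Cmod ?z <= _ => replace z with (csum (ring_list N0 (N - N0)) u) by ring end.
      eapply Rle_trans; [apply csum_Cmod|]. apply HN0.
      - apply ring_list_NoDup.
      - intros k Hk Hw. apply ring_list_in in Hk. apply win_in in Hw. lia.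
      - intros; apply Cmod_ge_0. }
    intros N M HN HM. specialize (H N HN) as H1. specialize (H M HM) as H2.
    replace (csum (win N) u - csum (win M) u)%C with
      ((csum (win N) u - csum (win N0) u) + - (csum (win M) u - csum (win N0) u))%C by ring.
    eapply Rle_trans; [apply Cmod_triangle|]. rewrite Cmod_opp. lra. }
  assert (HL : forall p : C -> R, (forall z, Rabs (p z) <= Cmod z) -> (forall z w, p (z - w)%C = p z - p w) ->
     forall eps, 0 < eps -> exists N0, forall N, (N0 <= N)%nat ->
        Rabs (p (csum (win N) u) - real (Lim_seq (fun N => p (csum (win N) u)))) <= eps).
  { intros p Hp Hm eps He.
    assert (ex_finite_lim_seq (fun N => p (csum (win N) u))) as Hex.
    { apply ex_lim_seq_cauchy_corr. intros e. destruct (HC (e / 2)) as [N0 HN0]; [destruct e; simpl; lra|].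
      exists N0. intros n m Hn Hm'. rewrite <- Hm. eapply Rle_lt_trans; [apply Hp|].
      eapply Rle_lt_trans; [apply HN0; assumption|]. destruct e; simpl; lra. }
    apply Lim_seq_correct' in Hex. apply is_lim_seq_spec in Hex.
    destruct (Hex (mkposreal eps He)) as [N0 HN0]. exists N0. intros N HN. apply Rlt_le, HN0, HN. }
  intros eps He.
  destruct (HL Re re_le_Cmod (fun _ _ => eq_refl) (eps / 2) ltac:(lra)) as [N1 H1].
  destruct (HL Im im_le_Cmod (fun _ _ => eq_refl) (eps / 2) ltac:(lra)) as [N2 H2].
  exists (Nat.max N1 N2). intros N HN. specialize (H1 N ltac:(lia)). specialize (H2 N ltac:(lia)).
  eapply Rle_trans; [apply Cmod_2Rmax|].
  assert (Hs : sqrt 2 <= 2) by (rewrite <- (sqrt_Rsqr 2) at 2 by lra; apply sqrt_le_1; unfold Rsqr; lra).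
  assert (Hr : Rmax (Rabs (fst (csum (win N) u - Zser u)%C)) (Rabs (snd (csum (win N) u - Zser u)%C)) <= eps / 2).
  { apply Rmax_lub; [exact H1|exact H2]. }
  assert (0 <= sqrt 2) by apply sqrt_pos.
  apply Rle_trans with (2 * (eps / 2)); [|lra].
  apply Rmult_le_compat; auto.
  eapply Rle_trans; [apply Rabs_pos|apply Rmax_l].
Qed.

(** Weierstrass M-test: the rate of convergence depends on the majorant only. *)
Lemma zser_uniform : forall a A, bnd a A -> forall eps, 0 < eps ->
  exists N0, forall N, (N0 <= N)%nat -> forall u, (forall k, Cmod (u k) <= a k) ->
    Cmod (csum (win N) u - Zser u) <= eps.
Proof.
  intros a A HA eps He. destruct (bnd_tail _ _ HA (eps / 2) ltac:(lra)) as [N0 HN0].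
  exists N0. intros N HN u Hu.
  assert (Hs : summable u) by (exists A; eapply bnd_mono; eauto).
  destruct (summable_zlim u Hs (eps / 2) ltac:(lra)) as [N1 HN1].
  specialize (HN1 (N1 + N)%nat ltac:(lia)). rewrite csum_win_add in HN1.
  assert (Cmod (csum (ring_list N N1) u) <= eps / 2).
  { eapply Rle_trans; [apply csum_Cmod|]. eapply Rle_trans; [apply lsum_le; intros; apply Hu|].
    apply HN0.
    - apply ring_list_NoDup.
    - intros k Hk Hw. apply ring_list_in in Hk. apply win_in in Hw. lia.
    - intros; eapply Rle_trans; [apply Cmod_ge_0|apply Hu]. }
  match goal with |- Cmod ?z <= _ =>
    replace z with ((csum (ring_list N N1) u + csum (win N) u - Zser u) + - csum (ring_list N N1) u)%C by ring end.
  eapply Rle_trans; [apply Cmod_triangle|]. rewrite Cmod_opp. lra.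
Qed.

Lemma summable_bnd : forall u a A, bnd a A -> (forall k, Cmod (u k) <= a k) -> summable u.
Proof. intros u a A HA H. exists A. eapply bnd_mono; eauto. Qed.

Lemma zlim_ext : forall u v s, (forall k, u k = v k) -> zlim u s -> zlim v s.
Proof.
  intros u v s H Hu eps He. destruct (Hu eps He) as [N0 HN]. exists N0. intros N HN'.
  rewrite <- (csum_ext _ u); auto.
Qed.

Lemma zlim_plus : forall u v s t, zlim u s -> zlim v t -> zlim (fun k => u k + v k)%C (s + t)%C.
Proof.
  intros u v s t Hu Hv eps He. destruct (Hu (eps / 2) ltac:(lra)) as [N1 H1].
  destruct (Hv (eps / 2) ltac:(lra)) as [N2 H2].
  exists (Nat.max N1 N2). intros N HN. rewrite csum_plus.
  specialize (H1 N ltac:(lia)). specialize (H2 N ltac:(lia)).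
  match goal with |- Cmod ?z <= _ => replace z with ((csum (win N) u - s) + (csum (win N) v - t))%C by ring end.
  eapply Rle_trans; [apply Cmod_triangle|lra].
Qed.

Lemma zlim_scal : forall u s c, zlim u s -> zlim (fun k => c * u k)%C (c * s)%C.
Proof.
  intros u s c Hu eps He. pose proof (Cmod_ge_0 c) as Hc.
  destruct (Hu (eps / (Cmod c + 1))) as [N1 H1].
  { apply Rdiv_lt_0_compat; lra. }
  exists N1. intros N HN. rewrite csum_scal. specialize (H1 N HN).
  replace (c * csum (win N) u - c * s)%C with (c * (csum (win N) u - s))%C by ring.
  rewrite Cmod_mult. apply Rle_trans with (Cmod c * (eps / (Cmod c + 1))).
  - apply Rmult_le_compat_l; auto.
  - apply Rmult_le_reg_r with (Cmod c + 1); [lra|]. field_simplify; [|lra].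
    lra.
Qed.

Lemma csum_single : forall l c j, NoDup l -> In j l ->
  csum l (fun k => if Z.eqb k j then c else RtoC 0) = c.
Proof.
  induction l as [|x l IH]; intros c j Hn Hi; [destruct Hi|]. inversion Hn; subst.
  simpl. destruct (Z.eqb_spec x j) as [->|Hx].
  - replace (csum l _) with (RtoC 0); [apply Cplus_0_r|].
    clear - H1. induction l as [|y l IH]; [reflexivity|]. simpl.
    destruct (Z.eqb_spec y j) as [->|]; [exfalso; apply H1; now left|].
    rewrite <- IH; [ring|]. intros H; apply H1; now right.
  - destruct Hi as [->|Hi]; [contradiction|]. rewrite IH; auto. apply Cplus_0_l.
Qed.

Lemma zlim_single : forall c j, zlim (fun k => if Z.eqb k j then c else RtoC 0) c.
Proof.
  intros c j eps He. exists (Z.to_nat (Z.abs j)). intros N HN.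
  rewrite csum_single; [|apply win_NoDup|apply win_in; lia].
  replace (c - c)%C with (RtoC 0) by ring. rewrite Cmod_0. lra.
Qed.

Lemma zlim_Cmod : forall u s A, zlim u s -> (forall N, Cmod (csum (win N) u) <= A) -> Cmod s <= A.
Proof.
  intros u s A H HA. apply Rnot_lt_le; intros Hlt.
  destruct (H ((Cmod s - A) / 2)) as [N HN]; [lra|]. specialize (HN N (le_n _)).
  specialize (HA N). set (x := csum _ _) in *.
  assert (Cmod s <= Cmod x + Cmod (x - s)); [|lra].
  replace s with (x + - (x - s))%C at 1 by ring.
  eapply Rle_trans; [apply Cmod_triangle|]. rewrite Cmod_opp. lra.
Qed.

Lemma Zser_Cmod : forall u A, bnd (fun k => Cmod (u k)) A -> Cmod (Zser u) <= A.
Proof.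
  intros u A H. apply (zlim_Cmod u); [apply summable_zlim; now exists A|].
  intros N. eapply Rle_trans; [apply csum_Cmod|]. apply H, win_NoDup.
Qed.

Lemma Zser_ext : forall u v, (forall k, u k = v k) -> Zser u = Zser v.
Proof.
  intros u v H. unfold Zser. f_equal; f_equal; apply Lim_seq_ext; intros N;
    rewrite (csum_ext _ u v); auto.
Qed.

Lemma zlim_list : forall (u : Z -> Z -> C) s l, (forall k, zlim (u k) (s k)) ->
  forall eps, 0 < eps -> exists N, forall k, In k l -> Cmod (csum (win N) (u k) - s k) <= eps.
Proof.
  intros u s l H eps He.
  assert (exists N0, forall N, (N0 <= N)%nat -> forall k, In k l -> Cmod (csum (win N) (u k) - s k) <= eps) as [N HN].
  { induction l as [|x l [N1 IH]].
    - exists O. intros N _ k [].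
    - destruct (H x eps He) as [N2 H2]. exists (Nat.max N1 N2). intros N HN k [<-|Hk].
      + apply H2; lia.
      + apply IH; auto; lia. }
  exists N. auto.
Qed.

Definition conv (u v : Z -> C) (k : Z) : C := Zser (fun j => u j * v (k - j)%Z)%C.

(** The weights [p], [a], [b], [c], [d] cover at once the submultiplicative
    estimate of a product and its version with one derivative, distributed over
    the two factors. *)
Lemma conv_bnd : forall (p a b c d : Z -> R) u v A B C D,
  (forall k, 0 <= p k) -> (forall k, 0 <= a k) -> (forall k, 0 <= b k) ->
  (forall k, 0 <= c k) -> (forall k, 0 <= d k) ->
  (forall j k, p k <= a j * b (k - j)%Z + c j * d (k - j)%Z) ->
  bnd (fun k => a k * Cmod (u k)) A -> bnd (fun k => b k * Cmod (v k)) B ->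
  bnd (fun k => c k * Cmod (u k)) C -> bnd (fun k => d k * Cmod (v k)) D ->
  (forall k, summable (fun j => u j * v (k - j)%Z)%C) ->
  bnd (fun k => p k * Cmod (conv u v k)) (A * B + C * D).
Proof.
  intros p a b c d u v A B C D Hp Ha Hb Hc Hd H HA HB HC HD Hs l Hl.
  assert (Hfin : forall N, lsum l (fun k => p k * Cmod (csum (win N) (fun j => u j * v (k - j)%Z)%C)) <= A * B + C * D).
  { intros N.
    apply Rle_trans with (lsum l (fun k => lsum (win N) (fun j =>
        (a j * Cmod (u j)) * (b (k - j)%Z * Cmod (v (k - j)%Z)) +
        (c j * Cmod (u j)) * (d (k - j)%Z * Cmod (v (k - j)%Z))))).
    { apply lsum_le. intros k _.
      apply Rle_trans with (p k * lsum (win N) (fun j => Cmod (u j * v (k - j)%Z)%C)).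
      { apply Rmult_le_compat_l; auto. apply csum_Cmod. }
      rewrite <- lsum_scal. apply lsum_le. intros j _. rewrite Cmod_mult.
      specialize (H j k).
      assert (0 <= Cmod (u j) * Cmod (v (k - j)%Z)) by (apply Rmult_le_pos; apply Cmod_ge_0).
      apply Rle_trans with ((a j * b (k - j)%Z + c j * d (k - j)%Z) * (Cmod (u j) * Cmod (v (k - j)%Z))).
      - apply Rmult_le_compat_r; auto.
      - right; ring. }
    rewrite lsum_swap.
    assert (forall x y X Y, bnd (fun k => x k * Cmod (u k)) X -> bnd (fun k => y k * Cmod (v k)) Y ->
       (forall k, 0 <= x k) ->
       lsum (win N) (fun j => lsum l (fun k => (x j * Cmod (u j)) * (y (k - j)%Z * Cmod (v (k - j)%Z)))) <= X * Y).
    { intros x y X Y HX HY Hx.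
      apply Rle_trans with (lsum (win N) (fun j => Y * (x j * Cmod (u j)))).
      - apply lsum_le. intros j _. rewrite lsum_scal, Rmult_comm.
        apply Rmult_le_compat_r; [apply Rmult_le_pos; [auto|apply Cmod_ge_0]|].
        exact (bnd_shift _ _ j HY l Hl).
      - rewrite lsum_scal, Rmult_comm. apply Rmult_le_compat_r.
        + eapply bnd_nonneg; eauto.
        + apply HX, win_NoDup. }
    rewrite (lsum_ext _ _ (fun j => lsum l (fun k => (a j * Cmod (u j)) * (b (k - j)%Z * Cmod (v (k - j)%Z))) +
       lsum l (fun k => (c j * Cmod (u j)) * (d (k - j)%Z * Cmod (v (k - j)%Z))))).
    2:{ intros j _. apply lsum_plus. }
    rewrite lsum_plus. apply Rplus_le_compat; apply H0; auto. }
  apply Rnot_lt_le. intros Hlt.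
  set (e := lsum l (fun k => p k * Cmod (conv u v k)) - (A * B + C * D)) in *.
  assert (0 < e) by (unfold e; lra).
  assert (0 <= lsum l p) by (apply lsum_nonneg; auto).
  destruct (zlim_list (fun k j => u j * v (k - j)%Z)%C (conv u v) l) with (eps := e / (2 * (lsum l p + 1))) as [N HN].
  { intros k. apply summable_zlim, Hs. }
  { apply Rdiv_lt_0_compat; lra. }
  assert (lsum l (fun k => p k * Cmod (conv u v k)) <=
     lsum l (fun k => p k * Cmod (csum (win N) (fun j => u j * v (k - j)%Z)%C) + e / (2 * (lsum l p + 1)) * p k)).
  { apply lsum_le. intros k Hk. specialize (HN k Hk). set (z := csum _ _) in *.
    assert (Cmod (conv u v k) <= Cmod z + e / (2 * (lsum l p + 1))).
    { replace (conv u v k) with (z + - (z - conv u v k))%C at 1 by ring.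
      eapply Rle_trans; [apply Cmod_triangle|]. rewrite Cmod_opp. lra. }
    specialize (Hp k). nra. }
  rewrite lsum_plus, lsum_scal in H2. specialize (Hfin N).
  assert (e / (2 * (lsum l p + 1)) * lsum l p <= e / 2).
  { apply Rmult_le_reg_r with (2 * (lsum l p + 1)); [lra|]. field_simplify; [|lra]. nra. }
  unfold e in *. lra.
Qed.


(** * Complex functions on the circle and their integrals *)

Definition ccont (F : R -> C) : Prop :=
  (forall x, continuous (fun y => Re (F y)) x) /\
  (forall x, continuous (fun y => Im (F y)) x).

Definition cper (F : R -> C) : Prop := forall x, F (x + 2 * PI) = F x.

Definition cint (F : R -> C) : C :=
  (RInt (fun x => Re (F x)) (- PI) PI, RInt (fun x => Im (F x)) (- PI) PI).

Definition cderiv (F : R -> C) (x : R) (l : C) : Prop :=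
  is_derive (fun y => Re (F y)) x (Re l) /\ is_derive (fun y => Im (F y)) x (Im l).

Lemma C_eq : forall z w : C, Re z = Re w -> Im z = Im w -> z = w.
Proof. intros [a b] [c d]; simpl; intros; subst; reflexivity. Qed.

Lemma Cmod_minus_sym : forall z w : C, Cmod (z - w) = Cmod (w - z).
Proof. intros. rewrite <- Cmod_opp. f_equal. ring. Qed.

Lemma Cmod_le_sub : forall z w : C, Cmod z <= Cmod w + Cmod (z - w).
Proof.
  intros. replace z with (w + (z - w))%C at 1 by ring. apply Cmod_triangle.
Qed.

Lemma Cmod_le_ReIm : forall z : C, Cmod z <= Rabs (Re z) + Rabs (Im z).
Proof.
  intros z. assert (E : z = (RtoC (Re z) + Ci * RtoC (Im z))%C) by (apply C_eq; simpl; ring).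
  pose proof (Cmod_triangle (RtoC (Re z)) (Ci * RtoC (Im z))) as H.
  rewrite <- E, Cmod_mult, Cmod_Ci, !Cmod_R in H. lra.
Qed.

Lemma cis_0 : cis 0 = RtoC 1.
Proof. unfold cis. rewrite cos_0, sin_0. reflexivity. Qed.

Lemma cis_add : forall a b, cis (a + b) = (cis a * cis b)%C.
Proof. intros. apply C_eq; simpl; [rewrite cos_plus|rewrite sin_plus]; ring. Qed.

Lemma Cmod_cis : forall a, Cmod (cis a) = 1.
Proof.
  intros. unfold Cmod, cis; cbn [fst snd]. transitivity (sqrt 1); [f_equal|apply sqrt_1].
  pose proof (sin2_cos2 a) as H. unfold Rsqr in H. lra.
Qed.

Lemma Cconj_cis : forall a, Cconj (cis a) = cis (- a).
Proof. intros. unfold Cconj, cis; simpl. now rewrite cos_neg, sin_neg. Qed.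

Lemma cis_2PI : forall (k : Z) x, cis (IZR k * (x + 2 * PI)) = cis (IZR k * x).
Proof.
  assert (Hn : forall (n : nat) y, cis (y + 2 * INR n * PI) = cis y).
  { intros. unfold cis. now rewrite cos_period, sin_period. }
  intros k x. destruct (Z_le_gt_dec 0 k) as [Hk|Hk].
  - rewrite <- (Hn (Z.to_nat k) (IZR k * x)). f_equal. rewrite INR_IZR_INZ, Z2Nat.id by lia. ring.
  - rewrite <- (Hn (Z.to_nat (- k)) (IZR k * (x + 2 * PI))). f_equal.
    rewrite INR_IZR_INZ, Z2Nat.id, opp_IZR by lia. ring.
Qed.

Lemma ccont_plus : forall F G, ccont F -> ccont G -> ccont (fun x => F x + G x)%C.
Proof. intros F G [H1 H2] [H3 H4]; split; intros x; simpl; apply @continuous_plus; auto. Qed.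

Lemma ccont_mult : forall F G, ccont F -> ccont G -> ccont (fun x => F x * G x)%C.
Proof.
  intros F G [H1 H2] [H3 H4]; split; intros x; simpl.
  - apply @continuous_minus; apply @continuous_mult; auto.
  - apply @continuous_plus; apply @continuous_mult; auto.
Qed.

Lemma ccont_const : forall c, ccont (fun _ => c).
Proof. intros; split; intros; apply continuous_const. Qed.

Lemma ccont_conj : forall F, ccont F -> ccont (fun x => Cconj (F x)).
Proof. intros F [H1 H2]; split; intros; simpl; auto. apply @continuous_opp; auto. Qed.

Lemma ccont_opp : forall F, ccont F -> ccont (fun x => - F x)%C.
Proof. intros F [H1 H2]; split; intros; simpl; apply @continuous_opp; auto. Qed.

Lemma ccont_minus : forall F G, ccont F -> ccont G -> ccont (fun x => F x - G x)%C.
Proof. intros. apply ccont_plus; auto. apply ccont_opp; auto. Qed.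

Lemma ccont_RtoC : forall f : R -> R, (forall x, continuous f x) -> ccont (fun x => RtoC (f x)).
Proof. intros; split; intros; simpl; auto. apply continuous_const. Qed.

Lemma ccont_ext : forall F G, (forall x, F x = G x) -> ccont F -> ccont G.
Proof.
  intros F G H [H1 H2]; split; intros x.
  - apply (continuous_ext (fun y => Re (F y))); auto. intros; now rewrite H.
  - apply (continuous_ext (fun y => Im (F y))); auto. intros; now rewrite H.
Qed.

Lemma continuous_of_derivable : forall (f : R -> R) x l, is_derive f x l -> continuous f x.
Proof. intros. apply @ex_derive_continuous. now exists l. Qed.

Lemma ccont_cis : forall c, ccont (fun x => cis (c * x)).
Proof.
  intros c; split; intros x; unfold cis; cbn [fst snd Re Im];
    eapply continuous_of_derivable; auto_derive; auto.
Qed.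

(** Passing to the limit in truncated series. *)
Lemma ccont_approx : forall F,
  (forall eps, 0 < eps -> exists G, ccont G /\ forall x, Cmod (G x - F x) <= eps) -> ccont F.
Proof.
  assert (key : forall f : R -> R,
    (forall eps, 0 < eps -> exists g, (forall x, continuous g x) /\ forall x, Rabs (g x - f x) <= eps) ->
    forall x, continuous f x).
  { intros f H x. apply continuity_pt_filterlim. intros e He.
    destruct (H (e / 3)) as (g & Hg & Hgf); [lra|].
    specialize (Hg x). apply continuity_pt_filterlim in Hg.
    destruct (Hg (e / 3)) as (d & Hd & Hdd); [lra|]. exists d. split; auto.
    intros y Hy. specialize (Hdd y Hy). pose proof (Hgf x) as Hx. pose proof (Hgf y) as Hyy.
    simpl in *. unfold R_dist in *.
    apply Rabs_le_between in Hx. apply Rabs_le_between in Hyy. apply Rabs_lt_between in Hdd.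
    apply Rabs_lt_between. lra. }
  intros F H; split; apply key; intros e He; destruct (H e He) as (G & HG & HGF).
  - exists (fun x => Re (G x)). split; [apply HG|]. intros x.
    eapply Rle_trans; [apply (re_le_Cmod (G x - F x))|apply HGF].
  - exists (fun x => Im (G x)). split; [apply HG|]. intros x.
    eapply Rle_trans; [apply (im_le_Cmod (G x - F x))|apply HGF].
Qed.

Lemma ex_RInt_cont : forall (f : R -> R) a b, (forall x, continuous f x) -> ex_RInt f a b.
Proof. intros. apply @ex_RInt_continuous. auto. Qed.

Lemma cint_plus : forall F G, ccont F -> ccont G -> cint (fun x => F x + G x)%C = (cint F + cint G)%C.
Proof.
  intros F G [H1 H2] [H3 H4]. apply C_eq; unfold cint; cbn [fst snd Re Im];
  (etransitivity; [|apply (RInt_plus (V := R_CompleteNormedModule)); now apply ex_RInt_cont]); reflexivity.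
Qed.

Lemma cint_scal : forall c F, ccont F -> cint (fun x => c * F x)%C = (c * cint F)%C.
Proof.
  intros [a b] F [H1 H2].
  assert (forall k (f : R -> R), (forall x, continuous f x) ->
     is_RInt (fun x => k * f x) (- PI) PI (k * RInt f (- PI) PI)).
  { intros k f Hf. apply (is_RInt_scal (V := R_NormedModule)). apply (RInt_correct (V := R_CompleteNormedModule)), ex_RInt_cont, Hf. }
  apply C_eq; unfold cint; cbn [fst snd Re Im]; apply is_RInt_unique.
  - apply (is_RInt_minus (V := R_NormedModule)); apply H; auto.
  - apply (is_RInt_plus (V := R_NormedModule)); apply H; auto.
Qed.

Lemma cint_ext : forall F G, (forall x, F x = G x) -> cint F = cint G.
Proof. intros F G H. unfold cint. f_equal; apply RInt_ext; intros; now rewrite H. Qed.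

Lemma cint_conj : forall F, ccont F -> cint (fun x => Cconj (F x)) = Cconj (cint F).
Proof.
  intros F HF. apply C_eq; unfold cint; cbn [fst snd Re Im Cconj]; [reflexivity|].
  apply is_RInt_unique. apply (is_RInt_opp (V := R_NormedModule)).
  apply (RInt_correct (V := R_CompleteNormedModule)), ex_RInt_cont, HF.
Qed.

Lemma cint_minus : forall F G, ccont F -> ccont G -> cint (fun x => F x - G x)%C = (cint F - cint G)%C.
Proof.
  intros F G HF HG.
  rewrite (cint_ext _ (fun x => F x + (RtoC (-1)) * G x)%C).
  - rewrite cint_plus, cint_scal; auto.
    + apply C_eq; simpl; ring.
    + apply ccont_mult; auto. apply ccont_const.
  - intros; apply C_eq; simpl; ring.
Qed.

Lemma cint_le : forall F g, ccont F -> (forall x, continuous g x) ->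
  (forall x, - PI <= x <= PI -> Cmod (F x) <= g x) -> Cmod (cint F) <= RInt g (- PI) PI.
Proof.
  intros F g HF Hg H. pose proof PI_RGT_0 as HPI.
  destruct (Req_dec (Cmod (cint F)) 0) as [H0|H0].
  - rewrite H0. apply RInt_ge_0; [lra|apply ex_RInt_cont; auto|].
    intros x Hx. eapply Rle_trans; [apply Cmod_ge_0|apply H; lra].
  - set (I := cint F) in *. set (c := (Cconj I * RtoC (/ Cmod I))%C).
    assert (Hc : Cmod c = 1).
    { unfold c. rewrite Cmod_mult, Cmod_conj, Cmod_R, Rabs_inv, Rabs_pos_eq by apply Cmod_ge_0.
      now apply Rinv_r. }
    assert (E : Cmod I = Re (cint (fun x => c * F x)%C)).
    { rewrite cint_scal by auto. fold I. unfold c.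
      replace (Cconj I * RtoC (/ Cmod I) * I)%C with (RtoC (/ Cmod I) * (I * Cconj I))%C by ring.
      rewrite <- Cmod2_conj. simpl. field_simplify; auto. }
    rewrite E. unfold cint. cbn [fst Re]. apply RInt_le.
    + lra.
    + apply ex_RInt_cont. apply (ccont_mult (fun _ => c) F); auto. apply ccont_const.
    + now apply ex_RInt_cont.
    + intros x Hx. eapply Rle_trans; [apply Rle_abs|]. eapply Rle_trans; [apply re_le_Cmod|].
      rewrite Cmod_mult, Hc, Rmult_1_l. apply H; lra.
Qed.

Lemma cint_bound : forall F M, ccont F -> (forall x, Cmod (F x) <= M) -> Cmod (cint F) <= 2 * PI * M.
Proof.
  intros F M HF H. eapply Rle_trans; [apply (cint_le F (fun _ => M)); auto|].
  - intros; apply continuous_const.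
  - rewrite RInt_const. unfold scal; simpl; unfold mult; simpl. lra.
Qed.

Lemma cderiv_ccont : forall F F', (forall x, cderiv F x (F' x)) -> ccont F.
Proof. intros F F' H; split; intros x; destruct (H x) as [H1 H2]; eapply continuous_of_derivable; eassumption. Qed.

Lemma der_mult : forall (f g : R -> R) (x a b : R), is_derive f x a -> is_derive g x b ->
  is_derive (fun y => f y * g y) x (a * g x + f x * b).
Proof. intros f g x a b Hf Hg. apply (is_derive_mult f g x a b Hf Hg). intros; apply Rmult_comm. Qed.

Lemma der_plus : forall (f g : R -> R) (x a b : R), is_derive f x a -> is_derive g x b ->
  is_derive (fun y => f y + g y) x (a + b).
Proof. intros f g x a b Hf Hg. exact (@is_derive_plus R_AbsRing R_NormedModule f g x a b Hf Hg). Qed.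

Lemma der_minus : forall (f g : R -> R) (x a b : R), is_derive f x a -> is_derive g x b ->
  is_derive (fun y => f y - g y) x (a - b).
Proof. intros f g x a b Hf Hg. exact (@is_derive_minus R_AbsRing R_NormedModule f g x a b Hf Hg). Qed.

Lemma der_eq : forall (f : R -> R) (x a b : R), is_derive f x a -> a = b -> is_derive f x b.
Proof. intros; now subst. Qed.

Lemma cderiv_mult : forall F G x l m, cderiv F x l -> cderiv G x m ->
  cderiv (fun y => F y * G y)%C x (l * G x + F x * m)%C.
Proof.
  intros F G x l m [H1 H2] [H3 H4]. split; simpl.
  - eapply der_eq; [apply der_minus; apply der_mult; eassumption|]. unfold Re, Im; simpl; ring.
  - eapply der_eq; [apply der_plus; apply der_mult; eassumption|]. unfold Re, Im; simpl; ring.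
Qed.

Lemma cderiv_eq : forall F x l m, cderiv F x l -> l = m -> cderiv F x m.
Proof. intros; now subst. Qed.

Lemma cint_deriv : forall F F', (forall x, cderiv F x (F' x)) -> ccont F' ->
  cint F' = (F PI - F (- PI)%R)%C.
Proof.
  intros F F' H [H1 H2]. apply C_eq; unfold cint; cbn [fst snd Re Im]; apply is_RInt_unique.
  - apply (is_RInt_derive (V := R_CompleteNormedModule) (fun x => Re (F x)) (fun x => Re (F' x))); auto.
    intros; apply H.
  - apply (is_RInt_derive (V := R_CompleteNormedModule) (fun x => Im (F x)) (fun x => Im (F' x))); auto.
    intros; apply H.
Qed.

Lemma cper_PI : forall F, cper F -> F PI = F (- PI).
Proof. intros F H. rewrite <- (H (- PI)). f_equal. ring. Qed.

Lemma cint_deriv_per : forall F F', (forall x, cderiv F x (F' x)) -> ccont F' -> cper F ->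
  cint F' = RtoC 0.
Proof. intros F F' H HF Hp. rewrite (cint_deriv F F' H HF), cper_PI by auto. ring. Qed.

Lemma cint_parts : forall F G F' G', (forall x, cderiv F x (F' x)) -> (forall x, cderiv G x (G' x)) ->
  ccont F' -> ccont G' -> cper F -> cper G ->
  cint (fun x => F' x * G x)%C = (- cint (fun x => F x * G' x))%C.
Proof.
  intros F G F' G' HF HG HF' HG' Fp Gp.
  pose proof (cderiv_ccont _ _ HF). pose proof (cderiv_ccont _ _ HG).
  assert (cint (fun x => F' x * G x + F x * G' x)%C = RtoC 0).
  { apply (cint_deriv_per (fun x => F x * G x)%C).
    - intros; apply cderiv_mult; auto.
    - apply ccont_plus; apply ccont_mult; auto.
    - intros x. now rewrite Fp, Gp. }
  rewrite cint_plus in H1 by (apply ccont_mult; auto).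
  rewrite <- (Cplus_0_l (- _)%C), <- H1. ring.
Qed.

Lemma cint_shift : forall F a, ccont F -> cper F -> cint (fun x => F (x + a)) = cint F.
Proof.
  assert (key : forall (f : R -> R) a, (forall x, continuous f x) -> (forall x, f (x + 2 * PI) = f x) ->
     RInt (fun x => f (x + a)) (- PI) PI = RInt f (- PI) PI).
  { intros f a Hf Hp.
    assert (E : forall c u v, RInt (fun x => f (x + c)) u v = RInt f (u + c) (v + c)).
    { intros c u v. replace (u + c) with (1 * u + c) by ring. replace (v + c) with (1 * v + c) by ring.
      rewrite <- (RInt_comp_lin (V := R_CompleteNormedModule)) by (now apply ex_RInt_cont).
      apply RInt_ext. intros; unfold scal; simpl; unfold mult; simpl.
      rewrite !Rmult_1_l. reflexivity. }
    rewrite E.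
    assert (I : forall u v, ex_RInt f u v) by (intros; now apply ex_RInt_cont).
    assert (E2 : RInt f (PI) (PI + a) = RInt f (- PI) (- PI + a)).
    { transitivity (RInt (fun x => f (x + 2 * PI)) (- PI) (- PI + a)).
      - rewrite (E (2 * PI)). replace (- PI + 2 * PI) with PI by ring.
        replace (- PI + a + 2 * PI) with (PI + a) by ring. reflexivity.
      - apply RInt_ext. intros; apply Hp. }
    assert (Ch : forall u v w, RInt f u v + RInt f v w = RInt f u w).
    { intros u v w. exact (RInt_Chasles f u v w (I _ _) (I _ _)). }
    pose proof (Ch (- PI) (- PI + a) (PI + a)) as C1.
    pose proof (Ch (- PI) PI (PI + a)) as C2.
    rewrite E2 in C2. apply Rplus_eq_reg_l with (RInt f (- PI) (- PI + a)).
    rewrite C1, <- C2. apply Rplus_comm. }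
  intros F a [H1 H2] Hp. unfold cint.
  rewrite (key (fun x => Re (F x)) a), (key (fun x => Im (F x)) a); auto; intros x; now rewrite Hp.
Qed.

Lemma ccont_shift : forall F a, ccont F -> ccont (fun x => F (x + a)).
Proof.
  intros F a [H1 H2]; split; intros x.
  - apply (continuous_comp (fun x => x + a) (fun y => Re (F y))); auto.
    apply @continuous_plus; [apply continuous_id|apply continuous_const].
  - apply (continuous_comp (fun x => x + a) (fun y => Im (F y))); auto.
    apply @continuous_plus; [apply continuous_id|apply continuous_const].
Qed.

Lemma per_reduce : forall x, exists k : Z, - PI <= x + IZR k * (2 * PI) <= PI.
Proof.
  intros x. pose proof PI_RGT_0 as HP.
  exists (- (up ((x - PI) / (2 * PI))))%Z. destruct (archimed ((x - PI) / (2 * PI))) as [H1 H2].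
  rewrite opp_IZR.
  assert (E : x - PI = (x - PI) / (2 * PI) * (2 * PI)) by (field; lra).
  split; nra.
Qed.

Lemma per_Z : forall {T} (F : R -> T), (forall x, F (x + 2 * PI) = F x) ->
  forall (k : Z) x, F (x + IZR k * (2 * PI)) = F x.
Proof.
  intros T F H.
  assert (Hn : forall (n : nat) x, F (x + INR n * (2 * PI)) = F x).
  { induction n as [|n IH]; intros x.
    - simpl. f_equal; ring.
    - rewrite S_INR. replace (x + (INR n + 1) * (2 * PI)) with (x + INR n * (2 * PI) + 2 * PI) by ring.
      now rewrite H. }
  intros k x. destruct (Z_le_gt_dec 0 k) as [Hk|Hk].
  - rewrite <- (Hn (Z.to_nat k) x). f_equal. rewrite INR_IZR_INZ, Z2Nat.id by lia. ring.
  - rewrite <- (Hn (Z.to_nat (- k)) (x + _)). f_equal.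
    rewrite INR_IZR_INZ, Z2Nat.id, opp_IZR by lia. ring.
Qed.

Lemma ccont_bounded : forall F, ccont F -> cper F -> exists M, 0 <= M /\ forall x, Cmod (F x) <= M.
Proof.
  assert (key : forall f : R -> R, (forall x, continuous f x) ->
     exists M, forall x, - PI <= x <= PI -> f x <= M).
  { intros f Hf. destruct (continuity_ab_maj f (- PI) PI) as (m & Hm & _).
    - pose proof PI_RGT_0; lra.
    - intros; apply continuity_pt_filterlim, Hf.
    - exists (f m); auto. }
  intros F [H1 H2] Hp.
  destruct (key _ H1) as [M1 HM1]. destruct (key _ H2) as [M2 HM2].
  destruct (key (fun x => - Re (F x))) as [M3 HM3]; [intros; apply @continuous_opp; auto|].
  destruct (key (fun x => - Im (F x))) as [M4 HM4]; [intros; apply @continuous_opp; auto|].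
  exists (Rabs M1 + Rabs M2 + Rabs M3 + Rabs M4). split.
  { pose proof (Rabs_pos M1); pose proof (Rabs_pos M2); pose proof (Rabs_pos M3); pose proof (Rabs_pos M4); lra. }
  intros x. destruct (per_reduce x) as [k Hk]. rewrite <- (per_Z F Hp k x).
  set (y := x + _) in *. specialize (HM1 y Hk). specialize (HM2 y Hk). specialize (HM3 y Hk). specialize (HM4 y Hk).
  eapply Rle_trans; [apply Cmod_le_ReIm|].
  pose proof (Rle_abs M1); pose proof (Rle_abs M2); pose proof (Rle_abs M3); pose proof (Rle_abs M4).
  pose proof (Rabs_pos M1); pose proof (Rabs_pos M2); pose proof (Rabs_pos M3); pose proof (Rabs_pos M4).
  unfold Rabs at 1 2. destruct (Rcase_abs (Re (F y))), (Rcase_abs (Im (F y))); lra.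
Qed.

Lemma ccont_Zser : forall (u : Z -> R -> C) a A, bnd a A -> (forall k x, Cmod (u k x) <= a k) ->
  (forall k, ccont (u k)) -> ccont (fun x => Zser (fun k => u k x)).
Proof.
  intros u a A HA Hu Hc. apply ccont_approx. intros eps He.
  destruct (zser_uniform a A HA eps He) as [N HN].
  exists (fun x => csum (win N) (fun k => u k x)). split.
  - generalize (win N). clear - Hc. induction l as [|y l IH]; simpl; [apply ccont_const|].
    apply ccont_plus; auto.
  - intros x. apply HN; auto.
Qed.

Lemma cint_csum : forall (u : Z -> R -> C) l, (forall k, ccont (u k)) ->
  cint (fun x => csum l (fun k => u k x)) = csum l (fun k => cint (u k)) /\ ccont (fun x => csum l (fun k => u k x)).
Proof.
  intros u l Hc. induction l as [|y l [IH1 IH2]]; simpl; split.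
  - unfold cint; simpl. rewrite RInt_const. unfold scal; simpl; unfold mult; simpl.
    rewrite Rmult_0_r. reflexivity.
  - apply ccont_const.
  - rewrite cint_plus, IH1; auto.
  - apply ccont_plus; auto.
Qed.

Lemma cint_Zser : forall (u : Z -> R -> C) a A, bnd a A -> (forall k x, Cmod (u k x) <= a k) ->
  (forall k, ccont (u k)) ->
  zlim (fun k => cint (u k)) (cint (fun x => Zser (fun k => u k x))).
Proof.
  intros u a A HA Hu Hc eps He. pose proof PI_RGT_0 as HP.
  destruct (zser_uniform a A HA (eps / (2 * PI))) as [N HN]; [apply Rdiv_lt_0_compat; lra|].
  exists N. intros n Hn. destruct (cint_csum u (win n) Hc) as [E Ec]. rewrite <- E, <- cint_minus; auto.
  - eapply Rle_trans; [apply (cint_bound _ (eps / (2 * PI)))|].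
    + apply ccont_minus; auto. eapply ccont_Zser; eauto.
    + intros x. apply HN; auto.
    + right; field; lra.
  - eapply ccont_Zser; eauto.
Qed.

Create HintDb cc discriminated.
#[export] Hint Constants Opaque : cc.
#[export] Hint Resolve ccont_plus ccont_mult ccont_const ccont_conj ccont_opp ccont_minus ccont_RtoC
  ccont_cis ccont_shift : cc.
Ltac cc := eauto 20 with cc.


(** * Exponentials of a periodic curve, and their completeness *)

(** [h1] is the derivative of [h]; the curve is [gamma x = x + i (h x)]. *)
Definition curve (h h1 : R -> R) : Prop :=
  (forall x, is_derive h x (h1 x)) /\ (forall x, continuous h1 x) /\
  (forall x, h (x + 2 * PI) = h x) /\ (forall x, h1 (x + 2 * PI) = h1 x).

(** [e^{- i k gamma}] *)
Definition Ek (h : R -> R) (k : Z) (x : R) : C :=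
  (RtoC (exp (IZR k * h x)) * cis (- (IZR k * x)))%C.

(** [gamma'] *)
Definition gp (h1 : R -> R) (x : R) : C := (1, h1 x).

Lemma curve_flat : curve (fun _ => 0) (fun _ => 0).
Proof.
  split; [|split; [|split]]; intros; try reflexivity; [apply @is_derive_const|apply continuous_const].
Qed.

Lemma curve_cont : forall h h1, curve h h1 -> forall x, continuous h x.
Proof. intros h h1 [H _] x. eapply continuous_of_derivable, H. Qed.

Lemma ccont_gp : forall h h1, curve h h1 -> ccont (gp h1).
Proof. intros h h1 (_ & H & _); split; intros x; [apply continuous_const|apply H]. Qed.

Lemma cper_gp : forall h h1, curve h h1 -> cper (gp h1).
Proof. intros h h1 (_ & _ & _ & H) x. unfold gp. now rewrite H. Qed.

Lemma Cmod_gp : forall h1 x b, Rabs (h1 x) <= b -> Cmod (gp h1 x) <= 1 + b.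
Proof. intros h1 x b H. eapply Rle_trans; [apply Cmod_le_ReIm|]. simpl. rewrite Rabs_R1. lra. Qed.

Lemma Ek_deriv : forall h h1 k, curve h h1 -> forall x,
  cderiv (Ek h k) x (- (Ci * RtoC (IZR k)) * gp h1 x * Ek h k x)%C.
Proof.
  intros h h1 k (H & _) x.
  eapply cderiv_eq.
  - apply (cderiv_mult (fun x => RtoC (exp (IZR k * h x))) (fun x => cis (- (IZR k * x))) x
      (RtoC (IZR k * h1 x * exp (IZR k * h x))) (- (Ci * RtoC (IZR k)) * cis (- (IZR k * x)))%C).
    + split; simpl.
      * eapply der_eq.
        { apply (is_derive_comp exp (fun y => IZR k * h y) x (exp (IZR k * h x)) (IZR k * h1 x)).
          - apply is_derive_Reals, derivable_pt_lim_exp.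
          - apply is_derive_scal, H. }
        unfold scal; simpl; unfold mult; simpl. reflexivity.
      * apply @is_derive_const.
    + split; simpl; auto_derive; auto; ring.
  - unfold Ek, gp. apply C_eq; simpl; ring.
Qed.

Lemma Ek_per : forall h h1 k, curve h h1 -> cper (Ek h k).
Proof.
  intros h h1 k (_ & _ & H & _) x. unfold Ek. rewrite H. f_equal.
  rewrite !Ropp_mult_distr_l, <- opp_IZR. apply cis_2PI.
Qed.

Lemma ccont_Ek : forall h h1 k, curve h h1 -> ccont (Ek h k).
Proof. intros. eapply cderiv_ccont. eapply Ek_deriv; eauto. Qed.

Lemma Ek_mult : forall h j k x, (Ek h j x * Ek h k x = Ek h (j + k) x)%C.
Proof.
  intros. unfold Ek. rewrite plus_IZR, !Rmult_plus_distr_r, Ropp_plus_distr, cis_add, exp_plus, RtoC_mult. ring.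
Qed.

Lemma Ek_0 : forall h x, Ek h 0 x = RtoC 1.
Proof. intros. unfold Ek. rewrite !Rmult_0_l, Ropp_0, exp_0, cis_0. ring. Qed.

Lemma Cmod_Ek : forall h k x, Cmod (Ek h k x) = exp (IZR k * h x).
Proof.
  intros. unfold Ek. rewrite Cmod_mult, Cmod_cis, Rmult_1_r, Cmod_R. apply Rabs_pos_eq. epos.
Qed.

Lemma Cmod_Ek_le : forall h k x d, Rabs (h x) <= d -> Cmod (Ek h k x) <= exp (zabs k * d).
Proof.
  intros h k x d H. rewrite Cmod_Ek.
  destruct (Rle_lt_or_eq_dec (IZR k * h x) (zabs k * d)) as [H1|H1].
  - rewrite abs_IZR. eapply Rle_trans; [apply Rle_abs|]. rewrite Rabs_mult.
    apply Rmult_le_compat_l; auto. apply Rabs_pos.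
  - left; now apply exp_increasing.
  - right; now rewrite H1.
Qed.

Lemma exp_mono : forall x y, x <= y -> exp x <= exp y.
Proof. intros x y [H| ->]; [left; now apply exp_increasing|lra]. Qed.

Lemma exp_le : forall c x y L, L = c * exp x -> 0 <= c -> x <= y -> L <= c * exp y.
Proof. intros c x y L -> Hc Hx. apply Rmult_le_compat_l; auto. now apply exp_mono. Qed.

Ltac exponent t :=
  match t with
  | ?a * ?b => let x := exponent a in let y := exponent b in constr:(x + y)
  | exp ?x => x
  | _ => constr:(0)
  end.

(** [exps] reduces [L <= c * exp y], where [L] is a product of exponentials and of
    the factors of [c], to [0 <= c] and the comparison of the exponents; [expe] is
    the case of equality. *)
Ltac exps :=
  match goal with |- ?L <= ?c * exp ?y =>
    let x := exponent L in apply (exp_le c x y L); [rewrite ?exp_plus, ?exp_0; ring| |] end.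
Ltac expe :=
  right; match goal with |- ?L = ?c * exp ?y =>
    let x := exponent L in transitivity (c * exp x);
    [rewrite ?exp_plus, ?exp_0; ring|do 2 f_equal; field] end.

(** [e^{- i k gamma} d gamma] is exact unless [k = 0]. *)
Lemma cint_gp_Ek : forall h h1 k, curve h h1 ->
  cint (fun x => gp h1 x * Ek h k x)%C = if Z.eqb k 0 then RtoC (2 * PI) else RtoC 0.
Proof.
  intros h h1 k H. destruct (Z.eqb_spec k 0) as [->|Hk].
  - rewrite (cint_ext _ (gp h1)) by (intros; rewrite Ek_0; ring).
    rewrite (cint_deriv (fun x => (x, h x)) (gp h1)).
    + destruct H as (_ & _ & Hp & _). specialize (Hp (- PI)). replace (- PI + 2 * PI) with PI in Hp by ring.
      rewrite Hp. apply C_eq; simpl; ring.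
    + intros x. split; simpl; [apply @is_derive_id|apply H].
    + eapply ccont_gp; eauto.
  - assert (HE : ccont (fun x => gp h1 x * Ek h k x)%C).
    { apply ccont_mult; [eapply ccont_gp|eapply ccont_Ek]; eauto. }
    assert (E : cint (fun x => (- (Ci * RtoC (IZR k))) * (gp h1 x * Ek h k x))%C = RtoC 0).
    { apply (cint_deriv_per (Ek h k)).
      - intros x. eapply cderiv_eq; [eapply Ek_deriv; eauto|]. ring.
      - apply ccont_mult; auto. apply ccont_const.
      - eapply Ek_per; eauto. }
    rewrite cint_scal in E by auto. set (z := cint _) in *.
    replace z with (Ci * RtoC (/ IZR k) * (- (Ci * RtoC (IZR k)) * z))%C.
    + rewrite E. ring.
    + apply C_eq; simpl; field; apply not_0_IZR; auto.
Qed.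

#[export] Hint Resolve ccont_gp ccont_Ek : cc.

(** The kernel [cos^2 ((gamma x - gamma 0) / 2)], a combination of three exponentials. *)
Definition kern (h : R -> R) (x : R) : C :=
  (RtoC (1 / 2) + RtoC (1 / 4 * exp (h 0)) * Ek h (-1) x + RtoC (1 / 4 * exp (- h 0)) * Ek h 1 x)%C.

Fixpoint kpow (h : R -> R) (n : nat) (x : R) : C :=
  match n with O => RtoC 1 | S m => (kern h x * kpow h m x)%C end.

Lemma cosh_bound : forall t, t ^ 2 <= 1 / 2 -> (exp t + exp (- t)) / 2 <= 1 + 2 * t ^ 2.
Proof.
  intros t Ht. assert (-1 < t < 1) by nra.
  assert (forall s, -1 < s < 1 -> exp s <= / (1 - s)).
  { intros s Hs. replace (exp s) with (/ exp (- s)) by (rewrite exp_Ropp, Rinv_inv; auto).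
    apply Rinv_le_contravar; [lra|]. pose proof (exp_ineq1_le (- s)). lra. }
  pose proof (H0 t H). pose proof (H0 (- t) ltac:(lra)).
  apply Rle_trans with ((/ (1 - t) + / (1 - - t)) / 2); [lra|].
  replace ((/ (1 - t) + / (1 - - t)) / 2) with (/ (1 - t ^ 2)) by (field; split; [|split]; nra).
  apply Rmult_le_reg_l with (1 - t ^ 2); [lra|]. rewrite Rinv_r by lra. nra.
Qed.

Lemma sin_lower : forall y, 0 <= y <= PI / 2 -> 1 / 3 * y <= sin y.
Proof.
  intros y Hy. pose proof PI_4 as HP.
  destruct (pre_sin_bound y 0 ltac:(lra) ltac:(lra)) as [H _]. eapply Rle_trans; [|exact H].
  unfold sin_approx, sum_f_R0, sin_term. simpl.
  nra.
Qed.

Lemma cos_upper : forall x, - PI <= x <= PI -> cos x <= 1 - x ^ 2 / 18.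
Proof.
  assert (key : forall x, 0 <= x <= PI -> cos x <= 1 - x ^ 2 / 18).
  { intros x Hx. replace x with (2 * (x / 2)) at 1 by field. rewrite cos_2a_sin.
    pose proof (sin_lower (x / 2) ltac:(lra)). nra. }
  intros x Hx. destruct (Rle_or_lt 0 x).
  - apply key; lra.
  - rewrite <- cos_neg. replace (x ^ 2) with ((- x) ^ 2) by ring. apply key; lra.
Qed.

Lemma Cmod_kern : forall h x, Cmod (kern h x) = ((exp (h x - h 0) + exp (- (h x - h 0))) / 2 + cos x) / 2.
Proof.
  intros h x. set (e := h x - h 0).
  assert (E : kern h x = (/2 * (1 + (exp e + exp (- e)) / 2 * cos x), / 2 * ((exp (- e) - exp e) / 2 * sin x))).
  { unfold kern, Ek.
    assert (E1 : exp (h 0) * exp (IZR (-1) * h x) = exp (- e)) by (rewrite <- exp_plus; f_equal; unfold e; ring).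
    assert (E2 : exp (- h 0) * exp (IZR 1 * h x) = exp e) by (rewrite <- exp_plus; f_equal; unfold e; ring).
    rewrite <- E1, <- E2.
    replace (- (IZR (-1) * x)) with x by ring. replace (- (IZR 1 * x)) with (- x) by ring.
    unfold cis. rewrite cos_neg, sin_neg. apply C_eq; simpl; field. }
  rewrite E. unfold Cmod. cbn [fst snd].
  assert (Hp : exp e * exp (- e) = 1) by (rewrite <- exp_plus, <- exp_0; f_equal; ring).
  pose proof (exp_pos e). pose proof (exp_pos (- e)).
  set (a := exp e) in *. set (b := exp (- e)) in *. clearbody a b.
  pose proof (sin2_cos2 x) as Hs. unfold Rsqr in Hs.
  pose proof (COS_bound x) as Hc.
  assert (2 <= a + b) by (assert (0 <= (a - b) ^ 2) by apply pow2_ge_0; nra).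
  rewrite <- (sqrt_pow2 (((a + b) / 2 + cos x) / 2)) by lra.
  f_equal. set (c := cos x) in *. set (s := sin x) in *.
  assert (s * s = 1 - c * c) by lra.
  assert (Hb : (b - a) * (b - a) = (a + b) * (a + b) - 4) by nra.
  replace ((/ 2 * ((b - a) / 2 * s)) ^ 2) with (/ 16 * ((b - a) * (b - a)) * (s * s)) by field.
  rewrite Hb, H2. field.
Qed.

Lemma ccont_kern : forall h h1, curve h h1 -> ccont (kern h).
Proof.
  intros h h1 H. pose proof (ccont_Ek h h1 (-1) H) as H1. pose proof (ccont_Ek h h1 1 H) as H2.
  unfold kern. apply ccont_plus; [apply ccont_plus; [apply ccont_const|]|];
    (apply ccont_mult; [apply ccont_const|assumption]).
Qed.

Lemma ccont_kpow : forall h h1 n, curve h h1 -> ccont (kpow h n).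
Proof.
  intros h h1 n H; induction n as [|n IH]; [apply ccont_const|].
  apply (ccont_ext (fun x => kern h x * kpow h n x)%C); [reflexivity|].
  apply ccont_mult; auto. eapply ccont_kern; eauto.
Qed.

Lemma kern_Ek : forall h k x, (kern h x * Ek h k x = RtoC (1/2) * Ek h k x
   + RtoC (1 / 4 * exp (h 0)) * Ek h (k - 1) x + RtoC (1 / 4 * exp (- h 0)) * Ek h (k + 1) x)%C.
Proof.
  intros. unfold kern.
  replace (Ek h (k - 1) x) with (Ek h (-1) x * Ek h k x)%C by (rewrite Ek_mult; f_equal; lia).
  replace (Ek h (k + 1) x) with (Ek h 1 x * Ek h k x)%C by (rewrite Ek_mult; f_equal; lia).
  ring.
Qed.

Lemma kpow_moment : forall h h1 (P : R -> C) n k, curve h h1 -> ccont P ->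
  cint (fun x => P x * Ek h k x * kpow h (S n) x)%C =
  (RtoC (1/2) * cint (fun x => P x * Ek h k x * kpow h n x)
   + RtoC (1 / 4 * exp (h 0)) * cint (fun x => P x * Ek h (k - 1) x * kpow h n x)
   + RtoC (1 / 4 * exp (- h 0)) * cint (fun x => P x * Ek h (k + 1) x * kpow h n x))%C.
Proof.
  intros h h1 P n k H HP.
  assert (Hc : forall j, ccont (fun x => P x * Ek h j x * kpow h n x)%C).
  { intros; apply ccont_mult; [apply ccont_mult; auto; eapply ccont_Ek; eauto|eapply ccont_kpow; eauto]. }
  assert (Hc' : forall c j, ccont (fun x => c * (P x * Ek h j x * kpow h n x))%C).
  { intros; apply ccont_mult; auto; apply ccont_const. }
  rewrite <- !cint_scal, <- !cint_plus; auto.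
  - apply cint_ext. intros x. cbn [kpow].
    replace (P x * Ek h k x * (kern h x * kpow h n x))%C with (P x * (kern h x * Ek h k x) * kpow h n x)%C by ring.
    rewrite kern_Ek. ring.
  - apply ccont_plus; auto.
Qed.

Lemma kpow_moment_zero : forall h h1 P n, curve h h1 -> ccont P ->
  (forall k, cint (fun x => P x * Ek h k x)%C = RtoC 0) ->
  forall k, cint (fun x => P x * Ek h k x * kpow h n x)%C = RtoC 0.
Proof.
  intros h h1 P n H HP H0. induction n as [|n IH]; intros k.
  - rewrite <- (H0 k). apply cint_ext. intros; apply Cmult_1_r.
  - rewrite (kpow_moment h h1) by auto. rewrite !IH. ring.
Qed.

(** The integrand is a combination of the [gamma' E_j], whose integrals do not depend on
    the curve; so the mass of the kernel can be computed on the line. *)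
Lemma kpow_mass : forall h h1 n k, curve h h1 ->
  (RtoC (exp (- IZR k * h 0)) * cint (fun x => gp h1 x * Ek h k x * kpow h n x)
   = cint (fun x => gp (fun _ => 0) x * Ek (fun _ => 0) k x * kpow (fun _ => 0) n x))%C.
Proof.
  intros h h1 n k H. revert k. pose proof curve_flat as H0.
  induction n as [|n IH]; intros k.
  - assert (E : forall (f f1 : R -> R), cint (fun x => gp f1 x * Ek f k x * kpow f 0 x)%C =
      cint (fun x => gp f1 x * Ek f k x)%C) by (intros; apply cint_ext; intros; apply Cmult_1_r).
    rewrite !E, !(cint_gp_Ek _ _ _ H), (cint_gp_Ek _ _ _ H0).
    destruct (Z.eqb_spec k 0) as [->|Hk]; [|ring].
    replace (- 0 * h 0) with 0 by ring. rewrite exp_0. ring.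
  - rewrite (kpow_moment h h1), (kpow_moment (fun _ => 0) (fun _ => 0)) by (auto; eapply ccont_gp; eauto).
    rewrite <- !IH. rewrite Ropp_0, exp_0.
    replace (exp (- IZR (k - 1) * h 0)) with (exp (- IZR k * h 0) * exp (h 0))
      by (rewrite <- exp_plus, minus_IZR; f_equal; ring).
    replace (exp (- IZR (k + 1) * h 0)) with (exp (- IZR k * h 0) * exp (- h 0))
      by (rewrite <- exp_plus, plus_IZR; f_equal; ring).
    rewrite !RtoC_mult. ring.
Qed.

Lemma kpow_flat : forall n x, kpow (fun _ => 0) n x = RtoC (((1 + cos x) / 2) ^ n).
Proof.
  induction n as [|n IH]; intros x; [reflexivity|]. cbn [kpow]. rewrite IH. cbn [pow]. rewrite RtoC_mult. f_equal.
  unfold kern, Ek. rewrite Ropp_0, !Rmult_0_r, exp_0.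
  replace (- (IZR (-1) * x)) with x by ring. replace (- (IZR 1 * x)) with (- x) by ring.
  unfold cis. rewrite cos_neg, sin_neg. apply C_eq; simpl; field.
Qed.

Lemma pow_bernoulli : forall (n : nat) s, 0 <= s <= 1 -> 1 - INR n * s <= (1 - s) ^ n.
Proof.
  induction n as [|n IH]; intros s Hs; [simpl; lra|].
  rewrite S_INR. cbn [pow]. specialize (IH s Hs).
  assert (0 <= INR n) by apply pos_INR.
  apply Rle_trans with ((1 - s) * (1 - INR n * s)); [nra|].
  apply Rmult_le_compat_l; lra.
Qed.

Lemma pow_upper : forall (n : nat) s, 0 <= s <= 1 -> (1 - s) ^ n <= / (1 + INR n * s).
Proof.
  intros n s Hs. assert (0 <= INR n) by apply pos_INR. assert (0 <= INR n * s) by nra.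
  apply Rle_trans with (/ exp (INR n * s)).
  - rewrite <- exp_Ropp. replace (- (INR n * s)) with (INR n * (- s)) by ring.
    replace (exp (INR n * - s)) with (exp (- s) ^ n).
    + apply pow_incr. pose proof (exp_ineq1_le (- s)). lra.
    + clear. induction n as [|n IH]; [simpl; rewrite Rmult_0_l, exp_0; reflexivity|].
      rewrite S_INR. cbn [pow]. rewrite IH, <- exp_plus. f_equal. ring.
  - apply Rinv_le_contravar; [lra|]. pose proof (exp_ineq1_le (INR n * s)). lra.
Qed.

(** The power [m^2] makes [cos^2] concentrate on a width [1 / m]. *)
Lemma kern_mass_lower : forall (m : nat), (1 <= m)%nat ->
  / INR m <= Cmod (cint (fun x => gp (fun _ => 0) x * Ek (fun _ => 0) 0 x * kpow (fun _ => 0) (m * m) x)%C).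
Proof.
  intros m Hm. assert (Hm' : 1 <= INR m) by (apply (le_INR 1); auto).
  pose proof PI2_3_2 as HP.
  set (f := fun x => ((1 + cos x) / 2) ^ (m * m)).
  assert (Hf : forall x, continuous f x).
  { intros x. unfold f. eapply continuous_of_derivable. auto_derive; auto. }
  assert (Hf0 : forall x, 0 <= f x).
  { intros x. apply pow_le. pose proof (COS_bound x). lra. }
  rewrite (cint_ext _ (fun x => RtoC (f x))).
  2:{ intros x. rewrite kpow_flat, Ek_0. unfold gp, f. apply C_eq; simpl; ring. }
  eapply Rle_trans; [|apply re_le_Cmod]. eapply Rle_trans; [|apply Rle_abs].
  unfold cint; simpl.
  assert (I : forall u v, ex_RInt f u v) by (intros; now apply ex_RInt_cont).
  set (r := / INR m).
  assert (Hr : 0 < r <= 1) by (unfold r; split; [apply Rinv_0_lt_compat; lra|rewrite <- Rinv_1; apply Rinv_le_contravar; lra]).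
  assert (Ch : forall u v w, RInt f u v + RInt f v w = RInt f u w).
  { intros u v w. exact (RInt_Chasles f u v w (I _ _) (I _ _)). }
  assert (P1 : 0 <= RInt f (- PI) (- r)) by (apply RInt_ge_0; auto; lra).
  assert (P2 : 0 <= RInt f r PI) by (apply RInt_ge_0; auto; lra).
  assert (P3 : (r - - r) * (3 / 4) <= RInt f (- r) r).
  { replace ((r - - r) * (3 / 4)) with (RInt (fun _ => 3 / 4) (- r) r).
    2:{ rewrite RInt_const. reflexivity. }
    apply RInt_le; auto; [lra|apply ex_RInt_cont; intros; apply continuous_const|].
    intros x Hx. unfold f.
    apply Rle_trans with ((1 - x ^ 2 / 4) ^ (m * m)).
    - eapply Rle_trans; [|apply pow_bernoulli; nra].
      rewrite mult_INR. assert (INR m * INR m * r ^ 2 = 1) by (unfold r; field; lra).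
      nra.
    - apply pow_incr. split; [nra|].
      assert (1 - x ^ 2 / 2 <= cos x); [|lra].
      pose proof (pre_cos_bound x 0) as Hc. unfold cos_approx, sum_f_R0, cos_term in Hc. simpl in Hc.
      lra. }
  apply Rle_trans with (RInt f (- PI) (- r) + (RInt f (- r) r + RInt f r PI)); [fold r; lra|].
  rewrite !Ch. right; reflexivity.
Qed.

Lemma curve_lipschitz : forall h h1 b, curve h h1 -> (forall x, Rabs (h1 x) <= b) ->
  forall x y, Rabs (h x - h y) <= b * Rabs (x - y).
Proof.
  intros h h1 b (H & _) Hb x y.
  destruct (MVT_gen h y x h1) as (c & _ & Hc).
  - intros; apply H.
  - intros z _. apply continuity_pt_filterlim. eapply continuous_of_derivable, H.
  - rewrite Hc, Rabs_mult. apply Rmult_le_compat_r; [apply Rabs_pos|apply Hb].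
Qed.

(** The modulus of the kernel is [cosh^2 ((h x - h 0) / 2) - sin^2 (x / 2)]; a small
    slope makes the second term win. *)
Lemma kpow_upper : forall h h1 (m : nat) x, curve h h1 -> (forall x, Rabs (h1 x) <= 1 / 10) ->
  - PI <= x <= PI -> Cmod (kpow h (m * m) x) <= / (1 + (INR m * x / 8) ^ 2).
Proof.
  intros h h1 m x H Hb Hx.
  assert (E : Cmod (kern h x) <= 1 - x ^ 2 / 64).
  { rewrite Cmod_kern. pose proof (curve_lipschitz h h1 _ H Hb x 0) as HL. rewrite Rminus_0_r in HL.
    pose proof PI_4. pose proof (cos_upper x Hx).
    set (e := h x - h 0) in *.
    assert (He : e ^ 2 <= x ^ 2 / 100).
    { rewrite <- (pow2_abs e), <- (pow2_abs x). pose proof (Rabs_pos e). nra. }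
    assert (x ^ 2 <= 16) by nra.
    assert (He2 : e ^ 2 <= 1 / 2) by lra. pose proof (cosh_bound e He2). pose proof (pow2_ge_0 x). lra. }
  assert (Hx2 : 0 <= x ^ 2 / 64 <= 1) by (pose proof PI_4; nra).
  apply Rle_trans with ((1 - x ^ 2 / 64) ^ (m * m)).
  - clear - E. generalize (m * m)%nat. induction n as [|n IH]; [simpl; rewrite Cmod_1; lra|].
    cbn [kpow pow]. rewrite Cmod_mult. apply Rmult_le_compat; auto; apply Cmod_ge_0.
  - eapply Rle_trans; [apply pow_upper; auto|]. rewrite mult_INR. right. f_equal. field.
Qed.

(** Where [D] is close to [D 0] the kernel has mass at most a constant over [m];
    elsewhere it is [O (1 / m^2)], to be compared with the lower bound [1 / m]. *)
Lemma complete_at_0 : forall h h1 D, curve h h1 -> (forall x, Rabs (h1 x) <= 1 / 10) ->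
  ccont D -> cper D ->
  (forall k, cint (fun x => D x * gp h1 x * Ek h k x)%C = RtoC 0) -> D 0 = RtoC 0.
Proof.
  intros h h1 D H Hb HD HDp H0. pose proof PI_RGT_0 as HPI. pose proof PI_4 as HP4.
  destruct (ccont_bounded D HD HDp) as (M & HM0 & HM).
  assert (Hgp : ccont (gp h1)) by (eapply ccont_gp; eauto).
  assert (main : forall eta, 0 < eta -> exists K, 0 <= K /\ forall m : nat, (1 <= m)%nat ->
     Cmod (D 0) <= 96 * eta + K * / INR m).
  { intros eta Heta.
    assert (exists d, 0 < d /\ forall x, Rabs x < d -> Cmod (D x - D 0) <= eta) as (d & Hd & Hdd).
    { destruct HD as [C1 C2]. specialize (C1 0). specialize (C2 0).
      apply continuity_pt_filterlim in C1. apply continuity_pt_filterlim in C2.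
      destruct (C1 (eta / 2) ltac:(lra)) as (d1 & Hd1 & H1).
      destruct (C2 (eta / 2) ltac:(lra)) as (d2 & Hd2 & H2).
      exists (Rmin d1 d2). split; [apply Rmin_glb_lt; auto|]. intros x Hx.
      destruct (Req_dec x 0) as [->|Hx0].
      { replace (D 0 - D 0)%C with (RtoC 0) by ring. rewrite Cmod_0; lra. }
      eapply Rle_trans; [apply Cmod_le_ReIm|].
      pose proof (Rmin_l d1 d2). pose proof (Rmin_r d1 d2).
      assert (Hr : forall e, Rabs x < e -> D_x no_cond 0 x /\ Rdist x 0 < e).
      { intros e He. unfold D_x, no_cond, Rdist. rewrite Rminus_0_r. repeat split; auto. }
      specialize (H1 x (Hr d1 ltac:(lra))). specialize (H2 x (Hr d2 ltac:(lra))).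
      simpl in H1, H2. unfold Rdist in *. unfold Re, Im in *. simpl in *. unfold Rminus in *. lra. }
    exists (2 * (2 * M / d ^ 2) * (64 * (2 * PI))).
    assert (Hd2 : 0 < d ^ 2) by nra.
    assert (HMd : 0 <= 2 * M / d ^ 2) by (apply Rdiv_le_0_compat; lra).
    split; [nra|]. intros m Hm.
    assert (Hm' : 1 <= INR m) by (apply (le_INR 1); auto).
    set (n := (m * m)%nat).
    assert (Hk : ccont (kpow h n)) by (eapply ccont_kpow; eauto).
    assert (E : (RtoC 0 = cint (fun x => (D x - D 0) * gp h1 x * Ek h 0 x * kpow h n x)
        + D 0 * cint (fun x => gp h1 x * Ek h 0 x * kpow h n x))%C).
    { rewrite <- (kpow_moment_zero h h1 (fun x => D x * gp h1 x)%C n H ltac:(now apply ccont_mult) H0 0).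
      rewrite <- cint_scal, <- cint_plus.
      - apply cint_ext; intros; ring.
      - cc.
      - cc.
      - cc. }
    pose proof (kpow_mass h h1 n 0 H) as Em. replace (- 0 * h 0) with 0 in Em by ring.
    rewrite exp_0, Cmult_1_l in Em. rewrite Em in E.
    pose proof (kern_mass_lower m Hm) as Hlow. fold n in Hlow.
    match type of Hlow with _ <= Cmod ?z => set (I0 := z) in * end.
    match type of E with _ = (?z + _)%C => set (J := z) in * end.
    assert (EJ : Cmod J = Cmod (D 0) * Cmod I0).
    { rewrite <- Cmod_mult, <- Cmod_opp. f_equal. clearbody J I0. clear - E.
      replace (- J)%C with (- (J + D 0 * I0) + D 0 * I0)%C by ring. rewrite <- E. ring. }
    set (g := fun x => 2 * (eta + (2 * M / d ^ 2) * x ^ 2) * / (1 + (INR m * x / 8) ^ 2)).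
    assert (Hden : forall x, 1 <= 1 + (INR m * x / 8) ^ 2) by (intros x; pose proof (pow2_ge_0 (INR m * x / 8)); lra).
    assert (HJ : Cmod J <= RInt (fun x => 2 * eta * / (1 + (INR m * x / 8) ^ 2) + 2 * (2 * M / d ^ 2) * (64 / INR m ^ 2)) (- PI) PI).
    { unfold J.
      assert (HF : ccont (fun x => (D x - D 0) * gp h1 x * Ek h 0 x * kpow h n x)%C).
      { cc. }
      assert (Hq : forall x, continuous (fun x => 2 * eta * / (1 + (INR m * x / 8) ^ 2) + 2 * (2 * M / d ^ 2) * (64 / INR m ^ 2)) x).
      { intros x. eapply continuous_of_derivable. auto_derive; [|reflexivity].
        specialize (Hden x). simpl in Hden. lra. }
      assert (Hloc : forall x, - PI <= x <= PI -> Cmod ((D x - D 0) * gp h1 x * Ek h 0 x * kpow h n x)%C <=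
         2 * eta * / (1 + (INR m * x / 8) ^ 2) + 2 * (2 * M / d ^ 2) * (64 / INR m ^ 2)).
      { intros x Hx. rewrite Ek_0, Cmult_1_r, !Cmod_mult.
        pose proof (kpow_upper h h1 m x H Hb Hx) as K1. fold n in K1.
        pose proof (Cmod_gp h1 x _ (Hb x)) as K2.
        assert (K3 : Cmod (D x - D 0) <= eta + (2 * M / d ^ 2) * x ^ 2).
        { destruct (Rlt_or_le (Rabs x) d) as [Hlt|Hge].
          - specialize (Hdd x Hlt). nra.
          - assert (Cmod (D x - D 0) <= 2 * M).
            { eapply Rle_trans; [apply Cmod_triangle|]. rewrite Cmod_opp. specialize (HM x) as A1. specialize (HM 0) as A2. lra. }
            assert (d ^ 2 <= x ^ 2) by (rewrite <- (pow2_abs x); nra).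
            assert (2 * M <= 2 * M / d ^ 2 * x ^ 2); [|lra].
            replace (2 * M) with (2 * M / d ^ 2 * d ^ 2) at 1 by (field; lra).
            apply Rmult_le_compat_l; auto. }
        assert (Hinv : 0 < / (1 + (INR m * x / 8) ^ 2)) by (apply Rinv_0_lt_compat; specialize (Hden x); lra).
        apply Rle_trans with ((eta + (2 * M / d ^ 2) * x ^ 2) * 2 * / (1 + (INR m * x / 8) ^ 2)).
        - repeat apply Rmult_le_compat; try apply Cmod_ge_0; auto; try lra.
          apply Rmult_le_pos; apply Cmod_ge_0.
        - assert (x ^ 2 * / (1 + (INR m * x / 8) ^ 2) <= 64 / INR m ^ 2).
          { apply Rmult_le_reg_r with (1 + (INR m * x / 8) ^ 2); [specialize (Hden x); lra|].
            rewrite Rmult_assoc, Rinv_l by (specialize (Hden x); lra).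
            replace (64 / INR m ^ 2 * (1 + (INR m * x / 8) ^ 2)) with (64 / INR m ^ 2 + x ^ 2) by (field; lra).
            assert (0 < 64 / INR m ^ 2) by (apply Rdiv_lt_0_compat; [lra|nra]). lra. }
          pose proof (Rmult_le_compat_l _ _ _ HMd H1). nra. }
      apply cint_le; auto. }
    assert (HI : RInt (fun x => 2 * eta * / (1 + (INR m * x / 8) ^ 2) + 2 * (2 * M / d ^ 2) * (64 / INR m ^ 2)) (- PI) PI
       <= 96 * eta * / INR m + 2 * (2 * M / d ^ 2) * (64 / INR m ^ 2) * (2 * PI)).
    { set (c := 2 * (2 * M / d ^ 2) * (64 / INR m ^ 2)).
      set (P := fun x => 16 * eta / INR m * atan (INR m * x / 8) + c * x).
      replace (RInt _ _ _) with (P PI - P (- PI)).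
      - unfold P. replace (INR m * - PI / 8) with (- (INR m * PI / 8)) by field. rewrite atan_opp.
        pose proof (atan_bound (INR m * PI / 8)).
        assert (0 < 16 * eta / INR m) by (apply Rdiv_lt_0_compat; lra).
        unfold Rdiv in *. nra.
      - symmetry. apply is_RInt_unique.
        apply (is_RInt_derive (V := R_CompleteNormedModule) P).
        + intros x _. unfold P. auto_derive; [auto|]. specialize (Hden x). unfold Rsqr in *. field. split; [nra|lra].
        + intros x _. eapply continuous_of_derivable. auto_derive; [|reflexivity].
          specialize (Hden x). simpl in Hden. lra. }
    assert (Hf : Cmod (D 0) * / INR m <= (96 * eta + 2 * (2 * M / d ^ 2) * (64 * (2 * PI)) * / INR m) * / INR m).
    { apply Rle_trans with (Cmod J).
      - rewrite EJ. apply Rmult_le_compat_l; [apply Cmod_ge_0|auto].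
      - eapply Rle_trans; [exact HJ|]. eapply Rle_trans; [exact HI|]. right. field. lra. }
    apply Rmult_le_reg_r with (/ INR m); [apply Rinv_0_lt_compat; lra|exact Hf]. }
  apply Cmod_eq_0. apply Rle_antisym; [|apply Cmod_ge_0].
  apply Rnot_lt_le. intros Hlt.
  destruct (main (Cmod (D 0) / 400)) as (K & HK & Hmm); [lra|].
  destruct (archimed_cor1 (Cmod (D 0) / (2 * (K + 1)))) as (m & Hm1 & Hm2).
  { apply Rdiv_lt_0_compat; lra. }
  specialize (Hmm m ltac:(lia)).
  assert (K * / INR m <= Cmod (D 0) / 2); [|lra].
  apply Rle_trans with (K * (Cmod (D 0) / (2 * (K + 1)))); [apply Rmult_le_compat_l; lra|].
  apply Rmult_le_reg_r with (2 * (K + 1)); [lra|]. field_simplify; [|lra]. nra.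
Qed.

(** The powers of [cos^2 ((gamma x - gamma x0) / 2)] are combinations of the exponentials
    and, on a flat enough curve, concentrate at [x0]; a translation moves [x0] to [0]. *)
Theorem curve_complete : forall h h1 D, curve h h1 -> (forall x, Rabs (h1 x) <= 1 / 10) ->
  ccont D -> cper D ->
  (forall k, cint (fun x => D x * gp h1 x * Ek h k x)%C = RtoC 0) -> forall x, D x = RtoC 0.
Proof.
  intros h h1 D H Hb HD HDp H0 a.
  assert (Hc : curve (fun x => h (x + a)) (fun x => h1 (x + a))).
  { destruct H as (D1 & D2 & D3 & D4). split; [|split; [|split]]; intros x.
    - eapply der_eq.
      + apply (is_derive_comp h (fun x => x + a) x (h1 (x + a)) 1 (D1 (x + a))). auto_derive; [auto|reflexivity].
      + unfold scal; simpl; unfold mult; simpl. ring.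
    - apply (continuous_comp (fun x => x + a) h1); auto.
      apply @continuous_plus; [apply continuous_id|apply continuous_const].
    - replace (x + 2 * PI + a) with (x + a + 2 * PI) by ring. apply D3.
    - replace (x + 2 * PI + a) with (x + a + 2 * PI) by ring. apply D4. }
  rewrite <- (Rplus_0_l a).
  apply (complete_at_0 (fun x => h (x + a)) (fun x => h1 (x + a)) (fun x => D (x + a))); auto.
  - now apply ccont_shift.
  - intros x. replace (x + 2 * PI + a) with (x + a + 2 * PI) by ring. apply HDp.
  - intros k.
    set (F := fun x => (D x * gp h1 x * Ek h k x)%C).
    assert (HF : ccont F).
    { unfold F. cc. }
    assert (HFp : cper F).
    { intros x. unfold F. rewrite HDp, (cper_gp h h1 H x), (Ek_per h h1 k H x). reflexivity. }
    rewrite (cint_ext _ (fun x => (cis (IZR k * a) * F (x + a)%R)%C)).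
    + rewrite cint_scal, cint_shift by (auto; now apply ccont_shift). unfold F. rewrite H0. ring.
    + intros x. unfold F, Ek, gp.
      replace (- (IZR k * x)) with (IZR k * a + - (IZR k * (x + a))) by ring. rewrite cis_add. ring.
Qed.


(** * Fourier series and weighted Wiener algebras *)

Lemma IZR_abs_pos : forall k, 0 <= zabs k.
Proof. intros; apply IZR_le; lia. Qed.

Ltac pos :=
  first [lra | assumption | match goal with
  | |- 0 <= exp _ => epos
  | |- 0 <= Cmod _ => apply Cmod_ge_0
  | |- 0 <= zabs _ => apply IZR_abs_pos
  | |- 0 <= Rabs _ => apply Rabs_pos
  | |- 0 <= _ ^ 2 => apply pow2_ge_0
  | |- 0 <= _ ^ _ => apply pow_le; pos
  | |- 0 <= _ * _ => apply Rmult_le_pos; pos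
  | |- 0 <= _ / _ => apply Rmult_le_pos; pos
  | |- 0 <= / _ => left; apply Rinv_0_lt_compat; lra
  end | solve [auto]].

Definition cft (F : R -> C) (k : Z) : C :=
  (RtoC (/ (2 * PI)) * cint (fun x => F x * cis (- (IZR k * x)))%C)%C.

Definition fser (c : Z -> C) (x : R) : C := Zser (fun k => c k * cis (IZR k * x))%C.

(** Membership in the Wiener algebra with weight [e^{rho |k|}], with a bound. *)
Definition W (rho : R) (F : R -> C) (A : R) : Prop :=
  ccont F /\ cper F /\ bnd (fun k => exp (rho * zabs k) * Cmod (cft F k)) A.

Lemma Cconj_mul : forall z w : C, Cconj (z * w) = (Cconj z * Cconj w)%C.
Proof. intros. apply C_eq; simpl; ring. Qed.

Lemma cint_RInt : forall F, ccont F ->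
  RInt (V := C_R_CompleteNormedModule) F (- PI) PI = cint F.
Proof.
  intros F [H1 H2]. apply is_RInt_unique.
  apply (is_RInt_fct_extend_pair (U := R_NormedModule) (V := R_NormedModule) F).
  - apply (RInt_correct (V := R_CompleteNormedModule)), ex_RInt_cont, H1.
  - apply (RInt_correct (V := R_CompleteNormedModule)), ex_RInt_cont, H2.
Qed.

Lemma ccont_cisn : forall k : Z, ccont (fun x => cis (- (IZR k * x))).
Proof.
  intros k. apply (ccont_ext (fun x => cis (- IZR k * x))); [intros; f_equal; ring|apply ccont_cis].
Qed.
#[export] Hint Resolve ccont_cisn : cc.

Lemma fourier_cft : forall u k, (forall x, continuous u x) -> fourier u k = cft (fun x => RtoC (u x)) k.
Proof.
  intros u k H. unfold fourier, cft. f_equal. apply cint_RInt. cc.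
Qed.

Lemma Ek_flat : forall k x, Ek (fun _ => 0) k x = cis (- (IZR k * x)).
Proof. intros. unfold Ek. rewrite Rmult_0_r, exp_0. apply Cmult_1_l. Qed.

Lemma gp_flat : forall x, gp (fun _ => 0) x = RtoC 1.
Proof. reflexivity. Qed.

Lemma cft_ext : forall F G, (forall x, F x = G x) -> forall k, cft F k = cft G k.
Proof. intros F G H k. unfold cft. f_equal. apply cint_ext. intros; now rewrite H. Qed.

Lemma cft_plus : forall F G k, ccont F -> ccont G -> cft (fun x => F x + G x)%C k = (cft F k + cft G k)%C.
Proof.
  intros F G k HF HG. unfold cft.
  rewrite (cint_ext _ (fun x => F x * cis (- (IZR k * x)) + G x * cis (- (IZR k * x)))%C) by (intros; ring).
  rewrite cint_plus by cc. ring.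
Qed.

Lemma cft_scal : forall c F k, ccont F -> cft (fun x => c * F x)%C k = (c * cft F k)%C.
Proof.
  intros c F k HF. unfold cft.
  rewrite (cint_ext _ (fun x => c * (F x * cis (- (IZR k * x))))%C) by (intros; ring).
  rewrite cint_scal by cc. ring.
Qed.

Lemma cft_minus : forall F G k, ccont F -> ccont G -> cft (fun x => F x - G x)%C k = (cft F k - cft G k)%C.
Proof.
  intros F G k HF HG.
  rewrite (cft_ext _ (fun x => F x + RtoC (-1) * G x)%C) by (intros; apply C_eq; simpl; ring).
  rewrite cft_plus, cft_scal by cc. apply C_eq; simpl; ring.
Qed.

Lemma cft_conj : forall F k, ccont F -> cft (fun x => Cconj (F x)) k = Cconj (cft F (- k)).
Proof.
  intros F k HF. unfold cft.
  rewrite (cint_ext _ (fun x => Cconj (F x * cis (- (IZR (- k) * x)))%C)).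
  - rewrite cint_conj by cc. apply C_eq; simpl; ring.
  - intros x. rewrite opp_IZR.
    replace (- (- IZR k * x)) with (IZR k * x) by ring.
    rewrite Cconj_mul, Cconj_cis. reflexivity.
Qed.

Lemma cft_bound : forall F M k, ccont F -> (forall x, Cmod (F x) <= M) -> Cmod (cft F k) <= M.
Proof.
  intros F M k HF H. unfold cft. pose proof PI_RGT_0.
  rewrite Cmod_mult, Cmod_R, Rabs_pos_eq by (pos).
  apply Rmult_le_reg_l with (2 * PI); [lra|]. rewrite <- Rmult_assoc, Rinv_r, Rmult_1_l by lra.
  apply cint_bound; [cc|]. intros x. rewrite Cmod_mult, Cmod_cis, Rmult_1_r. apply H.
Qed.

Lemma cft_cis : forall j k, cft (fun x => cis (IZR j * x)) k = if Z.eqb k j then RtoC 1 else RtoC 0.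
Proof.
  intros j k. unfold cft.
  rewrite (cint_ext _ (fun x => gp (fun _ => 0) x * Ek (fun _ => 0) (k - j) x)%C).
  - rewrite (cint_gp_Ek _ _ _ curve_flat). pose proof PI_RGT_0.
    destruct (Z.eqb_spec k j) as [->|Hk].
    + rewrite Z.sub_diag. simpl. rewrite <- RtoC_mult. f_equal. field. lra.
    + destruct (Z.eqb_spec (k - j) 0); [lia|]. ring.
  - intros x. rewrite gp_flat, Ek_flat, <- cis_add, Cmult_1_l. f_equal. rewrite minus_IZR. ring.
Qed.

Lemma cft_const : forall c k, cft (fun _ => c) k = if Z.eqb k 0 then c else RtoC 0.
Proof.
  intros c k. rewrite (cft_ext _ (fun x => c * cis (IZR 0 * x))%C).
  - rewrite cft_scal by cc. rewrite cft_cis. destruct Z.eqb; ring.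
  - intros x. rewrite Rmult_0_l, cis_0. ring.
Qed.

Lemma fser_term : forall c x k, Cmod (c k * cis (IZR k * x))%C = Cmod (c k).
Proof. intros. rewrite Cmod_mult, Cmod_cis. ring. Qed.

Lemma fser_ccont : forall c, summable c -> ccont (fser c).
Proof.
  intros c [A HA]. apply (ccont_Zser (fun k x => c k * cis (IZR k * x))%C (fun k => Cmod (c k)) A); auto.
  - intros; rewrite fser_term; lra.
  - intros; cc.
Qed.

Lemma fser_cper : forall c, cper (fser c).
Proof. intros c x. apply Zser_ext. intros k. now rewrite cis_2PI. Qed.

Lemma cft_Zser : forall (u : Z -> R -> C) a A, bnd a A -> (forall k x, Cmod (u k x) <= a k) ->
  (forall k, ccont (u k)) -> forall m, zlim (fun k => cft (u k) m) (cft (fun x => Zser (fun k => u k x)) m).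
Proof.
  intros u a A HA Hu Hc m.
  assert (E : cint (fun x => Zser (fun k => u k x) * cis (- (IZR m * x)))%C =
     cint (fun x => Zser (fun k => u k x * cis (- (IZR m * x)))%C)).
  { apply cint_ext. intros x. symmetry. apply zlim_Zser_eq.
    apply (zlim_ext (fun k => cis (- (IZR m * x)) * u k x)%C); [intros; ring|].
    rewrite Cmult_comm. apply zlim_scal, summable_zlim. eapply summable_bnd; eauto. }
  unfold cft. rewrite E. apply zlim_scal.
  apply (cint_Zser (fun k x => u k x * cis (- (IZR m * x)))%C a A); auto.
  - intros; rewrite Cmod_mult, Cmod_cis, Rmult_1_r; auto.
  - intros; cc.
Qed.

Lemma cft_fser : forall c k, summable c -> cft (fser c) k = c k.
Proof.
  intros c k [A HA].
  eapply zlim_unique.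
  - apply (cft_Zser (fun k x => c k * cis (IZR k * x))%C (fun k => Cmod (c k)) A); auto.
    + intros; rewrite fser_term; lra.
    + intros; cc.
  - apply (zlim_ext (fun j => if Z.eqb j k then c k else RtoC 0)).
    + intros j. rewrite cft_scal by cc. rewrite cft_cis, (Z.eqb_sym k j).
      destruct (Z.eqb_spec j k) as [->|]; ring.
    + apply zlim_single.
Qed.

(** Completeness of the exponentials of the flat curve. *)
Lemma cft_zero : forall D, ccont D -> cper D -> (forall k, cft D k = RtoC 0) -> forall x, D x = RtoC 0.
Proof.
  intros D HD Hp H. apply (curve_complete (fun _ => 0) (fun _ => 0)); auto using curve_flat.
  - intros; rewrite Rabs_R0; lra.
  - intros k. specialize (H k). unfold cft in H. pose proof PI_RGT_0.
    rewrite (cint_ext _ (fun x => D x * cis (- (IZR k * x)))%C).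
    + set (z := cint _) in *. replace z with (RtoC (2 * PI) * (RtoC (/ (2 * PI)) * z))%C.
      * rewrite H. ring.
      * rewrite Cmult_assoc, <- RtoC_mult, Rinv_r by lra. ring.
    + intros x. rewrite gp_flat, Ek_flat. ring.
Qed.

Lemma cft_inj : forall F G, ccont F -> ccont G -> cper F -> cper G ->
  (forall k, cft F k = cft G k) -> forall x, F x = G x.
Proof.
  intros F G HF HG Pf Pg H x.
  assert (E : (F x - G x)%C = RtoC 0).
  { apply (cft_zero (fun x => F x - G x)%C).
    - cc.
    - intros y. now rewrite Pf, Pg.
    - intros k. rewrite cft_minus, H by auto. ring. }
  replace (F x) with (F x - G x + G x)%C by ring. rewrite E. ring.
Qed.

Lemma fser_cft : forall F, ccont F -> cper F -> summable (cft F) -> forall x, F x = fser (cft F) x.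
Proof.
  intros F HF Hp Hs. apply cft_inj; auto using fser_ccont, fser_cper.
  intros k. now rewrite cft_fser.
Qed.

Lemma bnd_ext : forall a b A, bnd a A -> (forall k, a k = b k) -> bnd b A.
Proof. intros a b A H E. apply (bnd_mono _ a); auto. intros; rewrite E; lra. Qed.

Lemma expw_ge_1 : forall rho k, 0 <= rho -> 1 <= exp (rho * zabs k).
Proof.
  intros rho k H. rewrite <- exp_0. apply exp_mono. apply Rmult_le_pos; auto. apply IZR_le; lia.
Qed.

Lemma W_summable : forall rho F A, 0 <= rho -> W rho F A -> bnd (fun k => Cmod (cft F k)) A.
Proof.
  intros rho F A Hr (_ & _ & H). eapply bnd_mono; [exact H|]. intros k.
  pose proof (expw_ge_1 rho k Hr). pose proof (Cmod_ge_0 (cft F k)). nra.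
Qed.

Lemma W_inv : forall rho F A, 0 <= rho -> W rho F A -> forall x, F x = fser (cft F) x.
Proof.
  intros rho F A Hr H x. apply fser_cft; try apply H. exists A. eapply W_summable; eauto.
Qed.

Lemma W_sup : forall rho F A x, 0 <= rho -> W rho F A -> Cmod (F x) <= A.
Proof.
  intros rho F A x Hr H. rewrite (W_inv rho F A Hr H x). apply Zser_Cmod.
  eapply bnd_mono; [eapply W_summable; eauto|]. intros; rewrite fser_term; lra.
Qed.

Lemma W_term : forall rho F A k, W rho F A -> Cmod (cft F k) <= A * exp (- (rho * zabs k)).
Proof.
  intros rho F A k (_ & _ & H). apply (bnd_term _ _ k) in H. cbv beta in H.
  rewrite exp_Ropp. apply Rmult_le_reg_l with (exp (rho * zabs k)); [apply exp_pos|].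
  eapply Rle_trans; [exact H|]. right. field. apply Rgt_not_eq, exp_pos.
Qed.

Lemma W_ge0 : forall rho F A, W rho F A -> 0 <= A.
Proof. intros rho F A (_ & _ & H). eapply bnd_nonneg; eauto. Qed.

Lemma W_cc : forall rho F A, W rho F A -> ccont F.
Proof. intros rho F A H; apply H. Qed.
#[export] Hint Resolve W_cc : cc.

Lemma W_ext : forall rho F G A, (forall x, F x = G x) -> W rho F A -> W rho G A.
Proof.
  intros rho F G A H (H1 & H2 & H3). split; [|split].
  - eapply ccont_ext; eauto.
  - intros x. now rewrite <- !H.
  - eapply bnd_ext; [exact H3|]. intros k. cbv beta. now rewrite (cft_ext F G H).
Qed.

Lemma W_mono : forall rho rho' F A A', rho' <= rho -> A <= A' -> W rho F A -> W rho' F A'.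
Proof.
  intros rho rho' F A A' Hr HA (H1 & H2 & H3). split; [auto|split; auto].
  eapply bnd_le; [|exact HA]. eapply bnd_mono; [exact H3|]. intros k.
  apply Rmult_le_compat_r; [apply Cmod_ge_0|]. apply exp_mono, Rmult_le_compat_r; auto. apply IZR_le; lia.
Qed.

Lemma W_plus : forall rho F G A B, W rho F A -> W rho G B -> W rho (fun x => F x + G x)%C (A + B).
Proof.
  intros rho F G A B (F1 & F2 & F3) (G1 & G2 & G3). split; [cc|split].
  - intros x. now rewrite F2, G2.
  - eapply bnd_mono; [apply (bnd_plus _ _ _ _ F3 G3)|]. intros k. cbv beta.
    rewrite cft_plus by auto. pose proof (Cmod_triangle (cft F k) (cft G k)).
    pose proof (exp_pos (rho * zabs k)). nra.
Qed.

Lemma W_scal : forall rho c F A, W rho F A -> W rho (fun x => c * F x)%C (Cmod c * A).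
Proof.
  intros rho c F A (F1 & F2 & F3). split; [cc|split].
  - intros x. now rewrite F2.
  - eapply bnd_ext; [apply (bnd_scal _ _ (Cmod c) (Cmod_ge_0 c) F3)|]. intros k. cbv beta.
    rewrite cft_scal, Cmod_mult by auto. ring.
Qed.

Lemma W_opp : forall rho F A, W rho F A -> W rho (fun x => - F x)%C A.
Proof.
  intros rho F A H. apply (W_ext _ (fun x => RtoC (-1) * F x)%C).
  - intros; apply C_eq; simpl; ring.
  - replace A with (Cmod (RtoC (-1)) * A); [now apply W_scal|].
    rewrite Cmod_R, Rabs_left by lra. ring.
Qed.

Lemma W_minus : forall rho F G A B, W rho F A -> W rho G B -> W rho (fun x => F x - G x)%C (A + B).
Proof. intros. apply W_plus; auto. now apply W_opp. Qed.

Lemma W_conj : forall rho F A, W rho F A -> W rho (fun x => Cconj (F x)) A.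
Proof.
  intros rho F A (F1 & F2 & F3). split; [cc|split].
  - intros x. now rewrite F2.
  - eapply bnd_ext; [apply (bnd_reindex _ _ Z.opp ltac:(intros; lia) F3)|]. intros k. cbv beta.
    rewrite cft_conj, Cmod_conj, Z.abs_opp by auto. reflexivity.
Qed.

Lemma W_of_bnd : forall rho F A, ccont F -> cper F ->
  bnd (fun k => exp (rho * zabs k) * Cmod (cft F k)) A -> W rho F A.
Proof. intros; split; auto. Qed.

Lemma W_cis : forall rho k, W rho (fun x => cis (IZR k * x)) (exp (rho * zabs k)).
Proof.
  intros rho k. split; [cc|split].
  - intros x. apply cis_2PI.
  - intros l Hl.
    apply Rle_trans with (lsum l (fun j => if Z.eqb j k then exp (rho * zabs k) else 0)).
    + apply lsum_le. intros j _. rewrite cft_cis. destruct (Z.eqb_spec j k) as [->|].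
      * rewrite Cmod_1; lra.
      * rewrite Cmod_0; lra.
    + pose proof (exp_pos (rho * zabs k)).
      clear - Hl H. induction Hl as [|x l Hx Hl IH]; simpl; [lra|].
      destruct (Z.eqb_spec x k) as [->|]; [|lra].
      replace (lsum l _) with 0; [lra|].
      clear - Hx. induction l as [|y l IH]; simpl; [reflexivity|].
      destruct (Z.eqb_spec y k) as [->|]; [exfalso; apply Hx; now left|].
      rewrite <- IH; [ring|]. intros H; apply Hx; now right.
Qed.

Lemma W_const : forall rho c, W rho (fun _ => c) (Cmod c).
Proof.
  intros rho c. apply (W_ext _ (fun x => c * cis (IZR 0 * x))%C).
  - intros. rewrite Rmult_0_l, cis_0. ring.
  - replace (Cmod c) with (Cmod c * exp (rho * zabs 0)).
    + apply W_scal, W_cis.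
    + simpl. rewrite Rmult_0_r, exp_0. ring.
Qed.

Lemma cft_shift : forall F j k, cft (fun x => F x * cis (IZR j * x))%C k = cft F (k - j).
Proof.
  intros F j k. unfold cft. f_equal. apply cint_ext. intros x.
  rewrite <- Cmult_assoc, <- cis_add. do 2 f_equal. rewrite minus_IZR. ring.
Qed.

(** The coefficients of a product are the convolution of the coefficients, as
    soon as one of the factors has an absolutely convergent Fourier series. *)
Lemma cft_mult : forall F G, ccont F -> cper F -> summable (cft F) -> ccont G -> cper G ->
  forall k, cft (fun x => F x * G x)%C k = conv (cft F) (cft G) k.
Proof.
  intros F G HF Fp [A HA] HG Gp k.
  destruct (ccont_bounded G HG Gp) as (M & HM0 & HM).
  symmetry. apply zlim_Zser_eq.
  apply (zlim_ext (fun j => cft (fun x => cft F j * cis (IZR j * x) * G x)%C k)).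
  - intros j. rewrite (cft_ext _ (fun x => cft F j * (G x * cis (IZR j * x)))%C) by (intros; ring).
    rewrite cft_scal by cc. now rewrite cft_shift.
  - rewrite (cft_ext (fun x => F x * G x)%C (fun x => Zser (fun j => cft F j * cis (IZR j * x) * G x)%C)).
    + apply (cft_Zser (fun j x => cft F j * cis (IZR j * x) * G x)%C (fun j => M * Cmod (cft F j)) (M * A)).
      * now apply bnd_scal.
      * intros j x. rewrite !Cmod_mult, Cmod_cis. pose proof (Cmod_ge_0 (cft F j)). specialize (HM x). nra.
      * intros; cc.
    + intros x. rewrite (fser_cft F HF Fp ltac:(exists A; auto) x). symmetry. apply zlim_Zser_eq.
      apply (zlim_ext (fun j => G x * (cft F j * cis (IZR j * x)))%C); [intros; ring|].
      rewrite Cmult_comm. apply zlim_scal, summable_zlim. exists A.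
      eapply bnd_mono; [exact HA|]. intros; rewrite fser_term; lra.
Qed.

Lemma expw_sub : forall rho j k, 0 <= rho ->
  exp (rho * zabs k) <= exp (rho * zabs j) * exp (rho * zabs (k - j)).
Proof.
  intros rho j k H. rewrite <- exp_plus. apply exp_mono. rewrite <- Rmult_plus_distr_l, <- plus_IZR.
  apply Rmult_le_compat_l; auto. apply IZR_le. lia.
Qed.

Lemma summable_conv : forall u v A B, bnd (fun k => Cmod (u k)) A -> (forall k, Cmod (v k) <= B) ->
  forall k, summable (fun j => u j * v (k - j)%Z)%C.
Proof.
  intros u v A B HA HB k. exists (B * A). eapply bnd_mono.
  - apply bnd_scal; [|exact HA]. eapply Rle_trans; [apply Cmod_ge_0|apply (HB 0%Z)].
  - intros j. cbv beta. rewrite Cmod_mult, (Rmult_comm B).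
    apply Rmult_le_compat_l; [apply Cmod_ge_0|apply HB].
Qed.

Lemma bnd_zero : bnd (fun _ => 0) 0.
Proof. intros l _. induction l; simpl; lra. Qed.

Lemma W_mult : forall rho F G A B, 0 <= rho -> W rho F A -> W rho G B -> W rho (fun x => F x * G x)%C (A * B).
Proof.
  intros rho F G A B Hr HF HG.
  pose proof (W_summable _ _ _ Hr HF) as SF. pose proof (W_summable _ _ _ Hr HG) as SG.
  destruct HF as (F1 & F2 & F3). destruct HG as (G1 & G2 & G3).
  split; [cc|split].
  - intros x. now rewrite F2, G2.
  - eapply bnd_ext with (a := fun k => exp (rho * zabs k) * Cmod (conv (cft F) (cft G) k)).
    2:{ intros k. cbv beta. rewrite cft_mult; auto. now exists A. }
    replace (A * B) with (A * B + 0 * 0) by ring.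
    apply (conv_bnd _ (fun k => exp (rho * zabs k)) (fun k => exp (rho * zabs k)) (fun _ => 0) (fun _ => 0));
      auto; try (intros; lra); try (intros; epos).
    + intros j k. rewrite Rmult_0_l, Rplus_0_r. now apply expw_sub.
    + eapply bnd_ext; [apply bnd_zero|]. intros; cbv beta; ring.
    + eapply bnd_ext; [apply bnd_zero|]. intros; cbv beta; ring.
    + eapply summable_conv; [exact SF|]. intros k. apply (bnd_term _ _ k SG).
Qed.

(** The bound on finite sums of coefficients passes to uniform limits. *)
Lemma W_lim : forall rho F A, ccont F -> cper F ->
  (forall eps, 0 < eps -> exists G, W rho G A /\ forall x, Cmod (G x - F x) <= eps) -> W rho F A.
Proof.
  intros rho F A HF Hp H. split; [auto|split; [auto|]]. intros l Hl.
  apply Rnot_lt_le. intros Hlt. set (S := lsum l (fun k => exp (rho * zabs k) * Cmod (cft F k))) in *.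
  set (E := lsum l (fun k => exp (rho * zabs k))).
  assert (HE : 0 <= E) by (apply lsum_nonneg; intros; epos).
  destruct (H ((S - A) / (2 * (E + 1)))) as (G & HG & HGF); [apply Rdiv_lt_0_compat; lra|].
  set (e := (S - A) / (2 * (E + 1))) in *.
  assert (S <= lsum l (fun k => exp (rho * zabs k) * Cmod (cft G k) + e * exp (rho * zabs k))).
  { apply lsum_le. intros k _.
    assert (Cmod (cft F k) <= Cmod (cft G k) + e).
    { eapply Rle_trans; [apply (Cmod_le_sub _ (cft G k))|]. apply Rplus_le_compat_l.
      rewrite Cmod_minus_sym, <- cft_minus by cc. apply cft_bound; auto. cc. }
    pose proof (exp_pos (rho * zabs k)). nra. }
  rewrite lsum_plus, lsum_scal in H0. fold E in H0.
  pose proof (proj2 (proj2 HG) l Hl) as HGl. cbv beta in HGl.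
  assert (e * E <= (S - A) / 2).
  { unfold e. apply Rmult_le_reg_r with (2 * (E + 1)); [lra|]. field_simplify; [|lra]. nra. }
  lra.
Qed.

Lemma exp_quad : forall t, Rabs t <= 1 / 2 -> 0 <= exp t - (1 + t) <= 2 * t ^ 2.
Proof.
  intros t Ht. apply Rabs_le_between in Ht. pose proof (exp_ineq1_le t). split; [lra|].
  assert (exp t <= / (1 - t)).
  { replace (exp t) with (/ exp (- t)) by (rewrite exp_Ropp, Rinv_inv; auto).
    apply Rinv_le_contravar; [lra|]. pose proof (exp_ineq1_le (- t)). lra. }
  assert (/ (1 - t) <= 1 + t + 2 * t ^ 2); [|lra].
  apply Rmult_le_reg_l with (1 - t); [lra|]. rewrite Rinv_r by lra. nra.
Qed.

Lemma exp_nat : forall (n : nat) t, exp (INR n * t) = exp t ^ n.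
Proof.
  induction n as [|n IH]; intros t; [simpl; rewrite Rmult_0_l; apply exp_0|].
  rewrite S_INR. cbn [pow]. rewrite <- IH, <- exp_plus. f_equal; ring.
Qed.

Lemma ccont_exp : forall (h : R -> R) c, ccont (fun x => RtoC (h x)) -> ccont (fun x => RtoC (exp (c * h x))).
Proof.
  intros h c [H _]. apply ccont_RtoC. intros x.
  apply (continuous_comp (fun y => c * h y) exp).
  - apply @continuous_mult; [apply continuous_const|apply H].
  - eapply continuous_of_derivable. apply is_derive_Reals, derivable_pt_lim_exp.
Qed.
#[export] Hint Resolve ccont_exp : cc.

Lemma Zser_W : forall rho (u : Z -> R -> C) a A, 0 <= rho -> (forall k, W rho (u k) (a k)) -> bnd a A ->
  W rho (fun x => Zser (fun k => u k x)) A.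
Proof.
  intros rho u a A Hr Hu HA.
  assert (Hsup : forall k x, Cmod (u k x) <= a k) by (intros; eapply W_sup; eauto).
  apply W_lim.
  - apply (ccont_Zser u a A); auto. intros k; apply (Hu k).
  - intros x. apply Zser_ext. intros k. apply (Hu k).
  - intros eps He. destruct (zser_uniform a A HA eps He) as [N HN].
    exists (fun x => csum (win N) (fun k => u k x)). split.
    + apply (W_mono rho rho _ (lsum (win N) a)); [lra|apply HA, win_NoDup|].
      generalize (win N). clear - Hu. induction l as [|y l IH]; simpl.
      * pose proof (W_const rho (RtoC 0)) as Q. rewrite Cmod_0 in Q. exact Q.
      * apply W_plus; auto.
    + intros x. apply HN; auto.
Qed.

Definition eterm (y : R) (n : nat) : R := y ^ n / INR (fact n).

(** Taylor remainders of the exponential; having nonnegative coefficients, they act on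
    the algebras of [W] with the obvious bound. *)
Fixpoint etail (m : nat) (y : R) : R :=
  match m with O => exp y | S n => etail n y - eterm y n end.

Lemma etail_series : forall m y, is_series (fun n => eterm y (n + m)) (etail m y).
Proof.
  intros m y. induction m as [|m IH]; simpl.
  - eapply is_series_ext; [|exact (proj1 (is_pseries_R _ _ _) (is_exp_Reals y))].
    intros n. unfold eterm. rewrite Nat.add_0_r. simpl. unfold Rdiv. ring.
  - eapply is_series_ext; [|apply (is_series_incr_1 (fun n => eterm y (n + m)) (etail m y - eterm y m))].
    + intros n. simpl. f_equal. lia.
    + match goal with |- is_series _ ?l => replace l with (etail m y); [exact IH|] end. unfold plus; simpl. ring.
Qed.

Lemma eterm_pos : forall y n, 0 <= y -> 0 <= eterm y n.
Proof. intros y n Hy. apply Rmult_le_pos; [now apply pow_le|]. left. apply Rinv_0_lt_compat, INR_fact_lt_0. Qed.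

Lemma etail_partial : forall m y N, 0 <= y -> sum_n (fun n => eterm y (n + m)) N <= etail m y.
Proof.
  intros m y N Hy. apply (is_lim_seq_incr_compare (sum_n (fun n => eterm y (n + m)))); [apply etail_series|].
  intros n. rewrite sum_Sn. unfold plus; simpl. pose proof (eterm_pos y (S n + m) Hy). simpl in *. lra.
Qed.

Lemma etail_le : forall m y, 0 <= y -> 0 <= etail m y <= y ^ m * exp y.
Proof.
  intros m y Hy. split.
  - eapply Rle_trans; [|apply (etail_partial m y 0 Hy)]. rewrite sum_O. now apply eterm_pos.
  - assert (Hs : is_series (fun n => y ^ m * eterm y n) (y ^ m * exp y)).
    { apply (is_series_scal (K := R_AbsRing) (V := R_NormedModule) (y ^ m) (eterm y) (exp y)). eapply is_series_ext; [|exact (etail_series 0 y)]. intros n. simpl. f_equal. lia. }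
    apply (is_lim_seq_le (sum_n (fun n => eterm y (n + m))) (sum_n (fun n => y ^ m * eterm y n)) (etail m y) (y ^ m * exp y)); auto.
    + intros N. apply sum_n_m_le. intros n. unfold eterm. rewrite pow_add. unfold Rdiv.
      replace (y ^ m * (y ^ n * / INR (fact n))) with (y ^ n * y ^ m * / INR (fact n)) by ring.
      apply Rmult_le_compat_l; [apply Rmult_le_pos; now apply pow_le|]. apply Rinv_le_contravar; [apply INR_fact_lt_0|].
      apply le_INR, fact_le. lia.
    + apply etail_series.
Qed.

(** Absolute convergence of the exponential series in the algebra of [W]. *)
Lemma W_etail : forall rho (h : R -> R) d c m, 0 <= rho -> W rho (fun x => RtoC (h x)) d ->
  W rho (fun x => RtoC (etail m (c * h x))) (etail m (Rabs c * d)).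
Proof.
  intros rho h d c m Hr Hh. pose proof (W_ge0 _ _ _ Hh) as Hd. set (Y := Rabs c * d).
  assert (HY : 0 <= Y) by (apply Rmult_le_pos; [apply Rabs_pos|auto]).
  assert (Hp : forall n, W rho (fun x => RtoC ((c * h x) ^ n)) (Y ^ n)).
  { induction n as [|n IH]; simpl.
    - eapply W_mono; [apply Rle_refl| |apply W_const]. rewrite Cmod_1. lra.
    - apply (W_ext _ (fun x => RtoC c * RtoC (h x) * RtoC ((c * h x) ^ n))%C); [intros; now rewrite <- !RtoC_mult|].
      apply W_mult; auto. unfold Y. rewrite <- Cmod_R. now apply W_scal. }
  set (a := fun (y : R) (k : Z) => if Z.ltb k 0 then 0 else eterm y (Z.to_nat k + m)).
  assert (Hsum : forall y N, lsum (win N) (a y) = sum_n (fun n => eterm y (n + m)) N).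
  { intros y N. induction N as [|N IH].
    - rewrite sum_O. unfold a. simpl. ring.
    - rewrite sum_Sn, <- IH. unfold plus; simpl lsum. unfold a at 1 2.
      destruct (Z.ltb_spec (Z.pos (Pos.of_succ_nat N)) 0); [lia|]. destruct (Z.ltb_spec (Z.neg (Pos.of_succ_nat N)) 0); [|lia].
      replace (Z.to_nat (Z.pos (Pos.of_succ_nat N))) with (S N) by lia. simpl. ring. }
  apply (W_ext _ (fun x => Zser (fun k => RtoC (a (c * h x) k)))).
  - intros x. apply zlim_Zser_eq. intros eps Heps.
    destruct (proj1 (is_lim_seq_Reals _ _) (etail_series m (c * h x)) eps Heps) as (N0 & HN0).
    exists N0. intros N HN. rewrite csum_RtoC, <- RtoC_minus, Cmod_R, Hsum. left. now apply HN0.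
  - apply (Zser_W rho (fun k x => RtoC (a (c * h x) k)) (a Y)); auto.
    + intros k. unfold a. destruct Z.ltb.
      * eapply W_mono; [apply Rle_refl| |apply W_const]. rewrite Cmod_0. lra.
      * set (n := (Z.to_nat k + m)%nat). pose proof (INR_fact_lt_0 n).
        apply (W_ext _ (fun x => RtoC (/ INR (fact n)) * RtoC ((c * h x) ^ n))%C).
        { intros x. rewrite <- RtoC_mult. f_equal. unfold eterm. field. lra. }
        replace (eterm Y n) with (Cmod (RtoC (/ INR (fact n))) * Y ^ n); [now apply W_scal|].
        rewrite Cmod_R, Rabs_pos_eq by (left; now apply Rinv_0_lt_compat). unfold eterm. field. lra.
    + apply bnd_win; [|intros N; rewrite Hsum; now apply etail_partial].
      intros k. unfold a. destruct Z.ltb; [lra|now apply eterm_pos].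
Qed.

Lemma etail_1 : forall y, etail 1 y = exp y - 1.
Proof. intros. unfold etail, eterm. simpl. field. Qed.

Lemma etail_2 : forall y, etail 2 y = exp y - 1 - y.
Proof. intros. unfold etail, eterm. simpl. field. Qed.

Lemma etail_3 : forall y, etail 3 y = exp y - 1 - y - y ^ 2 / 2.
Proof. intros. unfold etail, eterm. simpl. field. Qed.

Lemma W_exp : forall rho (h : R -> R) d c, 0 <= rho -> W rho (fun x => RtoC (h x)) d ->
  W rho (fun x => RtoC (exp (c * h x)) - 1)%C (exp (Rabs c * d) - 1).
Proof.
  intros rho h d c Hr Hh. rewrite <- etail_1. apply (W_ext _ (fun x => RtoC (etail 1 (c * h x)))); [|now apply W_etail].
  intros x. now rewrite etail_1, RtoC_minus.
Qed.

Lemma W_exp' : forall rho (h : R -> R) d c, 0 <= rho -> W rho (fun x => RtoC (h x)) d ->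
  W rho (fun x => RtoC (exp (c * h x))) (exp (Rabs c * d)).
Proof.
  intros rho h d c Hr Hh.
  apply (W_ext _ (fun x => (RtoC (exp (c * h x)) - 1) + 1)%C); [intros; ring|].
  replace (exp (Rabs c * d)) with ((exp (Rabs c * d) - 1) + Cmod (RtoC 1)) by (rewrite Cmod_1; ring).
  apply W_plus; [now apply W_exp|apply W_const].
Qed.

(** ** Differentiation *)

Lemma x_exp : forall a x, 0 < a -> x <= / a * exp (a * x).
Proof.
  intros a x Ha. pose proof (exp_ineq1_le (a * x)).
  apply Rmult_le_reg_l with a; [lra|]. rewrite <- Rmult_assoc, Rinv_r by lra. lra.
Qed.

Lemma cis_quad : forall y, Cmod (cis y - 1 - Ci * RtoC y) <= 2 * y ^ 2.
Proof.
  assert (cosb : forall y, 0 <= 1 - cos y <= y ^ 2 / 2).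
  { intros y. replace y with (2 * (y / 2)) by field. rewrite cos_2a_sin.
    assert (Hs : sin (y / 2) ^ 2 <= (y / 2) ^ 2).
    { assert (Hpos : forall z, 0 <= z -> Rabs (sin z) <= z).
      { intros z Hz. destruct (MVT_gen sin 0 z cos) as (c & _ & Hc).
        - intros; apply is_derive_Reals, derivable_pt_lim_sin.
        - intros; apply continuity_sin.
        - rewrite sin_0, !Rminus_0_r in Hc. rewrite Hc, Rabs_mult, (Rabs_pos_eq z) by auto.
          pose proof (COS_bound c). assert (Rabs (cos c) <= 1) by (apply Rabs_le; lra). nra. }
      rewrite <- (pow2_abs (sin _)), <- (pow2_abs (y / 2)).
      apply pow_incr. split; [apply Rabs_pos|].
      destruct (Rle_or_lt 0 (y / 2)).
      - rewrite (Rabs_pos_eq (y / 2)) by auto. auto.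
      - rewrite (Rabs_left (y / 2)) by auto. rewrite <- Rabs_Ropp, <- sin_neg. apply Hpos. lra. }
    nra. }
  intros y. eapply Rle_trans; [apply Cmod_le_ReIm|]. unfold cis; simpl.
  replace (cos y + - (1) + - (0 * y - 1 * 0)) with (- (1 - cos y)) by ring.
  replace (sin y + - 0 + - (0 * 0 + 1 * y)) with (sin y - y) by ring.
  destruct (cosb y) as [H1 H2]. rewrite Rabs_Ropp, (Rabs_pos_eq (1 - cos y)) by auto.
  assert (Rabs (sin y - y) <= y ^ 2); [|lra].
  destruct (MVT_gen (fun z => sin z - z) 0 y (fun z => cos z - 1)) as (c & Hc1 & Hc).
  - intros. auto_derive; auto. ring.
  - intros. apply continuity_pt_minus; [apply continuity_sin|apply derivable_continuous_pt, derivable_pt_id].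
  - rewrite sin_0, !Rminus_0_r in Hc. rewrite Hc, Rabs_mult.
    destruct (cosb c) as [C1 C2]. rewrite Rabs_left1 by lra.
    assert (Hcy : c ^ 2 <= y ^ 2).
    { unfold Rmin, Rmax in Hc1. destruct Rle_dec; nra. }
    rewrite <- (pow2_abs y). rewrite <- (pow2_abs y) in Hcy.
    pose proof (COS_bound c).
    destruct (Rle_or_lt (Rabs y) 2).
    + nra.
    + nra.
Qed.

Lemma cderiv_quad : forall F x l B, (forall t, Cmod (F (x + t)%R - F x - RtoC t * l) <= B * t ^ 2) -> cderiv F x l.
Proof.
  assert (key : forall (f : R -> R) x l B, (forall t, Rabs (f (x + t) - f x - t * l) <= B * t ^ 2) -> is_derive f x l).
  { intros f x l B H. apply is_derive_Reals. intros e He.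
    assert (HB : 0 <= B). { specialize (H 1). pose proof (Rabs_pos (f (x + 1) - f x - 1 * l)). lra. }
    assert (Hd : 0 < e / (B + 1)) by (apply Rdiv_lt_0_compat; lra).
    exists (mkposreal _ Hd). intros t Ht0 Ht. simpl in Ht.
    replace ((f (x + t) - f x) / t - l) with ((f (x + t) - f x - t * l) * / t) by (field; auto).
    rewrite Rabs_mult, Rabs_inv. specialize (H t). rewrite <- (pow2_abs t) in H.
    assert (0 < Rabs t) by (apply Rabs_pos_lt; auto).
    apply Rmult_lt_reg_r with (Rabs t); auto. rewrite Rmult_assoc, Rinv_l, Rmult_1_r by lra.
    eapply Rle_lt_trans; [exact H|].
    assert (B * Rabs t < e); [|nra].
    apply Rle_lt_trans with (B * (e / (B + 1))); [apply Rmult_le_compat_l; lra|].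
    apply Rmult_lt_reg_r with (B + 1); [lra|]. field_simplify; [|lra]. nra. }
  intros F x l B H. split; apply (key _ _ _ B); intros t; (eapply Rle_trans; [|apply (H t)]).
  - eapply Rle_trans; [|apply re_le_Cmod]. right. f_equal. simpl. unfold Re. ring.
  - eapply Rle_trans; [|apply im_le_Cmod]. right. f_equal. simpl. unfold Im. ring.
Qed.

Definition dcoef (c : Z -> C) (k : Z) : C := (Ci * RtoC (IZR k) * c k)%C.

Lemma Cmod_Cik : forall k, Cmod (Ci * RtoC (IZR k)) = zabs k.
Proof. intros. rewrite Cmod_mult, Cmod_Ci, Cmod_R, abs_IZR. ring. Qed.

Lemma bnd_dweight : forall rho rho' (c : Z -> C) A, rho' < rho ->
  bnd (fun k => exp (rho * zabs k) * Cmod (c k)) A ->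
  bnd (fun k => exp (rho' * zabs k) * (zabs k * Cmod (c k))) (A / (rho - rho')).
Proof.
  intros rho rho' c A Hr H. unfold Rdiv. rewrite Rmult_comm.
  assert (Hi : 0 <= / (rho - rho')) by (pos).
  eapply bnd_mono; [apply (bnd_scal _ _ (/ (rho - rho')) Hi H)|].
  intros k. cbv beta. pose proof (x_exp (rho - rho') (zabs k) ltac:(lra)) as Hx.
  replace (exp (rho * zabs k)) with (exp ((rho - rho') * zabs k) * exp (rho' * zabs k))
    by (rewrite <- exp_plus; f_equal; ring).
  pose proof (exp_pos (rho' * zabs k)). pose proof (Cmod_ge_0 (c k)).
  assert (0 <= exp (rho' * zabs k) * Cmod (c k)) by nra.
  apply Rle_trans with (zabs k * (exp (rho' * zabs k) * Cmod (c k))); [right; ring|].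
  eapply Rle_trans; [apply Rmult_le_compat_r; [auto|exact Hx]|]. right; ring.
Qed.

(** Termwise differentiation; the factor [|k|] is paid by the loss of radius. *)
Lemma W_deriv : forall rho rho' F A, 0 <= rho' < rho -> W rho F A ->
  (forall x, cderiv F x (fser (dcoef (cft F)) x)) /\ W rho' (fser (dcoef (cft F))) (A / (rho - rho')) /\
  (forall k, cft (fser (dcoef (cft F))) k = dcoef (cft F) k).
Proof.
  intros rho rho' F A Hr HF.
  assert (Hb : bnd (fun k => exp (rho' * zabs k) * Cmod (dcoef (cft F) k)) (A / (rho - rho'))).
  { eapply bnd_ext; [apply (bnd_dweight rho rho' (cft F) A); [lra|apply HF]|].
    intros k. cbv beta. unfold dcoef. now rewrite (Cmod_mult (_ * _)%C), Cmod_Cik. }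
  assert (Hs : summable (dcoef (cft F))).
  { exists (A / (rho - rho')). eapply bnd_mono; [exact Hb|]. intros k. cbv beta.
    pose proof (expw_ge_1 rho' k ltac:(lra)). pose proof (Cmod_ge_0 (dcoef (cft F) k)). nra. }
  split; [|split].
  - assert (exists B, bnd (fun k => zabs k * (zabs k * Cmod (cft F k))) B) as [B HB].
    { pose proof (bnd_dweight rho (rho / 2) (cft F) A ltac:(lra) (proj2 (proj2 HF))) as B1.
      pose proof (bnd_dweight (rho / 2) 0 (fun k => RtoC (zabs k) * cft F k)%C (A / (rho - rho / 2)) ltac:(lra)) as B2.
      eexists. eapply bnd_ext; [apply B2|].
      - eapply bnd_ext; [apply B1|]. intros k; cbv beta.
        rewrite Cmod_mult, Cmod_R, (Rabs_pos_eq _ (IZR_abs_pos k)). reflexivity.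
      - intros k; cbv beta. rewrite Rmult_0_l, exp_0, Rmult_1_l, Cmod_mult, Cmod_R, (Rabs_pos_eq _ (IZR_abs_pos k)). reflexivity. }
    intros x. apply (cderiv_quad _ _ _ (2 * B)). intros t.
    rewrite (W_inv rho F A ltac:(lra) HF (x + t)), (W_inv rho F A ltac:(lra) HF x).
    pose proof (W_summable rho F A ltac:(lra) HF) as SF.
    assert (S1 : forall y, zlim (fun k => cft F k * cis (IZR k * y))%C (fser (cft F) y)).
    { intros y. apply summable_zlim. exists A. eapply bnd_mono; [exact SF|]. intros; rewrite fser_term; lra. }
    assert (S2 : zlim (fun k => dcoef (cft F) k * cis (IZR k * x))%C (fser (dcoef (cft F)) x)).
    { apply summable_zlim. destruct Hs as [D HD]. exists D. eapply bnd_mono; [exact HD|]. intros; rewrite fser_term; lra. }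
    assert (S3 : zlim (fun k => cft F k * cis (IZR k * x) * (cis (IZR k * t) - 1 - Ci * RtoC (IZR k * t)))%C
       (fser (cft F) (x + t)%R - fser (cft F) x - RtoC t * fser (dcoef (cft F)) x)%C).
    { replace (fser (cft F) (x + t)%R - fser (cft F) x - RtoC t * fser (dcoef (cft F)) x)%C
        with (fser (cft F) (x + t)%R + RtoC (-1) * fser (cft F) x + RtoC (- t) * fser (dcoef (cft F)) x)%C
        by (apply C_eq; simpl; ring).
      eapply zlim_ext; [|apply zlim_plus; [apply zlim_plus; [apply (S1 (x + t))|apply zlim_scal, (S1 x)]|apply zlim_scal, S2]].
      intros k. cbv beta. unfold dcoef. rewrite Rmult_plus_distr_l, cis_add, RtoC_mult.
      replace (RtoC (-1)) with (- RtoC 1)%C by (apply C_eq; simpl; ring).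
      replace (RtoC (- t)) with (- RtoC t)%C by (apply C_eq; simpl; ring). ring. }
    apply (zlim_Cmod _ _ _ S3). intros N. eapply Rle_trans; [apply csum_Cmod|].
    replace (2 * B * t ^ 2) with (2 * t ^ 2 * B) by ring.
    eapply Rle_trans; [|apply (bnd_scal _ _ (2 * t ^ 2) ltac:(nra) HB (win N) (win_NoDup N))].
    apply lsum_le. intros k _. rewrite Cmod_mult, fser_term.
    pose proof (cis_quad (IZR k * t)) as Hq. pose proof (Cmod_ge_0 (cft F k)).
    eapply Rle_trans; [apply Rmult_le_compat_l; [auto|exact Hq]|]. right.
    rewrite abs_IZR. replace (2 * (IZR k * t) ^ 2) with (2 * t ^ 2 * (IZR k) ^ 2) by ring.
    rewrite <- (pow2_abs (IZR k)). ring.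
  - split; [apply fser_ccont; auto|split; [apply fser_cper|]].
    eapply bnd_ext; [exact Hb|]. intros k. cbv beta. now rewrite cft_fser.
  - intros k. now apply cft_fser.
Qed.


(** * Expansions in the exponentials of a curve *)

(** By biorthogonality, the coefficient of [E_{- k}] in an expansion of [b] on the curve. *)
Definition ccf (h h1 : R -> R) (b : R -> C) (k : Z) : C :=
  (RtoC (/ (2 * PI)) * cint (fun x => b x * gp h1 x * Ek h k x)%C)%C.

Lemma geom_bnd : forall a, 0 < a -> bnd (fun k => exp (- a * zabs k)) (1 + 2 / a).
Proof.
  intros a Ha. apply bnd_win; [intros; epos|].
  assert (Hq2 : exp (- a) * (1 + / a) <= / a).
  { rewrite exp_Ropp. pose proof (exp_ineq1_le a). pose proof (exp_pos a).
    apply Rmult_le_reg_l with (exp a); auto. rewrite <- Rmult_assoc, Rinv_r by lra.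
    replace (1 * (1 + / a)) with ((1 + a) * / a) by (field; lra).
    apply Rmult_le_compat_r; [pos|lra]. }
  assert (Hia : 0 < / a) by (apply Rinv_0_lt_compat; lra).
  intros N.
  assert (H : lsum (win N) (fun k => exp (- a * zabs k)) <= 1 + 2 * / a * (1 - exp (- a * INR N))).
  { induction N as [|N IH].
    - simpl. rewrite !Rmult_0_r, exp_0. lra.
    - change (lsum (win (S N)) (fun k => exp (- a * zabs k))) with
        (exp (- a * zabs (Z.of_nat (S N))) + (exp (- a * zabs (- Z.of_nat (S N))) +
          lsum (win N) (fun k => exp (- a * zabs k)))).
      rewrite Z.abs_opp, Z.abs_eq, <- INR_IZR_INZ by lia.
      assert (E : exp (- a * INR (S N)) = exp (- a * INR N) * exp (- a)) by (rewrite <- exp_plus, S_INR; f_equal; ring).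
      rewrite E. pose proof (exp_pos (- a * INR N)). set (q := exp (- a)) in *. set (e := exp (- a * INR N)) in *.
      set (i := / a) in *. clearbody q e i. nra. }
  pose proof (exp_pos (- a * INR N)). unfold Rdiv. nra.
Qed.

Lemma Ek_cft : forall h h1 b k,
  (RtoC (/ (2 * PI)) * cint (fun x => b x * Ek h k x))%C = cft (fun x => b x * RtoC (exp (IZR k * h x)))%C k /\
  ccf h h1 b k = cft (fun x => b x * gp h1 x * RtoC (exp (IZR k * h x)))%C k.
Proof.
  intros. unfold ccf, cft. split; f_equal; apply cint_ext; intros x; unfold Ek; ring.
Qed.

Lemma W_gp : forall rho h1 d, W rho (fun x => RtoC (h1 x)) d -> W rho (gp h1) (1 + d).
Proof.
  intros rho h1 d H. apply (W_ext _ (fun x => 1 + Ci * RtoC (h1 x))%C).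
  - intros x. apply C_eq; unfold gp; simpl; ring.
  - replace (1 + d) with (Cmod (RtoC 1) + Cmod Ci * d) by (rewrite Cmod_1, Cmod_Ci; ring).
    apply W_plus; [apply W_const|now apply W_scal].
Qed.

Lemma W_gp1 : forall rho h1 d, W rho (fun x => RtoC (h1 x)) d -> W rho (fun x => gp h1 x - 1)%C d.
Proof.
  intros rho h1 d H. apply (W_ext _ (fun x => Ci * RtoC (h1 x))%C).
  - intros x. apply C_eq; unfold gp; simpl; ring.
  - replace d with (Cmod Ci * d) by (rewrite Cmod_Ci; ring). now apply W_scal.
Qed.

Lemma W_Ek : forall rho h d k, 0 <= rho -> W rho (fun x => RtoC (h x)) d ->
  W rho (Ek h k) (exp ((rho + d) * zabs k)).
Proof.
  intros rho h d k Hr H.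
  apply (W_ext _ (fun x => RtoC (exp (IZR k * h x)) * cis (IZR (- k) * x))%C).
  - intros x. unfold Ek. do 2 f_equal. rewrite opp_IZR. ring.
  - replace (exp ((rho + d) * zabs k)) with (exp (Rabs (IZR k) * d) * exp (rho * zabs (- k))).
    + apply W_mult; auto; [now apply W_exp'|apply W_cis].
    + rewrite <- exp_plus, Z.abs_opp, abs_IZR. f_equal. ring.
Qed.

(** Integration against an exponential gains decay up to the oscillation of [h]. *)
Lemma cint_Ek_bound : forall rho h d b A k, 0 <= rho -> W rho (fun x => RtoC (h x)) d -> W rho b A ->
  Cmod (RtoC (/ (2 * PI)) * cint (fun x => b x * Ek h k x)%C) <= A * exp (- (rho - d) * zabs k).
Proof.
  intros rho h d b A k Hr Hh Hb. rewrite (proj1 (Ek_cft h h b k)).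
  eapply Rle_trans; [apply W_term; apply W_mult; [exact Hr|exact Hb|apply W_exp'; [exact Hr|exact Hh]]|].
  rewrite Rmult_assoc, <- exp_plus, abs_IZR. right. do 2 f_equal. ring.
Qed.

Lemma Cmod_Ek_le' : forall h k x d, (forall x, Rabs (h x) <= d) -> Cmod (Ek h (- k) x) <= exp (d * zabs k).
Proof.
  intros. rewrite <- (Z.abs_opp k), Rmult_comm. apply Cmod_Ek_le. auto.
Qed.

Lemma ccf_majorant : forall h u k x d r A, (forall x, Rabs (h x) <= d) ->
  Cmod (u k) <= A * exp (- r * zabs k) ->
  Cmod (u k * Ek h (- k) x)%C <= A * exp (- (r - d) * zabs k).
Proof.
  intros h u k x d r A Hh Hu. rewrite Cmod_mult.
  eapply Rle_trans; [apply Rmult_le_compat; [apply Cmod_ge_0|apply Cmod_ge_0|exact Hu|now apply Cmod_Ek_le']|].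
  expe.
Qed.

Lemma bnd_decay : forall A r, 0 <= A -> 0 < r -> bnd (fun k => A * exp (- r * zabs k)) (A * (1 + 2 / r)).
Proof. intros. apply bnd_scal; auto. now apply geom_bnd. Qed.

(** The difference of the two sides is continuous and its moments vanish, by
    biorthogonality of the [E_j] on the curve; conclude by completeness. *)
Lemma ccf_expand : forall h h1 b d r A, curve h h1 -> (forall x, Rabs (h1 x) <= 1 / 10) ->
  ccont b -> cper b -> (forall x, Rabs (h x) <= d) -> d < r -> 0 <= A ->
  (forall k, Cmod (ccf h h1 b k) <= A * exp (- r * zabs k)) ->
  forall x, b x = Zser (fun k => ccf h h1 b k * Ek h (- k) x)%C.
Proof.
  intros h h1 b d r A H Hb1 Hb Hbp Hd Hr HA Hdec.
  set (u := ccf h h1 b).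
  assert (Hmaj : forall k x, Cmod (u k * Ek h (- k) x)%C <= A * exp (- (r - d) * zabs k)).
  { intros. apply ccf_majorant; auto. }
  pose proof (bnd_decay A (r - d) HA ltac:(lra)) as HB.
  set (B := fun x => Zser (fun k => u k * Ek h (- k) x)%C).
  assert (HBc : ccont B).
  { apply (ccont_Zser (fun k x => u k * Ek h (- k) x)%C _ _ HB Hmaj). intros; cc. }
  assert (HBp : cper B).
  { intros x. apply Zser_ext. intros k. f_equal. apply (Ek_per h h1 _ H). }
  assert (E : forall x, (b x - B x)%C = RtoC 0).
  { apply (curve_complete h h1); auto.
    - cc.
    - intros x. now rewrite Hbp, HBp.
    - intros k.
      rewrite (cint_ext _ (fun x => b x * gp h1 x * Ek h k x - B x * (gp h1 x * Ek h k x))%C) by (intros; ring).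
      rewrite cint_minus by cc.
      assert (EB : cint (fun x => B x * (gp h1 x * Ek h k x))%C = (RtoC (2 * PI) * u k)%C).
      { assert (Hgb : forall x, Cmod (gp h1 x * Ek h k x)%C <= (1 + 1 / 10) * exp (zabs k * d)).
        { intros x. rewrite Cmod_mult. apply Rmult_le_compat; try apply Cmod_ge_0; [now apply Cmod_gp|now apply Cmod_Ek_le]. }
        eapply zlim_unique.
        - rewrite (cint_ext _ (fun x => Zser (fun j => u j * Ek h (- j) x * (gp h1 x * Ek h k x))%C)).
          + apply (cint_Zser (fun j x => u j * Ek h (- j) x * (gp h1 x * Ek h k x))%C
              (fun j => ((1 + 1 / 10) * exp (zabs k * d)) * (A * exp (- (r - d) * zabs j)))
              (((1 + 1 / 10) * exp (zabs k * d)) * (A * (1 + 2 / (r - d))))).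
            * apply bnd_scal; auto. pose proof (exp_pos (zabs k * d)). lra.
            * intros j x. rewrite Cmod_mult, Rmult_comm. apply Rmult_le_compat; try apply Cmod_ge_0; auto.
            * intros; cc.
          + intros x. symmetry. apply zlim_Zser_eq.
            apply (zlim_ext (fun j => (gp h1 x * Ek h k x) * (u j * Ek h (- j) x))%C); [intros; ring|].
            unfold B. rewrite (Cmult_comm (Zser _)). apply zlim_scal, summable_zlim.
            eapply summable_bnd; [exact HB|]. intros; apply Hmaj.
        - apply (zlim_ext (fun j => if Z.eqb j k then (RtoC (2 * PI) * u k)%C else RtoC 0)); [|apply zlim_single].
          intros j.
          rewrite (cint_ext _ (fun x => u j * (gp h1 x * Ek h (k - j) x))%C).
          + rewrite cint_scal by cc. rewrite (cint_gp_Ek h h1) by auto.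
            destruct (Z.eqb_spec j k) as [->|Hj].
            * rewrite Z.sub_diag. simpl. ring.
            * destruct (Z.eqb_spec (k - j) 0); [lia|ring].
          + intros x. replace (k - j)%Z with (- j + k)%Z by lia. rewrite <- Ek_mult. ring. }
      rewrite EB. unfold u, ccf. rewrite Cmult_assoc, <- RtoC_mult, Rinv_r by (pose proof PI_RGT_0; lra). ring. }
  intros x. specialize (E x). replace (b x) with (b x - B x + B x)%C by ring. rewrite E. apply Cplus_0_l.
Qed.

Lemma expand_int : forall h h1 (u : Z -> C) d r A P, curve h h1 -> (forall x, Rabs (h x) <= d) -> d < r -> 0 <= A ->
  (forall k, Cmod (u k) <= A * exp (- r * zabs k)) -> ccont P -> cper P ->
  zlim (fun j => u j * cint (fun x => P x * Ek h (- j) x))%C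
    (cint (fun x => P x * Zser (fun j => u j * Ek h (- j) x))%C).
Proof.
  intros h h1 u d r A P H Hd Hr HA Hu HP HPp.
  destruct (ccont_bounded P HP HPp) as (M & HM0 & HM).
  pose proof (bnd_decay A (r - d) HA ltac:(lra)) as HB.
  assert (Hmaj : forall k x, Cmod (u k * Ek h (- k) x)%C <= A * exp (- (r - d) * zabs k)).
  { intros. apply ccf_majorant; auto. }
  rewrite (cint_ext _ (fun x => Zser (fun j => u j * (P x * Ek h (- j) x))%C)).
  - eapply zlim_ext; [|apply (cint_Zser (fun j x => u j * (P x * Ek h (- j) x))%C
      (fun j => M * (A * exp (- (r - d) * zabs j))) (M * (A * (1 + 2 / (r - d)))))].
    + intros j. cbv beta. apply cint_scal. cc.
    + now apply bnd_scal.
    + intros j x. replace (u j * (P x * Ek h (- j) x))%C with (P x * (u j * Ek h (- j) x))%C by ring.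
      rewrite Cmod_mult. apply Rmult_le_compat; try apply Cmod_ge_0; auto.
    + intros; cc.
  - intros x. symmetry. apply zlim_Zser_eq.
    apply (zlim_ext (fun j => P x * (u j * Ek h (- j) x))%C); [intros; ring|].
    apply zlim_scal, summable_zlim. eapply summable_bnd; [exact HB|]. intros; apply Hmaj.
Qed.

(** On the curve as on the circle, multiplication by [E_{-j}] shifts the moments. *)
Lemma ccf_mult : forall h h1 a b d r A, curve h h1 -> (forall x, Rabs (h1 x) <= 1 / 10) ->
  ccont a -> cper a -> ccont b -> cper b -> (forall x, Rabs (h x) <= d) -> d < r -> 0 <= A ->
  (forall k, Cmod (ccf h h1 b k) <= A * exp (- r * zabs k)) ->
  forall k, ccf h h1 (fun x => b x * a x)%C k = conv (ccf h h1 b) (ccf h h1 a) k.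
Proof.
  intros h h1 a b d r A H Hb1 Ha Hap Hb Hbp Hd Hr HA Hdec k.
  symmetry. apply zlim_Zser_eq.
  assert (Z : zlim (fun j => ccf h h1 b j * cint (fun x => (a x * gp h1 x * Ek h k x) * Ek h (- j) x))%C
    (cint (fun x => (a x * gp h1 x * Ek h k x) * Zser (fun j => ccf h h1 b j * Ek h (- j) x))%C)).
  { apply (expand_int h h1 _ d r A); auto.
    - cc.
    - intros x. now rewrite Hap, (cper_gp h h1 H x), (Ek_per h h1 k H x). }
  apply (zlim_scal _ _ (RtoC (/ (2 * PI)))) in Z.
  assert (E : (RtoC (/ (2 * PI)) * cint (fun x => (a x * gp h1 x * Ek h k x) * Zser (fun j => ccf h h1 b j * Ek h (- j) x))%C)%C
     = ccf h h1 (fun x => b x * a x)%C k).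
  { unfold ccf at 2. f_equal. apply cint_ext. intros x.
    rewrite <- (ccf_expand h h1 b d r A); auto. ring. }
  rewrite E in Z. eapply zlim_ext; [|exact Z]. intros j. cbv beta.
  unfold ccf at 3. rewrite (cint_ext _ (fun x => a x * gp h1 x * Ek h (k - j) x)%C); [ring|].
  intros x. replace (k - j)%Z with (k + - j)%Z by lia. rewrite <- Ek_mult. ring.
Qed.

(** [h] itself will be known with radius [1]; the difference pays for its derivative. *)
Definition small (d : R) (h h1 : R -> R) : Prop :=
  curve h h1 /\ W (19 / 20) (fun x => RtoC (h x)) d /\ W (19 / 20) (fun x => RtoC (h1 x)) d.

Lemma small_sup : forall d h h1, small d h h1 -> (forall x, Rabs (h x) <= d) /\ (forall x, Rabs (h1 x) <= d).
Proof.
  intros d h h1 (_ & H & H1). split; intros x.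
  - pose proof (W_sup (19 / 20) _ _ x ltac:(lra) H) as Q. cbv beta in Q. now rewrite Cmod_R in Q.
  - pose proof (W_sup (19 / 20) _ _ x ltac:(lra) H1) as Q. cbv beta in Q. now rewrite Cmod_R in Q.
Qed.

(** Reflecting the curve conjugates its exponentials. *)
Definition nf (h : R -> R) (x : R) : R := - h x.

Lemma curve_opp : forall h h1, curve h h1 -> curve (nf h) (nf h1).
Proof.
  intros h h1 (H1 & H2 & H3 & H4). unfold nf. split; [|split; [|split]]; intros x.
  - apply @is_derive_opp. auto.
  - apply @continuous_opp. auto.
  - now rewrite H3.
  - now rewrite H4.
Qed.

Lemma small_opp : forall d h h1, small d h h1 -> small d (nf h) (nf h1).
Proof.
  intros d h h1 (H1 & H2 & H3). split; [now apply curve_opp|split].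
  - apply (W_ext _ (fun x => - RtoC (h x))%C); [intros; unfold nf; now rewrite RtoC_opp|now apply W_opp].
  - apply (W_ext _ (fun x => - RtoC (h1 x))%C); [intros; unfold nf; now rewrite RtoC_opp|now apply W_opp].
Qed.

Lemma Ek_conj : forall h k x, Cconj (Ek h k x) = Ek (nf h) (- k) x.
Proof.
  intros. unfold Ek. rewrite Cconj_mul, Cconj_cis, opp_IZR. f_equal.
  - unfold nf. apply C_eq; simpl; [|ring]. f_equal; ring.
  - f_equal. ring.
Qed.

(** An a priori finite supremum absorbs half of itself. *)
Lemma sup_absorb : forall (f : R -> C) B, (exists M, forall x, Cmod (f x) <= M) ->
  (forall M, 0 <= M -> (forall x, Cmod (f x) <= M) -> forall x, Cmod (f x) <= B + M / 2) ->
  forall x, Cmod (f x) <= 2 * B.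
Proof.
  intros f B [M HM] H.
  destruct (completeness (fun y => exists x, y = Cmod (f x))) as [S [H1 H2]].
  - exists M. intros y [x ->]. auto.
  - exists (Cmod (f 0)), 0. reflexivity.
  - assert (HS : forall x, Cmod (f x) <= S) by (intros x; apply H1; now exists x).
    assert (S <= B + S / 2).
    { apply H2. intros y [x ->]. apply H; auto. eapply Rle_trans; [apply Cmod_ge_0|apply (HS 0)]. }
    intros x. specialize (HS x). lra.
Qed.

Lemma exp_m1 : forall t, 0 <= t -> exp t - 1 <= t * exp t.
Proof.
  intros t Ht. pose proof (exp_ineq1_le (- t)). pose proof (exp_pos t).
  assert (exp t * exp (- t) = 1) by (rewrite <- exp_plus, <- exp_0; f_equal; ring). nra.
Qed.

Lemma W_gp_exp1 : forall rho h h1 d c, 0 <= rho -> W rho (fun x => RtoC (h x)) d -> W rho (fun x => RtoC (h1 x)) d ->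
  W rho (fun x => gp h1 x * RtoC (exp (c * h x)) - 1)%C (exp (Rabs c * d) * (1 + d) - 1).
Proof.
  intros rho h h1 d c Hr H H1.
  apply (W_ext _ (fun x => gp h1 x * (RtoC (exp (c * h x)) - 1) + (gp h1 x - 1))%C); [intros; ring|].
  replace (exp (Rabs c * d) * (1 + d) - 1) with ((1 + d) * (exp (Rabs c * d) - 1) + d) by ring.
  apply W_plus; [apply W_mult; auto; [now apply W_gp|now apply W_exp]|now apply W_gp1].
Qed.

Lemma decay_aux : forall m d, 1 <= m -> 0 <= d ->
  exp (m * d) * (1 + d) - 1 <= 40 * d * exp (m * (1 / 20 + 2 * d)).
Proof.
  intros m d Hm Hd. pose proof (exp_ineq1_le d).
  apply Rle_trans with (exp ((m + 1) * d) - 1).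
  - replace ((m + 1) * d) with (m * d + d) by ring. rewrite exp_plus. pose proof (exp_pos (m * d)). nra.
  - eapply Rle_trans; [apply exp_m1; nra|].
    apply Rle_trans with ((2 * m * d) * exp (2 * d * m)).
    + apply Rmult_le_compat; [nra|epos|nra|apply exp_mono; nra].
    + pose proof (x_exp (1 / 20) m ltac:(lra)) as Hx.
      replace (m * (1 / 20 + 2 * d)) with (1 / 20 * m + 2 * d * m) by ring. rewrite exp_plus.
      pose proof (exp_pos (2 * d * m)). set (E := exp (2 * d * m)) in *. set (E2 := exp (1 / 20 * m)) in *.
      replace (2 * m * d * E) with (m * (2 * d * E)) by ring.
      replace (40 * d * (E2 * E)) with (20 * E2 * (2 * d * E)) by ring.
      apply Rmult_le_compat_r; [nra|]. lra.
Qed.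

Lemma cft_const_1 : forall F k, ccont F -> k <> 0%Z -> cft (fun x => F x - 1)%C k = cft F k.
Proof.
  intros F k HF Hk. rewrite cft_minus by cc. rewrite cft_const.
  destruct (Z.eqb_spec k 0); [contradiction|]. ring.
Qed.

(** On the flat curve this coefficient vanishes, so it is [O(d)]. *)
Lemma reflected_coeff : forall d h h1 i l, small d h h1 -> (0 < i)%Z -> (0 < l)%Z ->
  Cmod (ccf (nf h) (nf h1) (Ek h (- i)) (- l)) <=
  40 * d * exp (- (9 / 10 - 2 * d) * IZR (l + i)).
Proof.
  intros d h h1 i l Hs Hi Hl. pose proof (small_opp d h h1 Hs) as (Hc' & Ho & Ho1).
  destruct Hs as (Hc & H & H1).
  pose proof (W_ge0 _ _ _ H) as Hd.
  assert (E : ccf (nf h) (nf h1) (Ek h (- i)) (- l) =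
     cft (fun x => gp (nf h1) x * RtoC (exp (IZR (i - l) * nf h x)))%C (- (l + i))).
  { unfold ccf, cft. f_equal. apply cint_ext. intros x. unfold Ek.
    replace (IZR (i - l) * nf h x) with (IZR (- i) * h x + IZR (- l) * nf h x)
      by (unfold nf; rewrite minus_IZR, !opp_IZR; ring).
    replace (- (IZR (- (l + i)) * x)) with (- (IZR (- i) * x) + - (IZR (- l) * x))
      by (rewrite !opp_IZR, plus_IZR; ring).
    rewrite exp_plus, cis_add, RtoC_mult. ring. }
  assert (Hcg : ccont (fun x => gp (nf h1) x * RtoC (exp (IZR (i - l) * nf h x)))%C).
  { apply ccont_mult; [cc|apply (ccont_exp (nf h)); eapply W_cc; eauto]. }
  rewrite E, <- cft_const_1 by (auto; lia).
  eapply Rle_trans; [apply W_term; apply (W_gp_exp1 (19 / 20) (nf h) (nf h1) d); [lra|exact Ho|exact Ho1]|].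
  rewrite Z.abs_opp, (Z.abs_eq (l + i)) by lia.
  assert (Hm : 1 <= IZR (l + i)) by (apply IZR_le; lia).
  assert (Hab : Rabs (IZR (i - l)) <= IZR (l + i)) by (rewrite <- abs_IZR; apply IZR_le; lia).
  eapply Rle_trans; [apply Rmult_le_compat_r; [epos|]|].
  { apply Rle_trans with (exp (IZR (l + i) * d) * (1 + d) - 1); [|apply decay_aux; auto].
    apply Rplus_le_compat_r, Rmult_le_compat_r; [lra|]. apply exp_mono. apply Rmult_le_compat_r; auto. }
  expe.
Qed.

Lemma sum_lower : forall (a : Z -> R) A r, 0 <= A -> 0 < r ->
  (forall k, (0 <= k)%Z -> a k = 0) -> (forall k, (k < 0)%Z -> a k <= A * exp (r * IZR k)) -> bnd a (A * (2 / r)).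
Proof.
  intros a A r HA Hr H0 H l Hl.
  assert (HG : bnd (fun k => (if Z.ltb k 0 then exp (r * IZR k) else 0)) (2 / r)).
  { intros m Hm. pose proof (geom_bnd r Hr (0%Z :: filter (fun k => Z.ltb k 0) m)) as G.
    assert (Hn : NoDup (0%Z :: filter (fun k => Z.ltb k 0) m)).
    { constructor; [|now apply NoDup_filter]. intros Hin. apply filter_In in Hin. destruct Hin as [_ Hin]. discriminate. }
    specialize (G Hn). cbn [lsum fold_right] in G. simpl Z.abs in G. rewrite Rmult_0_r, exp_0 in G.
    match type of G with 1 + ?s <= _ => assert (lsum m (fun k => if Z.ltb k 0 then exp (r * IZR k) else 0) = s) as ->; [|lra] end.
    clear. induction m as [|x m IH]; [reflexivity|]. cbn [filter lsum fold_right].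
    destruct (Z.ltb_spec x 0).
    - cbn [fold_right]. rewrite <- IH. f_equal. rewrite Z.abs_neq, opp_IZR by lia. f_equal. ring.
    - rewrite <- IH. apply Rplus_0_l. }
  eapply Rle_trans; [|apply (bnd_scal _ _ A HA HG l Hl)]. apply lsum_le. intros k _.
  destruct (Z.ltb_spec k 0); [now apply H|]. rewrite H0 by lia. lra.
Qed.

(** The elliptic estimate.  [f = U gamma'] is the trace of the complex velocity;
    the vanishing moments say that [U] extends holomorphically below the curve.
    Prescribing one real component of [f] ([s = 1] or [s = -1] below) controls
    [U]: by [f = s conj f + q] and the vanishing of the reflected moments, the
    coefficients of [U] are given by [q] up to a small multiple of [f]. *)
Lemma elliptic : forall d h h1 f s q A, small d h h1 -> d <= 1 / 5000 -> ccont f -> cper f ->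
  Cmod s <= 1 -> (forall x, f x = s * Cconj (f x) + q x)%C -> W (9 / 10) q A ->
  (forall k, (0 <= k)%Z -> cint (fun x => f x * Ek h k x)%C = RtoC 0) ->
  exists U, (forall x, f x = U x * gp h1 x)%C /\ W (4 / 5) U (40 * A) /\
    (forall k, ccf h h1 U k = RtoC (/ (2 * PI)) * cint (fun x => f x * Ek h k x))%C.
Proof.
  intros d h h1 f s q A Hs Hd4 Hf Hfp Hs1 Hfq Hq Hk.
  pose proof Hs as (Hc & Hh & Hh1). pose proof (W_ge0 _ _ _ Hh) as Hd. pose proof (W_ge0 _ _ _ Hq) as HA.
  destruct (small_sup d h h1 Hs) as [Sh Sh1].
  pose proof (small_opp d h h1 Hs) as Hso. pose proof Hso as (Hco & Hho & Hh1o).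
  destruct (small_sup _ _ _ Hso) as [Sho Sh1o].
  pose proof PI_RGT_0 as HPI.
  assert (Hgp0 : forall x, gp h1 x <> RtoC 0).
  { intros x E. apply (f_equal fst) in E. simpl in E. lra. }
  set (U := fun x => (f x / gp h1 x)%C).
  assert (HU : forall x, f x = (U x * gp h1 x)%C) by (intros x; unfold U; field; auto).
  assert (HUc : ccont U).
  { apply (ccont_ext (fun x => f x * (Cconj (gp h1 x) * RtoC (/ (1 + h1 x ^ 2))))%C).
    - intros x. unfold U, gp. apply C_eq; simpl; field; nra.
    - apply ccont_mult; auto. apply ccont_mult; [cc|]. apply ccont_RtoC. intros x.
      destruct Hc as (_ & C1 & _).
      apply (continuous_comp h1 (fun y => / (1 + y ^ 2))); auto.
      eapply continuous_of_derivable. auto_derive; [nra|reflexivity]. }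
  assert (HUp : cper U) by (intros x; unfold U; now rewrite Hfp, (cper_gp h h1 Hc x)).
  assert (Hcf : forall k, ccf h h1 U k = (RtoC (/ (2 * PI)) * cint (fun x => f x * Ek h k x))%C).
  { intros k. unfold ccf. f_equal. apply cint_ext. intros x. now rewrite <- HU. }
  assert (Hup : forall k, (0 <= k)%Z -> ccf h h1 U k = RtoC 0) by (intros; rewrite Hcf, Hk by auto; ring).
  assert (main : forall M, 0 <= M -> (forall x, Cmod (f x) <= M) -> W (4 / 5) U (21 * (A + 100 * d * M))).
  { intros M HM0 HM.
    assert (Hlow : forall i, (0 < i)%Z -> Cmod (ccf h h1 U (- i)) <= (A + 100 * d * M) * exp (- (9 / 10 - 3 * d) * IZR i)).
    { intros i Hi.
      (* Expand [E_{- i}] on the reflected curve, along which [conj f] has moments zero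
         for [k >= 0]. *)
      set (u := ccf (nf h) (nf h1) (Ek h (- i))).
      assert (HWE : W (19 / 20) (fun x => Ek h (- i) x * gp (nf h1) x)%C (exp ((19 / 20 + d) * IZR i) * (1 + d))).
      { apply W_mult; [lra| |now apply W_gp]. replace (IZR i) with (zabs (- i)) by (f_equal; lia).
        apply W_Ek; auto; lra. }
      set (Ai := exp ((19 / 20 + d) * IZR i) * (1 + d)) in *.
      assert (HAi : 0 <= Ai) by (unfold Ai; pose proof (exp_pos ((19 / 20 + d) * IZR i)); nra).
      assert (Hu : forall k, Cmod (u k) <= Ai * exp (- (19 / 20 - d) * zabs k)).
      { intros k. unfold u, ccf. apply (cint_Ek_bound (19 / 20) (nf h) d); auto; lra. }
      assert (Hexp : forall x, Ek h (- i) x = Zser (fun k => u k * Ek (nf h) (- k) x)%C).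
      { unfold u. apply (ccf_expand (nf h) (nf h1) (Ek h (- i)) d (19 / 20 - d) Ai); auto.
        - intros x. specialize (Sh1o x). cbv beta in Sh1o. lra.
        - cc.
        - apply (Ek_per h h1 _ Hc).
        - lra. }
      assert (Z1 : zlim (fun k => u k * cint (fun x => Cconj (f x) * Ek (nf h) (- k) x))%C
         (cint (fun x => Cconj (f x) * Ek h (- i) x)%C)).
      { rewrite (cint_ext _ (fun x => Cconj (f x) * Zser (fun k => u k * Ek (nf h) (- k) x))%C)
          by (intros x; now rewrite <- Hexp).
        apply (expand_int _ _ u d (19 / 20 - d) Ai _ Hco); auto; [lra|cc|].
        intros x. now rewrite Hfp. }
      assert (E1 : Cmod (RtoC (/ (2 * PI)) * cint (fun x => Cconj (f x) * Ek h (- i) x)%C) <=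
         100 * d * M * exp (- (9 / 10 - 3 * d) * IZR i)).
      { apply (zlim_Cmod _ _ _ (zlim_scal _ _ (RtoC (/ (2 * PI))) Z1)). intros N.
        eapply Rle_trans; [apply csum_Cmod|].
        set (D := 40 * d * M * exp (- (9 / 10 - 3 * d) * IZR i)).
        assert (HD : 0 <= D) by (unfold D; repeat apply Rmult_le_pos; try lra; epos).
        assert (Hsl : bnd (fun k => Cmod (RtoC (/ (2 * PI)) * (u k * cint (fun x => Cconj (f x) * Ek (nf h) (- k) x)))%C) (D * (2 / (9 / 10 - 3 * d)))).
        { apply sum_lower; auto; [lra| |].
          - intros k Hk0.
            rewrite (cint_ext _ (fun x => Cconj (f x * Ek h k x)%C)) by (intros; now rewrite Cconj_mul, Ek_conj).
            rewrite cint_conj by cc. rewrite Hk by auto.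
            replace (Cconj (RtoC 0)) with (RtoC 0) by (apply C_eq; simpl; ring).
            rewrite !Cmult_0_r. apply Cmod_0.
          - intros k Hk0. set (l := (- k)%Z). replace k with (- l)%Z by (unfold l; lia). assert (Hl : (0 < l)%Z) by (unfold l; lia).
            rewrite !Cmod_mult, Cmod_R, Rabs_pos_eq by (pos).
            assert (I1 : Cmod (cint (fun x => Cconj (f x) * Ek (nf h) l x)%C) <= 2 * PI * (M * exp (IZR l * d))).
            { apply cint_bound; [cc|]. intros x. rewrite Cmod_mult, Cmod_conj.
              apply Rmult_le_compat; try apply Cmod_ge_0; auto.
              replace (IZR l) with (zabs l) by (f_equal; lia). apply Cmod_Ek_le. apply (Sho x). }
            pose proof (reflected_coeff d h h1 i l Hs Hi Hl) as R1. fold u in R1.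
            pose proof (Cmod_ge_0 (u (- l)%Z)).
            apply Rle_trans with (/ (2 * PI) * (40 * d * exp (- (9 / 10 - 2 * d) * IZR (l + i)) * (2 * PI * (M * exp (IZR l * d))))).
            + apply Rmult_le_compat_l; [pos|].
              apply Rmult_le_compat; auto. apply Cmod_ge_0.
            + replace (/ (2 * PI) * (40 * d * exp (- (9 / 10 - 2 * d) * IZR (l + i)) * (2 * PI * (M * exp (IZR l * d)))))
                with (40 * d * M * (exp (- (9 / 10 - 2 * d) * IZR (l + i)) * exp (IZR l * d))) by (field; lra).
              unfold D. rewrite !Rmult_assoc, <- !exp_plus.
              repeat (apply Rmult_le_compat_l; [lra|]). apply exp_mono.
              rewrite plus_IZR, opp_IZR. assert (0 < IZR i) by (apply IZR_lt; lia).
              nra. }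
        eapply Rle_trans; [apply (Hsl (win N) (win_NoDup N))|].
        replace (100 * d * M * exp (- (9 / 10 - 3 * d) * IZR i)) with (D * (5 / 2)) by (unfold D; field).
        apply Rmult_le_compat_l; auto.
        apply Rmult_le_reg_r with (9 / 10 - 3 * d); [lra|]. unfold Rdiv at 1. rewrite Rmult_assoc, Rinv_l by lra. lra. }
      assert (E2 : Cmod (RtoC (/ (2 * PI)) * cint (fun x => q x * Ek h (- i) x)%C) <= A * exp (- (9 / 10 - 3 * d) * IZR i)).
      { eapply Rle_trans; [apply (cint_Ek_bound (9 / 10) h d q A (- i)); auto; [lra|]|].
        - eapply W_mono; [| |exact Hh]; lra.
        - apply Rmult_le_compat_l; auto. apply exp_mono. rewrite Z.abs_opp, Z.abs_eq by lia.
          assert (0 < IZR i) by (apply IZR_lt; lia). nra. }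
      rewrite Hcf.
      rewrite (cint_ext _ (fun x => s * (Cconj (f x) * Ek h (- i) x) + q x * Ek h (- i) x)%C)
        by (intros x; rewrite (Hfq x) at 1; ring).
      rewrite cint_plus, cint_scal by cc.
      match goal with |- Cmod (?c * (s * ?a + ?b))%C <= _ =>
        replace (c * (s * a + b))%C with (s * (c * a) + c * b)%C by ring end.
      eapply Rle_trans; [apply Cmod_triangle|]. rewrite (Cmod_mult s).
      set (X := Cmod (_ * cint _)%C) in E1 |- *.
      assert (0 <= X) by apply Cmod_ge_0.
      apply Rle_trans with (X + A * exp (- (9 / 10 - 3 * d) * IZR i)); [|rewrite Rmult_plus_distr_r; lra].
      apply Rplus_le_compat; auto. nra. }
    set (B := A + 100 * d * M) in *.
    assert (HB : 0 <= B) by (unfold B; assert (0 <= d * M) by nra; lra).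
    assert (Hcoef : forall k, Cmod (ccf h h1 U k) <= B * exp (- (9 / 10 - 3 * d) * zabs k)).
    { intros k. destruct (Z_le_gt_dec 0 k).
      - rewrite Hup by auto. rewrite Cmod_0. apply Rmult_le_pos; auto. epos.
      - replace k with (- - k)%Z at 1 by lia. rewrite Z.abs_neq by lia. apply Hlow. lia. }
    assert (Hexp : forall x, U x = Zser (fun k => ccf h h1 U k * Ek h (- k) x)%C).
    { apply (ccf_expand h h1 U d (9 / 10 - 3 * d) B); auto; [|lra].
      intros x. specialize (Sh1 x). lra. }
    apply (W_ext _ (fun x => Zser (fun k => ccf h h1 U k * Ek h (- k) x)%C)); [intros; now rewrite <- Hexp|].
    apply (W_mono (4 / 5) (4 / 5) _ (B * (2 / (1 / 10 - 4 * d)))); [lra| |].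
    { rewrite (Rmult_comm 21). apply Rmult_le_compat_l; auto.
      apply Rmult_le_reg_r with (1 / 10 - 4 * d); [lra|]. unfold Rdiv at 1. rewrite Rmult_assoc, Rinv_l by lra. lra. }
    apply (Zser_W _ (fun k x => ccf h h1 U k * Ek h (- k) x)%C
       (fun k => Cmod (ccf h h1 U k) * exp ((4 / 5 + d) * zabs k))); [lra| |].
    - intros k. apply W_scal. rewrite <- (Z.abs_opp k). apply W_Ek; [lra|]. eapply W_mono; [| |exact Hh]; lra.
    - apply sum_lower; auto; [lra| |].
      + intros k Hk0. rewrite Hup by auto. rewrite Cmod_0. ring.
      + intros k Hk0. eapply Rle_trans; [apply Rmult_le_compat_r; [epos|apply Hcoef]|].
        rewrite Rmult_assoc, <- exp_plus, Z.abs_neq, opp_IZR by lia. right. do 2 f_equal. field. }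
  assert (HfM : forall x, Cmod (f x) <= 2 * (22 * A)).
  { apply sup_absorb.
    - destruct (ccont_bounded f Hf Hfp) as (M & _ & HM). now exists M.
    - intros M HM0 HM x. pose proof (W_sup (4 / 5) _ _ x ltac:(lra) (main M HM0 HM)) as Q.
      rewrite HU, Cmod_mult. pose proof (Cmod_gp h1 x d (Sh1 x)) as Q2.
      apply Rle_trans with (21 * (A + 100 * d * M) * (1 + d)).
      + apply Rmult_le_compat; auto; apply Cmod_ge_0.
      + assert (0 <= d * M) by nra.
        nra. }
  exists U. split; [auto|split; [|auto]].
  eapply W_mono; [apply Rle_refl| |apply (main (2 * (22 * A)))]; auto; [|lra].
  assert (d * A <= A / 5000) by nra. lra.
Qed.


(** * From the stream function to the vanishing moments *)

Lemma trace_eps : forall F x l, has_trace F x l -> forall e, 0 < e -> exists d, 0 < d /\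
  forall x' y, Rabs (x' - x) < d -> - d < y < 0 -> Rabs (F x' y - l) < e.
Proof.
  intros F x l H e He.
  specialize (H (fun z => Rabs (z - l) < e)). destruct H as [d Hd].
  - exists (mkposreal e He). intros y Hy. exact Hy.
  - exists d. split; [apply cond_pos|]. intros x' y Hx Hy.
    apply (Hd (x', y)); [|simpl; lra].
    split; simpl.
    + exact Hx.
    + change (Rabs (y - 0) < d). rewrite Rminus_0_r, Rabs_left by lra. lra.
Qed.

Lemma trace_cont : forall F l, (forall x, has_trace F x (l x)) -> forall x, continuous l x.
Proof.
  intros F l H x. apply continuity_pt_filterlim. intros e He.
  destruct (trace_eps F x (l x) (H x) (e / 3) ltac:(lra)) as (d & Hd & Hdd).
  exists d. split; auto. intros x' [_ Hx']. simpl in *. unfold Rdist in *.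
  destruct (trace_eps F x' (l x') (H x') (e / 3) ltac:(lra)) as (d' & Hd' & Hdd').
  set (y := - (Rmin d d' / 2)).
  assert (0 < Rmin d d') by (apply Rmin_glb_lt; auto).
  pose proof (Rmin_l d d'). pose proof (Rmin_r d d').
  assert (A1 : Rabs (F x' y - l x) < e / 3) by (apply Hdd; auto; unfold y; lra).
  assert (A2 : Rabs (F x' y - l x') < e / 3).
  { apply Hdd'; [|unfold y; lra]. unfold Rminus. rewrite Rplus_opp_r, Rabs_R0. auto. }
  apply Rabs_lt_between in A1. apply Rabs_lt_between in A2. apply Rabs_lt_between. lra.
Qed.

(** The trace is a limit in both variables, so compactness of a period makes it
    uniform. *)
Lemma trace_uniform : forall F l, (forall x, has_trace F x (l x)) -> forall e, 0 < e -> exists d, 0 < d /\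
  forall x y, - PI <= x <= PI -> - d < y < 0 -> Rabs (F x y - l x) <= e.
Proof.
  intros F l H e He.
  assert (Hx : forall x, exists d : posreal, forall x' y, Rabs (x' - x) < d -> - d < y < 0 ->
     Rabs (F x' y - l x) < e / 2 /\ Rabs (l x' - l x) < e / 2).
  { intros x. destruct (trace_eps F x (l x) (H x) (e / 2) ltac:(lra)) as (d & Hd & Hdd).
    pose proof (trace_cont F l H x) as Hc. apply continuity_pt_filterlim in Hc.
    destruct (Hc (e / 2) ltac:(lra)) as (d' & Hd' & Hdd').
    assert (Hm : 0 < Rmin d d') by (apply Rmin_glb_lt; auto).
    exists (mkposreal _ Hm). simpl. intros x' y Hx' Hy.
    pose proof (Rmin_l d d'). pose proof (Rmin_r d d'). split.
    - apply Hdd; lra.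
    - destruct (Req_dec x' x) as [->|Hne].
      + unfold Rminus. rewrite Rplus_opp_r, Rabs_R0. lra.
      + apply (Hdd' x'). split; [split; [exact I|auto]|]. simpl. unfold Rdist. lra. }
  pose proof (fun x => constructive_indefinite_description _ (Hx x)) as Hx'.
  set (delta := fun x => proj1_sig (Hx' x)).
  apply Classical_Prop.NNPP. intros Hn.
  destruct (compactness_value_1d (- PI) PI delta) as [d Hd]. apply Hn.
  exists d. split; [apply cond_pos|]. intros x y Hxx Hy.
  apply Rnot_lt_le. intros Hlt. apply (Hd x Hxx). intros (t & Ht & Htx & Htd).
  destruct (proj2_sig (Hx' t) x y) as [B1 B2]; [exact Htx|unfold delta in Htd; lra|].
  apply Rabs_lt_between in B1. apply Rabs_lt_between in B2.
  revert Hlt. apply Rle_not_lt. apply Rabs_le_between. lra.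
Qed.

Lemma cont_2d_x : forall (f : R -> R) x y, continuous f x -> continuity_2d_pt (fun u v => f v) y x.
Proof.
  intros f x y H. apply (continuity_1d_2d_pt_comp f (fun u v => v)).
  - now apply continuity_pt_filterlim.
  - apply continuity_2d_pt_id2.
Qed.

Lemma cont_2d_swap : forall f x y, continuity_2d_pt f x y -> continuity_2d_pt (fun u v => f v u) y x.
Proof. intros f x y H e. destruct (H e) as [d Hd]. exists d. intros u v Hu Hv. now apply Hd. Qed.

Lemma cont_2d_slice : forall f x y, continuity_2d_pt f x y -> continuous (fun u => f u y) x.
Proof.
  intros f x y H. apply continuity_pt_filterlim. intros e He.
  destruct (H (mkposreal e He)) as [d Hd]. exists d. split; [apply cond_pos|].
  intros u [_ Hu]. apply Hd; auto. unfold Rminus. rewrite Rplus_opp_r, Rabs_R0. apply cond_pos.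
Qed.

(** The trace [w - i p] of the complex velocity times [gamma']. *)
Definition tr (w p : R -> R) (x : R) : C := (w x, - p x).

Section Moments.
Variables (h h1 h2 w p : R -> R) (phi : R -> R -> R).
Hypothesis Hc : curve h h1.
Hypothesis Hc1 : curve h1 h2.
Hypothesis Hw : forall x, continuous w x.
Hypothesis HS : stream_function h w phi p.

Let g1 x y := Derive (fun t => phi t y) x.
Let g2 x y := Derive (fun t => phi x t) y.
Let g11 x y := Derive (fun t => g1 t y) x.
Let g21 x y := Derive (fun t => g1 x t) y.
Let g12 x y := Derive (fun t => g2 t y) x.
Let g22 x y := Derive (fun t => g2 x t) y.

Lemma Derive_h : forall x, Derive h x = h1 x.
Proof. intros x. apply is_derive_unique. apply Hc. Qed.

Lemma Derive_h2 : forall x, Derive_n h 2 x = h2 x.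
Proof.
  intros x. simpl. rewrite (Derive_ext _ h1) by apply Derive_h. apply is_derive_unique. apply Hc1.
Qed.

Lemma phi_reg : forall x y, y < 0 ->
  (is_derive (fun t => g1 t y) x (g11 x y) /\ is_derive (fun t => g1 x t) y (g21 x y) /\
   is_derive (fun t => g2 t y) x (g12 x y) /\ is_derive (fun t => g2 x t) y (g22 x y)) /\
  (continuity_2d_pt g1 x y /\ continuity_2d_pt g2 x y) /\
  (continuity_2d_pt g11 x y /\ continuity_2d_pt g21 x y /\ continuity_2d_pt g12 x y /\ continuity_2d_pt g22 x y).
Proof.
  intros x y Hy. destruct HS as (_ & HD & _). specialize (HD x y Hy).
  cbn [ex_diff_n] in HD.
  destruct HD as (_ & _ & _ & (C1 & D11 & D21 & (C11 & _) & (C21 & _)) & (C2 & D12 & D22 & (C12 & _) & (C22 & _))).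
  split; [|split; [split; assumption|split; [|split; [|split]]; assumption]].
  split; [|split; [|split]]; apply Derive_correct; assumption.
Qed.

Lemma phi_schwarz : forall x y, y < 0 -> g21 x y = g12 x y.
Proof.
  intros x y Hy. symmetry. apply (Schwarz phi x y).
  - exists (mkposreal (- y / 2) ltac:(lra)). intros u v Hu Hv. simpl in Hv.
    assert (Hv' : v < 0) by (apply Rabs_lt_between in Hv; lra).
    destruct HS as (_ & HD & _). specialize (HD u v Hv'). cbn [ex_diff_n] in HD.
    destruct HD as (_ & X & Y & (_ & _ & D21 & _) & (_ & D12 & _)).
    split; [|split; [|split]]; assumption.
  - apply phi_reg; auto.
  - apply phi_reg; auto.
Qed.

Lemma phi_pde : forall x y, y < 0 ->
  (1 + h1 x ^ 2) * g22 x y = - g11 x y + 2 * h1 x * g12 x y + h2 x * g2 x y.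
Proof.
  intros x y Hy. destruct HS as (_ & _ & HP & _). specialize (HP x y Hy). cbv zeta in HP.
  rewrite Derive_h, Derive_h2 in HP.
  change (g11 x y + g22 x y = 2 * h1 x * g12 x y + h2 x * g2 x y - h1 x ^ 2 * g22 x y) in HP. lra.
Qed.

Lemma phi_per : forall x y, y < 0 -> g1 (x + 2 * PI) y = g1 x y /\ g2 (x + 2 * PI) y = g2 x y.
Proof.
  intros x y Hy. destruct HS as (HP & HD & _). split.
  - unfold g1. specialize (HD (x + 2 * PI) y Hy) as (_ & HD & _).
    transitivity (Derive (fun t => phi (t + 2 * PI) y) x); [|apply Derive_ext; intros; now apply HP].
    symmetry. apply is_derive_unique.
    eapply der_eq; [apply (is_derive_comp (fun t => phi t y) (fun t => t + 2 * PI) x (Derive (fun t => phi t y) (x + 2 * PI)) 1)|].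
    + now apply Derive_correct.
    + auto_derive; auto.
    + unfold scal; simpl; unfold mult; simpl. ring.
  - unfold g2. apply Derive_ext_loc. exists (mkposreal (- y / 2) ltac:(lra)).
    intros t Ht. apply HP. unfold ball in Ht; simpl in Ht. unfold AbsRing_ball, abs, minus, plus, opp in Ht; simpl in Ht.
    apply Rabs_lt_between in Ht. lra.
Qed.

Lemma p_cont : forall x, continuous p x.
Proof. apply (trace_cont g1). apply HS. Qed.

Lemma p_per : forall x, p (x + 2 * PI) = p x.
Proof.
  intros x. destruct HS as (_ & _ & _ & HT & _).
  apply Rminus_diag_uniq.
  assert (H : forall e, 0 < e -> Rabs (p (x + 2 * PI) - p x) <= e).
  { intros e He.
    destruct (trace_eps _ _ _ (HT x) (e / 2) ltac:(lra)) as (d & Hd & H1).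
    destruct (trace_eps _ _ _ (HT (x + 2 * PI)) (e / 2) ltac:(lra)) as (d' & Hd' & H2).
    assert (0 < Rmin d d') by (apply Rmin_glb_lt; auto).
    pose proof (Rmin_l d d'). pose proof (Rmin_r d d').
    specialize (H1 x (- (Rmin d d' / 2))). specialize (H2 (x + 2 * PI) (- (Rmin d d' / 2))).
    rewrite Rminus_diag, Rabs_R0 in H1, H2.
    specialize (H1 ltac:(lra) ltac:(lra)). specialize (H2 ltac:(lra) ltac:(lra)).
    change (Rabs (g1 x (- (Rmin d d' / 2)) - p x) < e / 2) in H1.
    change (Rabs (g1 (x + 2 * PI) (- (Rmin d d' / 2)) - p (x + 2 * PI)) < e / 2) in H2.
    rewrite (proj1 (phi_per x (- (Rmin d d' / 2)) ltac:(lra))) in H2.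
    apply Rabs_lt_between in H1. apply Rabs_lt_between in H2. apply Rabs_le_between. lra. }
  destruct (Req_dec (p (x + 2 * PI) - p x) 0) as [|Hn]; [lra|].
  pose proof (Rabs_pos_lt _ Hn). specialize (H (Rabs (p (x + 2 * PI) - p x) / 2) ltac:(lra)). lra.
Qed.

(* The velocity [u1 - i u2] and its product with [gamma'], at height [y]. *)
Let V (y x : R) : C := (- g2 x y, - (g1 x y - h1 x * g2 x y)).
Let ff (y x : R) : C := (- (1 + h1 x ^ 2) * g2 x y + h1 x * g1 x y, - g1 x y).
Let Vx (y x : R) : C := (- g12 x y, - (g11 x y - (h2 x * g2 x y + h1 x * g12 x y))).

Lemma ff_V : forall y x, ff y x = (V y x * gp h1 x)%C.
Proof. intros. unfold ff, V, gp. apply C_eq; simpl; ring. Qed.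

Lemma V_deriv : forall y x, y < 0 -> cderiv (V y) x (Vx y x).
Proof.
  intros y x Hy. destruct (phi_reg x y Hy) as ((D11 & _ & D12 & _) & _).
  assert (Dh : is_derive h1 x (h2 x)) by apply Hc1.
  unfold V, Vx. split; unfold Re, Im; cbn [fst snd].
  - apply @is_derive_opp. exact D12.
  - apply @is_derive_opp. apply der_minus; [exact D11|]. exact (der_mult h1 (fun t => g2 t y) x _ _ Dh D12).
Qed.

Lemma Vx_cont : forall y, y < 0 -> ccont (Vx y).
Proof.
  intros y Hy.
  assert (K : forall x, continuous (fun u => g11 u y) x /\ continuous (fun u => g12 u y) x /\ continuous (fun u => g2 u y) x).
  { intros x. destruct (phi_reg x y Hy) as (_ & (_ & C2) & C11 & _ & C12 & _).
    split; [|split]; apply cont_2d_slice; assumption. }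
  assert (Ch1 : forall x, continuous h1 x) by apply Hc.
  assert (Ch2 : forall x, continuous h2 x) by apply Hc1.
  unfold Vx. split; intros x; destruct (K x) as (K1 & K2 & K3); unfold Re, Im; cbn [fst snd].
  - apply @continuous_opp. exact K2.
  - apply @continuous_opp. apply @continuous_minus; [exact K1|].
    apply @continuous_plus; apply @continuous_mult; auto.
Qed.

Lemma V_cont : forall y, y < 0 -> ccont (V y).
Proof. intros y Hy. apply (cderiv_ccont _ (Vx y)). intros; now apply V_deriv. Qed.

Lemma V_per : forall y, y < 0 -> cper (V y).
Proof.
  intros y Hy x. unfold V. destruct (phi_per x y Hy) as [-> ->].
  destruct Hc as (_ & _ & _ & ->). reflexivity.
Qed.

Lemma ff_cont : forall y, y < 0 -> ccont (ff y).
Proof.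
  intros y Hy. apply (ccont_ext (fun x => V y x * gp h1 x)%C); [intros; now rewrite ff_V|].
  apply ccont_mult; [now apply V_cont|cc].
Qed.

Let I (k : Z) (y : R) : C := cint (fun x => ff y x * Ek h k x)%C.

(* The equation satisfied by [phi] makes [d_y ff = i d_x V]. *)
Lemma ff_dy : forall x y, y < 0 ->
  is_derive (fun t => Re (ff t x)) y (Re (Ci * Vx y x)%C) /\
  is_derive (fun t => Im (ff t x)) y (Im (Ci * Vx y x)%C).
Proof.
  intros x y Hy. destruct (phi_reg x y Hy) as ((_ & D21 & _ & D22) & _).
  pose proof (phi_pde x y Hy) as HP. pose proof (phi_schwarz x y Hy) as HSch.
  unfold ff, Vx. split; unfold Re, Im; cbn [fst snd].
  - eapply der_eq.
    + apply der_plus.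
      * apply (is_derive_scal (fun t => g2 x t) y (- (1 + h1 x ^ 2))). exact D22.
      * apply (is_derive_scal (fun t => g1 x t) y (h1 x)). exact D21.
    + rewrite HSch. simpl. simpl in HP. lra.
  - eapply der_eq.
    + apply @is_derive_opp. exact D21.
    + rewrite HSch. unfold opp; simpl. ring.
Qed.

Lemma ff_dy_cont : forall x y, y < 0 ->
  continuity_2d_pt (fun u v => Re (Ci * Vx u v)%C) y x /\ continuity_2d_pt (fun u v => Im (Ci * Vx u v)%C) y x.
Proof.
  intros x y Hy. destruct (phi_reg x y Hy) as (_ & (_ & C2) & C11 & _ & C12 & _).
  apply cont_2d_swap in C2, C11, C12.
  assert (Ch1 : continuity_2d_pt (fun u v => h1 v) y x) by (apply cont_2d_x; apply Hc).
  assert (Ch2 : continuity_2d_pt (fun u v => h2 v) y x) by (apply cont_2d_x; apply Hc1).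
  unfold Vx. split; simpl.
  - apply (continuity_2d_pt_ext (fun u v => g11 v u - (h2 v * g2 v u + h1 v * g12 v u))); [intros; ring|].
    apply continuity_2d_pt_minus; auto. apply continuity_2d_pt_plus; now apply continuity_2d_pt_mult.
  - apply (continuity_2d_pt_ext (fun u v => - g12 v u)); [intros; ring|].
    now apply continuity_2d_pt_opp.
Qed.

Lemma I_deriv : forall k y, y < 0 -> cderiv (I k) y (cint (fun x => Ci * Vx y x * Ek h k x)%C).
Proof.
  intros k y Hy.
  assert (HE : ccont (Ek h k)) by cc. destruct HE as [Er Ei].
  assert (Hloc : locally y (fun u => u < 0)).
  { exists (mkposreal (- y) ltac:(lra)). intros u Hu. unfold ball in Hu; simpl in Hu.
    unfold AbsRing_ball, abs, minus, plus, opp in Hu; simpl in Hu. apply Rabs_lt_between in Hu. lra. }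
  assert (Hint : forall u, u < 0 -> ccont (fun x => ff u x * Ek h k x)%C).
  { intros u Hu. apply ccont_mult; [now apply ff_cont|cc]. }
  assert (Dre : forall u x, u < 0 -> is_derive (fun t => Re (ff t x * Ek h k x)%C) u (Re (Ci * Vx u x * Ek h k x)%C)).
  { intros u x Hu. destruct (ff_dy x u Hu) as [D1 D2]. eapply der_eq.
    - apply (der_minus (fun t => Re (ff t x) * Re (Ek h k x)) (fun t => Im (ff t x) * Im (Ek h k x))).
      + apply (der_mult (fun t => Re (ff t x)) (fun _ => Re (Ek h k x)) u _ 0 D1). apply @is_derive_const.
      + apply (der_mult (fun t => Im (ff t x)) (fun _ => Im (Ek h k x)) u _ 0 D2). apply @is_derive_const.
    - unfold Re, Im; simpl. ring. }
  assert (Dim : forall u x, u < 0 -> is_derive (fun t => Im (ff t x * Ek h k x)%C) u (Im (Ci * Vx u x * Ek h k x)%C)).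
  { intros u x Hu. destruct (ff_dy x u Hu) as [D1 D2]. eapply der_eq.
    - apply (der_plus (fun t => Re (ff t x) * Im (Ek h k x)) (fun t => Im (ff t x) * Re (Ek h k x))).
      + apply (der_mult (fun t => Re (ff t x)) (fun _ => Im (Ek h k x)) u _ 0 D1). apply @is_derive_const.
      + apply (der_mult (fun t => Im (ff t x)) (fun _ => Re (Ek h k x)) u _ 0 D2). apply @is_derive_const.
    - unfold Re, Im; simpl. ring. }
  assert (K2 : forall x, continuity_2d_pt (fun u v => Re (Ci * Vx u v * Ek h k v)%C) y x /\
     continuity_2d_pt (fun u v => Im (Ci * Vx u v * Ek h k v)%C) y x).
  { intros x. destruct (ff_dy_cont x y Hy) as [C1 C2].
    assert (CE1 : continuity_2d_pt (fun u v => Re (Ek h k v)) y x) by (apply (cont_2d_x (fun v => Re (Ek h k v))); apply Er).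
    assert (CE2 : continuity_2d_pt (fun u v => Im (Ek h k v)) y x) by (apply (cont_2d_x (fun v => Im (Ek h k v))); apply Ei).
    split.
    - apply (continuity_2d_pt_ext (fun u v => Re (Ci * Vx u v)%C * Re (Ek h k v) - Im (Ci * Vx u v)%C * Im (Ek h k v)));
        [intros; unfold Re, Im; simpl; ring|].
      apply continuity_2d_pt_minus; now apply continuity_2d_pt_mult.
    - apply (continuity_2d_pt_ext (fun u v => Re (Ci * Vx u v)%C * Im (Ek h k v) + Im (Ci * Vx u v)%C * Re (Ek h k v)));
        [intros; unfold Re, Im; simpl; ring|].
      apply continuity_2d_pt_plus; now apply continuity_2d_pt_mult. }
  assert (Hl2 : forall x (P : R -> R -> Prop), (forall u v, u < 0 -> P u v) -> locally_2d P y x).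
  { intros x P HP. exists (mkposreal (- y) ltac:(lra)). intros u v Hu _. apply HP. simpl in Hu.
    apply Rabs_lt_between in Hu. lra. }
  split.
  - eapply der_eq.
    + apply (is_derive_RInt_param (fun t x => Re (ff t x * Ek h k x)%C) (- PI) PI y).
      * apply (filter_imp _ _ (fun u Hu => fun t _ => ex_intro _ _ (Dre u t Hu)) Hloc).
      * intros x _. apply (continuity_2d_pt_ext_loc (fun u v => Re (Ci * Vx u v * Ek h k v)%C)); [|apply K2].
        apply Hl2. intros u v Hu. symmetry. apply is_derive_unique. now apply Dre.
      * apply (filter_imp _ _ (fun u Hu => ex_RInt_cont _ _ _ (proj1 (Hint u Hu))) Hloc).
    + unfold cint, Re; cbn [fst]. apply RInt_ext. intros x _. apply is_derive_unique. now apply Dre.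
  - eapply der_eq.
    + apply (is_derive_RInt_param (fun t x => Im (ff t x * Ek h k x)%C) (- PI) PI y).
      * apply (filter_imp _ _ (fun u Hu => fun t _ => ex_intro _ _ (Dim u t Hu)) Hloc).
      * intros x _. apply (continuity_2d_pt_ext_loc (fun u v => Im (Ci * Vx u v * Ek h k v)%C)); [|apply K2].
        apply Hl2. intros u v Hu. symmetry. apply is_derive_unique. now apply Dim.
      * apply (filter_imp _ _ (fun u Hu => ex_RInt_cont _ _ _ (proj2 (Hint u Hu))) Hloc).
    + unfold cint, Im; cbn [snd]. apply RInt_ext. intros x _. apply is_derive_unique. now apply Dim.
Qed.

(** Integrating [i d_x V] by parts against [E_k] gives back the integral itself. *)
Lemma I_ode : forall k y, y < 0 -> cderiv (I k) y (- RtoC (IZR k) * I k y)%C.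
Proof.
  intros k y Hy. eapply cderiv_eq; [now apply I_deriv|].
  pose proof (Vx_cont y Hy) as CVx.
  rewrite (cint_ext _ (fun x => Ci * (Vx y x * Ek h k x))%C) by (intros; ring).
  rewrite cint_scal by cc.
  rewrite (cint_parts (V y) (Ek h k) (Vx y) (fun x => - (Ci * RtoC (IZR k)) * gp h1 x * Ek h k x)%C).
  - rewrite (cint_ext _ (fun x => - (Ci * RtoC (IZR k)) * (ff y x * Ek h k x))%C) by (intros; rewrite ff_V; ring).
    rewrite cint_scal by (pose proof (ff_cont y Hy); cc). unfold I. apply C_eq; simpl; ring.
  - intros; now apply V_deriv.
  - intros; now apply Ek_deriv.
  - auto.
  - cc.
  - now apply V_per.
  - eapply Ek_per; eauto.
Qed.

(** Below the surface, this is the independence of the contour in Cauchy's theorem. *)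
Lemma I_const : forall k y z, y < 0 -> z < 0 ->
  (RtoC (exp (IZR k * y)) * I k y = RtoC (exp (IZR k * z)) * I k z)%C.
Proof.
  intros k y z Hy Hz.
  assert (HD : forall t, t < 0 -> cderiv (fun t => RtoC (exp (IZR k * t)) * I k t)%C t (RtoC 0)).
  { intros t Ht. eapply cderiv_eq.
    - apply (cderiv_mult (fun t => RtoC (exp (IZR k * t))) (I k) t (RtoC (IZR k * exp (IZR k * t)))).
      + split; simpl; [auto_derive; auto; ring|apply @is_derive_const].
      + now apply I_ode.
    - apply C_eq; simpl; ring. }
  assert (key : forall f : R -> R, (forall t, t < 0 -> is_derive f t 0) -> f y = f z).
  { intros f Hf. destruct (MVT_gen f z y (fun _ => 0)) as (c & _ & E).
    - intros t Ht. apply Hf. unfold Rmin, Rmax in Ht. destruct (Rle_dec z y); lra.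
    - intros t Ht. apply continuity_pt_filterlim. eapply continuous_of_derivable, Hf.
      unfold Rmin, Rmax in Ht. destruct (Rle_dec z y); lra.
    - lra. }
  apply C_eq.
  - apply (key (fun t => Re (RtoC (exp (IZR k * t)) * I k t)%C)). intros t Ht. apply HD; auto.
  - apply (key (fun t => Im (RtoC (exp (IZR k * t)) * I k t)%C)). intros t Ht. apply HD; auto.
Qed.

(** Let [z] tend to minus infinity: [e^{k z}] is bounded and the velocity decays. *)
Lemma I_zero : forall k y, (0 <= k)%Z -> y < 0 -> I k y = RtoC 0.
Proof.
  intros k y Hk Hy. apply Cmod_eq_0. apply Rle_antisym; [|apply Cmod_ge_0].
  apply Rnot_lt_le. intros Hlt.
  destruct (ccont_bounded (gp h1)) as (M1 & HM1 & Hg); [cc|eapply cper_gp; eauto|].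
  destruct (ccont_bounded (Ek h k)) as (M2 & HM2 & He); [cc|eapply Ek_per; eauto|].
  destruct HS as (_ & _ & _ & _ & _ & HV). pose proof PI_RGT_0 as HPI.
  set (e0 := exp (IZR k * y)). assert (He0 : 0 < e0) by apply exp_pos.
  set (eta := e0 * Cmod (I k y) / (8 * PI * ((M1 + 1) * (M2 + 1)))).
  assert (HMM : 0 < (M1 + 1) * (M2 + 1)) by nra.
  assert (Heta : 0 < eta) by (apply Rdiv_lt_0_compat; nra).
  destruct (HV (mkposreal eta Heta)) as [Y HY]. simpl in HY.
  set (z := Rmin (-1) (Y - 1)).
  assert (Hz : z < 0 /\ z < Y) by (unfold z; pose proof (Rmin_l (-1) (Y - 1)); pose proof (Rmin_r (-1) (Y - 1)); lra).
  pose proof (I_const k y z Hy (proj1 Hz)) as E. apply (f_equal Cmod) in E. rewrite !Cmod_mult, !Cmod_R in E.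
  rewrite !Rabs_pos_eq in E by (epos). fold e0 in E.
  assert (exp (IZR k * z) <= 1).
  { rewrite <- exp_0. apply exp_mono. assert (0 <= IZR k) by (apply IZR_le; lia). nra. }
  assert (Cmod (I k z) <= 2 * PI * (2 * eta * (M1 + 1) * (M2 + 1))).
  { apply cint_bound; [apply ccont_mult; [apply ff_cont; lra|cc]|]. intros x.
    rewrite Cmod_mult, ff_V, Cmod_mult.
    assert (Cmod (V z x) <= 2 * eta).
    { eapply Rle_trans; [apply Cmod_le_ReIm|]. destruct (HY x z (proj1 Hz) (proj2 Hz)) as [B1 B2].
      unfold V; simpl. rewrite Rabs_Ropp.
      change (Rabs (- g2 x z) < eta) in B1. change (Rabs (g1 x z - Derive h x * g2 x z) < eta) in B2.
      rewrite Derive_h in B2. rewrite Rabs_Ropp in B1. rewrite Rabs_Ropp. lra. }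
    specialize (Hg x). specialize (He x).
    pose proof (Cmod_ge_0 (V z x)). pose proof (Cmod_ge_0 (gp h1 x)). pose proof (Cmod_ge_0 (Ek h k x)).
    apply Rmult_le_compat; try lra; [nra|]. apply Rmult_le_compat; lra. }
  pose proof (exp_pos (IZR k * z)). pose proof (Cmod_ge_0 (I k z)).
  assert (e0 * Cmod (I k y) <= e0 * Cmod (I k y) / 2).
  { rewrite E at 1. apply Rle_trans with (Cmod (I k z)); [nra|]. eapply Rle_trans; [exact H0|].
    right. unfold eta. field. split; nra. }
  nra.
Qed.

(** Let [y] increase to [0]. *)
Lemma moments : forall k, (0 <= k)%Z -> cint (fun x => tr w p x * Ek h k x)%C = RtoC 0.
Proof.
  intros k Hk. apply Cmod_eq_0. apply Rle_antisym; [|apply Cmod_ge_0].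
  apply Rnot_lt_le. intros Hlt. set (A := Cmod (cint _)) in *.
  destruct (ccont_bounded (gp h1)) as (M1 & HM1 & Hg); [cc|eapply cper_gp; eauto|].
  destruct (ccont_bounded (Ek h k)) as (M2 & HM2 & He); [cc|eapply Ek_per; eauto|].
  pose proof PI_RGT_0 as HPI.
  assert (Hh1 : forall x, Rabs (h1 x) <= M1) by (intros x; eapply Rle_trans; [apply (im_le_Cmod (gp h1 x))|apply Hg]).
  set (K := (1 + M1 ^ 2) + (M1 + 1)).
  assert (HK : 0 < K) by (unfold K; nra).
  set (e := A / (4 * PI * (K * (M2 + 1)))).
  assert (HKM : 0 < K * (M2 + 1)) by nra.
  assert (Hee : 0 < e) by (apply Rdiv_lt_0_compat; nra).
  destruct HS as (_ & _ & _ & HT1 & HT2 & _).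
  destruct (trace_uniform _ _ HT1 e Hee) as (d1 & Hd1 & U1).
  destruct (trace_uniform _ _ HT2 e Hee) as (d2 & Hd2 & U2).
  set (y := - (Rmin d1 d2 / 2)).
  assert (0 < Rmin d1 d2) by (apply Rmin_glb_lt; auto).
  pose proof (Rmin_l d1 d2). pose proof (Rmin_r d1 d2).
  assert (Hy : y < 0 /\ - d1 < y /\ - d2 < y) by (unfold y; lra).
  assert (Cw : ccont (tr w p)).
  { split; intros x; simpl; auto. apply @continuous_opp. apply p_cont. }
  pose proof (ff_cont y (proj1 Hy)) as Cf.
  assert (E : A = Cmod (cint (fun x => (tr w p x - ff y x) * Ek h k x)%C)).
  { unfold A. f_equal.
    rewrite (cint_ext (fun x => (tr w p x - ff y x) * Ek h k x)%C
      (fun x => tr w p x * Ek h k x - ff y x * Ek h k x)%C) by (intros; ring).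
    rewrite cint_minus by cc. fold (I k y). rewrite (I_zero k y Hk (proj1 Hy)). ring. }
  assert (A <= RInt (fun _ => K * e * (M2 + 1)) (- PI) PI).
  { rewrite E. apply cint_le; [cc|intros; apply continuous_const|]. intros x Hx.
    rewrite Cmod_mult. specialize (He x).
    assert (Cmod (tr w p x - ff y x)%C <= K * e).
    { eapply Rle_trans; [apply Cmod_le_ReIm|].
      specialize (U1 x y Hx ltac:(lra)). specialize (U2 x y Hx ltac:(lra)).
      change (Rabs (g1 x y - p x) <= e) in U1.
      change (Rabs (g2 x y - (- w x + Derive h x * p x) / (1 + Derive h x ^ 2)) <= e) in U2.
      rewrite Derive_h in U2. unfold ff, tr; simpl.
      set (B1 := g1 x y - p x) in *. set (B2 := g2 x y - _) in *.
      replace (w x + - (- (1 + h1 x * (h1 x * 1)) * g2 x y + h1 x * g1 x y)) with ((1 + h1 x ^ 2) * B2 + - (h1 x * B1))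
        by (unfold B1, B2; field; nra).
      replace (- p x + - - g1 x y) with B1 by (unfold B1; ring).
      pose proof (Rabs_triang ((1 + h1 x ^ 2) * B2) (- (h1 x * B1))) as T.
      rewrite Rabs_Ropp, !Rabs_mult, (Rabs_pos_eq (1 + h1 x ^ 2)) in T by nra.
      specialize (Hh1 x). pose proof (Rabs_pos (h1 x)).
      pose proof (Rabs_pos B1). pose proof (Rabs_pos B2).
      assert (h1 x ^ 2 <= M1 ^ 2) by (rewrite <- (pow2_abs (h1 x)); apply pow_incr; lra).
      assert ((1 + h1 x ^ 2) * Rabs B2 <= (1 + M1 ^ 2) * e) by (apply Rmult_le_compat; nra).
      assert (Rabs (h1 x) * Rabs B1 <= M1 * e) by (apply Rmult_le_compat; lra).
      replace (K * e) with ((1 + M1 ^ 2) * e + M1 * e + e) by (unfold K; ring). lra. }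
    apply Rmult_le_compat; try apply Cmod_ge_0; lra. }
  rewrite RInt_const in H2. unfold scal in H2; simpl in H2; unfold mult in H2; simpl in H2.
  assert ((PI - - PI) * (K * e * (M2 + 1)) = A / 2) by (unfold e; field; split; nra).
  lra.
Qed.

End Moments.


(** * The spaces [X_tau] and derivatives in time *)

Definition rc (u : R -> R) (x : R) : C := RtoC (u x).

Lemma X_norm_lsum : forall tau u, (forall x, continuous u x) ->
  X_norm tau u = Lim_seq (fun N => lsum (win N) (fun k => exp (tau * zabs k) * Cmod (cft (rc u) k))).
Proof.
  intros tau u Hu. unfold X_norm. apply Lim_seq_ext. intros N. rewrite Zsum_lsum.
  apply lsum_ext. intros k _. now rewrite fourier_cft.
Qed.

Lemma lsum_win_incr : forall a, (forall k, 0 <= a k) -> forall N, lsum (win N) a <= lsum (win (S N)) a.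
Proof.
  intros a Ha N. apply lsum_incl; auto using win_NoDup.
  intros k Hk. apply win_in in Hk. apply win_in. lia.
Qed.

Lemma W_X_norm : forall tau u A, W tau (rc u) A -> Rbar_le (X_norm tau u) A.
Proof.
  intros tau u A H. rewrite X_norm_lsum by apply H.
  rewrite <- (Lim_seq_const A). apply Lim_seq_le_loc. exists O. intros N _. apply H, win_NoDup.
Qed.

Lemma X_norm_W : forall tau u A, periodic u -> (forall x, continuous u x) -> Rbar_le (X_norm tau u) (Finite A) ->
  W tau (rc u) A.
Proof.
  intros tau u A Hp Hu HA. split; [|split].
  - now apply ccont_RtoC.
  - intros x. unfold rc. now rewrite Hp.
  - set (a := fun k => exp (tau * zabs k) * Cmod (cft (rc u) k)).
    assert (Ha : forall k, 0 <= a k) by (intros; apply Rmult_le_pos; [epos|apply Cmod_ge_0]).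
    rewrite X_norm_lsum in HA by auto. fold a in HA.
    apply bnd_win; auto. intros N.
    assert (Hi : forall n, lsum (win n) a <= lsum (win (S n)) a) by (apply lsum_win_incr; auto).
    pose proof (Lim_seq_correct _ (ex_lim_seq_incr _ Hi)) as Hl.
    pose proof (is_lim_seq_incr_compare) as Hcmp.
    destruct (Lim_seq (fun N => lsum (win N) a)) as [l| |] eqn:E.
    + eapply Rle_trans; [apply (Hcmp _ _ Hl Hi N)|exact HA].
    + destruct HA.
    + exfalso. assert (Rbar_le 0 m_infty); [|auto].
      rewrite <- E, <- (Lim_seq_const 0). apply Lim_seq_le_loc. exists O. intros n _. now apply lsum_nonneg.
Qed.

Lemma in_X_W : forall tau u, in_X tau u -> exists A, W tau (rc u) A /\ X_norm tau u = Finite A.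
Proof.
  intros tau u (Hp & Hc & Hlt).
  assert (H0 : Rbar_le 0 (X_norm tau u)).
  { rewrite X_norm_lsum by auto. rewrite <- (Lim_seq_const 0). apply Lim_seq_le_loc. exists O. intros n _.
    apply lsum_nonneg. intros; pos. }
  destruct (X_norm tau u) as [l| |] eqn:E; try contradiction.
  exists l. split; auto. apply X_norm_W; auto. rewrite E. simpl; lra.
Qed.

Lemma in_CX_near : forall tau T u t, in_CX tau T u -> time_interval T t -> forall e, 0 < e ->
  exists d, 0 < d /\ forall s, time_interval T s -> Rabs (s - t) < d -> W tau (rc (fun x => u s x - u t x)) e.
Proof.
  intros tau T u t H Ht e He. destruct (H t Ht) as [Hx Hn]. destruct (Hn (mkposreal e He)) as [d Hd].
  exists d. split; [apply cond_pos|]. intros s Hs Hst.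
  specialize (Hd s Hst Hs). simpl in Hd. destruct (H s Hs) as [(P1 & C1 & _) _]. destruct Hx as (P2 & C2 & _).
  apply X_norm_W.
  - intros x. now rewrite P1, P2.
  - intros x. apply @continuous_minus; auto.
  - apply Rbar_lt_le. exact Hd.
Qed.

(** An elementary form of [is_time_derive]. *)
Definition tder (T : R) (f : R -> R) (t l : R) : Prop :=
  forall e, 0 < e -> exists d, 0 < d /\ forall s, time_interval T s -> Rabs (s - t) < d ->
    Rabs (f s - f t - (s - t) * l) <= e * Rabs (s - t).

Lemma time_derive_tder : forall T f t l, is_time_derive T f t l -> tder T f t l.
Proof.
  intros T f t l [_ H] e He.
  specialize (H t). destruct (H (fun P HP => filter_imp _ _ (fun x Hx _ => Hx) HP) (mkposreal e He)) as [d Hd].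
  exists d. split; [apply cond_pos|]. intros s Hs Hst. specialize (Hd s Hst Hs). simpl in Hd.
  unfold norm, minus, plus, opp, scal in Hd; simpl in Hd. unfold abs, mult in Hd; simpl in Hd.
  unfold Rminus. exact Hd.
Qed.

Definition clamp (T s : R) : R := Rmax 0 (Rmin T s).

Lemma clamp_in : forall T s, 0 <= T -> time_interval T (clamp T s).
Proof. intros T s HT. unfold time_interval, clamp, Rmax, Rmin. destruct (Rle_dec T s); destruct Rle_dec; lra. Qed.

Lemma clamp_id : forall T s, time_interval T s -> clamp T s = s.
Proof. intros T s [H1 H2]. unfold clamp, Rmax, Rmin. destruct (Rle_dec T s); destruct Rle_dec; lra. Qed.

Lemma clamp_dist : forall T s t, time_interval T t -> Rabs (clamp T s - t) <= Rabs (s - t).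
Proof.
  intros T s t [H1 H2]. unfold clamp, Rmax, Rmin.
  destruct (Rle_dec T s); destruct Rle_dec; unfold Rabs; repeat destruct Rcase_abs; lra.
Qed.

Lemma is_derive_eps : forall (f : R -> R) x l,
  (forall e, 0 < e -> exists d, 0 < d /\ forall y, Rabs (y - x) < d -> Rabs (f y - f x - (y - x) * l) <= e * Rabs (y - x)) ->
  is_derive f x l.
Proof.
  intros f x l H. apply is_derive_Reals. intros e He. destruct (H (e / 2) ltac:(lra)) as (d & Hd & Hdd).
  exists (mkposreal d Hd). intros t Ht0 Ht. simpl in Ht. specialize (Hdd (x + t)).
  replace (x + t - x) with t in Hdd by ring. specialize (Hdd Ht).
  replace ((f (x + t) - f x) / t - l) with ((f (x + t) - f x - t * l) * / t) by (field; auto).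
  rewrite Rabs_mult, Rabs_inv. assert (0 < Rabs t) by (apply Rabs_pos_lt; auto).
  apply Rmult_lt_reg_r with (Rabs t); auto. rewrite Rmult_assoc, Rinv_l, Rmult_1_r by lra. nra.
Qed.

(** Extending affinely outside [0,T] turns one-sided derivatives into derivatives. *)
Lemma tder_extend : forall T f f', 0 < T -> (forall t, time_interval T t -> tder T f t (f' t)) ->
  exists F, (forall t, time_interval T t -> F t = f t) /\ (forall t, time_interval T t -> is_derive F t (f' t)).
Proof.
  intros T f f' HT H. exists (fun s => f (clamp T s) + (s - clamp T s) * f' (clamp T s)). split.
  - intros t Ht. rewrite (clamp_id T t Ht). ring.
  - intros t Ht. apply is_derive_eps. intros e He. destruct (H t Ht e He) as (d & Hd & Hdd).
    set (d1 := if Rlt_dec 0 t then t else 1). set (d2 := if Rlt_dec t T then T - t else 1).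
    assert (Hd1 : 0 < d1) by (unfold d1; destruct Rlt_dec; lra).
    assert (Hd2 : 0 < d2) by (unfold d2; destruct (Rlt_dec t T) as [q|q]; [clear - q; lra|lra]).
    exists (Rmin d (Rmin d1 d2)). split; [repeat apply Rmin_glb_lt; auto|].
    intros s Hs. pose proof (Rmin_l d (Rmin d1 d2)). pose proof (Rmin_r d (Rmin d1 d2)).
    pose proof (Rmin_l d1 d2). pose proof (Rmin_r d1 d2).
    pose proof (clamp_dist T s t Ht) as Hcd. pose proof (clamp_in T s ltac:(lra)) as Hci.
    rewrite (clamp_id T t Ht).
    assert (E : (s - clamp T s) * f' (clamp T s) = (s - clamp T s) * f' t).
    { destruct (Req_dec s (clamp T s)) as [E|E]; [rewrite <- E; ring|].
      assert (clamp T s = t) as ->; [|reflexivity].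
      destruct Ht as [Ht1 Ht2]. apply Rabs_lt_between in Hs.
      unfold clamp, Rmax, Rmin in E |- *. unfold d1, d2 in *.
      destruct (Rle_dec T s); destruct (Rlt_dec 0 t); destruct (Rlt_dec t T); repeat destruct Rle_dec; lra. }
    rewrite E. specialize (Hdd (clamp T s) Hci ltac:(lra)).
    replace (f (clamp T s) + (s - clamp T s) * f' t - (f t + (t - t) * f' t) - (s - t) * f' t)
      with (f (clamp T s) - f t - (clamp T s - t) * f' t) by ring.
    eapply Rle_trans; [exact Hdd|]. apply Rmult_le_compat_l; lra.
Qed.

Lemma tder_lipschitz : forall T f f' L a b, 0 < T -> (forall t, time_interval T t -> tder T f t (f' t)) ->
  time_interval T a -> time_interval T b ->
  (forall t, Rmin a b <= t <= Rmax a b -> Rabs (f' t) <= L) -> Rabs (f b - f a) <= L * Rabs (b - a).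
Proof.
  intros T f f' L a b HT H Ha Hb HL. destruct (tder_extend T f f' HT H) as (F & F1 & F2).
  rewrite <- (F1 a Ha), <- (F1 b Hb).
  assert (Hin : forall t, Rmin a b <= t <= Rmax a b -> time_interval T t).
  { intros t. destruct Ha, Hb. unfold time_interval, Rmin, Rmax. destruct (Rle_dec a b); lra. }
  destruct (MVT_gen F a b f') as (c & Hc & E).
  - intros t Ht. apply F2, Hin. lra.
  - intros t Ht. apply continuity_pt_filterlim. eapply continuous_of_derivable, F2, Hin, Ht.
  - rewrite E, Rabs_mult. apply Rmult_le_compat_r; [apply Rabs_pos|auto].
Qed.

(** ** Differentiability in time, uniformly in space *)

Definition udiff (T t : R) (u : R -> R -> C) (v : R -> C) : Prop :=
  forall e, 0 < e -> exists d, 0 < d /\ forall s, time_interval T s -> Rabs (s - t) < d -> forall x,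
    Cmod (u s x - u t x - RtoC (s - t) * v x) <= e * Rabs (s - t).

Definition ctder (T : R) (f : R -> C) (t : R) (l : C) : Prop :=
  forall e, 0 < e -> exists d, 0 < d /\ forall s, time_interval T s -> Rabs (s - t) < d ->
    Cmod (f s - f t - RtoC (s - t) * l) <= e * Rabs (s - t).

Lemma W_lip : forall rho (f : R -> R) A, 0 < rho -> W rho (rc f) A ->
  forall x y, Rabs (f x - f y) <= A / rho * Rabs (x - y).
Proof.
  intros rho f A Hr H x y. destruct (W_deriv rho 0 (rc f) A ltac:(lra) H) as (D & HW & _).
  rewrite Rminus_0_r in HW.
  destruct (MVT_gen f y x (fun z => Re (fser (dcoef (cft (rc f))) z))) as (c & _ & E).
  - intros z _. apply (proj1 (D z)).
  - intros z _. apply continuity_pt_filterlim. eapply continuous_of_derivable. apply (proj1 (D z)).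
  - rewrite E, Rabs_mult. apply Rmult_le_compat_r; [apply Rabs_pos|].
    eapply Rle_trans; [apply re_le_Cmod|]. apply (W_sup 0 _ _ c (Rle_refl 0) HW).
Qed.

Lemma grid_min : forall (P : nat -> R -> Prop) N, (forall i d d', 0 < d' <= d -> P i d -> P i d') ->
  (forall i, (i <= N)%nat -> exists d, 0 < d /\ P i d) -> exists d, 0 < d /\ forall i, (i <= N)%nat -> P i d.
Proof.
  intros P N Hm H. induction N as [|N IH].
  - destruct (H O (le_n _)) as (d & Hd & HP). exists d. split; auto. intros i Hi. replace i with O by lia. auto.
  - destruct IH as (d & Hd & HP); [intros; apply H; lia|]. destruct (H (S N) (le_n _)) as (d' & Hd' & HP').
    assert (0 < Rmin d d') by (apply Rmin_glb_lt; auto).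
    exists (Rmin d d'). split; auto. intros i Hi.
    destruct (Nat.eq_dec i (S N)) as [->|].
    + apply (Hm _ d'); auto. split; [auto|apply Rmin_r].
    + apply (Hm _ d); [split; [auto|apply Rmin_l]|apply HP; lia].
Qed.

(** Pointwise derivatives that are Lipschitz in space, uniformly in time, are
    derivatives uniformly in space: compare with the points of a fine grid. *)
Lemma udiff_pointwise : forall T t (u ut : R -> R -> R) L d0, 0 < T -> time_interval T t ->
  (forall s x, time_interval T s -> tder T (fun s => u s x) s (ut s x)) ->
  (forall s x, time_interval T s -> u s (x + 2 * PI) = u s x) ->
  (forall x, ut t (x + 2 * PI) = ut t x) ->
  0 < d0 -> 0 <= L -> (forall s, time_interval T s -> Rabs (s - t) < d0 -> forall x y, Rabs (ut s x - ut s y) <= L * Rabs (x - y)) ->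
  udiff T t (fun s => rc (u s)) (rc (ut t)).
Proof.
  intros T t u ut L d0 HT Ht Hd Hup Hutp Hd0 HL HLip e He. pose proof PI_RGT_0 as HPI.
  destruct (archimed_cor1 (e / (8 * PI * (L + 1)))) as (N & HN & HN0).
  { apply Rdiv_lt_0_compat; nra. }
  assert (HNr : 1 <= INR N) by (apply (le_INR 1); lia).
  set (xi := fun i : nat => - PI + INR i * (2 * PI / INR N)).
  destruct (grid_min (fun i d => forall s, time_interval T s -> Rabs (s - t) < d ->
    Rabs (u s (xi i) - u t (xi i) - (s - t) * ut t (xi i)) <= e / 2 * Rabs (s - t)) N) as (d & Hdp & Hdd).
  { intros i d d' Hd' HP s Hs Hst. apply HP; auto; lra. }
  { intros i _. apply (Hd t (xi i) Ht (e / 2)). lra. }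
  exists (Rmin d d0). split; [apply Rmin_glb_lt; auto|].
  intros s Hs Hst x. pose proof (Rmin_l d d0). pose proof (Rmin_r d d0).
  destruct (per_reduce x) as [k Hk].
  unfold rc. rewrite <- RtoC_minus, <- RtoC_mult, <- RtoC_minus, Cmod_R.
  rewrite <- (per_Z (u s) (fun y => Hup s y Hs) k x), <- (per_Z (u t) (fun y => Hup t y Ht) k x), <- (per_Z (ut t) Hutp k x).
  set (y := x + IZR k * (2 * PI)) in *.
  assert (Hi : exists i, (i <= N)%nat /\ Rabs (y - xi i) <= 2 * PI / INR N).
  { assert (Hstep : 0 < 2 * PI / INR N) by (apply Rdiv_lt_0_compat; lra).
    destruct (archimed ((y + PI) / (2 * PI / INR N))) as [A1 A2].
    set (q := (y + PI) / (2 * PI / INR N)) in *. set (n := up q) in *.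
    assert (Hq : y + PI = q * (2 * PI / INR N)) by (unfold q; field; lra).
    assert (Hq0 : 0 <= q) by (unfold q; apply Rdiv_le_0_compat; lra).
    assert (HqN : q <= INR N).
    { unfold q. apply Rmult_le_reg_r with (2 * PI / INR N); auto. unfold Rdiv at 1. rewrite Rmult_assoc, Rinv_l by lra.
      rewrite Rmult_1_r. replace (INR N * (2 * PI / INR N)) with (2 * PI) by (field; lra). lra. }
    assert (Hn : (0 < n)%Z) by (apply lt_IZR; lra).
    assert (HnN : (n - 1 <= Z.of_nat N)%Z) by (apply le_IZR; rewrite minus_IZR, <- INR_IZR_INZ; lra).
    exists (Z.to_nat (n - 1)). split; [lia|]. unfold xi.
    rewrite INR_IZR_INZ, Z2Nat.id, minus_IZR by lia.
    replace (y - (- PI + (IZR n - 1) * (2 * PI / INR N))) with ((q - (IZR n - 1)) * (2 * PI / INR N))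
      by (replace y with (q * (2 * PI / INR N) - PI) by lra; ring).
    rewrite Rabs_pos_eq by nra. nra. }
  destruct Hi as (i & Hi & Hiy). set (z := xi i) in *.
  specialize (Hdd i Hi s Hs ltac:(lra)). fold z in Hdd.
  assert (Hdiff : Rabs ((u s y - u s z) - (u t y - u t z)) <= L * Rabs (y - z) * Rabs (s - t)).
  { apply (tder_lipschitz T (fun s => u s y - u s z) (fun s => ut s y - ut s z) (L * Rabs (y - z)) t s HT); auto.
    - intros r Hr e' He'. destruct (Hd r y Hr (e' / 2) ltac:(lra)) as (r1 & Hr1 & R1).
      destruct (Hd r z Hr (e' / 2) ltac:(lra)) as (r2 & Hr2 & R2).
      exists (Rmin r1 r2). split; [apply Rmin_glb_lt; auto|]. intros q Hq Hqr.
      pose proof (Rmin_l r1 r2). pose proof (Rmin_r r1 r2).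
      specialize (R1 q Hq ltac:(lra)). specialize (R2 q Hq ltac:(lra)).
      replace (u q y - u q z - (u r y - u r z) - (q - r) * (ut r y - ut r z)) with
        ((u q y - u r y - (q - r) * ut r y) + - (u q z - u r z - (q - r) * ut r z)) by ring.
      eapply Rle_trans; [apply Rabs_triang|]. rewrite Rabs_Ropp. lra.
    - intros r Hr. apply HLip.
      + unfold time_interval, Rmin, Rmax in *. destruct (Rle_dec t s); lra.
      + apply Rabs_lt_between. apply Rabs_lt_between in Hst. unfold Rmin, Rmax in *. destruct (Rle_dec t s); lra. }
  assert (Hlt : Rabs ((s - t) * ut t y - (s - t) * ut t z) <= L * Rabs (y - z) * Rabs (s - t)).
  { rewrite <- Rmult_minus_distr_l, Rabs_mult, Rmult_comm. apply Rmult_le_compat_r; [apply Rabs_pos|].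
    apply HLip; auto. unfold Rminus. rewrite Rplus_opp_r, Rabs_R0. auto. }
  replace (u s y - u t y - (s - t) * ut t y) with
    ((u s z - u t z - (s - t) * ut t z) + (((u s y - u s z) - (u t y - u t z)) + - ((s - t) * ut t y - (s - t) * ut t z))) by ring.
  eapply Rle_trans; [apply Rabs_triang|].
  eapply Rle_trans; [apply Rplus_le_compat_l; apply Rabs_triang|]. rewrite Rabs_Ropp.
  assert (L * Rabs (y - z) <= e / 4).
  { apply Rle_trans with (L * (2 * PI * / INR N)); [apply Rmult_le_compat_l; [auto|exact Hiy]|].
    apply Rle_trans with (L * (2 * PI * (e / (8 * PI * (L + 1))))).
    - apply Rmult_le_compat_l; auto. apply Rmult_le_compat_l; lra.
    - replace (L * (2 * PI * (e / (8 * PI * (L + 1))))) with (e / 4 * (L / (L + 1))) by (field; split; lra).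
      assert (L / (L + 1) <= 1) by (apply Rmult_le_reg_r with (L + 1); [lra|]; unfold Rdiv; rewrite Rmult_assoc, Rinv_l; lra).
      nra. }
  pose proof (Rabs_pos (s - t)). nra.
Qed.

Definition cbounded (v : R -> C) : Prop := exists M, 0 <= M /\ forall x, Cmod (v x) <= M.

Lemma udiff_ext : forall T t u v u' v', (forall s x, u s x = v s x) -> (forall x, u' x = v' x) ->
  udiff T t u u' -> udiff T t v v'.
Proof.
  intros T t u v u' v' H H' Hu e He. destruct (Hu e He) as (d & Hd & Hdd). exists d. split; auto.
  intros s Hs Hst x. rewrite <- !H, <- H'. auto.
Qed.

Lemma udiff_lip : forall T t u u', udiff T t u u' -> cbounded u' -> exists d K, 0 < d /\ 0 <= K /\
  forall s, time_interval T s -> Rabs (s - t) < d -> forall x, Cmod (u s x - u t x) <= K * Rabs (s - t).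
Proof.
  intros T t u u' Hu (M & HM & HMx). destruct (Hu 1 ltac:(lra)) as (d & Hd & D). exists d, (1 + M).
  split; [auto|split; [lra|]]. intros s Hs Hst x. specialize (D s Hs Hst x). specialize (HMx x).
  replace (u s x - u t x)%C with ((u s x - u t x - RtoC (s - t) * u' x) + RtoC (s - t) * u' x)%C by ring.
  eapply Rle_trans; [apply Cmod_triangle|]. rewrite (Cmod_mult (RtoC _)), Cmod_R.
  pose proof (Rabs_pos (s - t)). nra.
Qed.

Lemma udiff_mult : forall T t u v u' v', udiff T t u u' -> udiff T t v v' ->
  cbounded (u t) -> cbounded (v t) -> cbounded u' -> cbounded v' ->
  udiff T t (fun s x => u s x * v s x)%C (fun x => u' x * v t x + u t x * v' x)%C.
Proof.
  intros T t u v u' v' Hu Hv (Mu & HMu & Bu) (Mv & HMv & Bv) Bu' Bv' e He.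
  destruct (udiff_lip _ _ _ _ Hu Bu') as (d1 & K1 & Hd1 & HK1 & L1).
  destruct (udiff_lip _ _ _ _ Hv Bv') as (d2 & K2 & Hd2 & HK2 & L2).
  assert (Hq : 0 < e / (3 * (Mu + Mv + 1))) by (apply Rdiv_lt_0_compat; lra).
  destruct (Hu _ Hq) as (d3 & Hd3 & D3). destruct (Hv _ Hq) as (d4 & Hd4 & D4).
  set (d5 := e / (3 * (K1 * K2 + 1))).
  assert (HKK : 0 <= K1 * K2) by nra.
  assert (Hd5 : 0 < d5) by (apply Rdiv_lt_0_compat; lra).
  exists (Rmin (Rmin d1 d2) (Rmin (Rmin d3 d4) d5)). split; [repeat apply Rmin_glb_lt; auto|].
  intros s Hs Hst x.
  assert (Hst' : Rabs (s - t) < d1 /\ Rabs (s - t) < d2 /\ Rabs (s - t) < d3 /\ Rabs (s - t) < d4 /\ Rabs (s - t) < d5).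
  { pose proof (Rmin_l (Rmin d1 d2) (Rmin (Rmin d3 d4) d5)). pose proof (Rmin_r (Rmin d1 d2) (Rmin (Rmin d3 d4) d5)).
    pose proof (Rmin_l d1 d2). pose proof (Rmin_r d1 d2). pose proof (Rmin_l (Rmin d3 d4) d5). pose proof (Rmin_r (Rmin d3 d4) d5).
    pose proof (Rmin_l d3 d4). pose proof (Rmin_r d3 d4). lra. }
  destruct Hst' as (S1 & S2 & S3 & S4 & S5).
  specialize (L1 s Hs S1 x). specialize (L2 s Hs S2 x). specialize (D3 s Hs S3 x). specialize (D4 s Hs S4 x).
  specialize (Bu x). specialize (Bv x).
  set (q := e / (3 * (Mu + Mv + 1))) in *.
  match goal with |- Cmod ?z <= _ => replace z with
    ((u s x - u t x - RtoC (s - t) * u' x) * v t x + u t x * (v s x - v t x - RtoC (s - t) * v' x)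
      + (u s x - u t x) * (v s x - v t x))%C by ring end.
  eapply Rle_trans; [apply Cmod_triangle|]. eapply Rle_trans; [apply Rplus_le_compat_r, Cmod_triangle|].
  rewrite !Cmod_mult.
  set (h := Rabs (s - t)) in *. assert (Hh : 0 <= h) by apply Rabs_pos.
  assert (A1 : Cmod (u s x - u t x - RtoC (s - t) * u' x) * Cmod (v t x) <= q * h * Mv).
  { apply Rmult_le_compat; auto using Cmod_ge_0. }
  assert (A2 : Cmod (u t x) * Cmod (v s x - v t x - RtoC (s - t) * v' x) <= Mu * (q * h)).
  { apply Rmult_le_compat; auto using Cmod_ge_0. }
  assert (A3 : Cmod (u s x - u t x) * Cmod (v s x - v t x) <= (K1 * h) * (K2 * h)).
  { apply Rmult_le_compat; auto using Cmod_ge_0. }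
  assert (A4 : q * (Mu + Mv) <= e / 3).
  { unfold q. apply Rmult_le_reg_r with (3 * (Mu + Mv + 1)); [lra|]. field_simplify; [|lra]. nra. }
  assert (A5 : K1 * K2 * h <= e / 3).
  { apply Rle_trans with (K1 * K2 * d5); [apply Rmult_le_compat_l; lra|].
    unfold d5. apply Rmult_le_reg_r with (3 * (K1 * K2 + 1)); [lra|]. field_simplify; [|lra]. nra. }
  assert ((K1 * h) * (K2 * h) <= e / 3 * h) by nra.
  nra.
Qed.

Lemma udiff_exp : forall T t (h ht : R -> R -> R) k, udiff T t (fun s => rc (h s)) (rc (ht t)) ->
  cbounded (rc (h t)) -> cbounded (rc (ht t)) ->
  udiff T t (fun s => rc (fun x => exp (k * h s x))) (rc (fun x => k * ht t x * exp (k * h t x))).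
Proof.
  intros T t h ht k Hu (M & HM & BM) Bt e He.
  destruct (udiff_lip _ _ _ _ Hu Bt) as (d1 & K & Hd1 & HK & L1).
  set (E := exp (Rabs k * M)). assert (HE : 0 < E) by apply exp_pos.
  pose proof (Rabs_pos k) as Hk0.
  destruct (Hu (e / (2 * (Rabs k * E + 1)))) as (d2 & Hd2 & D2); [apply Rdiv_lt_0_compat; nra|].
  set (Q := 2 * E * (Rabs k * K) ^ 2). assert (HQ : 0 <= Q) by (unfold Q; pose proof (pow2_ge_0 (Rabs k * K)); nra).
  set (d3 := e / (2 * (Q + 1))). assert (Hd3 : 0 < d3) by (apply Rdiv_lt_0_compat; lra).
  set (d4 := 1 / (2 * (Rabs k * K + 1))). assert (HkK : 0 <= Rabs k * K) by nra.
  assert (Hd4 : 0 < d4) by (apply Rdiv_lt_0_compat; lra).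
  exists (Rmin (Rmin d1 d2) (Rmin d3 d4)). split; [repeat apply Rmin_glb_lt; auto|].
  intros s Hs Hst x.
  assert (Hst' : Rabs (s - t) < d1 /\ Rabs (s - t) < d2 /\ Rabs (s - t) < d3 /\ Rabs (s - t) < d4).
  { pose proof (Rmin_l (Rmin d1 d2) (Rmin d3 d4)). pose proof (Rmin_r (Rmin d1 d2) (Rmin d3 d4)).
    pose proof (Rmin_l d1 d2). pose proof (Rmin_r d1 d2). pose proof (Rmin_l d3 d4). pose proof (Rmin_r d3 d4). lra. }
  destruct Hst' as (S1 & S2 & S3 & S4).
  specialize (L1 s Hs S1 x). specialize (D2 s Hs S2 x). specialize (BM x). unfold rc in *.
  rewrite <- RtoC_minus, Cmod_R in L1. rewrite <- RtoC_minus, <- RtoC_mult, <- RtoC_minus, Cmod_R in D2. rewrite Cmod_R in BM.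
  rewrite <- RtoC_minus, <- RtoC_mult, <- RtoC_minus, Cmod_R.
  set (del := k * (h s x - h t x)).
  set (hh := Rabs (s - t)) in *. assert (Hhh : 0 <= hh) by apply Rabs_pos.
  assert (Hdel : Rabs del <= Rabs k * K * hh).
  { unfold del. rewrite Rabs_mult, Rmult_assoc. apply Rmult_le_compat_l; auto. }
  assert (Hdel2 : Rabs del <= 1 / 2).
  { eapply Rle_trans; [exact Hdel|]. apply Rle_trans with (Rabs k * K * d4); [apply Rmult_le_compat_l; lra|].
    unfold d4. apply Rmult_le_reg_r with (2 * (Rabs k * K + 1)); [lra|]. field_simplify; lra. }
  destruct (exp_quad del Hdel2) as [Q1 Q2].
  assert (He1 : exp (k * h t x) <= E).
  { apply exp_mono. eapply Rle_trans; [apply Rle_abs|]. rewrite Rabs_mult. apply Rmult_le_compat_l; auto. }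
  pose proof (exp_pos (k * h t x)) as He0.
  assert (Heq : exp (k * h s x) = exp (k * h t x) * exp del) by (rewrite <- exp_plus; f_equal; unfold del; ring).
  rewrite Heq. set (X := exp (k * h t x)) in *.
  replace (X * exp del - X - (s - t) * (k * ht t x * X)) with
    (X * (exp del - (1 + del)) + X * k * (h s x - h t x - (s - t) * ht t x)) by (unfold del; ring).
  eapply Rle_trans; [apply Rabs_triang|]. rewrite !Rabs_mult, (Rabs_pos_eq X) by lra.
  rewrite (Rabs_pos_eq (exp del - _)) by lra.
  assert (B1 : X * (exp del - (1 + del)) <= e / 2 * hh).
  { apply Rle_trans with (E * (2 * (Rabs k * K * hh) ^ 2)).
    - apply Rmult_le_compat; try lra. eapply Rle_trans; [exact Q2|]. apply Rmult_le_compat_l; [lra|].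
      rewrite <- (pow2_abs del). apply pow_incr. split; [apply Rabs_pos|auto].
    - replace (E * (2 * (Rabs k * K * hh) ^ 2)) with (Q * hh * hh) by (unfold Q; ring).
      apply Rmult_le_compat_r; auto. apply Rle_trans with (Q * d3); [apply Rmult_le_compat_l; lra|].
      unfold d3. apply Rmult_le_reg_r with (2 * (Q + 1)); [lra|]. field_simplify; [|lra]. nra. }
  assert (B2 : X * Rabs k * Rabs (h s x - h t x - (s - t) * ht t x) <= e / 2 * hh).
  { apply Rle_trans with (E * Rabs k * (e / (2 * (Rabs k * E + 1)) * hh)).
    - apply Rmult_le_compat; auto; [pos|apply Rabs_pos|apply Rmult_le_compat_r; auto].
    - rewrite <- Rmult_assoc. apply Rmult_le_compat_r; auto.
      assert (0 <= Rabs k * E) by nra.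
      apply Rmult_le_reg_r with (2 * (Rabs k * E + 1)); [lra|]. field_simplify; [|lra]. nra. }
  lra.
Qed.

Lemma udiff_cint : forall T t u u' (P : R -> C), udiff T t u u' ->
  time_interval T t -> (forall s, time_interval T s -> ccont (u s)) -> ccont u' -> ccont P -> cper P ->
  ctder T (fun s => cint (fun x => u s x * P x)%C) t (cint (fun x => u' x * P x)%C).
Proof.
  intros T t u u' P Hu Ht Hc Hc' HP HPp e He. pose proof PI_RGT_0 as HPI.
  destruct (ccont_bounded P HP HPp) as (M & HM & BM).
  destruct (Hu (e / (2 * PI * (M + 1)))) as (d & Hd & D).
  { apply Rdiv_lt_0_compat; nra. }
  exists d. split; auto. intros s Hs Hst. specialize (D s Hs Hst).
  rewrite <- cint_minus, <- cint_scal, <- cint_minus by cc.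
  eapply Rle_trans; [apply (cint_bound _ (e / (2 * PI * (M + 1)) * Rabs (s - t) * (M + 1)))|].
  - cc.
  - intros x. match goal with |- Cmod ?z <= _ => replace z with
      ((u s x - u t x - RtoC (s - t) * u' x) * P x)%C by ring end.
    rewrite Cmod_mult. specialize (BM x). apply Rmult_le_compat; auto using Cmod_ge_0. lra.
  - right. field. split; lra.
Qed.

Lemma ctder_cft : forall T t u u' k, udiff T t u u' -> time_interval T t ->
  (forall s, time_interval T s -> ccont (u s)) -> ccont u' ->
  ctder T (fun s => cft (u s) k) t (cft u' k).
Proof.
  intros T t u u' k Hu Ht Hc Hc' e He.
  assert (HH : cper (fun x => cis (- (IZR k * x)))).
  { intros x. rewrite !Ropp_mult_distr_l, <- opp_IZR. apply cis_2PI. }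
  destruct (udiff_cint T t u u' _ Hu Ht Hc Hc' (ccont_cisn k) HH (e * (2 * PI))) as (d & Hd & D).
  { pose proof PI_RGT_0; nra. }
  exists d. split; auto. intros s Hs Hst. specialize (D s Hs Hst). unfold cft.
  match goal with |- Cmod (?c * ?a - ?c * ?b - ?r * (?c * ?f))%C <= _ =>
    replace (c * a - c * b - r * (c * f))%C with (c * (a - b - r * f))%C by ring end.
  pose proof PI_RGT_0. rewrite Cmod_mult, Cmod_R, Rabs_pos_eq by (pos).
  apply Rmult_le_reg_l with (2 * PI); [lra|]. rewrite <- Rmult_assoc, Rinv_r, Rmult_1_l by lra.
  eapply Rle_trans; [exact D|]. right; ring.
Qed.

Lemma ctder_scal : forall T f t l c, ctder T f t l -> ctder T (fun s => c * f s)%C t (c * l)%C.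
Proof.
  intros T f t l c H e He. pose proof (Cmod_ge_0 c).
  destruct (H (e / (Cmod c + 1))) as (d & Hd & D); [apply Rdiv_lt_0_compat; lra|].
  exists d. split; auto. intros s Hs Hst. specialize (D s Hs Hst).
  match goal with |- Cmod ?z <= _ => replace z with (c * (f s - f t - RtoC (s - t) * l))%C by ring end.
  rewrite Cmod_mult. apply Rle_trans with (Cmod c * (e / (Cmod c + 1) * Rabs (s - t))); [now apply Rmult_le_compat_l|].
  rewrite <- Rmult_assoc. apply Rmult_le_compat_r; [apply Rabs_pos|].
  apply Rmult_le_reg_r with (Cmod c + 1); [lra|]. field_simplify; [|lra]. nra.
Qed.

Lemma ctder_plus : forall T f g t l m, ctder T f t l -> ctder T g t m -> ctder T (fun s => f s + g s)%C t (l + m)%C.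
Proof.
  intros T f g t l m Hf Hg e He. destruct (Hf (e / 2) ltac:(lra)) as (d1 & Hd1 & D1).
  destruct (Hg (e / 2) ltac:(lra)) as (d2 & Hd2 & D2).
  exists (Rmin d1 d2). split; [apply Rmin_glb_lt; auto|]. intros s Hs Hst.
  pose proof (Rmin_l d1 d2). pose proof (Rmin_r d1 d2).
  specialize (D1 s Hs ltac:(lra)). specialize (D2 s Hs ltac:(lra)).
  match goal with |- Cmod ?z <= _ => replace z with
    ((f s - f t - RtoC (s - t) * l) + (g s - g t - RtoC (s - t) * m))%C by ring end.
  eapply Rle_trans; [apply Cmod_triangle|]. lra.
Qed.

Lemma ctder_eq : forall T f g t l m, (forall s, f s = g s) -> l = m -> ctder T f t l -> ctder T g t m.
Proof.
  intros T f g t l m H E Hf e He. destruct (Hf e He) as (d & Hd & D). exists d. split; auto.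
  intros s Hs Hst. rewrite <- !H, <- E. auto.
Qed.

Lemma ctder_extend : forall T f f', 0 < T -> (forall t, time_interval T t -> ctder T f t (f' t)) ->
  exists F, (forall t, time_interval T t -> F t = f t) /\ (forall t, time_interval T t -> cderiv F t (f' t)).
Proof.
  intros T f f' HT H.
  destruct (tder_extend T (fun t => Re (f t)) (fun t => Re (f' t)) HT) as (F1 & A1 & B1).
  { intros t Ht e He. destruct (H t Ht e He) as (d & Hd & D). exists d. split; auto. intros s Hs Hst.
    eapply Rle_trans; [|apply (D s Hs Hst)]. eapply Rle_trans; [|apply re_le_Cmod]. right. f_equal.
    unfold Re; simpl. ring. }
  destruct (tder_extend T (fun t => Im (f t)) (fun t => Im (f' t)) HT) as (F2 & A2 & B2).
  { intros t Ht e He. destruct (H t Ht e He) as (d & Hd & D). exists d. split; auto. intros s Hs Hst.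
    eapply Rle_trans; [|apply (D s Hs Hst)]. eapply Rle_trans; [|apply im_le_Cmod]. right. f_equal.
    unfold Im; simpl. ring. }
  exists (fun t => (F1 t, F2 t)). split.
  - intros t Ht. apply C_eq; simpl; auto.
  - intros t Ht. split; simpl; auto.
Qed.


(** * Propagation of analyticity *)

(** If the bound up to time [t] improves to a strict bound at [t], the set of good
    times is open and closed. *)
Lemma cont_induction : forall (f : R -> R) T m, 0 <= T ->
  (forall t, time_interval T t -> forall e, 0 < e -> exists d, 0 < d /\ forall s, time_interval T s ->
     Rabs (s - t) < d -> Rabs (f s - f t) <= e) ->
  f 0 < m -> (forall t, time_interval T t -> (forall s, 0 <= s <= t -> f s <= m) -> f t < m) ->
  forall t, time_interval T t -> f t < m.
Proof.
  intros f T m HT Hc H0 Hstep t0 Ht0. apply Rnot_le_lt. intros Hbad.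
  destruct (completeness (fun x => time_interval T x /\ forall s, 0 <= s <= x -> f s < m)) as [x [Hub Hlub]].
  - exists T. intros x [[_ Hx] _]. exact Hx.
  - exists 0. split; [split; lra|]. intros s Hs. replace s with 0 by lra. auto.
  - assert (Hx0 : 0 <= x) by (apply Hub; split; [split; lra|]; intros s Hs; replace s with 0 by lra; auto).
    assert (HxT : x <= T) by (apply Hlub; intros y [[_ Hy] _]; exact Hy).
    assert (Hxi : time_interval T x) by (split; lra).
    assert (Hlt : forall s, 0 <= s < x -> f s < m).
    { intros s Hs. apply Rnot_le_lt. intros Hge.
      assert (x <= s); [|lra]. apply Hlub. intros y [Hy Hys]. apply Rnot_lt_le. intros Hsy.
      specialize (Hys s ltac:(lra)). lra. }
    assert (Hfx : f x < m).
    { apply Hstep; auto. intros s Hs. destruct (Req_dec s x) as [->|]; [|left; apply Hlt; lra].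
      apply Rnot_lt_le. intros Hgt. destruct (Hc x Hxi ((f x - m) / 2) ltac:(lra)) as (d & Hd & D).
      destruct (Req_dec x 0) as [->|Hx]; [lra|].
      set (r := Rmax 0 (x - d / 2)).
      assert (Hr : 0 <= r < x /\ x - d < r) by (unfold r, Rmax; destruct Rle_dec; lra).
      specialize (D r ltac:(split; lra) ltac:(apply Rabs_lt_between; lra)).
      specialize (Hlt r ltac:(lra)). apply Rabs_le_between in D. lra. }
    destruct (Hc x Hxi ((m - f x) / 2) ltac:(lra)) as (d & Hd & D).
    assert (Hxt : x < t0).
    { apply Rnot_le_lt. intros Hle. destruct Ht0. destruct (Req_dec t0 x) as [E|E]; [subst; lra|].
      specialize (Hlt t0 ltac:(lra)). lra. }
    set (r := Rmin (x + d / 2) t0).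
    assert (Hr : x < r /\ r <= t0 /\ r < x + d) by (unfold r, Rmin; destruct Rle_dec; lra).
    destruct Ht0 as [Ht1 Ht2].
    assert (r <= x); [|lra]. apply Hub. split; [split; lra|].
    intros s Hs. destruct (Rlt_or_le s x); [apply Hlt; lra|].
    specialize (D s ltac:(split; lra) ltac:(apply Rabs_lt_between; lra)). apply Rabs_le_between in D. lra.
Qed.

Lemma nonincr : forall (F F' : R -> R) T, (forall t, time_interval T t -> is_derive F t (F' t)) ->
  (forall t, time_interval T t -> F' t <= 0) -> forall t, time_interval T t -> F t <= F 0.
Proof.
  intros F F' T HF HF' t [Ht1 Ht2].
  destruct (MVT_gen F 0 t F') as (c & Hc & E).
  - intros s Hs. apply HF. rewrite Rmin_left, Rmax_right in Hs by lra. split; lra.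
  - intros s Hs. apply continuity_pt_filterlim. eapply continuous_of_derivable, HF.
    rewrite Rmin_left, Rmax_right in Hs by lra. split; lra.
  - rewrite Rmin_left, Rmax_right in Hc by lra. specialize (HF' c ltac:(split; lra)). nra.
Qed.

(** The modulus is not differentiable at zero; this majorant is, and its derivative
    is still bounded by the modulus of the derivative. *)
Definition smod (kap : R) (z : C) : R := sqrt (Re z ^ 2 + Im z ^ 2 + kap ^ 2).

Lemma smod_ge : forall kap z, Cmod z <= smod kap z.
Proof.
  intros. unfold Cmod, smod. apply sqrt_le_1_alt. unfold Re, Im. pose proof (pow2_ge_0 kap). lra.
Qed.

Lemma smod_le : forall kap z, 0 <= kap -> smod kap z <= Cmod z + kap.
Proof.
  intros kap z Hk. pose proof (Cmod_ge_0 z) as Hz. rewrite <- (sqrt_pow2 (Cmod z + kap)) by lra.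
  unfold smod. apply sqrt_le_1_alt.
  assert (E : Cmod z ^ 2 = Re z ^ 2 + Im z ^ 2) by apply Cmod2_alt.
  nra.
Qed.

Lemma smod_deriv : forall kap F t l, 0 < kap -> cderiv F t l ->
  exists m, is_derive (fun s => smod kap (F s)) t m /\ m <= Cmod l.
Proof.
  intros kap F t l Hk [H1 H2].
  assert (Hp : 0 < Re (F t) ^ 2 + Im (F t) ^ 2 + kap ^ 2).
  { nra. }
  exists ((Re l * Re (F t) + Im l * Im (F t)) / smod kap (F t)). split.
  - unfold smod. eapply der_eq.
    + apply (is_derive_comp sqrt (fun s => Re (F s) ^ 2 + Im (F s) ^ 2 + kap ^ 2) t
        (/ (2 * sqrt (Re (F t) ^ 2 + Im (F t) ^ 2 + kap ^ 2))) (2 * (Re l * Re (F t) + Im l * Im (F t)))).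
      * apply is_derive_Reals. apply derivable_pt_lim_sqrt. auto.
      * eapply der_eq.
        { apply der_plus; [apply der_plus|apply @is_derive_const].
          - apply (is_derive_ext (fun s => Re (F s) * Re (F s))); [intros; simpl; ring|]. apply der_mult; exact H1.
          - apply (is_derive_ext (fun s => Im (F s) * Im (F s))); [intros; simpl; ring|]. apply der_mult; exact H2. }
        unfold zero; simpl. ring.
    + unfold scal; simpl; unfold mult; simpl. field.
      apply Rgt_not_eq. apply sqrt_lt_R0. simpl in Hp. exact Hp.
  - assert (Hs : 0 < smod kap (F t)) by (apply sqrt_lt_R0; auto).
    apply Rmult_le_reg_r with (smod kap (F t)); auto. unfold Rdiv. rewrite Rmult_assoc, Rinv_l, Rmult_1_r by lra.
    assert (CS : Re l * Re (F t) + Im l * Im (F t) <= Cmod l * Cmod (F t)).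
    { rewrite <- (Cmod_conj (F t)), <- Cmod_mult. eapply Rle_trans; [|eapply Rle_trans; [apply Rle_abs|apply re_le_Cmod]].
      right. unfold Re, Im; simpl. ring. }
    pose proof (smod_ge kap (F t)). pose proof (Cmod_ge_0 l). nra.
Qed.

Lemma lsum_deriv : forall (F F' : Z -> R -> R) l t, (forall k, In k l -> is_derive (F k) t (F' k t)) ->
  is_derive (fun s => lsum l (fun k => F k s)) t (lsum l (fun k => F' k t)).
Proof.
  intros F F' l t H. induction l as [|x l IH]; simpl.
  - apply @is_derive_const.
  - apply (der_plus (F x) (fun s => lsum l (fun k => F k s))).
    + apply H; now left.
    + apply IH. intros; apply H; now right.
Qed.

(** Gronwall's inequality for a finite weighted sum of moduli. *)
Lemma gronwall : forall (l : list Z) T B eta (w w' : Z -> R -> R) (b v b' v' : Z -> R -> C) al,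
  0 <= B -> 0 <= eta -> 0 <= al ->
  (forall k t, time_interval T t -> 0 <= w k t /\ w' k t <= 0 /\ is_derive (w k) t (w' k t)) ->
  (forall k t, time_interval T t -> cderiv (b k) t (b' k t) /\ cderiv (v k) t (v' k t)) ->
  (forall t, time_interval T t ->
    lsum l (fun k => w' k t * (al * Cmod (b k t) + Cmod (v k t)) + w k t * (al * Cmod (b' k t) + Cmod (v' k t)))
     <= B * lsum l (fun k => w k t * (al * Cmod (b k t) + Cmod (v k t))) + eta) ->
  forall t, time_interval T t ->
    lsum l (fun k => w k t * (al * Cmod (b k t) + Cmod (v k t))) <=
    (lsum l (fun k => w k 0 * (al * Cmod (b k 0) + Cmod (v k 0))) + eta * t) * exp (B * t).
Proof.
  intros l T B eta w w' b v b' v' al HB Heta Hal Hw Hd Hin t Ht.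
  assert (H0i : time_interval T 0) by (destruct Ht; split; lra).
  assert (main : forall kap, 0 < kap -> lsum l (fun k => w k t * (al * Cmod (b k t) + Cmod (v k t))) <=
    (lsum l (fun k => w k 0 * (al * Cmod (b k 0) + Cmod (v k 0))) + kap * lsum l (fun k => w k 0 * (al + 1)) + eta * t) * exp (B * t)).
  { intros kap Hk.
    assert (Hex : forall k s, exists m n, time_interval T s ->
       (is_derive (fun r => smod kap (b k r)) s m /\ m <= Cmod (b' k s)) /\
       (is_derive (fun r => smod kap (v k r)) s n /\ n <= Cmod (v' k s))).
    { intros k s. destruct (Classical_Prop.classic (time_interval T s)) as [Hs|Hs].
      - destruct (Hd k s Hs) as [D1 D2].
        destruct (smod_deriv kap _ _ _ Hk D1) as (m & M1). destruct (smod_deriv kap _ _ _ Hk D2) as (n & N1).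
        exists m, n. auto.
      - exists 0, 0. tauto. }
    pose (mb := fun k s => proj1_sig (constructive_indefinite_description _ (Hex k s))).
    assert (Hmb : forall k s, exists n, time_interval T s ->
       (is_derive (fun r => smod kap (b k r)) s (mb k s) /\ mb k s <= Cmod (b' k s)) /\
       (is_derive (fun r => smod kap (v k r)) s n /\ n <= Cmod (v' k s))).
    { intros k s. exact (proj2_sig (constructive_indefinite_description _ (Hex k s))). }
    pose (mv := fun k s => proj1_sig (constructive_indefinite_description _ (Hmb k s))).
    assert (Hm : forall k s, time_interval T s ->
       (is_derive (fun r => smod kap (b k r)) s (mb k s) /\ mb k s <= Cmod (b' k s)) /\
       (is_derive (fun r => smod kap (v k r)) s (mv k s) /\ mv k s <= Cmod (v' k s))).
    { intros k s. exact (proj2_sig (constructive_indefinite_description _ (Hmb k s))). }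
    set (F := fun s => lsum l (fun k => w k s * (al * smod kap (b k s) + smod kap (v k s)))).
    set (F' := fun s => lsum l (fun k => w' k s * (al * smod kap (b k s) + smod kap (v k s)) + w k s * (al * mb k s + mv k s))).
    assert (HF : forall s, time_interval T s -> is_derive F s (F' s)).
    { intros s Hs. unfold F, F'.
      apply (lsum_deriv (fun k s => w k s * (al * smod kap (b k s) + smod kap (v k s)))
        (fun k s => w' k s * (al * smod kap (b k s) + smod kap (v k s)) + w k s * (al * mb k s + mv k s))).
      intros k _. destruct (Hm k s Hs) as [[M1 _] [N1 _]]. destruct (Hw k s Hs) as (_ & _ & W1).
      apply (der_mult (w k) (fun s => al * smod kap (b k s) + smod kap (v k s))); auto.
      apply (der_plus (fun s => al * smod kap (b k s)) (fun s => smod kap (v k s))); auto.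
      apply (is_derive_scal (fun r => smod kap (b k r))). exact M1. }
    set (S := fun s => lsum l (fun k => w k s * (al * Cmod (b k s) + Cmod (v k s)))) in *.
    assert (HSF : forall s, time_interval T s -> S s <= F s).
    { intros s Hs. apply lsum_le. intros k _. destruct (Hw k s Hs) as (W0 & _).
      apply Rmult_le_compat_l; auto. apply Rplus_le_compat; [apply Rmult_le_compat_l; auto|]; apply smod_ge. }
    assert (HF'b : forall s, time_interval T s -> F' s <= B * F s + eta).
    { intros s Hs. apply Rle_trans with (B * S s + eta).
      - eapply Rle_trans; [|apply (Hin s Hs)]. apply lsum_le. intros k _.
        destruct (Hw k s Hs) as (W0 & W1 & _). destruct (Hm k s Hs) as [[_ M1] [_ N1]].
        apply Rplus_le_compat.
        + assert (al * Cmod (b k s) + Cmod (v k s) <= al * smod kap (b k s) + smod kap (v k s)).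
          { apply Rplus_le_compat; [apply Rmult_le_compat_l; auto|]; apply smod_ge. }
          nra.
        + apply Rmult_le_compat_l; auto. apply Rplus_le_compat; auto. apply Rmult_le_compat_l; auto.
      - apply Rplus_le_compat_r, Rmult_le_compat_l; auto. }
    set (Gf := fun s => exp (- B * s) * F s - eta * s).
    set (G' := fun s => (- B * exp (- B * s) * F s + exp (- B * s) * F' s) - eta).
    assert (HG : Gf t <= Gf 0).
    { apply (nonincr Gf G' T); auto.
      - intros s Hs. unfold Gf, G'.
        apply (der_minus (fun s => exp (- B * s) * F s) (fun s => eta * s) s
          (- B * exp (- B * s) * F s + exp (- B * s) * F' s) eta).
        + apply (der_mult (fun s => exp (- B * s)) F s (- B * exp (- B * s)) (F' s)); auto.
          auto_derive; auto. ring.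
        + auto_derive; auto. ring.
      - intros s Hs. unfold G'. specialize (HF'b s Hs). pose proof (exp_pos (- B * s)).
        assert (exp (- B * s) <= 1) by (rewrite <- exp_0; apply exp_mono; destruct Hs; nra). nra. }
    unfold Gf in HG. rewrite !Rmult_0_r, exp_0, Rmult_1_l, Rminus_0_r in HG.
    assert (HF0 : F 0 <= S 0 + kap * lsum l (fun k => w k 0 * (al + 1))).
    { unfold F, S. rewrite <- lsum_scal, <- lsum_plus. apply lsum_le. intros k _. destruct (Hw k 0 H0i) as (W0 & _).
      replace (w k 0 * (al * Cmod (b k 0) + Cmod (v k 0)) + kap * (w k 0 * (al + 1))) with
        (w k 0 * (al * (Cmod (b k 0) + kap) + (Cmod (v k 0) + kap))) by ring.
      apply Rmult_le_compat_l; auto. apply Rplus_le_compat; [apply Rmult_le_compat_l; auto|]; apply smod_le; lra. }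
    apply Rle_trans with (F t); [now apply HSF|].
    replace (F t) with ((exp (- B * t) * F t) * exp (B * t)).
    - apply Rmult_le_compat_r; [epos|]. fold (S 0). lra.
    - replace (exp (- B * t) * F t * exp (B * t)) with (F t * (exp (- B * t) * exp (B * t))) by ring.
      rewrite <- exp_plus. replace (- B * t + B * t) with 0 by ring. rewrite exp_0. ring. }
  apply Rnot_lt_le. intros Hlt.
  set (L := lsum l (fun k => w k t * (al * Cmod (b k t) + Cmod (v k t)))) in *.
  set (R0 := lsum l (fun k => w k 0 * (al * Cmod (b k 0) + Cmod (v k 0)))) in *.
  set (Q := lsum l (fun k => w k 0 * (al + 1))) in *.
  assert (HQ : 0 <= Q).
  { apply lsum_nonneg. intros k. destruct (Hw k 0 H0i) as (W0 & _). pos. }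
  pose proof (exp_pos (B * t)) as HE. set (E := exp (B * t)) in *.
  set (gap := L - (R0 + eta * t) * E) in *.
  assert (Hgap : 0 < gap) by (unfold gap; lra).
  specialize (main (gap / (2 * (Q + 1) * E))).
  assert (Hp : 0 < gap / (2 * (Q + 1) * E)) by (apply Rdiv_lt_0_compat; nra).
  specialize (main Hp).
  assert (gap / (2 * (Q + 1) * E) * Q * E <= gap / 2).
  { apply Rmult_le_reg_r with (2 * (Q + 1)); [lra|].
    replace (gap / (2 * (Q + 1) * E) * Q * E * (2 * (Q + 1))) with (gap * Q) by (field; split; lra). nra. }
  unfold gap in *. nra.
Qed.

Lemma lsum_filter : forall (P : Z -> bool) l a, lsum l a = lsum (filter P l) a + lsum (filter (fun k => negb (P k)) l) a.
Proof.
  induction l as [|x l IH]; intros a; simpl; [ring|]. rewrite (IH a). destruct (P x); simpl; ring.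
Qed.

Lemma bnd_win_tail : forall K a S e, (forall k, 0 <= a k) -> lsum (win K) a <= S ->
  (forall l, NoDup l -> (forall k, In k l -> ~ In k (win K)) -> lsum l a <= e) -> bnd a (S + e).
Proof.
  intros K a S e Ha HS He l Hl.
  rewrite (lsum_filter (fun k => if in_dec Z.eq_dec k (win K) then true else false)).
  apply Rplus_le_compat.
  - eapply Rle_trans; [|exact HS]. apply lsum_incl; auto; [now apply NoDup_filter|].
    intros k Hk. apply filter_In in Hk. destruct Hk as [_ Hk]. destruct in_dec; [auto|discriminate].
  - apply He; [now apply NoDup_filter|]. intros k Hk. apply filter_In in Hk. destruct Hk as [_ Hk].
    destruct in_dec; [discriminate|auto].
Qed.

Lemma exp_derive_lin : forall a c t, is_derive (fun s => exp (a - c * s)) t (- c * exp (a - c * t)).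
Proof. intros. auto_derive; auto. unfold Rminus. ring. Qed.

Lemma continuous_Cmod : forall F t l, cderiv F t l -> continuous (fun s => Cmod (F s)) t.
Proof.
  intros F t l [D1 D2]. unfold Cmod.
  apply (continuous_comp (fun s => fst (F s) ^ 2 + snd (F s) ^ 2) sqrt); [|apply continuous_sqrt].
  apply (continuous_ext (fun s => fst (F s) * fst (F s) + snd (F s) * snd (F s))); [intros; simpl; ring|].
  eapply continuous_of_derivable.
  exact (der_plus _ _ _ _ _ (der_mult _ _ _ _ _ D1 D1) (der_mult _ _ _ _ _ D2 D2)).
Qed.

Definition pw (phi : Z -> R) (lam : R) (k : Z) (t : R) : R := exp (phi k - lam * zabs k * t).

(** The system has the form [b' = O(|k| v)], [v' = O(g b + |k| q)], where [q] stands for a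
    nonlinearity which, as long as the weighted norm is at most [mu], is bounded by a
    small multiple of the norm with one more derivative.  The fourth clause is a
    qualitative decay, uniform in time, that only serves to truncate sums.  The factor
    [al] on [b] makes the coupling [b'] cheap, at the price of the growth
    [exp (g T / al)]. *)
Definition propagating (der : R -> (R -> C) -> R -> C -> Prop) T g al lam mu s1 Bd (phi : Z -> R)
  (b v b' v' : Z -> R -> C) (q : Z -> R -> R) : Prop :=
  (forall k t, time_interval T t -> der T (b k) t (b' k t) /\ der T (v k) t (v' k t)) /\
  (forall k t, time_interval T t -> Cmod (b' k t) <= zabs k * Cmod (v k t)) /\
  (forall k t, time_interval T t -> Cmod (v' k t) <= g * Cmod (b k t) + zabs k * q k t) /\
  (forall k t, time_interval T t -> Cmod (b k t) <= Bd * exp (- s1 * zabs k) /\ Cmod (v k t) <= Bd * exp (- s1 * zabs k)) /\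
  (forall t, time_interval T t -> bnd (fun k => pw phi lam k t * (al * Cmod (b k t) + Cmod (v k t))) mu ->
     forall D, bnd (fun k => zabs k * (pw phi lam k t * (al * Cmod (b k t) + Cmod (v k t)))) D ->
     bnd (fun k => zabs k * (pw phi lam k t * q k t)) (lam / 2 * D)).

(** Abstract Cauchy--Kovalevskaya estimate.  Differentiating the weights produces
    [- lam |k|]; half of it pays for [b'] and half for [q].  The qualitative decay
    reduces the sums to finitely many modes up to an error [eps], and continuous
    induction keeps the norm below [mu]. *)
Lemma propagate : forall T g al lam mu N s0 s1 Bd Y0 (phi : Z -> R) (b v b' v' : Z -> R -> C) (q : Z -> R -> R),
  0 < T -> 0 <= g -> 0 < al -> 2 * al <= lam -> s0 < s1 -> 0 <= Bd -> 0 <= N -> 0 <= Y0 ->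
  (forall k, phi k <= N + s0 * zabs k) -> propagating (fun _ => cderiv) T g al lam mu s1 Bd phi b v b' v' q ->
  bnd (fun k => pw phi lam k 0 * (al * Cmod (b k 0) + Cmod (v k 0))) Y0 ->
  Y0 * exp (g / al * T) < mu ->
  forall t, time_interval T t ->
    bnd (fun k => pw phi lam k t * (al * Cmod (b k t) + Cmod (v k t))) (Y0 * exp (g / al * T)).
Proof.
  intros T g al lam mu N s0 s1 Bd Y0 phi b v b' v' q HT Hg Hal Hlam Hs HBd HN HY0 Hphi (Hder & Hb' & Hv' & Hdec & HNL) H0 Hmu.
  set (E := exp (g / al * T)) in *. assert (HE : 0 < E) by apply exp_pos.
  set (e := fun k t => pw phi lam k t * (al * Cmod (b k t) + Cmod (v k t))).
  assert (He0 : forall k t, 0 <= e k t).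
  { intros k t. unfold e. apply Rmult_le_pos; [epos|].
    pose proof (Cmod_ge_0 (b k t)). pose proof (Cmod_ge_0 (v k t)). nra. }
  set (c := (s1 - s0) / 2).
  assert (Hc : 0 < c) by (unfold c; lra).
  set (maj := fun k => (1 + / c) * (exp N * ((al + 1) * Bd)) * exp (- c * zabs k)).
  assert (Hmaj : forall k t, time_interval T t -> e k t <= maj k /\ zabs k * e k t <= maj k).
  { intros k t Ht.
    pose proof (IZR_abs_pos k) as Hk.
    assert (A1 : e k t <= exp N * ((al + 1) * Bd) * exp (- (2 * c) * zabs k)).
    { unfold e. destruct (Hdec k t Ht) as [D1 D2].
      apply Rle_trans with (exp (N + s0 * zabs k) * ((al + 1) * Bd * exp (- s1 * zabs k))).
      - apply Rmult_le_compat; [epos| | |].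
        + pose proof (Cmod_ge_0 (b k t)). pose proof (Cmod_ge_0 (v k t)). nra.
        + apply exp_mono. specialize (Hphi k). destruct Ht.
          assert (0 <= lam * zabs k * t) by (repeat pos). lra.
        + assert (al * Cmod (b k t) <= al * (Bd * exp (- s1 * zabs k))) by (apply Rmult_le_compat_l; lra).
          lra.
      - right. rewrite exp_plus. unfold c. replace (- (2 * ((s1 - s0) / 2)) * zabs k) with
          (s0 * zabs k + - s1 * zabs k) by field. rewrite exp_plus. ring. }
    set (Q := exp N * ((al + 1) * Bd)) in *.
    assert (HQ : 0 <= Q) by (unfold Q; pos).
    assert (X1 : exp (- (2 * c) * zabs k) <= exp (- c * zabs k)) by (apply exp_mono; nra).
    assert (X2 : zabs k * exp (- (2 * c) * zabs k) <= / c * exp (- c * zabs k)).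
    { pose proof (x_exp c (zabs k) Hc) as X.
      replace (exp (- (2 * c) * zabs k)) with (exp (- c * zabs k) * exp (- c * zabs k))
        by (rewrite <- exp_plus; f_equal; ring).
      assert (X3 : exp (c * zabs k) * exp (- c * zabs k) = 1) by (rewrite <- exp_plus, <- exp_0; f_equal; ring).
      set (x := exp (- c * zabs k)) in *.
      apply Rle_trans with (/ c * exp (c * zabs k) * (x * x)); [apply Rmult_le_compat_r; nra|].
      right. transitivity (/ c * (exp (c * zabs k) * x) * x); [ring|]. rewrite X3. ring. }
    pose proof (Rinv_0_lt_compat c Hc) as Hic. pose proof (exp_pos (- c * zabs k)) as Hx.
    unfold maj. fold Q. split.
    - eapply Rle_trans; [exact A1|]. apply Rle_trans with (Q * exp (- c * zabs k)); [now apply Rmult_le_compat_l|].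
      assert (0 <= Q * exp (- c * zabs k)) by (pos). nra.
    - apply Rle_trans with (Q * (zabs k * exp (- (2 * c) * zabs k))).
      + rewrite (Rmult_comm (IZR _)). replace (Q * (zabs k * exp (- (2 * c) * zabs k))) with
          (Q * exp (- (2 * c) * zabs k) * zabs k) by ring. apply Rmult_le_compat_r; auto.
      + apply Rle_trans with (Q * (/ c * exp (- c * zabs k))); [now apply Rmult_le_compat_l|].
        nra. }
  assert (Hmajb : exists M, bnd maj M).
  { eexists. apply bnd_decay; [|exact Hc]. pose proof (Rinv_0_lt_compat c Hc).
    apply Rmult_le_pos; [lra|]. pos. }
  destruct Hmajb as [M HM].
  assert (Hmaj0 : forall k, 0 <= maj k).
  { intros k. specialize (Hmaj k 0 ltac:(split; lra)). specialize (He0 k 0). lra. }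
  (* Only the modes [|k| <= K] are differentiated; the others sum to at most [eps]. *)
  assert (main : forall eps, 0 < eps -> (Y0 + lam / 2 * eps * T) * E < mu - eps ->
     forall t, time_interval T t -> bnd (fun k => e k t) ((Y0 + lam / 2 * eps * T) * E + eps)).
  { intros eps Heps Hsm.
    destruct (bnd_tail _ _ HM eps Heps) as [K HK].
    assert (HK1 : forall t, time_interval T t -> forall S, lsum (win K) (fun k => e k t) <= S -> bnd (fun k => e k t) (S + eps)).
    { intros t Ht S HS. apply (bnd_win_tail K); auto. intros l Hl Hd.
      eapply Rle_trans; [apply lsum_le; intros k _; apply (Hmaj k t Ht)|]. now apply HK. }
    assert (HK2 : forall t, time_interval T t ->
       bnd (fun k => zabs k * e k t) (lsum (win K) (fun k => zabs k * e k t) + eps)).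
    { intros t Ht. apply (bnd_win_tail K); [|lra|].
      - intros k. apply Rmult_le_pos; auto. apply IZR_abs_pos.
      - intros l Hl Hd. eapply Rle_trans; [apply lsum_le; intros k _; apply (Hmaj k t Ht)|]. now apply HK. }
    set (f := fun t => lsum (win K) (fun k => e k t)).
    assert (Hf0 : f 0 <= Y0) by (apply H0, win_NoDup).
    assert (Hstep : forall t, time_interval T t -> (forall s, 0 <= s <= t -> f s <= mu - eps) ->
       f t <= (Y0 + lam / 2 * eps * T) * E).
    { intros t Ht Hsmall.
      pose proof (gronwall (win K) t (g / al) (lam / 2 * eps) (pw phi lam)
        (fun k s => - (lam * zabs k) * pw phi lam k s) b v b' v' al) as Gr.
      assert (Hga : 0 <= g / al) by (apply Rdiv_le_0_compat; lra).
      assert (Hti : forall s, time_interval t s -> time_interval T s) by (intros s [? ?]; destruct Ht; split; lra).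
      eapply Rle_trans; [apply Gr|].
      - auto.
      - nra.
      - lra.
      - intros k s Hss. pose proof (exp_pos (phi k - lam * zabs k * s)) as Hx. pose proof (IZR_abs_pos k).
        unfold pw. split; [lra|split].
        + assert (0 <= lam * zabs k) by nra. nra.
        + apply exp_derive_lin.
      - intros k s Hss. apply Hder. auto.
      - intros s Hss. pose proof (Hti s Hss) as HsT.
        set (PD := lsum (win K) (fun k => zabs k * e k s)).
        assert (Hq : bnd (fun k => zabs k * (pw phi lam k s * q k s)) (lam / 2 * (PD + eps))).
        { apply HNL; auto.
          - replace mu with (mu - eps + eps) by ring. apply HK1; auto. apply Hsmall. destruct Hss; lra.
          - now apply HK2. }
        specialize (Hq (win K) (win_NoDup K)).
        apply Rle_trans with (lsum (win K) (fun k => (- (lam / 2)) * (zabs k * e k s) + (g / al) * e k s +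
            zabs k * (pw phi lam k s * q k s))).
        + apply lsum_le. intros k _. unfold e.
          pose proof (Hb' k s HsT) as B1. pose proof (Hv' k s HsT) as B2. pose proof (IZR_abs_pos k) as Hk.
          pose proof (exp_pos (phi k - lam * zabs k * s)) as Hx. fold (pw phi lam k s) in Hx.
          pose proof (Cmod_ge_0 (b k s)) as C1. pose proof (Cmod_ge_0 (v k s)) as C2.
          set (x := pw phi lam k s) in *. set (bb := Cmod (b k s)) in *. set (vv := Cmod (v k s)) in *.
          set (kk := zabs k) in *. set (bp := Cmod (b' k s)) in *. set (vp := Cmod (v' k s)) in *.
          assert (B3 : al * bp <= lam / 2 * (kk * vv)).
          { apply Rle_trans with (al * (kk * vv)); [apply Rmult_le_compat_l; lra|]. apply Rmult_le_compat_r; [nra|lra]. }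
          assert (B4 : g * bb <= g / al * (al * bb + vv)).
          { replace (g / al * (al * bb + vv)) with (g * bb + g / al * vv) by (field; lra).
            assert (0 <= g / al * vv) by (apply Rmult_le_pos; auto). lra. }
          assert (B5 : al * bp + vp <= lam / 2 * (kk * vv) + g / al * (al * bb + vv) + kk * q k s) by lra.
          assert (B7 : 0 <= lam / 2 * (x * (kk * (al * bb)))) by (repeat pos).
          nra.
        + change (fun k => pw phi lam k s * (al * Cmod (b k s) + Cmod (v k s))) with (fun k => e k s).
          rewrite !lsum_plus, !lsum_scal. fold PD. lra.
      - split; destruct Ht; lra.
      - destruct Ht as [Ht1 Ht2].
        apply Rmult_le_compat; [| epos| |].
        + apply Rplus_le_le_0_compat; [apply lsum_nonneg; intros; apply He0|]. pos.
        + apply Rplus_le_compat; [exact Hf0|]. apply Rmult_le_compat_l; [nra|lra].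
        + apply exp_mono. apply Rmult_le_compat_l; auto. }
    assert (Hlt : forall t, time_interval T t -> f t < mu - eps).
    { apply (cont_induction f T (mu - eps)); [lra| | |].
      - intros t Ht e1 He1.
        assert (Hcont : continuous f t).
        { unfold f.
          assert (Hk : forall k, continuous (fun s => e k s) t).
          { intros k. destruct (Hder k t Ht) as [[D1 D2] [D3 D4]]. unfold e.
            apply @continuous_mult.
            - unfold pw. eapply continuous_of_derivable. apply exp_derive_lin.
            - apply @continuous_plus; [apply @continuous_mult; [apply continuous_const|]|];
                eapply continuous_Cmod; split; eassumption. }
          generalize (win K). induction l as [|x l IH]; simpl; [apply continuous_const|].
          apply @continuous_plus; auto. }
        apply continuity_pt_filterlim in Hcont. destruct (Hcont e1 He1) as (d & Hd & D).
        exists d. split; auto. intros s _ Hst. destruct (Req_dec s t) as [->|Hne].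
        + unfold Rminus. rewrite Rplus_opp_r, Rabs_R0. lra.
        + left. apply (D s). split; [split; [exact I|auto]|exact Hst].
      - assert (0 <= lam / 2 * eps * T) by (repeat pos).
        assert (1 <= E) by (rewrite <- exp_0; apply exp_mono; pos).
        nra.
      - intros t Ht Hsm2. specialize (Hstep t Ht Hsm2). lra. }
    intros t Ht. apply HK1; auto. apply Hstep; auto. intros s [Hs1 Hs2]. left. apply Hlt. destruct Ht; split; lra. }
  intros t Ht l Hl. apply Rnot_lt_le. intros Hlt.
  set (gap := Rmin (lsum l (fun k => pw phi lam k t * (al * Cmod (b k t) + Cmod (v k t))) - Y0 * E) (mu - Y0 * E)).
  assert (Hgap : 0 < gap) by (apply Rmin_glb_lt; lra).
  set (eps := gap / (2 * (lam / 2 * T * E + 1))).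
  assert (HLT : 0 <= lam / 2 * T * E) by (repeat pos).
  assert (Heps : 0 < eps) by (apply Rdiv_lt_0_compat; lra).
  assert (Heq : (Y0 + lam / 2 * eps * T) * E + eps = Y0 * E + gap / 2) by (unfold eps; field; lra).
  pose proof (Rmin_l (lsum l (fun k => pw phi lam k t * (al * Cmod (b k t) + Cmod (v k t))) - Y0 * E) (mu - Y0 * E)) as G1.
  pose proof (Rmin_r (lsum l (fun k => pw phi lam k t * (al * Cmod (b k t) + Cmod (v k t))) - Y0 * E) (mu - Y0 * E)) as G2.
  fold gap in G1, G2.
  specialize (main eps Heps ltac:(lra) t Ht l Hl). unfold e in main. lra.
Qed.

Lemma ctder_extend_fam : forall T (f f' : Z -> R -> C), 0 < T ->
  (forall k t, time_interval T t -> ctder T (f k) t (f' k t)) ->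
  exists F : Z -> R -> C, (forall k t, time_interval T t -> F k t = f k t) /\
    (forall k t, time_interval T t -> cderiv (F k) t (f' k t)).
Proof.
  intros T f f' HT H.
  assert (X : forall k, exists F, (forall t, time_interval T t -> F t = f k t) /\ (forall t, time_interval T t -> cderiv F t (f' k t)))
    by (intros k; apply ctder_extend; auto).
  exists (fun k => proj1_sig (constructive_indefinite_description _ (X k))).
  split; intros k; destruct (constructive_indefinite_description _ (X k)) as (F & A & B); simpl; auto.
Qed.

(** Slope [2] on the low modes, slope [s] at infinity. *)
Definition phiN (s N : R) (k : Z) : R := Rmin (2 * zabs k) (N + s * zabs k).

(** The a priori decay only allows weights of slope [s0 < s1] at infinity; taking
    the truncation [N] large, depending on the mode, recovers the decay of the initial
    data, up to the loss [2 al T <= 1 / 10]. *)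
Lemma propagate_decay : forall T g al mu s0 s1 Bd Y0 (b v b' v' : Z -> R -> C) (q : Z -> R -> R),
  0 < T -> 0 <= g -> 0 < al -> 2 * al * T <= 1 / 10 -> 0 <= s0 < s1 -> 0 <= Bd -> 0 <= Y0 ->
  (forall N, 0 <= N -> propagating ctder T g al (2 * al) mu s1 Bd (phiN s0 N) b v b' v' q) ->
  bnd (fun k => exp (2 * zabs k) * (al * Cmod (b k 0) + Cmod (v k 0))) Y0 ->
  Y0 * exp (g / al * T) < mu ->
  forall t k, time_interval T t ->
    al * Cmod (b k t) + Cmod (v k t) <= Y0 * exp (g / al * T) * exp (- (19 / 10) * zabs k).
Proof.
  intros T g al mu s0 s1 Bd Y0 b v b' v' q HT Hg Hal HalT Hs HBd HY Hp H0 Hmu t k Ht.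
  (* With this [N] the weight of the mode [k] is not truncated. *)
  pose proof (IZR_abs_pos k) as Hk. set (N := 2 * zabs k). assert (HN : 0 <= N) by (unfold N; lra).
  assert (I0 : time_interval T 0) by (split; lra).
  assert (Hpos : forall k t, 0 <= al * Cmod (b k t) + Cmod (v k t)).
  { intros j s. pose proof (Cmod_ge_0 (b j s)). pose proof (Cmod_ge_0 (v j s)). nra. }
  destruct (Hp N HN) as (Hd & Hb' & Hv' & Hdec & HNL).
  destruct (ctder_extend_fam T b b' HT (fun k t Ht => proj1 (Hd k t Ht))) as (Fb & Eb & Db).
  destruct (ctder_extend_fam T v v' HT (fun k t Ht => proj2 (Hd k t Ht))) as (Fv & Ev & Dv).
  pose proof (fun Hphi Hpr Hin => bnd_term _ _ k (propagate T g al (2 * al) mu N s0 s1 Bd Y0 (phiN s0 N) Fb Fv b' v' q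
    HT Hg Hal (Rle_refl _) (proj2 Hs) HBd HN HY Hphi Hpr Hin Hmu t Ht)) as X.
  cbv beta in X. rewrite Eb, Ev in X by auto. specialize (Hpos k t). set (y := al * Cmod (b k t) + Cmod (v k t)) in *.
  assert (Hpw : exp (19 / 10 * zabs k) <= pw (phiN s0 N) (2 * al) k t).
  { unfold pw, phiN. destruct Ht. rewrite Rmin_left by (unfold N; nra).
    assert (2 * al * t <= 1 / 10) by nra. apply exp_mono. nra. }
  apply Rmult_le_reg_l with (exp (19 / 10 * zabs k)); [apply exp_pos|].
  eapply Rle_trans; [apply Rmult_le_compat_r; [exact Hpos|exact Hpw]|]. eapply Rle_trans; [apply X|].
  - intros j. apply Rmin_r.
  - split; [|split; [|split; [|split]]].
    + intros j r Hr. split; auto.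
    + intros j r Hr. rewrite Ev; auto.
    + intros j r Hr. rewrite Eb; auto.
    + intros j r Hr. rewrite Eb, Ev; auto.
    + intros s Hs' Hm D HD. apply HNL; auto.
      * eapply bnd_ext; [exact Hm|]. intros j. cbv beta. now rewrite Eb, Ev.
      * eapply bnd_ext; [exact HD|]. intros j. cbv beta. now rewrite Eb, Ev.
  - eapply bnd_mono; [exact H0|]. intros j. cbv beta. rewrite Eb, Ev by auto. apply Rmult_le_compat_r.
    + pose proof (Cmod_ge_0 (b j 0)). pose proof (Cmod_ge_0 (v j 0)). nra.
    + unfold pw, phiN. rewrite Rmult_0_r, Rminus_0_r. apply exp_mono, Rmin_l.
  - right. transitivity (Y0 * exp (g / al * T) * exp (19 / 10 * zabs k + - (19 / 10) * zabs k)); [|rewrite exp_plus; ring].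
    replace (19 / 10 * zabs k + - (19 / 10) * zabs k) with 0 by ring. rewrite exp_0. ring.
Qed.


(** * The water waves system at a fixed time *)

Definition mom (h : R -> R) (P : R -> C) (k : Z) : C :=
  (RtoC (/ (2 * PI)) * cint (fun x => P x * Ek h k x)%C)%C.

Lemma mom_ext : forall h P Q k, (forall x, P x = Q x) -> mom h P k = mom h Q k.
Proof. intros. unfold mom. f_equal. apply cint_ext. intros; now rewrite H. Qed.

Lemma mom_cft : forall h P k, mom h P k = cft (fun x => P x * RtoC (exp (IZR k * h x)))%C k.
Proof. intros. apply (proj1 (Ek_cft h h P k)). Qed.

Lemma mom_plus : forall h h1 P Q k, curve h h1 -> ccont P -> ccont Q ->
  mom h (fun x => P x + Q x)%C k = (mom h P k + mom h Q k)%C.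
Proof.
  intros. unfold mom.
  rewrite (cint_ext _ (fun x => P x * Ek h k x + Q x * Ek h k x)%C) by (intros; ring).
  rewrite cint_plus by cc. ring.
Qed.

Lemma mom_scal : forall h h1 c P k, curve h h1 -> ccont P -> mom h (fun x => c * P x)%C k = (c * mom h P k)%C.
Proof.
  intros. unfold mom.
  rewrite (cint_ext _ (fun x => c * (P x * Ek h k x))%C) by (intros; ring).
  rewrite cint_scal by cc. ring.
Qed.

Lemma mom_gp : forall h h1 k, curve h h1 -> mom h (gp h1) k = if Z.eqb k 0 then RtoC 1 else RtoC 0.
Proof.
  intros h h1 k H. unfold mom. rewrite (cint_gp_Ek h h1) by auto. pose proof PI_RGT_0.
  destruct Z.eqb; [|ring]. rewrite <- RtoC_mult. f_equal. field. lra.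
Qed.

Lemma mom_sup : forall h h1 P k M d, curve h h1 -> ccont P -> (forall x, Cmod (P x) <= M) -> (forall x, Rabs (h x) <= d) ->
  Cmod (mom h P k) <= M * exp (d * zabs k).
Proof.
  intros h h1 P k M d H HP HM Hd. unfold mom. pose proof PI_RGT_0.
  rewrite Cmod_mult, Cmod_R, Rabs_pos_eq by (pos).
  apply Rmult_le_reg_l with (2 * PI); [lra|]. rewrite <- Rmult_assoc, Rinv_r, Rmult_1_l by lra.
  apply cint_bound; [cc|]. intros x. rewrite Cmod_mult, (Rmult_comm d).
  apply Rmult_le_compat; auto using Cmod_ge_0. apply Cmod_Ek_le. auto.
Qed.

Lemma mom_bound : forall rho h d P A k, 0 <= rho -> W rho (rc h) d -> W rho P A ->
  Cmod (mom h P k) <= A * exp (- (rho - d) * zabs k).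
Proof. intros. apply (cint_Ek_bound rho h d); auto. Qed.

Lemma ccont_div_gp : forall h h1 F, curve h h1 -> ccont F -> ccont (fun x => F x / gp h1 x)%C.
Proof.
  intros h h1 F Hc HF.
  apply (ccont_ext (fun x => F x * (Cconj (gp h1 x) * RtoC (/ (1 + h1 x ^ 2))))%C).
  - intros x. unfold gp. apply C_eq; simpl; field; nra.
  - apply ccont_mult; auto. apply ccont_mult; [cc|]. apply ccont_RtoC. intros x.
    destruct Hc as (_ & C1 & _).
    apply (continuous_comp h1 (fun y => / (1 + y ^ 2))); auto.
    eapply continuous_of_derivable. auto_derive; [nra|reflexivity].
Qed.

Lemma gp_neq_0 : forall h1 x, gp h1 x <> RtoC 0.
Proof. intros h1 x E. apply (f_equal fst) in E. simpl in E. lra. Qed.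

(** The expansion on the curve of [P / gamma']. *)
Lemma mom_expand : forall d h h1 P r A, small d h h1 -> d <= 1 / 10 -> ccont P -> cper P -> d < r -> 0 <= A ->
  (forall k, Cmod (mom h P k) <= A * exp (- r * zabs k)) ->
  forall x, P x = Zser (fun j => mom h P j * (gp h1 x * RtoC (exp (IZR (- j) * h x))) * cis (IZR j * x))%C.
Proof.
  intros d h h1 P r A Hs Hd HP HPp Hr HA Hdec x. destruct (small_sup _ _ _ Hs) as [S0 S1]. pose proof Hs as (Hc & _ & _).
  assert (Hcf : forall k, ccf h h1 (fun x => P x / gp h1 x)%C k = mom h P k).
  { intros k. unfold ccf, mom. f_equal. apply cint_ext. intros y. f_equal. field. apply gp_neq_0. }
  pose proof (ccf_expand h h1 (fun x => P x / gp h1 x)%C d r A Hc) as E.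
  assert (E' : forall x, (P x / gp h1 x)%C = Zser (fun k => ccf h h1 (fun x => P x / gp h1 x)%C k * Ek h (- k) x)%C).
  { apply E; auto.
    - intros y. specialize (S1 y). lra.
    - now apply (ccont_div_gp h).
    - intros y. now rewrite HPp, (cper_gp h h1 Hc y).
    - intros k. now rewrite Hcf. }
  replace (P x) with (gp h1 x * (P x / gp h1 x))%C at 1 by (field; apply gp_neq_0).
  rewrite E'. symmetry. apply zlim_Zser_eq.
  eapply zlim_ext; [|apply zlim_scal, summable_zlim].
  - intros j. cbv beta. rewrite Hcf. unfold Ek. rewrite opp_IZR, !Ropp_mult_distr_l_reverse, Ropp_involutive. ring.
  - eapply summable_bnd; [apply (bnd_decay A (r - d) HA); lra|]. intros j. apply ccf_majorant; auto.
    now rewrite Hcf.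
Qed.

(** As for [ccf_mult]. *)
Lemma mom_mult : forall d h h1 b P r A, small d h h1 -> d <= 1 / 10 -> ccont P -> cper P -> ccont b -> cper b ->
  d < r -> 0 <= A -> (forall k, Cmod (ccf h h1 b k) <= A * exp (- r * zabs k)) ->
  forall k, mom h (fun x => b x * P x)%C k = conv (ccf h h1 b) (mom h P) k.
Proof.
  intros d h h1 b P r A Hs Hd HP HPp Hb Hbp Hr HA Hdec k. destruct (small_sup _ _ _ Hs) as [S0 S1]. pose proof Hs as (Hc & _ & _).
  assert (Hm : forall j, mom h P j = ccf h h1 (fun x => P x / gp h1 x)%C j).
  { intros j. unfold ccf, mom. f_equal. apply cint_ext. intros y. f_equal. field. apply gp_neq_0. }
  transitivity (conv (ccf h h1 b) (ccf h h1 (fun x => P x / gp h1 x)%C) k).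
  - rewrite <- (ccf_mult h h1 (fun x => P x / gp h1 x)%C b d r A); auto.
    + unfold mom, ccf. f_equal. apply cint_ext. intros y. f_equal. field. apply gp_neq_0.
    + intros y. specialize (S1 y). lra.
    + now apply (ccont_div_gp h).
    + intros y. now rewrite HPp, (cper_gp h h1 Hc y).
  - apply Zser_ext. intros j. now rewrite <- Hm.
Qed.

(** Control of the positive modes of a sum of modulated exponentials.  For
    [j <= 0] the factor [P j] must supply the jump to a positive mode, so only
    its distance to one matters, and [c j] is needed in a weak norm only. *)
Lemma recover : forall rho (c : Z -> C) (P : Z -> R -> C) (pi : Z -> R) maj M S F, 0 <= rho ->
  (forall j, W rho (fun x => P j x - 1)%C (pi j)) -> bnd maj M -> (forall j x, Cmod (c j * P j x)%C <= maj j) ->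
  (forall x, F x = Zser (fun j => c j * P j x * cis (IZR j * x))%C) ->
  bnd (fun j => if Z.ltb 0 j then Cmod (c j) * exp (rho * IZR j) * (1 + pi j) else Cmod (c j) * exp (rho * IZR j) * pi j) S ->
  bnd (fun k => if Z.ltb 0 k then exp (rho * IZR k) * Cmod (cft F k) else 0) S.
Proof.
  intros rho c P pi maj M S F Hr HP HM Hmaj HF HS l Hl.
  assert (HPc : forall j, ccont (P j)).
  { intros j. apply (ccont_ext (fun x => (P j x - 1) + 1)%C); [intros; ring|].
    apply ccont_plus; [apply (HP j)|apply ccont_const]. }
  assert (HP1 : forall j, W rho (P j) (1 + pi j)).
  { intros j. apply (W_ext _ (fun x => 1 + (P j x - 1))%C); [intros; ring|].
    replace (1 + pi j) with (Cmod (RtoC 1) + pi j) by (rewrite Cmod_1; ring). apply W_plus; [apply W_const|auto]. }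
  assert (Z0 : forall k, zlim (fun j => c j * cft (P j) (k - j))%C (cft F k)).
  { intros k. rewrite (cft_ext F (fun x => Zser (fun j => c j * P j x * cis (IZR j * x))%C)) by auto.
    eapply zlim_ext; [|apply (cft_Zser (fun j x => c j * P j x * cis (IZR j * x))%C maj M)]; auto.
    - intros j. cbv beta. rewrite cft_shift, cft_scal by auto. reflexivity.
    - intros j x. rewrite Cmod_mult, Cmod_cis, Rmult_1_r. auto.
    - intros; cc. }
  assert (Hfin : forall N, lsum l (fun k => if Z.ltb 0 k then exp (rho * IZR k) * Cmod (csum (win N) (fun j => c j * cft (P j) (k - j))%C) else 0) <= S).
  { intros N. eapply Rle_trans; [|apply (HS (win N) (win_NoDup N))].
    apply Rle_trans with (lsum l (fun k => lsum (win N) (fun j => if Z.ltb 0 k then exp (rho * IZR k) * (Cmod (c j) * Cmod (cft (P j) (k - j))) else 0))).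
    { apply lsum_le. intros k _. destruct (Z.ltb 0 k).
      - rewrite lsum_scal. apply Rmult_le_compat_l; [epos|].
        eapply Rle_trans; [apply csum_Cmod|]. apply lsum_le. intros j _. rewrite Cmod_mult. lra.
      - apply lsum_nonneg. intros; lra. }
    rewrite lsum_swap. apply lsum_le. intros j _.
    assert (Hmul : forall B (Q : R -> C), W rho Q B ->
      (forall k, (0 < k)%Z -> (k - j <> 0)%Z \/ Q = P j -> cft (P j) (k - j) = cft Q (k - j)) -> (Q = P j \/ (j <= 0)%Z) ->
      lsum l (fun k => if Z.ltb 0 k then exp (rho * IZR k) * (Cmod (c j) * Cmod (cft (P j) (k - j))) else 0) <= Cmod (c j) * exp (rho * IZR j) * B).
    { intros B Q HQ HE Hor.
      eapply Rle_trans; [|apply Rmult_le_compat_l; [|apply (bnd_shift _ _ j (proj2 (proj2 HQ)) l Hl)]].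
      - rewrite <- lsum_scal. apply lsum_le. intros k _. destruct (Z.ltb_spec 0 k).
        + assert (Hkj : (k - j <> 0)%Z \/ Q = P j) by (destruct Hor; [now right|left; lia]).
          rewrite (HE k) by assumption.
          pose proof (Cmod_ge_0 (c j)) as C1. pose proof (Cmod_ge_0 (cft Q (k - j))) as C2.
          apply Rle_trans with (exp (rho * IZR j + rho * zabs (k - j)) * (Cmod (c j) * Cmod (cft Q (k - j)))).
          * apply Rmult_le_compat_r; [apply Rmult_le_pos; auto|]. apply exp_mono. rewrite <- Rmult_plus_distr_l, <- plus_IZR.
            apply Rmult_le_compat_l; auto. apply IZR_le; lia.
          * rewrite exp_plus. right. ring.
        + repeat apply Rmult_le_pos; try apply Cmod_ge_0; epos.
      - pos. }
    destruct (Z.ltb_spec 0 j).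
    - apply (Hmul _ (P j)); auto.
    - apply (Hmul _ (fun x => P j x - 1)%C); auto. intros k Hk [Hkj|E].
      + symmetry. now apply cft_const_1.
      + now rewrite E. }
  apply Rnot_lt_le. intros Hlt.
  set (X := lsum l (fun k => if Z.ltb 0 k then exp (rho * IZR k) * Cmod (cft F k) else 0)) in *.
  set (E := lsum l (fun k => exp (rho * IZR k))).
  assert (HE : 0 <= E) by (apply lsum_nonneg; intros; epos).
  set (e := (X - S) / (2 * (E + 1))). assert (He : 0 < e) by (apply Rdiv_lt_0_compat; lra).
  destruct (zlim_list (fun k j => c j * cft (P j) (k - j))%C (cft F) l Z0 e He) as [N HN].
  assert (X <= lsum l (fun k => (if Z.ltb 0 k then exp (rho * IZR k) * Cmod (csum (win N) (fun j => c j * cft (P j) (k - j))%C) else 0) + e * exp (rho * IZR k))).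
  { apply lsum_le. intros k Hk. specialize (HN k Hk). pose proof (exp_pos (rho * IZR k)).
    destruct (Z.ltb 0 k); [|nra].
    pose proof (Cmod_le_sub (cft F k) (csum (win N) (fun j => c j * cft (P j) (k - j))%C)) as Q.
    rewrite Cmod_minus_sym in Q. nra. }
  rewrite lsum_plus, lsum_scal in H. fold E in H. specialize (Hfin N).
  assert (e * E <= (X - S) / 2).
  { unfold e. apply Rmult_le_reg_r with (2 * (E + 1)); [lra|]. field_simplify; [|lra]. nra. }
  lra.
Qed.

Lemma bnd_pos_split : forall (a : Z -> R) A0 Ap An, 0 <= A0 -> a 0%Z <= A0 ->
  bnd (fun k => if Z.ltb 0 k then a k else 0) Ap -> bnd (fun k => if Z.ltb k 0 then a k else 0) An ->
  bnd a (A0 + Ap + An).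
Proof.
  intros a A0 Ap An HA0 Ha0 Hp Hn.
  assert (H0 : bnd (fun k => if Z.eqb k 0 then A0 else 0) A0).
  { intros l Hl. assert (Hz : forall m, ~ In 0%Z m -> lsum m (fun k => if Z.eqb k 0 then A0 else 0) = 0).
    { induction m as [|x m IH]; intros Hm; simpl; [reflexivity|].
      destruct (Z.eqb_spec x 0) as [->|]; [exfalso; apply Hm; now left|].
      rewrite IH; [ring|]. intros Hi; apply Hm; now right. }
    induction Hl as [|x l Hx Hl IH]; simpl; [lra|].
    destruct (Z.eqb_spec x 0) as [->|]; [rewrite Hz by auto; lra|lra]. }
  eapply bnd_mono; [apply (bnd_plus _ _ _ _ (bnd_plus _ _ _ _ H0 Hp) Hn)|]. intros k. cbv beta.
  destruct (Z.eqb_spec k 0) as [->|]; [simpl; lra|].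
  destruct (Z.ltb_spec 0 k); destruct (Z.ltb_spec k 0); lra || lia.
Qed.

Lemma sum_upper : forall (a : Z -> R) A r, 0 <= A -> 0 < r ->
  (forall k, (k <= 0)%Z -> a k = 0) -> (forall k, (0 < k)%Z -> a k <= A * exp (- r * IZR k)) -> bnd a (A * (2 / r)).
Proof.
  intros a A r HA Hr H0 H.
  assert (Hb : bnd (fun k => a (- k)%Z) (A * (2 / r))).
  { apply sum_lower; auto.
    - intros k Hk. apply H0. lia.
    - intros k Hk. eapply Rle_trans; [apply H; lia|]. rewrite opp_IZR. right. do 2 f_equal. ring. }
  eapply bnd_ext; [apply (bnd_reindex _ _ Z.opp ltac:(intros; lia) Hb)|].
  intros k. cbv beta. now rewrite Z.opp_involutive.
Qed.

(** The negative modes of [F] are conjugates of positive modes of [conj F]. *)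
Lemma W_pos_neg : forall rho F A0 Ap An, ccont F -> cper F -> 0 <= A0 -> Cmod (cft F 0) <= A0 ->
  bnd (fun k => if Z.ltb 0 k then exp (rho * IZR k) * Cmod (cft F k) else 0) Ap ->
  bnd (fun k => if Z.ltb 0 k then exp (rho * IZR k) * Cmod (cft (fun x => Cconj (F x)) k) else 0) An ->
  W rho F (A0 + Ap + An).
Proof.
  intros rho F A0 Ap An HF HFp HA0 H0 Hp Hn. apply W_of_bnd; auto. apply bnd_pos_split; auto.
  - simpl. rewrite Rmult_0_r, exp_0. lra.
  - eapply bnd_ext; [exact Hp|]. intros k. cbv beta. destruct (Z.ltb_spec 0 k); auto. rewrite Z.abs_eq by lia. reflexivity.
  - eapply bnd_ext; [apply (bnd_reindex _ _ Z.opp ltac:(intros; lia) Hn)|]. intros k. cbv beta.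
    destruct (Z.ltb_spec 0 (- k)); destruct (Z.ltb_spec k 0); try lia; auto.
    rewrite cft_conj, Cmod_conj, Z.opp_involutive, Z.abs_neq by (auto; lia). reflexivity.
Qed.

(** [sigma k]: the coefficients of [S' - 1], where [S] is the Schwarz function of the curve. *)
Definition sig (h : R -> R) (k : Z) : C := if Z.eqb k 0 then RtoC 0 else (RtoC 2 * mom h (fun _ => RtoC 1) k)%C.

(** As [conj gamma' + gamma' = 2] and the moments of [gamma'] are known, those of
    [conj gamma'] reduce to those of [1]. *)
Lemma mom_conj_gp : forall h h1 k, curve h h1 ->
  mom h (fun x => Cconj (gp h1 x)) k = ((if Z.eqb k 0 then RtoC 1 else RtoC 0) + sig h k)%C.
Proof.
  intros h h1 k H.
  rewrite (mom_ext h _ (fun x => RtoC 2 * 1 + RtoC (-1) * gp h1 x)%C) by (intros; unfold gp; apply C_eq; simpl; ring).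
  rewrite (mom_plus h h1) by cc. rewrite (mom_scal h h1 _ (fun _ => RtoC 1)), (mom_scal h h1) by cc.
  rewrite (mom_gp h h1) by auto. unfold sig. destruct (Z.eqb_spec k 0) as [->|].
  - assert (E : mom h (fun _ => RtoC 1) 0 = RtoC 1).
    { rewrite mom_cft. rewrite (cft_ext _ (fun _ => RtoC 1)).
      - rewrite cft_const. reflexivity.
      - intros x. rewrite Rmult_0_l, exp_0. ring. }
    rewrite E. apply C_eq; simpl; ring.
  - ring.
Qed.

(** [sigma k] is twice the [k]-th coefficient of [e^{k h} - 1]. *)
Lemma sig_bound : forall rho h a k, 0 <= rho -> W rho (rc h) a ->
  Cmod (sig h k) <= 2 * (exp (zabs k * a) - 1) * exp (- rho * zabs k).
Proof.
  intros rho h a k Hr H. unfold sig. destruct (Z.eqb_spec k 0) as [->|Hk].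
  - rewrite Cmod_0. simpl. rewrite Rmult_0_l, exp_0. lra.
  - rewrite Cmod_mult, Cmod_R, Rabs_pos_eq, Rmult_assoc by lra. apply Rmult_le_compat_l; [lra|].
    rewrite mom_cft. rewrite (cft_ext _ (fun x => RtoC (exp (IZR k * h x)))) by (intros; ring).
    rewrite <- cft_const_1; auto.
    + eapply Rle_trans; [apply W_term, W_exp; [exact Hr|exact H]|]. rewrite abs_IZR. right. do 2 f_equal. ring.
    + apply (ccont_exp h). apply H.
Qed.

(** Integration by parts.  It turns a bound on [sigma] into one on the coefficients
    of [h] on the curve, from which [h] is expanded. *)
Lemma sig_ccf : forall h h1 k, curve h h1 -> k <> 0%Z -> (RtoC (2 * IZR k) * ccf h h1 (rc h) k = sig h k)%C.
Proof.
  intros h h1 k H Hk. unfold sig. destruct (Z.eqb_spec k 0); [contradiction|].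
  unfold ccf, mom.
  assert (E : cint (fun x => RtoC (h1 x) * Ek h k x)%C =
    (- cint (fun x => rc h x * (- (Ci * RtoC (IZR k)) * gp h1 x * Ek h k x)))%C).
  { apply (cint_parts (rc h) (Ek h k) (fun x => RtoC (h1 x))).
    - intros x. split; simpl; [apply H|apply @is_derive_const].
    - intros x. now apply Ek_deriv.
    - apply ccont_RtoC. apply H.
    - cc.
    - intros x. unfold rc. destruct H as (_ & _ & -> & _). reflexivity.
    - apply (Ek_per h h1 k H). }
  assert (Ch1 : ccont (fun x => RtoC (h1 x))) by (apply ccont_RtoC; apply H).
  assert (Ch : ccont (rc h)) by (apply ccont_RtoC; eapply curve_cont; eauto).
  rewrite (cint_ext (fun x => rc h x * (- (Ci * RtoC (IZR k)) * gp h1 x * Ek h k x))%C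
    (fun x => (- (Ci * RtoC (IZR k))) * (rc h x * gp h1 x * Ek h k x))%C) in E by (intros; ring).
  rewrite cint_scal in E by cc.
  assert (E2 : cint (fun x => RtoC (h1 x) * Ek h k x)%C = (Ci * cint (fun x => RtoC 1 * Ek h k x))%C).
  { pose proof (cint_gp_Ek h h1 k H) as Hg. destruct (Z.eqb_spec k 0); [contradiction|].
    rewrite (cint_ext _ (fun x => Ci * (RtoC 1 * Ek h k x) + (- Ci) * (gp h1 x * Ek h k x))%C)
      by (intros; unfold gp; apply C_eq; simpl; ring).
    rewrite cint_plus, !cint_scal by cc. rewrite Hg. ring. }
  rewrite E2 in E. cbv beta. set (A := cint (fun x => rc h x * gp h1 x * Ek h k x)%C) in *.
  set (B := cint (fun x => RtoC 1 * Ek h k x)%C) in *. clearbody A B.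
  assert (E3 : B = (RtoC (IZR k) * A)%C).
  { transitivity (- Ci * (Ci * B))%C; [apply C_eq; unfold Re, Im; simpl; ring|]. rewrite E. apply C_eq; unfold Re, Im; simpl; ring. }
  rewrite E3, RtoC_mult. ring.
Qed.


(** ** One-sided weights *)

(** Growing weights on the positive modes, decaying ones on the negative modes:
    the negative modes are controlled by the size of the functions alone. *)
Definition wz (N m : R) (k : Z) : R :=
  if Z.ltb k 0 then exp (1 / 2 * IZR k) else exp (phiN (7 / 10) N k - m * zabs k).

Lemma wz_sub : forall N m j k, 0 <= N -> 0 <= m <= 1 / 10 -> wz N m k <= wz N m j * wz N m (k - j).
Proof.
  intros N m j k HN Hm. unfold wz, phiN.
  assert (E : IZR k = IZR j + IZR (k - j)) by (rewrite <- plus_IZR; f_equal; lia).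
  assert (R : forall i, (i < 0)%Z -> IZR i <= -1) by (intros; apply IZR_le; lia).
  assert (R' : forall i, (0 <= i)%Z -> 0 <= IZR i) by (intros; apply IZR_le; lia).
  assert (Ra : forall i, (0 <= i)%Z -> zabs i = IZR i) by (intros; f_equal; lia).
  destruct (Z.ltb_spec k 0) as [Hk|Hk]; destruct (Z.ltb_spec j 0) as [Hj|Hj]; destruct (Z.ltb_spec (k - j) 0) as [Hi|Hi];
    rewrite <- exp_plus; apply exp_mono; try lia;
    try (apply R in Hk || (rewrite (Ra k Hk) in *; apply R' in Hk));
    try (apply R in Hj || (rewrite (Ra j Hj) in *; apply R' in Hj));
    try (apply R in Hi || (rewrite (Ra _ Hi) in *; apply R' in Hi));
    rewrite E in *; set (x := IZR j) in *; set (y := IZR (k - j)) in *; clearbody x y; clear E R R' Ra;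
    unfold Rmin; repeat destruct Rle_dec; nra.
Qed.

Lemma wz_pos : forall N m k, 0 < wz N m k.
Proof. intros. unfold wz. destruct Z.ltb; apply exp_pos. Qed.

Lemma wz_le : forall N m k, 0 <= N -> 0 <= m -> wz N m k <= exp N * exp (7 / 10 * zabs k).
Proof.
  intros N m k HN Hm. unfold wz, phiN. rewrite <- exp_plus. pose proof (IZR_abs_pos k) as Hk.
  destruct (Z.ltb_spec k 0); apply exp_mono.
  - assert (IZR k <= 0) by (apply IZR_le; lia). lra.
  - pose proof (Rmin_r (2 * zabs k) (N + 7 / 10 * zabs k)). nra.
Qed.

Definition kp (k : Z) : R := IZR (Z.max k 0).

Lemma kp_pos : forall k, 0 <= kp k.
Proof. intros. apply IZR_le. lia. Qed.

Lemma kp_sub : forall j k, kp k <= kp j + kp (k - j).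
Proof. intros. unfold kp. rewrite <- plus_IZR. apply IZR_le. lia. Qed.

(** Products in a space with a submultiplicative weight [w], and the Leibniz rule
    for an additional subadditive factor [c]. *)
Lemma conv_weight : forall (w c : Z -> R) u v A B A' B', (forall k, 0 <= w k) -> (forall k, 0 <= c k) ->
  (forall j k, w k <= w j * w (k - j)%Z) -> (forall j k, c k <= c j + c (k - j)%Z) ->
  (forall k, summable (fun j => u j * v (k - j)%Z)%C) ->
  bnd (fun k => w k * Cmod (u k)) A -> bnd (fun k => w k * Cmod (v k)) B ->
  bnd (fun k => c k * w k * Cmod (u k)) A' -> bnd (fun k => c k * w k * Cmod (v k)) B' ->
  bnd (fun k => w k * Cmod (conv u v k)) (A * B) /\ bnd (fun k => c k * w k * Cmod (conv u v k)) (A' * B + A * B').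
Proof.
  intros w c u v A B A' B' Hw Hc Hsub Hcs Hs Hu Hv Hu' Hv'.
  assert (Hcw : forall k, 0 <= c k * w k) by (intros; now apply Rmult_le_pos). split.
  - replace (A * B) with (A * B + 0 * 0) by ring.
    apply (conv_bnd _ w w (fun _ => 0) (fun _ => 0)); auto; try (intros; lra).
    + intros j k. rewrite Rmult_0_l, Rplus_0_r. auto.
    + eapply bnd_ext; [apply bnd_zero|]. intros; cbv beta; ring.
    + eapply bnd_ext; [apply bnd_zero|]. intros; cbv beta; ring.
  - apply (conv_bnd _ (fun k => c k * w k) w w (fun k => c k * w k)); auto.
    intros j k. assert (0 <= w j * w (k - j)%Z) by (apply Rmult_le_pos; auto).
    apply Rle_trans with ((c j + c (k - j)%Z) * (w j * w (k - j)%Z)).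
    + apply Rmult_le_compat; auto.
    + right; ring.
Qed.

Lemma bnd_wz_decay : forall N m u A, 0 <= N -> 0 <= m -> 0 <= A ->
  (forall k, Cmod (u k) <= A * exp (- (3 / 4) * zabs k)) ->
  exists B, bnd (fun k => wz N m k * Cmod (u k)) B /\ bnd (fun k => kp k * wz N m k * Cmod (u k)) B.
Proof.
  intros N m u A HN Hm HA Hu.
  assert (Hk : forall k, kp k <= 40 * exp (1 / 40 * zabs k)).
  { intros k. apply Rle_trans with (zabs k); [apply IZR_le; lia|].
    pose proof (x_exp (1 / 40) (zabs k) ltac:(lra)). lra. }
  assert (H1 : forall k, wz N m k * Cmod (u k) <= exp N * A * exp (- (1 / 20) * zabs k)).
  { intros k. eapply Rle_trans; [apply Rmult_le_compat; [left; apply wz_pos|apply Cmod_ge_0|apply wz_le; auto|apply Hu]|].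
    right. replace (- (1 / 20) * zabs k) with (7 / 10 * zabs k + - (3 / 4) * zabs k) by field.
    rewrite exp_plus. ring. }
  assert (HNA : 0 <= exp N * A) by (pos).
  exists (40 * (exp N * A) * (1 + 2 / (1 / 40))). split.
  - eapply bnd_mono; [apply (bnd_decay (40 * (exp N * A)) (1 / 40)); lra|]. intros k. eapply Rle_trans; [apply H1|].
    pose proof (IZR_abs_pos k).
    apply Rmult_le_compat; try lra; [epos|]. apply exp_mono. lra.
  - eapply bnd_mono; [apply (bnd_decay (40 * (exp N * A)) (1 / 40)); lra|]. intros k. rewrite Rmult_assoc.
    eapply Rle_trans; [apply Rmult_le_compat; [apply kp_pos|apply Rmult_le_pos; [left; apply wz_pos|apply Cmod_ge_0]|apply Hk|apply H1]|].
    right. replace (- (1 / 40) * zabs k) with (1 / 40 * zabs k + - (1 / 20) * zabs k) by field.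
    rewrite exp_plus. ring.
Qed.

(** The state at a fixed time: the curve, the trace [f = U gamma'], the vanishing moments.
    The bounds are rough, and only their smallness is used. *)
Definition snap (d : R) (h h1 : R -> R) (f U : R -> C) (B : R) : Prop :=
  small d h h1 /\ d <= 1 / 10000 /\ W 1 (rc h) d /\ (forall x, f x = (U x * gp h1 x)%C) /\ W (4 / 5) U B /\
  (forall k, (0 <= k)%Z -> mom h f k = RtoC 0).

Definition cj (f : R -> C) (x : R) : C := Cconj (f x).

Lemma small_W : forall d h h1 rho, small d h h1 -> rho <= 19 / 20 -> W rho (rc h) d /\ W rho (rc h1) d /\ W rho (gp h1) (1 + d).
Proof.
  intros d h h1 rho (_ & H & H1) Hr.
  assert (A1 : W rho (rc h1) d) by (eapply W_mono; [exact Hr|apply Rle_refl|exact H1]).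
  split; [eapply W_mono; [exact Hr|apply Rle_refl|exact H]|split; [auto|now apply W_gp]].
Qed.

Lemma snap_W : forall d h h1 f U B, snap d h h1 f U B -> W (4 / 5) f (2 * B) /\ W (4 / 5) (cj f) (2 * B).
Proof.
  intros d h h1 f U B (Hs & Hd & _ & Hf & HU & _). pose proof (W_ge0 _ _ _ HU).
  destruct (small_W d h h1 (4 / 5) Hs ltac:(lra)) as (_ & _ & Hg).
  assert (HW : W (4 / 5) f (2 * B)).
  { apply (W_ext _ (fun x => U x * gp h1 x)%C); [intros; now rewrite Hf|].
    eapply W_mono; [apply Rle_refl| |apply W_mult; [lra|exact HU|exact Hg]]. nra. }
  split; auto. now apply W_conj.
Qed.

Lemma mom_cj_0 : forall h f, ccont f -> mom h f 0 = RtoC 0 -> cft f 0 = RtoC 0 /\ mom h (cj f) 0 = RtoC 0.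
Proof.
  intros h f Hf H. rewrite mom_cft in *.
  assert (E : forall P, cft (fun x => P x * RtoC (exp (IZR 0 * h x)))%C 0 = cft P 0).
  { intros P. apply cft_ext. intros x. rewrite Rmult_0_l, exp_0. ring. }
  rewrite E in *. split; auto. unfold cj. rewrite cft_conj by auto. simpl. rewrite H. apply C_eq; simpl; ring.
Qed.

Lemma d_le_neg : forall (l : Z) d, (0 < l)%Z -> 0 <= d ->
  exp (IZR l * d) - 1 <= d * (IZR l * exp (IZR l * d)) /\ IZR l <= exp (IZR l).
Proof.
  intros l d Hl Hd. assert (0 < IZR l) by (apply IZR_lt; lia). split.
  - eapply Rle_trans; [apply exp_m1; nra|]. right; ring.
  - pose proof (exp_ineq1_le (IZR l)). lra.
Qed.

(** The quadratic term [Q] of the evolution of [G] is the convolution of [G] with the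
    coefficients [Ut] of [conj U].  Since [conj f = conj U conj gamma'], one has
    [G = Ut + Ut * sigma], which is solved for [Ut] by absorption, both in the norm and
    with one derivative.  So [Q] loses one derivative, with a coefficient as small as
    the solution. *)
Lemma nl_est : forall d h h1 f U B N m al mu D, snap d h h1 f U B -> 0 <= N -> 0 <= m <= 1 / 10 ->
  0 < al <= 1 -> 0 <= mu -> mu + 4 * B <= al / 8 -> mu / al + 10 * d <= 1 / 2 ->
  bnd (fun k => if Z.ltb 0 k then wz N m k * (al * Cmod (sig h k) + Cmod (mom h (cj f) k)) else 0) mu ->
  bnd (fun k => if Z.ltb 0 k then kp k * wz N m k * (al * Cmod (sig h k) + Cmod (mom h (cj f) k)) else 0) D ->
  bnd (fun k => kp k * wz N m k * Cmod (mom h (fun x => cj U x * cj f x)%C k)) (al * D).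
Proof.
  intros d h h1 f U B N m al mu D Hsn HN Hm Hal Hmu Hg Hsg Hb Hb'.
  destruct (snap_W _ _ _ _ _ _ Hsn) as [Wf Wcf]. destruct Hsn as (Hs & Hd & Hh & Hf & HU & H0).
  pose proof (W_ge0 _ _ _ Hh) as Hd0. pose proof (W_ge0 _ _ _ HU) as HB. pose proof (bnd_nonneg _ _ Hb') as HD.
  pose proof Hs as (Hc & _). destruct (small_W d h h1 (4 / 5) Hs ltac:(lra)) as (Hh8 & _ & Hg8).
  assert (HcU : W (4 / 5) (cj U) B) by now apply W_conj.
  set (G := mom h (cj f)). set (S := sig h). set (Ut := ccf h h1 (cj U)).
  assert (HG : forall k, Cmod (G k) <= 2 * B * exp (- (3 / 4) * zabs k)).
  { intros k. eapply Rle_trans; [apply (mom_bound (4 / 5) h d (cj f) (2 * B)); auto; lra|].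
    pose proof (IZR_abs_pos k). apply Rmult_le_compat_l; [lra|]. apply exp_mono. nra. }
  assert (HUt : forall k, Cmod (Ut k) <= 2 * B * exp (- (3 / 4) * zabs k)).
  { intros k. unfold Ut, ccf.
    eapply Rle_trans; [apply (mom_bound (4 / 5) h d (fun x => cj U x * gp h1 x)%C (B * (1 + d))); auto; [lra|apply W_mult; auto; lra]|].
    pose proof (IZR_abs_pos k). apply Rmult_le_compat; [nra|epos|nra|]. apply exp_mono. nra. }
  assert (HS : forall k, Cmod (S k) <= 2 * (exp (zabs k * d) - 1) * exp (- 1 * zabs k)).
  { intros k. apply (sig_bound 1 h d); auto. lra. }
  assert (Kp0 : forall k, (k <= 0)%Z -> kp k = 0) by (intros k Hk; unfold kp; replace (Z.max k 0) with 0%Z by lia; reflexivity).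
  destruct (mom_cj_0 h f (W_cc _ _ _ Wf) (H0 0%Z ltac:(lia))) as [_ HG0]. fold G in HG0.
  assert (Hw0 : forall k, 0 <= wz N m k) by (intros; left; apply wz_pos).
  (* On negative modes the weight decays, so that the rough bounds suffice. *)
  assert (GN : bnd (fun k => wz N m k * Cmod (G k)) (mu + 4 * B)).
  { replace (mu + 4 * B) with (0 + mu + 4 * B) by ring. apply bnd_pos_split; [lra| | |].
    - rewrite HG0, Cmod_0. lra.
    - eapply bnd_mono; [exact Hb|]. intros k. cbv beta. destruct (Z.ltb 0 k); [|lra].
      apply Rmult_le_compat_l; auto. fold S G. pose proof (Cmod_ge_0 (S k)). nra.
    - eapply bnd_le; [apply (sum_lower _ (2 * B) 1); [lra|lra| |]|lra].
      + intros k Hk. destruct (Z.ltb_spec k 0); [lia|auto].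
      + intros k Hk.
        assert (IZR k <= 0) by (apply IZR_le; lia).
        apply Rle_trans with (exp (1 / 2 * IZR k) * (2 * B * exp (- (3 / 4) * zabs k))).
        * unfold wz. destruct (Z.ltb_spec k 0); [|lia]. apply Rmult_le_compat_l; [epos|apply HG].
        * rewrite Z.abs_neq, opp_IZR by lia. exps; lra. }
  assert (SN : bnd (fun k => wz N m k * Cmod (S k)) (mu / al + 10 * d)).
  { replace (mu / al + 10 * d) with (0 + mu / al + 10 * d) by ring. apply bnd_pos_split; [lra| | |].
    - unfold S, sig. simpl. rewrite Cmod_0. lra.
    - unfold Rdiv. rewrite Rmult_comm.
      assert (Hia : 0 <= / al) by (pos).
      eapply bnd_mono; [apply (bnd_scal _ _ (/ al) Hia Hb)|]. intros k. cbv beta. destruct (Z.ltb 0 k); [|lra].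
      fold S G. pose proof (Cmod_ge_0 (G k)). apply Rle_trans with (/ al * (wz N m k * (al * Cmod (S k)))).
      + right. field. lra.
      + apply Rmult_le_compat_l; auto. apply Rmult_le_compat_l; auto. lra.
    - eapply bnd_le; [apply (sum_lower _ (2 * d) (2 / 5)); [lra|lra| |]|lra].
      + intros k Hk. destruct (Z.ltb_spec k 0); [lia|auto].
      + intros k Hk. set (l := (- k)%Z). assert (Hl : (0 < l)%Z) by (unfold l; lia).
        assert (Ek' : IZR k = - IZR l) by (unfold l; rewrite opp_IZR; ring).
        assert (0 < IZR l) by (apply IZR_lt; lia).
        specialize (HS k). replace (Z.abs k) with l in HS by (unfold l; lia).
        destruct (d_le_neg l d Hl Hd0) as [X1 X2].
        unfold wz. destruct (Z.ltb_spec k 0); [|lia]. rewrite Ek'.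
        apply Rle_trans with (exp (1 / 2 * - IZR l) * (2 * d * exp (IZR l * d))).
        * apply Rmult_le_compat_l; [epos|]. eapply Rle_trans; [exact HS|].
          apply Rle_trans with (2 * (d * (exp (IZR l) * exp (IZR l * d))) * exp (- 1 * IZR l)).
          -- apply Rmult_le_compat_r; [epos|]. apply Rmult_le_compat_l; [lra|]. eapply Rle_trans; [exact X1|].
             apply Rmult_le_compat_l; auto. apply Rmult_le_compat_r; [epos|auto].
          -- right. replace (2 * (d * (exp (IZR l) * exp (IZR l * d))) * exp (- 1 * IZR l)) with
              (2 * d * exp (IZR l * d) * (exp (IZR l) * exp (- 1 * IZR l))) by ring.
             rewrite <- exp_plus. replace (IZR l + - 1 * IZR l) with 0 by ring. rewrite exp_0. ring.
        * exps; [lra|nra]. }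
  assert (GD : bnd (fun k => kp k * wz N m k * Cmod (G k)) D).
  { eapply bnd_mono; [exact Hb'|]. intros k. cbv beta. destruct (Z.ltb_spec 0 k).
    - fold S G. apply Rmult_le_compat_l; [apply Rmult_le_pos; [apply kp_pos|auto]|]. pose proof (Cmod_ge_0 (S k)). nra.
    - rewrite Kp0 by lia. lra. }
  assert (SD : bnd (fun k => kp k * wz N m k * Cmod (S k)) (/ al * D)).
  { assert (Hia : 0 <= / al) by (pos).
    eapply bnd_mono; [apply (bnd_scal _ _ (/ al) Hia Hb')|]. intros k. cbv beta. destruct (Z.ltb_spec 0 k).
    - fold S G. pose proof (Cmod_ge_0 (G k)). apply Rle_trans with (/ al * (kp k * wz N m k * (al * Cmod (S k)))).
      + right. field. lra.
      + apply Rmult_le_compat_l; auto. apply Rmult_le_compat_l; [apply Rmult_le_pos; [apply kp_pos|auto]|]. lra.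
    - rewrite Kp0 by lia. lra. }
  (* [conj f = conj U conj gamma'] gives [G = Ut + Ut * S]. *)
  assert (UtS : bnd (fun k => Cmod (Ut k)) (2 * B * (1 + 2 / (3 / 4)))).
  { eapply bnd_mono; [apply (bnd_decay (2 * B) (3 / 4)); lra|]. auto. }
  assert (SB : forall k, Cmod (S k) <= 2).
  { intros k. eapply Rle_trans; [apply HS|]. pose proof (IZR_abs_pos k).
    assert (exp (zabs k * d) * exp (- 1 * zabs k) <= 1).
    { rewrite <- exp_plus, <- exp_0. apply exp_mono. nra. }
    pose proof (exp_pos (- 1 * zabs k)). nra. }
  assert (GB : forall k, Cmod (G k) <= 2 * B).
  { intros k. eapply Rle_trans; [apply HG|]. pose proof (IZR_abs_pos k).
    assert (exp (- (3 / 4) * zabs k) <= 1) by (rewrite <- exp_0; apply exp_mono; lra). nra. }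
  assert (Cf : ccont (cj f)) by cc. assert (Cu : ccont (cj U)) by cc.
  assert (Pf : cper (cj f)) by apply Wcf. assert (Pu : cper (cj U)) by apply HcU.
  assert (Pg : cper (fun x => Cconj (gp h1 x))) by (intros x; now rewrite (cper_gp h h1 Hc x)).
  assert (EG : forall k, Ut k = (G k - conv Ut S k)%C).
  { intros k. assert (E : G k = conv Ut (mom h (fun x => Cconj (gp h1 x))) k).
    { unfold G. rewrite (mom_ext h _ (fun x => cj U x * Cconj (gp h1 x))%C) by (intros; unfold cj; now rewrite Hf, Cconj_mul).
      apply (mom_mult d h h1 _ _ (3 / 4) (2 * B)); auto; try lra. cc. }
    assert (E2 : conv Ut (mom h (fun x => Cconj (gp h1 x))) k = (Ut k + conv Ut S k)%C).
    { apply zlim_Zser_eq.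
      apply (zlim_ext (fun j => (if Z.eqb j k then Ut k else RtoC 0) + Ut j * S (k - j)%Z)%C).
      - intros j. rewrite (mom_conj_gp h h1) by auto. fold S. destruct (Z.eqb_spec j k) as [->|].
        + rewrite Z.sub_diag. simpl. ring.
        + destruct (Z.eqb_spec (k - j) 0); [lia|]. ring.
      - apply zlim_plus; [apply zlim_single|]. apply summable_zlim. eapply summable_conv; eauto. }
    rewrite E, E2. ring. }
  assert (EQ : forall k, mom h (fun x => cj U x * cj f x)%C k = conv Ut G k).
  { intros k. apply (mom_mult d h h1 _ _ (3 / 4) (2 * B)); auto; lra. }
  destruct (bnd_wz_decay N m Ut (2 * B) HN ltac:(lra) ltac:(lra) HUt) as (X & HX & HX').
  destruct (bnd_least _ _ HX) as (A0 & HA0 & A0min). destruct (bnd_least _ _ HX') as (D0 & HD0 & D0min).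
  assert (Hsum : forall k, summable (fun j => Ut j * S (k - j)%Z)%C) by (eapply summable_conv; eauto).
  assert (HsumG : forall k, summable (fun j => Ut j * G (k - j)%Z)%C) by (eapply summable_conv; eauto).
  set (gam := mu + 4 * B) in *. set (sg := mu / al + 10 * d) in *.
  pose proof (bnd_nonneg _ _ HA0) as A0p. pose proof (bnd_nonneg _ _ HD0) as D0p.
  assert (CW := fun v B B' Hs Hv Hv' => conv_weight (wz N m) kp Ut v A0 B D0 B' Hw0 kp_pos (fun j k => wz_sub N m j k HN Hm) kp_sub
    Hs HA0 Hv HD0 Hv').
  (* The least bounds exist by the rough decay of [Ut]; they absorb the factor [sg <= 1 / 2]. *)
  assert (HA0' : A0 <= 2 * gam).
  { assert (A0 <= gam + A0 * sg); [|nra]. apply A0min.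
    eapply bnd_mono; [apply (bnd_plus _ _ _ _ GN (proj1 (CW S sg (/ al * D) Hsum SN SD)))|]. intros k. cbv beta.
    rewrite (EG k) at 1. pose proof (Cmod_triangle (G k) (- conv Ut S k)) as T. rewrite Cmod_opp in T.
    specialize (Hw0 k). unfold Cminus. nra. }
  assert (HD0' : D0 <= 2 * (D + 2 * gam * (/ al * D))).
  { assert (D0 <= D + (D0 * sg + A0 * (/ al * D))).
    { apply D0min.
      eapply bnd_mono; [apply (bnd_plus _ _ _ _ GD (proj2 (CW S sg (/ al * D) Hsum SN SD)))|]. intros k. cbv beta.
      rewrite (EG k) at 1. pose proof (Cmod_triangle (G k) (- conv Ut S k)) as T. rewrite Cmod_opp in T.
      assert (0 <= kp k * wz N m k) by (apply Rmult_le_pos; [apply kp_pos|auto]). unfold Cminus. nra. }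
    assert (0 <= / al * D) by (pos). nra. }
  eapply bnd_le.
  - eapply bnd_ext; [apply (CW G gam D HsumG GN GD)|]. intros k. cbv beta. now rewrite EQ.
  - assert (Hia : 0 < / al) by (apply Rinv_0_lt_compat; lra).
    assert (gam * / al <= 1 / 8).
    { apply Rle_trans with (al / 8 * / al); [apply Rmult_le_compat_r; lra|]. right. field. lra. }
    assert (D0 <= 5 / 2 * D). { apply Rle_trans with (2 * (D + 2 * (gam * / al) * D)); [lra|]. nra. }
    nra.
Qed.

(** Expand [h] in the exponentials of the curve.  The coefficients with [k > 0] are
    given by [sigma]; the others reach positive modes only through [e^{k h} - 1] and so
    contribute a small multiple of the norm of [h], which is absorbed: the least norm
    [dh] is the unknown of the inequality.  As [h] is real its positive modes suffice. *)
Lemma recover_h : forall d h h1 Y a, small d h h1 -> d <= 1 / 10000 -> W 1 (rc h) d -> 0 <= Y -> 0 <= a ->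
  (forall k, (0 < k)%Z -> Cmod (sig h k) <= Y * exp (- (19 / 10) * IZR k)) -> Cmod (cft (rc h) 0) <= a ->
  W 1 (rc h) (2 * a + 6 * Y).
Proof.
  intros d h h1 Y a Hs Hd Hh HY Ha HS H0.
  pose proof Hs as (Hc & H95 & H195). pose proof (W_ge0 _ _ _ Hh) as Hd0. destruct (small_sup _ _ _ Hs) as [Sh Sh1].
  assert (Hhp : cper (rc h)) by apply Hh. assert (Hhc : ccont (rc h)) by cc.
  destruct (bnd_least _ _ (proj2 (proj2 Hh))) as (dh & Hdh & Hmin).
  assert (Wdh : W 1 (rc h) dh) by (split; auto). pose proof (W_ge0 _ _ _ Wdh) as Hdh0.
  assert (Hdhd : dh <= d) by (apply Hmin; apply Hh).
  set (c := ccf h h1 (rc h)).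
  assert (Hcd : forall k, Cmod (c k) <= d * (1 + d) * exp (- (9 / 10) * zabs k)).
  { intros k. eapply Rle_trans; [apply (mom_bound (19 / 20) h d (fun x => rc h x * gp h1 x)%C (d * (1 + d))); auto; [lra|]|].
    - apply W_mult; auto; [lra|]. now apply W_gp.
    - pose proof (IZR_abs_pos k). apply Rmult_le_compat_l; [nra|]. apply exp_mono. nra. }
  assert (Hexp : forall x, rc h x = Zser (fun j => c j * RtoC (exp (IZR (- j) * h x)) * cis (IZR j * x))%C).
  { intros x. rewrite (ccf_expand h h1 (rc h) d (9 / 10) (d * (1 + d)) Hc); auto; try lra; [|intros y; specialize (Sh1 y); lra|nra].
    apply Zser_ext. intros j. fold c. unfold Ek. rewrite opp_IZR, !Ropp_mult_distr_l_reverse, Ropp_involutive. ring. }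
  assert (Hcs : forall k, k <> 0%Z -> Cmod (c k) <= Cmod (sig h k) / (2 * zabs k)).
  { intros k Hk. rewrite <- (sig_ccf h h1 k Hc Hk). fold c. rewrite Cmod_mult, Cmod_R, Rabs_mult, (Rabs_pos_eq 2), <- abs_IZR by lra.
    assert (0 < zabs k) by (apply IZR_lt; lia). right. field. lra. }
  assert (HR : bnd (fun k => if Z.ltb 0 k then exp (1 * IZR k) * Cmod (cft (rc h) k) else 0) (5 / 4 * Y + 3 * d * dh)).
  { apply (recover 1 c (fun j x => RtoC (exp (IZR (- j) * h x))) (fun j => exp (Rabs (IZR (- j)) * dh) - 1)
      (fun j => d * (1 + d) * exp (- (9 / 10 - d) * zabs j)) (d * (1 + d) * (1 + 2 / (9 / 10 - d)))); auto; [lra| | | |].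
    - intros j. now apply W_exp; [lra|].
    - apply bnd_decay; [nra|lra].
    - intros j x. rewrite Cmod_mult, Cmod_R, Rabs_pos_eq by (epos).
      apply Rle_trans with (d * (1 + d) * exp (- (9 / 10) * zabs j) * exp (zabs j * d)).
      + apply Rmult_le_compat; auto using Cmod_ge_0; [epos|]. apply exp_mono.
        eapply Rle_trans; [apply Rle_abs|]. rewrite Rabs_mult, <- abs_IZR, Z.abs_opp. apply Rmult_le_compat_l; auto. apply IZR_abs_pos.
      + expe.
    - replace (5 / 4 * Y + 3 * d * dh) with (0 + 5 / 4 * Y + 3 * d * dh) by ring.
      apply bnd_pos_split; [lra| | |].
      + simpl. rewrite Rabs_R0, Rmult_0_l, exp_0. lra.
      + eapply bnd_le; [apply (sum_upper _ (Y / 2) (4 / 5)); [lra|lra| |]|lra].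
        * intros k Hk. destruct (Z.ltb_spec 0 k); [lia|auto].
        * intros k Hk. destruct (Z.ltb_spec 0 k); [|lia].
          assert (Hk1 : 1 <= IZR k) by (apply IZR_le; lia).
          rewrite <- abs_IZR, Z.abs_opp, (Z.abs_eq k) by lia.
          assert (Q : Cmod (c k) <= Y / 2 * exp (- (19 / 10) * IZR k)).
          { eapply Rle_trans; [apply Hcs; lia|]. rewrite Z.abs_eq by lia. specialize (HS k Hk).
            pose proof (Cmod_ge_0 (sig h k)).
            apply Rmult_le_reg_r with (2 * IZR k); [lra|]. unfold Rdiv at 1. rewrite Rmult_assoc, Rinv_l by lra.
            nra. }
          replace (1 + (exp (IZR k * dh) - 1)) with (exp (IZR k * dh)) by ring.
          eapply Rle_trans; [apply Rmult_le_compat_r; [epos|apply Rmult_le_compat_r; [epos|exact Q]]|].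
          exps; [lra|nra].
      + eapply bnd_le; [apply (sum_lower _ (d * dh) (9 / 10)); [nra|lra| |]|nra].
        * intros k Hk. destruct (Z.ltb_spec k 0); [lia|auto].
        * intros k Hk. destruct (Z.ltb_spec k 0); [|lia]. destruct (Z.ltb_spec 0 k); [lia|].
          set (l := (- k)%Z). assert (Hl : (0 < l)%Z) by (unfold l; lia).
          assert (Ek' : IZR k = - IZR l) by (unfold l; rewrite opp_IZR; ring).
          assert (Hl1 : 1 <= IZR l) by (apply IZR_le; lia).
          rewrite Ek', (Rabs_pos_eq (IZR l)) by lra.
          destruct (d_le_neg l d Hl Hd0) as [X1 X2]. destruct (d_le_neg l dh Hl Hdh0) as [Y1 _].
          assert (Q : Cmod (c k) <= d * exp (IZR l * d) * exp (- IZR l)).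
          { eapply Rle_trans; [apply Hcs; lia|]. pose proof (sig_bound 1 h d k ltac:(lra) Hh) as SB.
            replace (Z.abs k) with l in * by (unfold l; lia).
            apply Rmult_le_reg_r with (2 * IZR l); [lra|]. unfold Rdiv at 1. rewrite Rmult_assoc, Rinv_l, Rmult_1_r by lra.
            eapply Rle_trans; [exact SB|]. replace (- (1) * IZR l) with (- IZR l) by ring.
            apply Rle_trans with (2 * (d * (IZR l * exp (IZR l * d))) * exp (- IZR l)); [|right; ring].
            apply Rmult_le_compat_r; [epos|]. lra. }
          apply Rle_trans with (d * exp (IZR l * d) * exp (- IZR l) * exp (- IZR l) * (dh * (exp (IZR l) * exp (IZR l * d)))).
          -- replace (1 * - IZR l) with (- IZR l) by ring.
             apply Rmult_le_compat; [pos| | |].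
             ++ assert (1 <= exp (IZR l * dh)) by (rewrite <- exp_0; apply exp_mono; nra). lra.
             ++ apply Rmult_le_compat_r; [epos|exact Q].
             ++ eapply Rle_trans; [exact Y1|]. apply Rmult_le_compat_l; auto.
                apply Rmult_le_compat; [lra|epos|auto|apply exp_mono; nra].
          -- exps; nra. }
  assert (Hself : forall x, Cconj (rc h x) = rc h x) by (intros; unfold rc; apply C_eq; simpl; ring).
  assert (Wn : W 1 (rc h) (a + (5 / 4 * Y + 3 * d * dh) + (5 / 4 * Y + 3 * d * dh))).
  { apply W_pos_neg; auto. eapply bnd_ext; [exact HR|]. intros k. cbv beta. now rewrite (cft_ext (fun x => Cconj (rc h x)) (rc h) Hself). }
  assert (dh <= a + (5 / 4 * Y + 3 * d * dh) + (5 / 4 * Y + 3 * d * dh)) by (apply Hmin, Wn).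
  assert (d * dh <= dh / 10000) by nra.
  eapply W_mono; [apply Rle_refl| |exact Wdh]. lra.
Qed.

(** The positive modes of [conj f] come from [G] as in [recover_h], those of [f] from its
    vanishing moments; the errors are a small multiple of the supremum of [f]. *)
Lemma recover_f : forall d h h1 f U B Y, snap d h h1 f U B -> 0 <= Y ->
  (forall k, (0 < k)%Z -> Cmod (mom h (cj f) k) <= Y * exp (- (19 / 10) * IZR k)) -> W (9 / 10) f (4 * Y).
Proof.
  intros d h h1 f U B Y Hsn HY HG. destruct (snap_W _ _ _ _ _ _ Hsn) as [Wf Wcf].
  destruct Hsn as (Hs & Hd & Hh & Hf & HU & H0). pose proof Hs as (Hc & _). destruct (small_sup _ _ _ Hs) as [Sh Sh1].
  pose proof (W_ge0 _ _ _ Hh) as Hd0. pose proof (W_ge0 _ _ _ Wf) as HB.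
  destruct (small_W d h h1 (4 / 5) Hs ltac:(lra)) as (Hh8 & _ & _).
  destruct (small_W d h h1 (9 / 10) Hs ltac:(lra)) as (Hh9 & Hh19 & _).
  assert (Cf : ccont f) by cc. assert (Pf : cper f) by apply Wf.
  destruct (mom_cj_0 h f Cf (H0 0%Z ltac:(lia))) as [Hf0 HG0].
  set (pij := fun j => exp (Rabs (IZR (- j)) * d) * (1 + d) - 1).
  assert (gen : forall F M Y', W (4 / 5) F (2 * B) -> 0 <= M -> 0 <= Y' -> (forall x, Cmod (F x) <= M) -> mom h F 0 = RtoC 0 ->
    (forall k, (0 < k)%Z -> Cmod (mom h F k) <= Y' * exp (- (19 / 10) * IZR k)) ->
    bnd (fun k => if Z.ltb 0 k then exp (9 / 10 * IZR k) * Cmod (cft F k) else 0) (3 * Y' + 100 * d * M)).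
  { intros F M Y' HF HM HY' HFM HF0 HFk.
    assert (HFd : forall k, Cmod (mom h F k) <= 2 * B * exp (- (3 / 4) * zabs k)).
    { intros k. eapply Rle_trans; [apply (mom_bound (4 / 5) h d F (2 * B)); auto; lra|].
      pose proof (IZR_abs_pos k). apply Rmult_le_compat_l; [lra|]. apply exp_mono. nra. }
    apply (recover (9 / 10) (mom h F) (fun j x => gp h1 x * RtoC (exp (IZR (- j) * h x)))%C pij
      (fun j => 2 * B * (1 + d) * exp (- (3 / 4 - d) * zabs j)) (2 * B * (1 + d) * (1 + 2 / (3 / 4 - d)))); [lra| | | | |].
    - intros j. apply W_gp_exp1; [lra|exact Hh9|exact Hh19].
    - apply bnd_decay; [nra|lra].
    - intros j x. rewrite !Cmod_mult, Cmod_R, (Rabs_pos_eq (exp _)) by (epos).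
      apply Rle_trans with (2 * B * exp (- (3 / 4) * zabs j) * ((1 + d) * exp (zabs j * d))).
      + apply Rmult_le_compat; auto using Cmod_ge_0; [pos|].
        apply Rmult_le_compat; [apply Cmod_ge_0|epos|apply Cmod_gp; auto|]. apply exp_mono.
        eapply Rle_trans; [apply Rle_abs|]. rewrite Rabs_mult, <- abs_IZR, Z.abs_opp. apply Rmult_le_compat_l; auto. apply IZR_abs_pos.
      + expe.
    - apply (mom_expand d h h1 F (3 / 4) (2 * B)); auto; try lra; apply HF.
    - replace (3 * Y' + 100 * d * M) with (0 + 3 * Y' + 100 * d * M) by ring. apply bnd_pos_split; [lra| | |].
      + simpl. rewrite HF0, Cmod_0. lra.
      + eapply bnd_le; [apply (sum_upper _ (Y' * (1 + d)) (1 - d)); [nra|lra| |]|].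
        * intros k Hk. destruct (Z.ltb_spec 0 k); [lia|auto].
        * intros k Hk. destruct (Z.ltb_spec 0 k); [|lia]. unfold pij.
          rewrite <- abs_IZR, Z.abs_opp, (Z.abs_eq k) by lia.
          replace (1 + (exp (IZR k * d) * (1 + d) - 1)) with ((1 + d) * exp (IZR k * d)) by ring.
          eapply Rle_trans; [apply Rmult_le_compat_r; [|apply Rmult_le_compat_r; [epos|apply HFk; auto]]|].
          { pose proof (exp_pos (IZR k * d)). nra. }
          expe.
        * assert ((1 + d) * (2 / (1 - d)) <= 3).
          { apply Rmult_le_reg_r with (1 - d); [lra|]. replace ((1 + d) * (2 / (1 - d)) * (1 - d)) with (2 * (1 + d)) by (field; lra). lra. }
          nra.
      + eapply bnd_le; [apply (sum_lower _ (40 * d * M) (4 / 5)); [nra|lra| |]|lra].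
        * intros k Hk. destruct (Z.ltb_spec k 0); [lia|auto].
        * intros k Hk. destruct (Z.ltb_spec k 0); [|lia]. destruct (Z.ltb_spec 0 k); [lia|]. unfold pij.
          set (l := (- k)%Z).
          assert (Ek' : IZR k = - IZR l) by (unfold l; rewrite opp_IZR; ring).
          assert (Hl1 : 1 <= IZR l) by (apply IZR_le; lia).
          rewrite Ek', (Rabs_pos_eq (IZR l)) by lra.
          pose proof (decay_aux (IZR l) d Hl1 Hd0) as DA.
          pose proof (mom_sup h h1 F k M d Hc ltac:(apply HF) HFM Sh) as MS. replace (Z.abs k) with l in MS by (unfold l; lia).
          assert (0 <= exp (IZR l * d) * (1 + d) - 1).
          { assert (1 <= exp (IZR l * d)) by (rewrite <- exp_0; apply exp_mono; nra). nra. }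
          apply Rle_trans with (M * exp (d * IZR l) * exp (9 / 10 * - IZR l) * (40 * d * exp (IZR l * (1 / 20 + 2 * d)))).
          -- apply Rmult_le_compat; auto; [pos|].
             apply Rmult_le_compat_r; [epos|exact MS].
          -- exps; nra. }
  assert (main : forall M, 0 <= M -> (forall x, Cmod (f x) <= M) -> W (9 / 10) f (3 * Y + 200 * d * M)).
  { intros M HM HMf.
    replace (3 * Y + 200 * d * M) with (0 + (3 * 0 + 100 * d * M) + (3 * Y + 100 * d * M)) by ring.
    apply W_pos_neg; auto; [lra|rewrite Hf0, Cmod_0; lra| |].
    - apply gen; auto; [lra|apply H0; lia|]. intros k Hk. rewrite H0 by lia. rewrite Cmod_0. lra.
    - apply (gen (cj f)); auto. intros x. unfold cj. rewrite Cmod_conj. auto. }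
  assert (HM : forall x, Cmod (f x) <= 2 * (3 * Y)).
  { apply sup_absorb.
    - destruct (ccont_bounded f Cf Pf) as (M & _ & HM). now exists M.
    - intros M HM0 HM x. pose proof (W_sup (9 / 10) _ _ x ltac:(lra) (main M HM0 HM)). nra. }
  eapply W_mono; [apply Rle_refl| |apply (main (2 * (3 * Y))); auto; lra]. nra.
Qed.


(** * The evolution of the moments *)

Lemma real_deriv : forall rho rho' (u : R -> R) A, 0 <= rho' < rho -> W rho (rc u) A ->
  (forall x, is_derive u x (Derive u x)) /\ W rho' (rc (Derive u)) (A / (rho - rho')) /\
  (forall k, cft (rc (Derive u)) k = dcoef (cft (rc u)) k).
Proof.
  intros rho rho' u A Hr HW. destruct (W_deriv rho rho' (rc u) A Hr HW) as (H1 & H2 & H3).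
  assert (D : forall x, is_derive u x (Re (fser (dcoef (cft (rc u))) x))) by (intros x; apply (H1 x)).
  assert (E : forall x, fser (dcoef (cft (rc u))) x = rc (Derive u) x).
  { intros x. unfold rc. apply C_eq.
    - symmetry. apply is_derive_unique, D.
    - pose proof (proj2 (H1 x)) as X. apply is_derive_unique in X.
      change (Im (fser (dcoef (cft (rc u))) x) = 0). rewrite <- X. apply (Derive_const 0 x). }
  split; [|split].
  - intros x. rewrite (is_derive_unique _ _ _ (D x)). apply D.
  - apply (W_ext _ _ _ _ E). auto.
  - intros k. rewrite <- H3. apply cft_ext. intros x. now rewrite E.
Qed.

Lemma W_per : forall rho u A, W rho (rc u) A -> forall x, u (x + 2 * PI) = u x.
Proof. intros rho u A (_ & H & _) x. specialize (H x). unfold rc, RtoC in H. congruence. Qed.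

Lemma W_cont : forall rho u A, W rho (rc u) A -> forall x, continuous u x.
Proof. intros rho u A ((H & _) & _) x. apply H. Qed.

Lemma W_curve : forall rho u A, 0 < rho -> W rho (rc u) A -> curve u (Derive u).
Proof.
  intros rho u A Hr HW. destruct (real_deriv rho (rho / 2) u A ltac:(lra) HW) as (H1 & H2 & _).
  split; [auto|]. split; [eapply W_cont, H2|]. split; [eapply W_per, HW|eapply W_per, H2].
Qed.

Definition nrm (tau : R) (u : R -> R) : R := real (X_norm tau u).

Lemma nrm_W : forall tau u A, W tau (rc u) A -> W tau (rc u) (nrm tau u) /\ 0 <= nrm tau u <= A.
Proof.
  intros tau u A HW. pose proof (W_X_norm _ _ _ HW) as Hle.
  assert (Hge : Rbar_le 0 (X_norm tau u)).
  { rewrite X_norm_lsum by (eapply W_cont; eauto). rewrite <- (Lim_seq_const 0). apply Lim_seq_le_loc.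
    exists 0%nat. intros n _. apply lsum_nonneg. intros k. pos. }
  unfold nrm. pose proof (X_norm_W tau u) as HX.
  destruct (X_norm tau u) as [r| |]; simpl in *; try tauto.
  split; auto. apply HX; [intros x; eapply W_per; eauto|eapply W_cont; eauto|lra].
Qed.

Lemma nrm_le : forall tau u A, W tau (rc u) A -> nrm tau u <= A.
Proof. intros. now apply nrm_W. Qed.

Lemma nrm_dist : forall tau u v e A B, W tau (rc u) A -> W tau (rc v) B -> W tau (rc (fun x => u x - v x)) e ->
  Rabs (nrm tau u - nrm tau v) <= e.
Proof.
  intros tau u v e A B Hu Hv He. destruct (nrm_W _ _ _ Hu) as [Hu' _]. destruct (nrm_W _ _ _ Hv) as [Hv' _].
  assert (X1 : nrm tau u <= nrm tau v + e).
  { apply nrm_le. apply (W_ext _ (fun x => rc v x + rc (fun x => u x - v x)%R x)%C).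
    - intros x. unfold rc. rewrite <- RtoC_plus. f_equal. ring.
    - apply W_plus; auto. }
  assert (X2 : nrm tau v <= nrm tau u + e).
  { apply nrm_le. apply (W_ext _ (fun x => rc u x - rc (fun x => u x - v x)%R x)%C).
    - intros x. unfold rc. rewrite <- RtoC_minus. f_equal. ring.
    - apply W_minus; auto. }
  apply Rabs_le. lra.
Qed.

Lemma tder_sub : forall T T' f t l, T' <= T -> tder T f t l -> tder T' f t l.
Proof.
  intros T T' f t l HT H e He. destruct (H e He) as (d & Hd & Hs). exists d. split; auto.
  intros s Hs'. apply Hs. unfold time_interval in *. lra.
Qed.

Lemma ctder_eq_on : forall T f g t l, time_interval T t -> (forall s, time_interval T s -> f s = g s) ->
  ctder T f t l -> ctder T g t l.
Proof.
  intros T f g t l Ht E H e He. destruct (H e He) as (d & Hd & Hs). exists d. split; auto.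
  intros s Hs' Hst. rewrite <- !E by auto. auto.
Qed.

Lemma ctder_const : forall T f, 0 < T -> (forall t, time_interval T t -> ctder T f t (RtoC 0)) ->
  forall t, time_interval T t -> f t = f 0.
Proof.
  intros T f HT H t Ht. destruct (ctder_extend T f (fun _ => RtoC 0) HT H) as (F & E & D).
  rewrite <- !E by (auto; unfold time_interval in *; lra).
  assert (Z : forall (u : R -> R), (forall t, time_interval T t -> is_derive u t 0) -> u t = u 0).
  { intros u Hu. apply Rle_antisym.
    - apply (nonincr u (fun _ => 0) T); auto. intros; lra.
    - assert (- u t <= - u 0); [|lra]. apply (nonincr (fun s => - u s) (fun _ => 0) T); auto; [|intros; lra].
      intros s Hs. eapply der_eq; [apply (is_derive_opp u s 0 (Hu s Hs))|]. unfold opp; simpl. ring. }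
  apply C_eq; [apply (Z (fun s => Re (F s)))|apply (Z (fun s => Im (F s)))]; intros s Hs; apply (D s Hs).
Qed.


Definition quot (h : R -> R) (f : R -> C) (x : R) : C := (f x / gp (Derive h) x)%C.

Lemma quot_gp : forall h f x, f x = (quot h f x * gp (Derive h) x)%C.
Proof. intros. unfold quot. field. apply gp_neq_0. Qed.

Lemma small_of_W : forall d h, W 1 (rc h) d -> small (20 * d) h (Derive h).
Proof.
  intros d h Hh. pose proof (W_ge0 _ _ _ Hh). split; [apply (W_curve 1 h d); auto; lra|].
  destruct (real_deriv 1 (19 / 20) h d ltac:(lra) Hh) as (_ & H1 & _). split.
  - eapply W_mono; [| |exact Hh]; lra.
  - eapply W_mono; [apply Rle_refl| |exact H1]. right; field.
Qed.

(** [moments] and [elliptic] turn a bound on one component of the trace into the state. *)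
Lemma snap_of : forall d (h w p : R -> R) phi s q A, d <= 1 / 200000 -> W 1 (rc h) d ->
  (forall x, continuous w x) -> cper (rc w) -> stream_function h w phi p -> Cmod s <= 1 ->
  (forall x, tr w p x = s * Cconj (tr w p x) + q x)%C -> W (9 / 10) q A ->
  snap (20 * d) h (Derive h) (tr w p) (quot h (tr w p)) (40 * A).
Proof.
  intros d h w p phi s q A Hd Hh Hw Hwp HS Hs Hf Hq. pose proof (small_of_W _ _ Hh) as Hsm. pose proof (W_ge0 _ _ _ Hh).
  pose proof Hsm as (Hc & _).
  assert (Hc1 : curve (Derive h) (Derive (Derive h))).
  { apply (W_curve (19 / 20) _ (20 * d)); [lra|]. apply Hsm. }
  assert (Cf : ccont (tr w p)).
  { split; intros x; [apply Hw|]. apply (continuous_opp p x). eapply (p_cont h w p phi HS). }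
  assert (Pf : cper (tr w p)).
  { intros x. unfold tr. specialize (Hwp x). unfold rc, RtoC in Hwp.
    rewrite (p_per h w p phi HS). congruence. }
  assert (HM : forall k, (0 <= k)%Z -> cint (fun x => tr w p x * Ek h k x)%C = RtoC 0).
  { apply (moments h _ _ w p phi Hc Hc1 Hw HS). }
  destruct (elliptic (20 * d) h (Derive h) (tr w p) s q A Hsm ltac:(lra) Cf Pf Hs Hf Hq HM) as (U & HU & WU & _).
  split; [auto|]. split; [lra|]. split; [eapply W_mono; [apply Rle_refl| |exact Hh]; lra|]. split; [intros x; apply quot_gp|]. split.
  - apply (W_ext _ U); auto. intros x. unfold quot. rewrite HU. field. apply gp_neq_0.
  - intros k Hk. unfold mom. rewrite HM by auto. ring.
Qed.

Lemma tr_conj : forall w p x, tr w p x = (RtoC (-1) * Cconj (tr w p x) + RtoC 2 * rc w x)%C.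
Proof. intros. apply C_eq; unfold tr, rc; simpl; ring. Qed.

Lemma tr_conj' : forall w p x, tr w p x = (1 * Cconj (tr w p x) + (- (RtoC 2 * Ci)) * rc p x)%C.
Proof. intros. apply C_eq; unfold tr, rc; simpl; ring. Qed.

Lemma Cmod_Ci : Cmod Ci = 1.
Proof. unfold Cmod, Ci; simpl. transitivity (sqrt 1); [f_equal; ring|apply sqrt_1]. Qed.

Lemma tr_parts : forall w p rho A, W rho (tr w p) A -> W rho (rc w) A /\ W rho (rc p) A.
Proof.
  intros w p rho A HW. pose proof (W_conj _ _ _ HW) as HC. split.
  - apply (W_ext _ (fun x => RtoC (/ 2) * (tr w p x + Cconj (tr w p x)))%C).
    { intros x. apply C_eq; unfold tr, rc; simpl; field. }
    eapply W_mono; [apply Rle_refl| |apply W_scal, W_plus; eauto]. rewrite Cmod_R, Rabs_pos_eq by lra. lra.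
  - apply (W_ext _ (fun x => (RtoC (/ 2) * Ci) * (tr w p x - Cconj (tr w p x)))%C).
    { intros x. apply C_eq; unfold tr, rc; simpl; field. }
    eapply W_mono; [apply Rle_refl| |apply W_scal, W_minus; eauto].
    rewrite Cmod_mult, Cmod_R, Cmod_Ci, Rabs_pos_eq by lra. lra.
Qed.

(** The trace at the initial time is controlled by the normal velocity. *)
Lemma snap_initial : forall d h w p phi A, d <= 1 / 200000 -> W 1 (rc h) d -> W (9 / 10) (rc p) A ->
  (forall x, continuous w x) -> cper (rc w) -> stream_function h w phi p ->
  snap (20 * d) h (Derive h) (tr w p) (quot h (tr w p)) (80 * A).
Proof.
  intros d h w p phi A Hd Hh Hp Hw Hwp HS. replace (80 * A) with (40 * (2 * A)) by ring.
  apply (snap_of d h w p phi (RtoC 1) (fun x => (- (RtoC 2 * Ci)) * rc p x)%C); auto.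
  - rewrite Cmod_1. lra.
  - intros x. apply tr_conj'.
  - assert (E : Cmod (- (RtoC 2 * Ci)) = 2) by (rewrite Cmod_opp, Cmod_mult, Cmod_R, Cmod_Ci, Rabs_pos_eq; lra).
    apply (W_mono (9 / 10) _ _ (Cmod (- (RtoC 2 * Ci)) * A)); [lra|rewrite E; lra|now apply W_scal].
Qed.

(** At later times the trace is controlled by the tangential velocity. *)
Lemma snap_state : forall d h w p phi A, d <= 1 / 200000 -> W 1 (rc h) d -> W (9 / 10) (rc w) A ->
  stream_function h w phi p ->
  snap (20 * d) h (Derive h) (tr w p) (quot h (tr w p)) (80 * A).
Proof.
  intros d h w p phi A Hd Hh Hw HS. replace (80 * A) with (40 * (2 * A)) by ring.
  apply (snap_of d h w p phi (RtoC (-1)) (fun x => RtoC 2 * rc w x)%C); auto.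
  - eapply W_cont; eauto.
  - apply Hw.
  - rewrite Cmod_R, Rabs_left; lra.
  - intros x. apply tr_conj.
  - apply (W_mono (9 / 10) _ _ (Cmod (RtoC 2) * A)); [lra|rewrite Cmod_R, Rabs_pos_eq; lra|now apply W_scal].
Qed.

Definition brk (h w p : R -> R) (x : R) : R :=
  ((p x) ^ 2 - (w x) ^ 2 + 2 * w x * p x * Derive h x) / (1 + (Derive h x) ^ 2).

(** The Bernoulli bracket is [- Re (U^2 gamma')]. *)
Lemma brk_eq : forall h w p x, let U := quot h (tr w p) in
  rc (brk h w p) x = (- RtoC (/ 2) * (U x * tr w p x + Cconj (U x * tr w p x)))%C.
Proof.
  intros h w p x U. unfold U, quot, brk, rc. set (b := Derive h x).
  assert (1 + b ^ 2 <> 0) by nra.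
  apply C_eq; unfold tr, gp, Cdiv, Cinv; simpl; fold b; field; nra.
Qed.

Lemma brk_W : forall d h w p B, snap d h (Derive h) (tr w p) (quot h (tr w p)) B ->
  W (4 / 5) (rc (brk h w p)) (2 * B * B).
Proof.
  intros d h w p B Hs. destruct (snap_W _ _ _ _ _ _ Hs) as [Wf _]. destruct Hs as (_ & _ & _ & _ & HU & _).
  apply (W_ext _ (fun x => - RtoC (/ 2) * (quot h (tr w p) x * tr w p x + Cconj (quot h (tr w p) x * tr w p x)))%C).
  { intros x. symmetry. apply brk_eq. }
  assert (X : W (4 / 5) (fun x => quot h (tr w p) x * tr w p x)%C (B * (2 * B))) by (apply W_mult; auto; lra).
  eapply W_mono; [apply Rle_refl| |apply W_scal, W_plus; [exact X|apply W_conj, X]].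
  rewrite Cmod_opp, Cmod_R, Rabs_pos_eq by lra. lra.
Qed.

(** It collects, under the moments of the evolution of [G], the Bernoulli bracket and the
    term [w d_t h] produced by the motion of [E_k]: only conjugates remain, hence only [G]. *)
Lemma brk_identity : forall h w p x,
  (Ci * RtoC (/ 2) * (rc (brk h w p) x * gp (Derive h) x) + rc w x * rc p x =
   - (Ci * RtoC (/ 2)) * (cj (quot h (tr w p)) x * cj (tr w p) x))%C.
Proof.
  intros h w p x. unfold cj. rewrite brk_eq. pose proof (quot_gp h (tr w p) x) as E.
  set (U := quot h (tr w p) x) in *. set (g := gp (Derive h) x) in *.
  assert (Ec : (Cconj (tr w p x) = Cconj U * (2 - g))%C).
  { rewrite E at 1. rewrite Cconj_mul. f_equal. unfold g, gp. apply C_eq; simpl; ring. }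
  assert (Ew : (rc w x * rc p x = Ci * RtoC (/ 4) * (tr w p x * tr w p x - Cconj (tr w p x) * Cconj (tr w p x)))%C).
  { apply C_eq; unfold tr, rc; simpl; field. }
  rewrite Ew, Cconj_mul. set (F := tr w p x) in *. set (Fc := Cconj F) in *. set (V := Cconj U) in *.
  assert (E2 : (RtoC (/ 4) = RtoC (/ 2) * RtoC (/ 2))%C) by (rewrite <- RtoC_mult; f_equal; field).
  assert (E3 : (RtoC (/ 2) * 2 = 1)%C) by (rewrite <- RtoC_mult; f_equal; field).
  rewrite E2.
  transitivity (Ci * RtoC (/ 2) * (RtoC (/ 2)) * (F * F - (U * g) * F - V * Fc * g - Fc * Fc))%C; [ring|].
  rewrite <- E. rewrite Ec at 2.
  transitivity (- (Ci * RtoC (/ 2)) * (V * Fc) * (RtoC (/ 2) * 2))%C; [ring|]. rewrite E3. ring.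
Qed.


Definition wdot (g : R) (h w ht : R -> R) (x : R) : R := - g * Derive h x + 1 / 2 * Derive (brk h w ht) x.

(** What the evolution of the moments needs from a solution: a uniform bound [d], the
    stream function, and the two equations. *)
Definition ww_on (g T d : R) (h w ht : R -> R -> R) : Prop := forall t, time_interval T t ->
  W 1 (rc (h t)) d /\ W (9 / 10) (rc (w t)) d /\ (exists phi, stream_function (h t) (w t) phi (ht t)) /\
  forall x, tder T (fun s => h s x) t (ht t x) /\ tder T (fun s => w s x) t (wdot g (h t) (w t) (ht t) x).

(** [G] and [Q], the moments of [conj f] and of [conj U conj f]. *)
Definition gmom (h w ht : R -> R) (k : Z) : C := mom h (cj (tr w ht)) k.
Definition qmom (h w ht : R -> R) (k : Z) : C := mom h (fun x => cj (quot h (tr w ht)) x * cj (tr w ht) x)%C k.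

Lemma ww_snap : forall g T d h w ht t, ww_on g T d h w ht -> d <= 1 / 200000 -> time_interval T t ->
  snap (20 * d) (h t) (Derive (h t)) (tr (w t) (ht t)) (quot (h t) (tr (w t) (ht t))) (80 * d).
Proof. intros g T d h w ht t H Hd Ht. destruct (H t Ht) as (H1 & H2 & (phi & H3) & _). now apply (snap_state d _ _ _ phi). Qed.

Lemma ww_ht : forall g T d h w ht t, ww_on g T d h w ht -> d <= 1 / 200000 -> time_interval T t ->
  W (4 / 5) (rc (w t)) (160 * d) /\ W (4 / 5) (rc (ht t)) (160 * d).
Proof.
  intros g T d h w ht t H Hd Ht. destruct (snap_W _ _ _ _ _ _ (ww_snap _ _ _ _ _ _ _ H Hd Ht)) as [X _].
  replace (160 * d) with (2 * (80 * d)) by ring. now apply tr_parts.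
Qed.

Lemma ww_brk : forall g T d h w ht t, ww_on g T d h w ht -> d <= 1 / 200000 -> time_interval T t ->
  let B := brk (h t) (w t) (ht t) in
  (forall x, is_derive B x (Derive B x)) /\ cper (rc B) /\ W (3 / 4) (rc (Derive B)) (256000 * d ^ 2).
Proof.
  intros g T d h w ht t H Hd Ht B.
  pose proof (brk_W _ _ _ _ _ (ww_snap _ _ _ _ _ _ _ H Hd Ht)) as X. fold B in X.
  destruct (real_deriv (4 / 5) (3 / 4) B _ ltac:(lra) X) as (H1 & H2 & _).
  split; [auto|]. split; [apply X|]. eapply W_mono; [apply Rle_refl| |exact H2]. right. field.
Qed.

Lemma wdot_W : forall g T d h w ht t, ww_on g T d h w ht -> d <= 1 / 200000 -> time_interval T t ->
  W (3 / 4) (rc (wdot g (h t) (w t) (ht t))) (Rabs g * (4 * d) + 256000 * d ^ 2).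
Proof.
  intros g T d h w ht t H Hd Ht. destruct (ww_brk _ _ _ _ _ _ _ H Hd Ht) as (_ & _ & HB).
  destruct (H t Ht) as (H1 & _). destruct (real_deriv 1 (3 / 4) (h t) d ltac:(lra) H1) as (_ & H2 & _).
  apply (W_ext _ (fun x => RtoC (- g) * rc (Derive (h t)) x + RtoC (1 / 2) * rc (Derive (brk (h t) (w t) (ht t))) x)%C).
  { intros x. unfold rc, wdot. rewrite <- !RtoC_mult, <- RtoC_plus. reflexivity. }
  eapply W_mono; [apply Rle_refl| |apply W_plus; apply W_scal; eauto].
  rewrite !Cmod_R, Rabs_Ropp, (Rabs_pos_eq (1 / 2)) by lra.
  replace (d / (1 - 3 / 4)) with (4 * d) by field. nra.
Qed.

(** The right-hand sides are Lipschitz in space, uniformly in time, thanks to the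
    analytic bounds. *)
Lemma ww_udiff : forall g T d h w ht t, ww_on g T d h w ht -> d <= 1 / 200000 -> 0 < T -> time_interval T t ->
  udiff T t (fun s => rc (h s)) (rc (ht t)) /\ udiff T t (fun s => rc (w s)) (rc (wdot g (h t) (w t) (ht t))).
Proof.
  intros g T d h w ht t H Hd HT Ht.
  assert (Hd0 : 0 <= d) by (apply (W_ge0 1 (rc (h t))), (H t Ht)).
  split.
  - apply (udiff_pointwise T t h ht (160 * d / (4 / 5)) 1); auto; try lra.
    + intros s x Hs. apply (H s Hs).
    + intros s x Hs. apply (W_per 1 _ d), (H s Hs).
    + apply (W_per (4 / 5) _ (160 * d)). eapply ww_ht; eauto.
    + intros s Hs _. apply (W_lip (4 / 5)); [lra|]. eapply ww_ht; eauto.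
  - pose proof (Rabs_pos g).
    apply (udiff_pointwise T t w (fun s => wdot g (h s) (w s) (ht s)) ((Rabs g * (4 * d) + 256000 * d ^ 2) / (3 / 4)) 1); auto; try lra.
    + intros s x Hs. apply (H s Hs).
    + intros s x Hs. apply (W_per (9 / 10) _ d), (H s Hs).
    + eapply W_per, wdot_W; eauto.
    + apply Rmult_le_pos; [nra|lra].
    + intros s Hs _. apply (W_lip (3 / 4)); [lra|]. eapply wdot_W; eauto.
Qed.

Lemma W_bounded : forall rho F A, 0 <= rho -> W rho F A -> cbounded F.
Proof. intros rho F A Hr H. exists A. split; [eapply W_ge0; eauto|]. intros x. eapply W_sup; eauto. Qed.

(** The vanishing moments of [w - i p] make those of [w] and of [p] proportional. *)
Lemma mom_tr : forall d h f U B w p k, snap d h (Derive h) f U B -> (forall x, f x = tr w p x) -> (0 <= k)%Z ->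
  ccont (rc w) -> ccont (rc p) ->
  gmom h w p k = (RtoC 2 * mom h (rc w) k)%C /\ mom h (rc p) k = (- (Ci * RtoC (/ 2)) * gmom h w p k)%C.
Proof.
  intros d h f U B w p k (Hs & _ & _ & _ & _ & H0) Hf Hk Cw Cp. pose proof Hs as (Hc & _).
  specialize (H0 k Hk). rewrite (mom_ext h f (fun x => rc w x + (- Ci) * rc p x)%C) in H0 by (intros x; rewrite Hf; apply C_eq; unfold tr, rc; simpl; ring).
  assert (E : gmom h w p k = (mom h (rc w) k + Ci * mom h (rc p) k)%C).
  { unfold gmom. rewrite (mom_ext h _ (fun x => rc w x + Ci * rc p x)%C) by (intros x; apply C_eq; unfold cj, tr, rc; simpl; ring).
    rewrite (mom_plus h (Derive h)), (mom_scal h (Derive h)) by (auto; cc). reflexivity. }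
  rewrite (mom_plus h (Derive h)), (mom_scal h (Derive h)) in H0 by (auto; cc).
  assert (E1 : mom h (rc w) k = (Ci * mom h (rc p) k)%C).
  { replace (mom h (rc w) k) with (mom h (rc w) k + - Ci * mom h (rc p) k + Ci * mom h (rc p) k)%C by ring. rewrite H0. ring. }
  rewrite E, E1. split; [ring|]. apply C_eq; unfold Re, Im; simpl; lra.
Qed.

Section Dynamics.
Variables (g T d : R) (h w ht : R -> R -> R) (t : R) (k : Z).
Hypothesis HW : ww_on g T d h w ht.
Hypothesis Hd : d <= 1 / 200000.
Hypothesis HT : 0 < T.
Hypothesis Ht : time_interval T t.
Hypothesis Hk : (0 < k)%Z.

Let E s := rc (fun x => exp (IZR k * h s x)).

Lemma E_udiff : udiff T t E (fun x => RtoC (IZR k) * rc (ht t) x * E t x)%C.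
Proof.
  destruct (ww_udiff _ _ _ _ _ _ _ HW Hd HT Ht) as [H1 _]. destruct (HW t Ht) as (Wh & _).
  destruct (ww_ht _ _ _ _ _ _ _ HW Hd Ht) as [_ Wp].
  eapply udiff_ext; [| |apply (udiff_exp T t h ht (IZR k) H1)].
  - reflexivity.
  - intros x. unfold E, rc. now rewrite !RtoC_mult.
  - eapply W_bounded; [|exact Wh]. lra.
  - eapply W_bounded; [|exact Wp]. lra.
Qed.

Lemma E_W : forall s, time_interval T s -> exists A, W 1 (E s) A.
Proof. intros s Hs. exists (exp (Rabs (IZR k) * d)). apply W_exp'; [lra|]. apply (HW s Hs). Qed.

Lemma wc s : time_interval T s -> ccont (rc (w s)) /\ ccont (rc (ht s)).
Proof. intros Hs. destruct (ww_ht _ _ _ _ _ _ _ HW Hd Hs) as [A B]. split; cc. Qed.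

(** [d_t E_k = k p E_k], and the moments of [p] are multiples of those of [conj f]. *)
Lemma sigma_dot : ctder T (fun s => sig (h s) k) t (- (Ci * RtoC (IZR k)) * gmom (h t) (w t) (ht t) k)%C.
Proof.
  destruct (wc t Ht) as [Cw Cp]. destruct (E_W t Ht) as [A WE].
  apply (ctder_eq_on T (fun s => RtoC 2 * cft (E s) k)%C); auto.
  { intros s Hs. unfold sig. replace (Z.eqb k 0) with false by (symmetry; apply Z.eqb_neq; lia).
    rewrite mom_cft. f_equal. apply cft_ext. intros x. unfold E, rc. ring. }
  apply (ctder_eq T _ _ t (RtoC 2 * cft (fun x => RtoC (IZR k) * rc (ht t) x * E t x)%C k)%C _ (fun s => eq_refl)).
  - destruct (mom_tr _ _ _ _ _ (w t) (ht t) k (ww_snap _ _ _ _ _ _ _ HW Hd Ht) (fun x => eq_refl) ltac:(lia) Cw Cp) as [_ X].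
    rewrite (cft_ext _ (fun x => RtoC (IZR k) * (rc (ht t) x * E t x))%C) by (intros; ring).
    rewrite cft_scal by cc. change (cft (fun x => rc (ht t) x * E t x)%C k) with (cft (fun x => rc (ht t) x * RtoC (exp (IZR k * h t x)))%C k).
    rewrite <- mom_cft, X. transitivity (- (Ci * RtoC (IZR k)) * gmom (h t) (w t) (ht t) k * (RtoC 2 * RtoC (/ 2)))%C; [ring|].
    rewrite <- RtoC_mult, Rinv_r by lra. ring.
  - apply ctder_scal, ctder_cft; auto; [apply E_udiff| |cc].
    intros s Hs. destruct (E_W s Hs). cc.
Qed.

(** Differentiate [G = 2 mom w]; the slope gives [sigma], and an integration by parts
    moves the derivative of the bracket onto [E_k], producing [gamma']. *)
Lemma G_dot : ctder T (fun s => gmom (h s) (w s) (ht s) k) t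
  (- (Ci * RtoC g) * sig (h t) k - Ci * RtoC (IZR k) * qmom (h t) (w t) (ht t) k)%C.
Proof.
  destruct (E_W t Ht) as [A WE].
  pose proof (ww_snap _ _ _ _ _ _ _ HW Hd Ht) as Hsn. pose proof Hsn as ((Hc & _) & _).
  destruct (ww_udiff _ _ _ _ _ _ _ HW Hd HT Ht) as [_ Uw].
  destruct (ww_ht _ _ _ _ _ _ _ HW Hd Ht) as [Ww Wp]. pose proof (wdot_W _ _ _ _ _ _ _ HW Hd Ht) as Wwt.
  destruct (ww_brk _ _ _ _ _ _ _ HW Hd Ht) as (DB & PB & WB). destruct (HW t Ht) as (Wh & _).
  destruct (snap_W _ _ _ _ _ _ Hsn) as [_ Wcf].
  set (B := brk (h t) (w t) (ht t)) in *.
  destruct (real_deriv 1 (4 / 5) (h t) d ltac:(lra) Wh) as (_ & Wh1 & _).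
  assert (CB : ccont (rc B)) by (apply ccont_RtoC; intros x; apply (continuous_of_derivable _ _ _ (DB x))).
  apply (ctder_eq_on T (fun s => RtoC 2 * cft (fun x => rc (w s) x * E s x)%C k)%C); auto.
  { intros s Hs. destruct (wc s Hs) as [Cws Cps].
    destruct (mom_tr _ _ _ _ _ (w s) (ht s) k (ww_snap _ _ _ _ _ _ _ HW Hd Hs) (fun x => eq_refl) ltac:(lia) Cws Cps) as [X _].
    rewrite X, mom_cft. reflexivity. }
  set (wt := rc (wdot g (h t) (w t) (ht t))) in *.
  apply (ctder_eq T _ _ t (RtoC 2 * cft (fun x => wt x * E t x + rc (w t) x * (RtoC (IZR k) * rc (ht t) x * E t x))%C k)%C _ (fun s => eq_refl)).
  - assert (Dsplit : cft (fun x => wt x * E t x + rc (w t) x * (RtoC (IZR k) * rc (ht t) x * E t x))%C k =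
      (- RtoC g * mom (h t) (rc (Derive (h t))) k + RtoC (/ 2) * mom (h t) (rc (Derive B)) k
       + RtoC (IZR k) * mom (h t) (fun x => rc (w t) x * rc (ht t) x)%C k)%C).
    { rewrite <- !(mom_scal (h t) (Derive (h t))), <- !(mom_plus (h t) (Derive (h t))) by (auto; cc).
      rewrite mom_cft. apply cft_ext. intros x. unfold wt, wdot, rc, E. fold B.
      apply C_eq; unfold rc; simpl; field. }
    (* [gamma' = 1 + i d_1 h] has vanishing moments. *)
    assert (M1 : mom (h t) (rc (Derive (h t))) k = (Ci * RtoC (/ 2) * sig (h t) k)%C).
    { pose proof (mom_gp (h t) _ k Hc) as M. replace (Z.eqb k 0) with false in M by (symmetry; apply Z.eqb_neq; lia).
      rewrite (mom_ext _ _ (fun x => RtoC 1 + Ci * rc (Derive (h t)) x)%C) in M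
        by (intros x; apply C_eq; unfold gp, rc; simpl; ring).
      rewrite (mom_plus _ (Derive (h t))), (mom_scal _ (Derive (h t))) in M by (auto; cc).
      unfold sig. replace (Z.eqb k 0) with false by (symmetry; apply Z.eqb_neq; lia).
      set (m1 := mom (h t) (fun _ => RtoC 1) k) in *. set (m2 := mom (h t) (rc (Derive (h t))) k) in *.
      transitivity (Ci * m1 * (RtoC (/ 2) * RtoC 2))%C; [|ring].
      rewrite <- RtoC_mult, Rinv_l by lra.
      assert (Hi : (Ci * Ci + RtoC 1 = RtoC 0)%C) by (apply C_eq; simpl; ring).
      transitivity (Ci * m1 - Ci * (m1 + Ci * m2) + (Ci * Ci + RtoC 1) * m2)%C; [ring|]. rewrite M, Hi. ring. }
    assert (M2 : mom (h t) (rc (Derive B)) k = (Ci * RtoC (IZR k) * mom (h t) (fun x => rc B x * gp (Derive (h t)) x)%C k)%C).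
    { unfold mom. rewrite (cint_parts (rc B) (Ek (h t) k) (rc (Derive B)) (fun x => - (Ci * RtoC (IZR k)) * gp (Derive (h t)) x * Ek (h t) k x)%C).
      - rewrite (cint_ext _ (fun x => - (Ci * RtoC (IZR k)) * (rc B x * gp (Derive (h t)) x * Ek (h t) k x))%C) by (intros; ring).
        rewrite cint_scal by cc. ring.
      - intros x. split; [apply DB|]. apply (is_derive_const 0 x).
      - intros x. now apply Ek_deriv.
      - cc.
      - cc.
      - exact PB.
      - now apply (Ek_per _ (Derive (h t))). }
    assert (M3 : (Ci * RtoC (/ 2) * mom (h t) (fun x => rc B x * gp (Derive (h t)) x)%C k + mom (h t) (fun x => rc (w t) x * rc (ht t) x)%C k
      = - (Ci * RtoC (/ 2)) * qmom (h t) (w t) (ht t) k)%C).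
    { assert (CcU : ccont (cj (quot (h t) (tr (w t) (ht t))))).
      { destruct Hsn as (_ & _ & _ & _ & HU & _). apply ccont_conj. cc. }
      unfold qmom. rewrite <- !(mom_scal (h t) (Derive (h t))), <- (mom_plus (h t) (Derive (h t))) by (auto; cc).
      apply mom_ext. intros x. apply brk_identity. }
    rewrite Dsplit, M1, M2.
    transitivity (- (RtoC g * Ci) * sig (h t) k * (RtoC 2 * RtoC (/ 2)) +
      RtoC 2 * RtoC (IZR k) * (Ci * RtoC (/ 2) * mom (h t) (fun x => rc B x * gp (Derive (h t)) x)%C k + mom (h t) (fun x => rc (w t) x * rc (ht t) x)%C k))%C; [ring|].
    rewrite M3.
    transitivity (- (RtoC g * Ci) * sig (h t) k * (RtoC 2 * RtoC (/ 2)) - Ci * RtoC (IZR k) * qmom (h t) (w t) (ht t) k * (RtoC 2 * RtoC (/ 2)))%C; [ring|].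
    rewrite <- RtoC_mult, Rinv_r by lra. ring.
  - apply ctder_scal, ctder_cft; auto; [| |cc].
    + apply udiff_mult; [exact Uw|apply E_udiff| | | |].
      * eapply W_bounded; [|exact Ww]; lra.
      * eapply W_bounded; [|exact WE]; lra.
      * eapply W_bounded; [|exact Wwt]; lra.
      * apply (W_bounded (4 / 5) _ (Cmod (RtoC (IZR k)) * (160 * d) * A)); [lra|]. apply W_mult; [lra| |].
        -- apply W_scal, Wp.
        -- eapply W_mono; [| |exact WE]; lra.
    + intros s Hs. destruct (E_W s Hs). destruct (wc s Hs). cc.
Qed.

(** Conservation of volume. *)
Lemma h0_dot : ctder T (fun s => cft (rc (h s)) 0) t (RtoC 0).
Proof.
  destruct (ww_udiff _ _ _ _ _ _ _ HW Hd HT Ht) as [H1 _]. destruct (wc t Ht) as [Cw Cp].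
  apply (ctder_eq T _ _ t (cft (rc (ht t)) 0) _ (fun s => eq_refl)).
  - pose proof (ww_snap _ _ _ _ _ _ _ HW Hd Ht) as Hsn.
    destruct (mom_tr _ _ _ _ _ (w t) (ht t) 0 Hsn (fun x => eq_refl) ltac:(lia) Cw Cp) as [_ X].
    destruct (snap_W _ _ _ _ _ _ Hsn) as [Wf _]. destruct Hsn as (_ & _ & _ & _ & _ & H0).
    destruct (mom_cj_0 (h t) _ (W_cc _ _ _ Wf) (H0 0%Z ltac:(lia))) as [_ Y]. unfold gmom in X. rewrite Y in X.
    rewrite mom_cft in X. rewrite <- (Cmult_0_r (- (Ci * RtoC (/ 2)))), <- X. apply cft_ext.
    intros x. rewrite Rmult_0_l, exp_0. ring.
  - apply ctder_cft; auto. intros s Hs. apply (W_cc 1 _ d), (HW s Hs).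
Qed.

End Dynamics.


(** ** A priori bounds for water waves *)

Lemma gmom_ht : forall d h f U B w p k, snap d h (Derive h) f U B -> (forall x, f x = tr w p x) -> (0 <= k)%Z ->
  ccont (rc w) -> ccont (rc p) -> gmom h w p k = (RtoC 2 * Ci * mom h (rc p) k)%C.
Proof.
  intros d h f U B w p k Hs Hf Hk Cw Cp. destruct (mom_tr _ _ _ _ _ w p k Hs Hf Hk Cw Cp) as [_ X]. rewrite X.
  apply C_eq; unfold Re, Im; simpl; lra.
Qed.

(** The trigonometric data belong to all the spaces [W rho]; radius [3] leaves room for
    the rate [2] of the weights. *)
Lemma initial_moments : forall d h f U B w p e k, snap d h (Derive h) f U B -> (forall x, f x = tr w p x) -> (0 < k)%Z ->
  ccont (rc w) -> W 3 (rc h) e -> W 3 (rc p) e -> e <= 1 / 10 ->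
  Cmod (sig h k) + Cmod (gmom h w p k) <= 22 * e * exp (- (14 / 5) * IZR k).
Proof.
  intros d h f U B w p e k Hs Hf Hk Cw Wh Wp He. pose proof (W_ge0 _ _ _ Wh) as He0.
  assert (Hk1 : 1 <= IZR k) by (apply IZR_le; lia).
  rewrite (gmom_ht _ _ _ _ _ w p k Hs Hf) by (try lia; cc). rewrite !Cmod_mult, Cmod_R, Cmod_Ci, Rabs_pos_eq by lra.
  pose proof (sig_bound 3 h e k ltac:(lra) Wh) as HS. rewrite Z.abs_eq in HS by lia.
  pose proof (mom_bound 3 h e (rc p) e k ltac:(lra) Wh Wp) as HP. rewrite Z.abs_eq in HP by lia.
  assert (X1 : 2 * (exp (IZR k * e) - 1) * exp (- (3) * IZR k) <= 20 * e * exp (- (14 / 5) * IZR k)).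
  { apply Rle_trans with (2 * (IZR k * e * exp (IZR k * e)) * exp (- (3) * IZR k)).
    - apply Rmult_le_compat_r; [epos|]. apply Rmult_le_compat_l; [lra|]. apply exp_m1. nra.
    - apply Rle_trans with (2 * (10 * exp (1 / 10 * IZR k) * e * exp (IZR k * e)) * exp (- (3) * IZR k)).
      + apply Rmult_le_compat_r; [epos|]. apply Rmult_le_compat_l; [lra|]. apply Rmult_le_compat_r; [epos|].
        apply Rmult_le_compat_r; auto. pose proof (x_exp (1 / 10) (IZR k) ltac:(lra)). lra.
      + exps; [lra|nra]. }
  assert (X2 : e * exp (- (3 - e) * IZR k) <= e * exp (- (14 / 5) * IZR k)).
  { apply Rmult_le_compat_l; auto. apply exp_mono. nra. }
  lra.
Qed.

Lemma pw_wz : forall N lam k t, (0 < k)%Z -> pw (phiN (7 / 10) N) lam k t = wz N (lam * t) k.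
Proof.
  intros N lam k t Hk. unfold pw, wz. destruct (Z.ltb_spec k 0); [lia|]. f_equal. ring.
Qed.

(** Only positive modes are propagated; the others are extended by zero. *)
Definition posp (u : Z -> C) (k : Z) : C := if Z.ltb 0 k then u k else RtoC 0.

(** [propagate_decay] applied to [sigma] and [G], with [nl_est] for the nonlinearity.  The
    result depends on the data only, not on the rough bound [d]. *)
Lemma ww_prop : forall g T d h w ht e al Tm, 0 < g -> 0 < T <= Tm -> ww_on g T d h w ht -> d <= 1 / 200000 ->
  0 < al <= 1 -> 2 * al * Tm <= 1 / 10 -> 320 * d <= al / 16 ->
  W 3 (rc (h 0)) e -> W 3 (rc (ht 0)) e -> e <= 1 / 10 -> 55 * e * exp (g / al * Tm) < al / 16 ->
  forall t k, time_interval T t -> (0 < k)%Z ->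
   al * Cmod (sig (h t) k) + Cmod (gmom (h t) (w t) (ht t) k) <= 55 * e * exp (g / al * Tm) * exp (- (19 / 10) * IZR k).
Proof.
  intros g T d h w ht e al Tm Hg HT Hon Hd Hal HalT Hd2 Wh0 Wp0 He Hsm t k Ht Hk.
  pose proof (W_ge0 _ _ _ Wh0) as He0.
  assert (I0 : time_interval T 0) by (unfold time_interval; lra).
  assert (Hd0 : 0 <= d) by (apply (W_ge0 1 (rc (h 0))), (Hon 0 I0)).
  assert (HgT : exp (g / al * T) <= exp (g / al * Tm)).
  { apply exp_mono, Rmult_le_compat_l; [|lra]. pos. }
  set (b := fun k s => posp (sig (h s)) k). set (v := fun k s => posp (gmom (h s) (w s) (ht s)) k).
  assert (Hsn : forall s, time_interval T s -> snap (20 * d) (h s) (Derive (h s)) (tr (w s) (ht s)) (quot (h s) (tr (w s) (ht s))) (80 * d)).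
  { intros s Hs. eapply ww_snap; eauto. }
  set (q := fun k s => Cmod (posp (qmom (h s) (w s) (ht s)) k)).
  assert (Hp : forall N, 0 <= N -> propagating ctder T g al (2 * al) (al / 16) (17 / 20) 2 (phiN (7 / 10) N) b v
    (fun k s => - (Ci * RtoC (IZR k)) * v k s)%C
    (fun k s => posp (fun k => - (Ci * RtoC g) * sig (h s) k - Ci * RtoC (IZR k) * qmom (h s) (w s) (ht s) k)%C k) q).
  { intros N HN. unfold q. split; [|split; [|split; [|split]]].
    - intros j s Hs. unfold b, v, posp. destruct (Z.ltb_spec 0 j).
      + split; [eapply sigma_dot; eauto; lra|eapply G_dot; eauto; lra].
      + assert (Z0 : ctder T (fun _ => RtoC 0) s (RtoC 0)).
        { intros eps Heps. exists 1. split; [lra|]. intros r _ _.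
          replace (RtoC 0 - RtoC 0 - RtoC (r - s) * RtoC 0)%C with (RtoC 0) by ring. rewrite Cmod_0.
          pos. }
        split; [|auto]. eapply ctder_eq; [intros; reflexivity| |exact Z0]. ring.
    - intros j s Hs. rewrite Cmod_mult, Cmod_opp, Cmod_Cik. lra.
    - intros j s Hs. unfold b, posp. destruct (Z.ltb_spec 0 j).
      + eapply Rle_trans; [apply Cmod_triangle|]. rewrite Cmod_opp, !Cmod_mult, Cmod_opp, Cmod_mult, !Cmod_R, Cmod_Ci.
        rewrite (Rabs_pos_eq g) by lra. rewrite <- abs_IZR. lra.
      + rewrite Cmod_0. lra.
    - intros j s Hs. unfold b, v, posp.
      assert (E1 : 0 <= 2 * exp (- (17 / 20) * zabs j)) by (pose proof (exp_pos (- (17 / 20) * zabs j)); lra).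
      destruct (Z.ltb_spec 0 j); [|rewrite Cmod_0; lra]. pose proof (IZR_abs_pos j) as Hj.
      destruct (Hon s Hs) as (Wh & Ww & _). destruct (wc g T d h w ht Hon Hd s Hs) as [Cw Cp]. split.
      + eapply Rle_trans; [apply (sig_bound 1 (h s) d); [lra|auto]|].
        apply Rle_trans with (2 * exp (zabs j * d) * exp (- (1) * zabs j)).
        { apply Rmult_le_compat_r; [epos|lra]. }
        exps; [lra|nra].
      + destruct (mom_tr _ _ _ _ _ (w s) (ht s) j (Hsn s Hs) (fun x => eq_refl) ltac:(lia) Cw Cp) as [X _].
        rewrite X, Cmod_mult, Cmod_R, Rabs_pos_eq by lra. apply Rmult_le_compat_l; [lra|].
        eapply Rle_trans; [apply (mom_bound (9 / 10) (h s) d (rc (w s)) d); auto; [lra|]|].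
        { eapply W_mono; [| |exact Wh]; lra. }
        rewrite <- (Rmult_1_l (exp (- (17 / 20) * _))). apply Rmult_le_compat; [lra|epos|lra|]. apply exp_mono. nra.
    - intros s Hs Hb D HD. replace (2 * al / 2) with al by field. assert (0 <= s <= Tm) by (unfold time_interval in Hs; lra).
      assert (bB : forall i, (0 < i)%Z -> b i s = sig (h s) i /\ v i s = mom (h s) (cj (tr (w s) (ht s))) i).
      { intros i Hi. unfold b, v, posp. destruct (Z.ltb_spec 0 i); [auto|lia]. }
      pose proof (nl_est (20 * d) (h s) (Derive (h s)) _ _ (80 * d) N (2 * al * s) al (al / 16) D (Hsn s Hs) HN) as NL.
      eapply bnd_mono; [apply NL|].
      + nra.
      + auto.
      + lra.
      + lra.
      + assert (al / 16 / al = 1 / 16) by (field; lra). lra.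
      + eapply bnd_ext; [exact Hb|]. intros i. cbv beta. destruct (Z.ltb_spec 0 i).
        * destruct (bB i) as [E1 E2]; auto. rewrite pw_wz by auto. unfold b, v in *. now rewrite E1, E2.
        * unfold b, v, posp. destruct (Z.ltb_spec 0 i); [lia|]. rewrite Cmod_0. ring.
      + eapply bnd_ext; [exact HD|]. intros i. cbv beta. destruct (Z.ltb_spec 0 i).
        * destruct (bB i) as [E1 E2]; auto. rewrite pw_wz by auto. rewrite E1, E2.
          unfold kp. rewrite Z.abs_eq, Z.max_l by lia. ring.
        * unfold b, v, posp. destruct (Z.ltb_spec 0 i); [lia|]. rewrite Cmod_0. ring.
      + intros i. cbv beta. unfold posp. destruct (Z.ltb_spec 0 i).
        * rewrite pw_wz by auto. unfold kp, qmom. rewrite Z.abs_eq, Z.max_l by lia. right; ring.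
        * rewrite Cmod_0. unfold kp. rewrite Z.max_r by lia. right; ring. }
  assert (H0 : bnd (fun k => exp (2 * zabs k) * (al * Cmod (b k 0) + Cmod (v k 0))) (55 * e)).
  { eapply bnd_le; [apply (sum_upper _ (22 * e) (4 / 5)); [lra|lra| |]|lra].
    - intros j Hj. unfold b, v, posp. destruct (Z.ltb_spec 0 j); [lia|]. rewrite Cmod_0. ring.
    - intros j Hj. unfold b, v, posp. destruct (Z.ltb_spec 0 j); [|lia].
      destruct (wc g T d h w ht Hon Hd 0 I0) as [Cw Cp].
      pose proof (initial_moments _ _ _ _ _ _ _ e j (Hsn 0 I0) (fun x => eq_refl) Hj Cw Wh0 Wp0 He) as X.
      apply Rle_trans with (exp (2 * IZR j) * (22 * e * exp (- (14 / 5) * IZR j))).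
      + pose proof (Cmod_ge_0 (sig (h 0) j)). pose proof (Cmod_ge_0 (gmom (h 0) (w 0) (ht 0) j)).
        apply Rmult_le_compat; [epos|nra| |nra]. rewrite Z.abs_eq by lia. lra.
      + expe. }
  assert (Hk1 : 1 <= IZR k) by (apply IZR_le; lia).
  assert (Hm : 55 * e * exp (g / al * T) <= 55 * e * exp (g / al * Tm)) by (apply Rmult_le_compat_l; lra).
  assert (X : al * Cmod (b k t) + Cmod (v k t) <= 55 * e * exp (g / al * T) * exp (- (19 / 10) * zabs k)).
  { apply (propagate_decay T g al (al / 16) (7 / 10) (17 / 20) 2 (55 * e) b v _ _ _ ltac:(lra) ltac:(lra) ltac:(lra) ltac:(nra)
      ltac:(lra) ltac:(lra) ltac:(lra) Hp H0 ltac:(lra) t k Ht). }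
  unfold b, v, posp in X.
  destruct (Z.ltb_spec 0 k); [|lia]. rewrite Z.abs_eq in X by lia.
  eapply Rle_trans; [exact X|]. apply Rmult_le_compat_r; [epos|auto].
Qed.


(** One step of the bootstrap: a rough bound on an interval gives a bound
    proportional to the data at its end. *)
Lemma ww_step : forall g T d h w ht e al Tm, 0 < g -> 0 < T <= Tm -> ww_on g T d h w ht -> d <= 1 / 200000 ->
  0 < al <= 1 -> 2 * al * Tm <= 1 / 10 -> 320 * d <= al / 16 ->
  W 3 (rc (h 0)) e -> W 3 (rc (ht 0)) e -> e <= 1 / 10 -> 55 * e * exp (g / al * Tm) < al / 16 ->
  let Y := 55 * e * exp (g / al * Tm) in
  forall t, time_interval T t -> cft (rc (h t)) 0 = cft (rc (h 0)) 0 /\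
    W 1 (rc (h t)) (2 * e + 6 * (Y / al)) /\ W (9 / 10) (rc (w t)) (4 * Y).
Proof.
  intros g T d h w ht e al Tm Hg HT Hon Hd Hal HalT Hd2 Wh0 Wp0 He Hsm Y t Ht.
  pose proof (W_ge0 _ _ _ Wh0) as He0. pose proof (exp_pos (g / al * Tm)) as HE.
  assert (HY : 0 <= Y) by (unfold Y; pos).
  pose proof (ww_snap _ _ _ _ _ _ _ Hon Hd Ht) as Hsn.
  pose proof (ww_prop g T d h w ht e al Tm Hg HT Hon Hd Hal HalT Hd2 Wh0 Wp0 He Hsm t) as HP. fold Y in HP.
  assert (Z0 : cft (rc (h t)) 0 = cft (rc (h 0)) 0).
  { apply (ctder_const T (fun s => cft (rc (h s)) 0)); auto; [lra|]. intros s Hs. eapply h0_dot; eauto. lra. }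
  split; [auto|]. split.
  - apply (recover_h (20 * d) (h t) (Derive (h t))); auto; try apply Hsn.
    + pos.
    + intros k Hk. specialize (HP k Ht Hk). pose proof (Cmod_ge_0 (gmom (h t) (w t) (ht t) k)).
      apply Rmult_le_reg_l with al; [lra|]. replace (al * (Y / al * exp (- (19 / 10) * IZR k))) with (Y * exp (- (19 / 10) * IZR k)) by (field; lra).
      lra.
    + rewrite Z0. apply (bnd_term _ e 0%Z (W_summable 3 _ e ltac:(lra) Wh0)).
  - apply (tr_parts (w t) (ht t)). eapply recover_f; [exact Hsn|auto|].
    intros k Hk. specialize (HP k Ht Hk). unfold gmom in HP. pose proof (Cmod_ge_0 (sig (h t) k)). nra.
Qed.

(** With this rate, the weights lose at most [1 / 10] in the exponent over [0,Tm]. *)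
Lemma small_rate : forall Tm, 0 < Tm -> exists al, 0 < al <= 1 /\ 2 * al * Tm <= 1 / 10.
Proof.
  intros Tm HTm. assert (Hi : 0 < / (20 * Tm)) by (apply Rinv_0_lt_compat; lra). exists (Rmin 1 (/ (20 * Tm))).
  split; [split; [apply Rmin_glb_lt; lra|apply Rmin_l]|].
  apply Rle_trans with (2 * / (20 * Tm) * Tm); [|right; field; lra].
  apply Rmult_le_compat_r; [lra|]. apply Rmult_le_compat_l; [lra|apply Rmin_r].
Qed.

(** The norms in [X_1] and [X_{9/10}] are continuous in time, and by [ww_step] they are
    [O(e)] at [t] if they are at most [del] up to [t]; for small [e] this improves the
    assumption, and continuous induction applies. *)
Lemma ww_bound : forall g Tm, 0 < g -> 0 < Tm -> exists K e0, 0 < K /\ 0 < e0 /\ K * e0 <= 1 / 200000 /\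
  forall e hinit hdot T h w, 0 < T <= Tm -> e <= e0 -> W 3 (rc hinit) e -> W 3 (rc hdot) e ->
  water_waves_solution g hinit hdot T h w ->
  exists ht, ww_on g T (K * e) h w ht /\ (forall x, h 0 x = hinit x /\ ht 0 x = hdot x) /\
    forall t, time_interval T t -> cft (rc (h t)) 0 = cft (rc (h 0)) 0.
Proof.
  intros g Tm Hg HTm. destruct (small_rate Tm HTm) as (al & Hal & HalT).
  set (E := exp (g / al * Tm)).
  assert (HE : 1 <= E).
  { unfold E. rewrite <- exp_0. apply exp_mono. apply Rmult_le_pos; [|lra]. pos. }
  set (del := al / 200000). assert (Hdel : 0 < del <= 1 / 200000) by (unfold del; lra).
  assert (Hia : 1 <= / al) by (rewrite <- Rinv_1; apply Rinv_le_contravar; lra).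
  set (K := 2 + 6 * (55 * E * / al) + 4 * (55 * E)).
  assert (HEa : E <= E * / al) by nra.
  assert (HK : 552 <= K) by (unfold K; lra).
  exists K, (del / (2 * K)). split; [lra|].
  split; [apply Rmult_lt_0_compat; [lra|apply Rinv_0_lt_compat; lra]|].
  assert (HK2 : K * (del / (2 * K)) = del / 2) by (field; lra).
  split; [rewrite HK2; lra|].
  intros e hinit hdot T h w HT He Whi Whd (Ch & Cw & phi & ht & Hsol & Hini).
  pose proof (W_ge0 _ _ _ Whi) as He0.
  assert (HKe : K * e <= del / 2) by (rewrite <- HK2; apply Rmult_le_compat_l; lra).
  assert (Wh0 : W 3 (rc (h 0)) e).
  { apply (W_ext _ (rc hinit)); auto. intros x. unfold rc. now rewrite (proj1 (Hini x)). }
  assert (Wp0 : W 3 (rc (ht 0)) e).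
  { apply (W_ext _ (rc hdot)); auto. intros x. unfold rc. now rewrite (proj2 (Hini x)). }
  assert (I0 : time_interval T 0) by (unfold time_interval; lra).
  exists ht.
  assert (Wh : forall t, time_interval T t -> W 1 (rc (h t)) (nrm 1 (h t))).
  { intros t Ht. destruct (in_X_W _ _ (proj1 (Ch t Ht))) as (A & HA & _). eapply nrm_W; eauto. }
  assert (Ww1 : forall t, time_interval T t -> exists A, W (9 / 10) (rc (w t)) A).
  { intros t Ht. destruct (in_X_W _ _ (proj1 (Cw t Ht))) as (A & HA & _). exists A. eapply W_mono; [| |exact HA]; lra. }
  assert (Ww : forall t, time_interval T t -> W (9 / 10) (rc (w t)) (nrm (9 / 10) (w t))).
  { intros t Ht. destruct (Ww1 t Ht) as [A HA]. eapply nrm_W; eauto. }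
  assert (Hon : forall T' d, 0 <= T' <= T -> (forall s, 0 <= s <= T' -> nrm 1 (h s) <= d /\ nrm (9 / 10) (w s) <= d) ->
    ww_on g T' d h w ht).
  { intros T' d HT' Hs s Hs'. assert (Ht : time_interval T s) by (unfold time_interval in *; lra).
    destruct (Hsol s Ht) as [S1 S2]. destruct (Hs s Hs') as [N1 N2].
    split; [eapply W_mono; [apply Rle_refl|exact N1|auto]|]. split; [eapply W_mono; [apply Rle_refl|exact N2|auto]|].
    split; [exists (phi s); exact S1|]. intros x. destruct (S2 x) as (D1 & _ & D2).
    split; apply (tder_sub T); try lra; apply time_derive_tder; auto. }
  set (Y := 55 * e * exp (g / al * Tm)).
  assert (HY : Y = 55 * E * e) by (unfold Y, E; ring).
  assert (HYa : 2 * e + 6 * (Y / al) + 4 * Y = K * e) by (rewrite HY; unfold K; field; lra).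
  assert (HYp : 0 <= Y) by (rewrite HY; nra).
  assert (HYa0 : 0 <= Y / al) by (pos).
  assert (HYs : Y < al / 16) by (unfold del in *; lra).
  assert (Nn : forall s, time_interval T s -> 0 <= nrm 1 (h s) /\ 0 <= nrm (9 / 10) (w s)).
  { intros s Hs. split; [apply (nrm_W _ _ _ (Wh s Hs))|apply (nrm_W _ _ _ (Ww s Hs))]. }
  assert (step : forall t, 0 < t <= T -> (forall s, 0 <= s <= t -> nrm 1 (h s) + nrm (9 / 10) (w s) <= del) ->
    cft (rc (h t)) 0 = cft (rc (h 0)) 0 /\ nrm 1 (h t) <= 2 * e + 6 * (Y / al) /\ nrm (9 / 10) (w t) <= 4 * Y).
  { intros t Ht Hs.
    destruct (ww_step g t del h w ht e al Tm Hg ltac:(lra)) with (t := t) as (A & B & C); auto; try lra.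
    - apply Hon; [lra|]. intros s Hs'. destruct (Nn s) as [N1 N2]; [unfold time_interval; lra|]. specialize (Hs s Hs'). lra.
    - unfold del. lra.
    - unfold time_interval. lra.
    - split; [auto|]. split; eapply nrm_le; eauto. }
  (* Initially [d_t h] is known, and the elliptic estimate bounds [w]. *)
  assert (init : nrm 1 (h 0) <= e /\ nrm (9 / 10) (w 0) <= 88 * e).
  { split; [apply nrm_le; eapply W_mono; [| |exact Wh0]; lra|]. apply nrm_le.
    assert (Cw0 : ccont (rc (w 0))) by (eapply W_cc, Ww; auto).
    assert (Hs0 : snap (20 * e) (h 0) (Derive (h 0)) (tr (w 0) (ht 0)) (quot (h 0) (tr (w 0) (ht 0))) (80 * e)).
    { apply (snap_initial e _ _ _ (phi 0)); try lra.
      - eapply W_mono; [| |exact Wh0]; lra.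
      - eapply W_mono; [| |exact Wp0]; lra.
      - apply Cw0.
      - eapply Ww; auto.
      - apply (Hsol 0 I0). }
    apply (tr_parts (w 0) (ht 0)). replace (88 * e) with (4 * (22 * e)) by ring. eapply recover_f; [exact Hs0|lra|].
    intros k Hk.
    pose proof (initial_moments _ _ _ _ _ (w 0) (ht 0) e k Hs0 (fun x => eq_refl) Hk Cw0 Wh0 Wp0 ltac:(lra)) as X.
    unfold gmom in X. pose proof (Cmod_ge_0 (sig (h 0) k)).
    assert (22 * e * exp (- (14 / 5) * IZR k) <= 22 * e * exp (- (19 / 10) * IZR k)); [|lra].
    apply Rmult_le_compat_l; [lra|]. apply exp_mono. assert (1 <= IZR k) by (apply IZR_le; lia). lra. }
  assert (boot : forall t, time_interval T t -> nrm 1 (h t) + nrm (9 / 10) (w t) < del).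
  { apply (cont_induction (fun t => nrm 1 (h t) + nrm (9 / 10) (w t)) T del); [lra| |nra|].
    - intros t Ht eps Heps.
      destruct (in_CX_near 1 T h t Ch Ht (eps / 2) ltac:(lra)) as (d1 & Hd1 & N1).
      destruct (in_CX_near 1 T w t Cw Ht (eps / 2) ltac:(lra)) as (d2 & Hd2 & N2).
      exists (Rmin d1 d2). split; [apply Rmin_glb_lt; auto|]. intros s Hs Hst.
      pose proof (Rmin_l d1 d2). pose proof (Rmin_r d1 d2).
      pose proof (nrm_dist 1 (h s) (h t) (eps / 2) _ _ (Wh s Hs) (Wh t Ht) (N1 s Hs ltac:(lra))) as Q1.
      assert (N2' : W (9 / 10) (rc (fun x => w s x - w t x)) (eps / 2)).
      { eapply W_mono; [| |apply (N2 s Hs ltac:(lra))]; lra. }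
      pose proof (nrm_dist (9 / 10) (w s) (w t) (eps / 2) _ _ (Ww s Hs) (Ww t Ht) N2') as Q2.
      apply Rabs_le_between in Q1. apply Rabs_le_between in Q2. apply Rabs_le. lra.
    - intros t Ht Hs. destruct (Req_dec t 0) as [->|Hn]; [nra|]. unfold time_interval in Ht.
      destruct (step t ltac:(lra) Hs) as (_ & A & B). lra. }
  assert (fin : forall t, time_interval T t -> nrm 1 (h t) + nrm (9 / 10) (w t) <= K * e /\ cft (rc (h t)) 0 = cft (rc (h 0)) 0).
  { intros t Ht. destruct (Req_dec t 0) as [->|Hn]; [split; [nra|auto]|]. unfold time_interval in Ht.
    destruct (step t ltac:(lra)) as (Z0 & A & B); [|split; [lra|auto]].
    intros s Hs. left. apply boot. unfold time_interval. lra. }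
  split; [|split; [auto|intros t Ht; apply (fin t Ht)]].
  apply Hon; [lra|]. intros s Hs. destruct (fin s Hs) as [X _]. destruct (Nn s Hs). lra.
Qed.


(** * The quadratic model *)

Lemma cft_rc_conj : forall rho u A k, W rho (rc u) A -> cft (rc u) (- k) = Cconj (cft (rc u) k).
Proof.
  intros rho u A k Hu. rewrite <- (Z.opp_involutive k) at 2. rewrite <- cft_conj by cc.
  apply cft_ext. intros x. unfold rc. apply C_eq; simpl; ring.
Qed.

(** The symmetry of the symbol makes the series real, so that taking the real part in
    the definition changes nothing. *)
Lemma multiplier_W : forall m rho rho' u A A', 0 <= rho' -> W rho (rc u) A -> (forall k, m (- k)%Z = Cconj (m k)) ->
  bnd (fun k => exp (rho' * zabs k) * Cmod (m k * cft (rc u) k)) A' ->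
  W rho' (rc (multiplier m u)) A' /\ forall k, cft (rc (multiplier m u)) k = (m k * cft (rc u) k)%C.
Proof.
  intros m rho rho' u A A' Hr Hu Hm Hb. set (c := fun k => (m k * cft (rc u) k)%C).
  assert (Hs : summable c).
  { exists A'. eapply bnd_mono; [exact Hb|]. intros k. cbv beta. fold (c k). pose proof (expw_ge_1 rho' k Hr).
    pose proof (Cmod_ge_0 (c k)). nra. }
  pose proof (fser_ccont c Hs) as Cc. pose proof (fser_cper c) as Pc.
  assert (Hreal : forall x, Cconj (fser c x) = fser c x).
  { apply cft_inj; auto; [cc|intros x; now rewrite Pc|]. intros k. rewrite cft_conj by cc. rewrite !cft_fser by auto.
    unfold c. rewrite Hm, (cft_rc_conj rho u A) by auto. rewrite Cconj_mul, !Cconj_conj. reflexivity. }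
  assert (E : forall x, fser c x = rc (multiplier m u) x).
  { intros x. specialize (Hreal x). unfold rc. apply C_eq.
    - change (real (Lim_seq (fun N => Re (csum (win N) (fun k => c k * cis (IZR k * x))%C))) = multiplier m u x).
      unfold multiplier. f_equal. apply Lim_seq_ext. intros N. rewrite Zsum_csum. f_equal. apply csum_ext.
      intros k _. unfold c. rewrite fourier_cft; [reflexivity|]. eapply W_cont; eauto.
    - apply (f_equal Im) in Hreal. change (- Im (fser c x) = Im (fser c x)) in Hreal. change (Im (fser c x) = 0). lra. }
  split.
  - apply (W_ext _ _ _ _ E), W_of_bnd; auto. eapply bnd_ext; [exact Hb|]. intros k. cbv beta. now rewrite cft_fser.
  - intros k. transitivity (cft (fser c) k); [|now apply cft_fser]. apply cft_ext. auto.
Qed.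

Lemma Lambda_W : forall rho rho' u A, 0 <= rho' < rho -> W rho (rc u) A ->
  W rho' (rc (Lambda u)) (A / (rho - rho')) /\ forall k, cft (rc (Lambda u)) k = (RtoC (zabs k) * cft (rc u) k)%C.
Proof.
  intros rho rho' u A Hr Hu. apply (multiplier_W _ rho rho' u A); auto; [lra| |].
  - intros k. rewrite Z.abs_opp. apply C_eq; simpl; ring.
  - eapply bnd_ext; [apply (bnd_dweight rho rho' (cft (rc u)) A); [lra|apply Hu]|].
    intros k. cbv beta. rewrite Cmod_mult, Cmod_R, Rabs_pos_eq by apply IZR_abs_pos. reflexivity.
Qed.

Lemma Hilbert_W : forall rho u A, 0 <= rho -> W rho (rc u) A ->
  W rho (rc (Hilbert u)) A /\ forall k, cft (rc (Hilbert u)) k = (- Ci * RtoC (IZR (Z.sgn k)) * cft (rc u) k)%C.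
Proof.
  intros rho u A Hr Hu. apply (multiplier_W _ rho rho u A); auto.
  - intros k. rewrite Z.sgn_opp, opp_IZR. apply C_eq; simpl; ring.
  - eapply bnd_mono; [apply Hu|]. intros k. cbv beta. apply Rmult_le_compat_l; [epos|].
    rewrite !Cmod_mult, Cmod_opp, Cmod_Ci, Cmod_R, <- abs_IZR. pose proof (Cmod_ge_0 (cft (rc u) k)).
    assert (zabs (Z.sgn k) <= 1) by (apply IZR_le; lia). nra.
Qed.

Lemma W_mult_R : forall rho u v A B, 0 <= rho -> W rho (rc u) A -> W rho (rc v) B -> W rho (rc (fun x => u x * v x)) (A * B).
Proof.
  intros. apply (W_ext _ (fun x => rc u x * rc v x)%C); [intros; unfold rc; now rewrite RtoC_mult|]. now apply W_mult.
Qed.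

Lemma W_plus_R : forall rho u v A B, W rho (rc u) A -> W rho (rc v) B -> W rho (rc (fun x => u x + v x)) (A + B).
Proof.
  intros. apply (W_ext _ (fun x => rc u x + rc v x)%C); [intros; unfold rc; now rewrite RtoC_plus|]. now apply W_plus.
Qed.

Lemma cft_mult_R : forall rho u v A B k, 0 <= rho -> W rho (rc u) A -> W rho (rc v) B ->
  cft (rc (fun x => u x * v x)) k = conv (cft (rc u)) (cft (rc v)) k.
Proof.
  intros rho u v A B k Hr Hu Hv. rewrite <- cft_mult; [|cc|apply Hu| |cc|apply Hv].
  - apply cft_ext. intros x. unfold rc. now rewrite RtoC_mult.
  - exists A. now apply (W_summable rho).
Qed.

Lemma cft_lin3 : forall a b c F G H k, ccont F -> ccont G -> ccont H ->
  cft (fun x => a * F x + b * G x + c * H x)%C k = (a * cft F k + b * cft G k + c * cft H k)%C.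
Proof. intros. rewrite !cft_plus, !cft_scal by cc. reflexivity. Qed.

(** The quadratic part of the acceleration. *)
Definition qm_rem (g : R) (h p : R -> R) (x : R) : R :=
  - Lambda (fun y => (Rabs (Hilbert p y)) ^ 2) x + g * Lambda (fun y => h y * Lambda h y) x
  + g * Derive (fun y => h y * Derive h y) x.

(** The coefficients of the terms quadratic in [h], with [c] those of [h]. *)
Definition qm_sym (c : Z -> C) (k : Z) : C :=
  (RtoC (zabs k) * conv c (fun j => RtoC (zabs j) * c j) k + Ci * RtoC (IZR k) * conv c (dcoef c) k)%C.

Lemma qm_sym_eq : forall rho h M k, 1 / 5 <= rho -> W rho (rc h) M ->
  (RtoC (zabs k) * cft (rc (fun y => h y * Lambda h y)%R) k + Ci * RtoC (IZR k) * cft (rc (fun y => h y * Derive h y)%R) k)%C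
  = qm_sym (cft (rc h)) k.
Proof.
  intros rho h M k Hr Hh.
  destruct (Lambda_W rho (rho - 1 / 20) h M ltac:(lra) Hh) as [L2 L2c].
  destruct (real_deriv rho (rho - 1 / 20) h M ltac:(lra) Hh) as (_ & D1 & D1c).
  assert (Hh2 : W (rho - 1 / 20) (rc h) M) by (eapply W_mono; [| |exact Hh]; lra).
  rewrite (cft_mult_R (rho - 1 / 20) h (Lambda h) _ _ k ltac:(lra) Hh2 L2), (cft_mult_R (rho - 1 / 20) h (Derive h) _ _ k ltac:(lra) Hh2 D1).
  unfold qm_sym. f_equal; f_equal; apply Zser_ext; intros j; [now rewrite L2c|now rewrite D1c].
Qed.

Lemma qm_rem_W : forall g rho h p M, 0 <= g -> 1 / 5 <= rho -> W rho (rc h) M -> W rho (rc p) M ->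
  W (rho - 1 / 10) (rc (qm_rem g h p)) ((20 + 800 * g) * M ^ 2) /\
  forall k, cft (rc (qm_rem g h p)) k =
    (- (RtoC (zabs k) * cft (rc (fun y => Hilbert p y * Hilbert p y)%R) k) + RtoC g * (RtoC (zabs k) * cft (rc (fun y => h y * Lambda h y)%R) k + Ci * RtoC (IZR k) * cft (rc (fun y => h y * Derive h y)%R) k))%C.
Proof.
  intros g rho h p M Hg Hr Hh Hp.
  destruct (Hilbert_W rho p M ltac:(lra) Hp) as [HH _].
  assert (HH2 : W rho (rc (fun y => Rabs (Hilbert p y) ^ 2)) (M * M)).
  { apply (W_ext _ (rc (fun y => Hilbert p y * Hilbert p y))).
    - intros x. unfold rc. f_equal. rewrite pow2_abs. ring.
    - apply W_mult_R; auto; lra. }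
  destruct (Lambda_W rho (rho - 1 / 10) _ _ ltac:(lra) HH2) as [L1 L1c].
  destruct (Lambda_W rho (rho - 1 / 20) h M ltac:(lra) Hh) as [L2 L2c].
  assert (Hh2 : W (rho - 1 / 20) (rc h) M) by (eapply W_mono; [| |exact Hh]; lra).
  assert (HL : W (rho - 1 / 20) (rc (fun y => h y * Lambda h y)) (M * (M / (rho - (rho - 1 / 20))))) by (apply W_mult_R; auto; lra).
  destruct (Lambda_W (rho - 1 / 20) (rho - 1 / 10) _ _ ltac:(lra) HL) as [L3 L3c].
  destruct (real_deriv rho (rho - 1 / 20) h M ltac:(lra) Hh) as (_ & D1 & D1c).
  assert (HD : W (rho - 1 / 20) (rc (fun y => h y * Derive h y)) (M * (M / (rho - (rho - 1 / 20))))) by (apply W_mult_R; auto; lra).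
  destruct (real_deriv (rho - 1 / 20) (rho - 1 / 10) _ _ ltac:(lra) HD) as (_ & D2 & D2c).
  assert (E : forall x, (RtoC (-1) * rc (Lambda (fun y => Rabs (Hilbert p y) ^ 2)%R) x + RtoC g * rc (Lambda (fun y => h y * Lambda h y)%R) x +
    RtoC g * rc (Derive (fun y => h y * Derive h y)%R) x)%C = rc (qm_rem g h p) x).
  { intros x. unfold rc, qm_rem. rewrite <- !RtoC_mult, <- !RtoC_plus. f_equal. ring. }
  split.
  - apply (W_ext _ _ _ _ E).
    eapply W_mono; [apply Rle_refl| |exact (W_plus _ _ _ _ _ (W_plus _ _ _ _ _ (W_scal _ (RtoC (-1)) _ _ L1) (W_scal _ (RtoC g) _ _ L3)) (W_scal _ (RtoC g) _ _ D2))].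
    rewrite !Cmod_R, (Rabs_pos_eq g), Rabs_left by lra.
    replace (M * M / (rho - (rho - 1 / 10))) with (10 * M ^ 2) by (field; lra).
    replace (M * (M / (rho - (rho - 1 / 20))) / (rho - 1 / 20 - (rho - 1 / 10))) with (400 * M ^ 2) by (field; lra). nra.
  - intros k. rewrite <- (cft_ext _ _ E).
    assert (C1 := W_cc _ _ _ L1). assert (C2 := W_cc _ _ _ L3). assert (C3 := W_cc _ _ _ D2).
    rewrite (cft_lin3 _ _ _ _ _ _ k C1 C2 C3), L1c, L3c, D2c. unfold dcoef at 1.
    rewrite (cft_ext (rc (fun y => Rabs (Hilbert p y) ^ 2)) (rc (fun y => Hilbert p y * Hilbert p y))).
    2:{ intros x. unfold rc. f_equal. rewrite pow2_abs. ring. }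
    replace (RtoC (-1)) with (- (RtoC 1))%C by (apply C_eq; simpl; ring). ring.
Qed.


Lemma bnd_Zser_abs : forall a, summable (fun k => RtoC (a k)) -> (forall k, 0 <= a k) ->
  bnd a (Cmod (Zser (fun k => RtoC (a k)))).
Proof.
  intros a Hs Ha. apply bnd_win; auto. intros N. apply le_epsilon. intros eps Heps.
  destruct (summable_zlim _ Hs eps Heps) as (N0 & HN). set (N' := max N N0).
  apply Rle_trans with (lsum (win N') a).
  - apply lsum_incl; auto using win_NoDup. intros k Hk. apply win_in. apply win_in in Hk. unfold N'. lia.
  - specialize (HN N' ltac:(unfold N'; lia)). rewrite csum_RtoC in HN.
    rewrite <- (Rabs_pos_eq (lsum (win N') a)) by now apply lsum_nonneg. rewrite <- Cmod_R.
    eapply Rle_trans; [apply (Cmod_le_sub _ (Zser (fun k => RtoC (a k))))|]. lra.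
Qed.

Lemma Zser_dom : forall u a, summable (fun k => RtoC (a k)) -> (forall k, Cmod (u k) <= a k) ->
  Cmod (Zser u) <= Cmod (Zser (fun k => RtoC (a k))).
Proof.
  intros u a Hs Hu. apply Zser_Cmod. eapply bnd_mono; [|exact Hu]. apply bnd_Zser_abs; auto.
  intros k. eapply Rle_trans; [apply Cmod_ge_0|apply Hu].
Qed.

(** The symbols of the two terms quadratic in [h] cancel unless [k] and [k - j] have
    opposite signs, and then [|j| >= 1]: what remains is one derivative of a product of
    two unknowns [|j| h_j], in which the mean of [h] does not appear. *)
Lemma qm_symbol : forall j k, Rabs (zabs k * zabs (k - j) - IZR k * IZR (k - j)) <=
  2 * zabs k * (zabs j * zabs (k - j)).
Proof.
  intros j k. rewrite <- !mult_IZR, <- minus_IZR, <- abs_IZR. apply IZR_le.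
  set (l := (k - j)%Z). assert (E : j = (k - l)%Z) by (unfold l; lia). clearbody l. subst j.
  assert (Em : (Z.abs k * Z.abs l = Z.abs (k * l))%Z) by (symmetry; apply Z.abs_mul). rewrite Em.
  replace (2 * Z.abs k * (Z.abs (k - l) * Z.abs l))%Z with (2 * Z.abs (k - l) * (Z.abs k * Z.abs l))%Z by ring. rewrite Em.
  assert (H : (k * l < 0 -> 1 <= Z.abs (k - l))%Z) by (intros; assert (k <> l) by nia; lia).
  set (m := (k * l)%Z) in *. clearbody m. nia.
Qed.

Definition kmod (c : Z -> C) (j : Z) : C := RtoC (zabs j * Cmod (c j)).

Lemma Cmod_kmod : forall c j, Cmod (kmod c j) = zabs j * Cmod (c j).
Proof. intros. unfold kmod. rewrite Cmod_R, Rabs_pos_eq; auto. pos. Qed.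

Lemma qm_sym_bound : forall c A B k, bnd (fun j => Cmod (c j)) A -> bnd (fun j => zabs j * Cmod (c j)) B ->
  Cmod (qm_sym c k) <= 2 * zabs k * Cmod (conv (kmod c) (kmod c) k).
Proof.
  intros c A B k HA HB.
  assert (HkB : forall j, zabs j * Cmod (c j) <= B) by (intros j; apply (bnd_term _ _ j HB)).
  assert (S1 : summable (fun j => c j * (RtoC (zabs (k - j)) * c (k - j)%Z))%C).
  { apply (summable_conv c (fun j => RtoC (zabs j) * c j)%C A B); auto.
    intros j. rewrite Cmod_mult, Cmod_R, Rabs_pos_eq by apply IZR_abs_pos. auto. }
  assert (S2 : summable (fun j => c j * dcoef c (k - j)%Z)%C).
  { apply (summable_conv c (dcoef c) A B); auto. intros j. unfold dcoef. rewrite Cmod_mult, Cmod_Cik. auto. }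
  assert (S3 : summable (fun j => kmod c j * kmod c (k - j)%Z)%C).
  { apply (summable_conv (kmod c) (kmod c) B B).
    - eapply bnd_ext; [exact HB|]. intros j. now rewrite Cmod_kmod.
    - intros j. rewrite Cmod_kmod. auto. }
  set (a := fun j => 2 * zabs k * ((zabs j * Cmod (c j)) * (zabs (k - j) * Cmod (c (k - j)%Z)))).
  assert (Ea : Zser (fun j => RtoC (a j)) = (RtoC (2 * zabs k) * conv (kmod c) (kmod c) k)%C).
  { apply zlim_Zser_eq. eapply zlim_ext; [|apply zlim_scal, (summable_zlim _ S3)].
    intros j. cbv beta. unfold kmod, a. now rewrite <- !RtoC_mult. }
  assert (Eq : qm_sym c k = Zser (fun j => (RtoC (zabs k * zabs (k - j) - IZR k * IZR (k - j)) * (c j * c (k - j)%Z))%C)).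
  { symmetry. apply zlim_Zser_eq. unfold qm_sym, conv.
    eapply zlim_ext; [|apply zlim_plus; apply zlim_scal; [exact (summable_zlim _ S1)|exact (summable_zlim _ S2)]].
    intros j. cbv beta. unfold dcoef. apply C_eq; unfold Re, Im; simpl; ring. }
  rewrite Eq. eapply Rle_trans; [apply (Zser_dom _ a)|].
  - destruct S3 as [X HX]. exists (2 * zabs k * X).
    pose proof (IZR_abs_pos k).
    eapply bnd_ext; [apply (bnd_scal _ _ (2 * zabs k) ltac:(lra) HX)|]. intros j. cbv beta.
    rewrite Cmod_mult, !Cmod_kmod, Cmod_R. unfold a. rewrite Rabs_pos_eq; auto.
    apply Rmult_le_pos; [lra|]. apply Rmult_le_pos; apply Rmult_le_pos; auto using IZR_abs_pos, Cmod_ge_0.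
  - intros j. rewrite !Cmod_mult, Cmod_R. unfold a.
    apply Rle_trans with (2 * zabs k * (zabs j * zabs (k - j)) * (Cmod (c j) * Cmod (c (k - j)%Z))); [|right; ring].
    apply Rmult_le_compat_r; [apply Rmult_le_pos; apply Cmod_ge_0|apply qm_symbol].
  - rewrite Ea, Cmod_mult, Cmod_R, Rabs_pos_eq; [lra|]. pose proof (IZR_abs_pos k). lra.
Qed.

Lemma pwQ_sub : forall N lam t j k, 0 <= N -> 0 <= lam * t <= 1 / 10 ->
  pw (phiN (2 / 5) N) lam k t <= pw (phiN (2 / 5) N) lam j t * pw (phiN (2 / 5) N) lam (k - j) t.
Proof.
  intros N lam t j k HN Hm. unfold pw, phiN. rewrite <- exp_plus. apply exp_mono.
  assert (E : zabs k <= zabs j + zabs (k - j)) by (rewrite <- plus_IZR; apply IZR_le; lia).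
  pose proof (IZR_abs_pos j). pose proof (IZR_abs_pos (k - j)).
  set (x := zabs k) in *. set (y := zabs j) in *. set (z := zabs (k - j)) in *.
  replace (lam * x * t) with (lam * t * x) by ring. replace (lam * y * t) with (lam * t * y) by ring.
  replace (lam * z * t) with (lam * t * z) by ring. set (m := lam * t) in *. clearbody x y z m.
  unfold Rmin; repeat destruct Rle_dec; nra.
Qed.

Lemma zabs_sub : forall j k, zabs k <= zabs j + zabs (k - j).
Proof. intros. rewrite <- plus_IZR. apply IZR_le. lia. Qed.

Lemma W_kcoef : forall rho F A, 0 < rho -> W rho F A -> bnd (fun k => zabs k * Cmod (cft F k)) (A / rho).
Proof.
  intros rho F A Hr HW. pose proof (bnd_dweight rho 0 (cft F) A Hr (proj2 (proj2 HW))) as X. rewrite Rminus_0_r in X.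
  eapply bnd_ext; [exact X|]. intros k. cbv beta. rewrite Rmult_0_l, exp_0. ring.
Qed.

(** The unknowns are [|k| h_k] and [(d_t h)_k], in terms of which the nonlinearity loses
    one derivative and is quadratic. *)
Lemma qm_nl : forall g rho h p M N lam t al mu D, 0 <= g -> 0 < rho -> W rho (rc h) M -> W rho (rc p) M ->
  0 <= N -> 0 <= lam * t <= 1 / 10 -> 0 < al <= 1 -> 0 <= mu -> 2 * mu + 4 * g * mu / (al * al) <= al ->
  let b := fun k => (RtoC (zabs k) * cft (rc h) k)%C in
  let v := cft (rc p) in
  bnd (fun k => pw (phiN (2 / 5) N) lam k t * (al * Cmod (b k) + Cmod (v k))) mu ->
  bnd (fun k => zabs k * (pw (phiN (2 / 5) N) lam k t * (al * Cmod (b k) + Cmod (v k)))) D ->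
  bnd (fun k => zabs k * (pw (phiN (2 / 5) N) lam k t *
    (Cmod (cft (rc (fun y => Hilbert p y * Hilbert p y)) k) + 2 * g * Cmod (conv (kmod (cft (rc h))) (kmod (cft (rc h))) k)))) (al * D).
Proof.
  intros g rho h p M N lam t al mu D Hg Hr Hh Hp HN Hm Hal Hmu Hsm b v Hb HD.
  pose proof (bnd_nonneg _ _ HD) as HD0. destruct (Hilbert_W rho p M ltac:(lra) Hp) as [WH Hc].
  set (w := fun k => pw (phiN (2 / 5) N) lam k t) in *. set (beta := kmod (cft (rc h))). set (hv := cft (rc (Hilbert p))).
  assert (Hw : forall k, 0 <= w k) by (intros; epos).
  assert (Hsub : forall j k, w k <= w j * w (k - j)%Z) by (intros; now apply pwQ_sub).
  assert (Hbeta : forall k, Cmod (beta k) = Cmod (b k)).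
  { intros k. unfold beta, b. rewrite Cmod_kmod, Cmod_mult, Cmod_R, Rabs_pos_eq; auto. apply IZR_abs_pos. }
  assert (Hhv : forall k, Cmod (hv k) <= Cmod (v k)).
  { intros k. unfold hv, v. rewrite Hc, !Cmod_mult, Cmod_opp, Cmod_Ci, Cmod_R, <- abs_IZR. pose proof (Cmod_ge_0 (cft (rc p) k)).
    assert (zabs (Z.sgn k) <= 1) by (apply IZR_le; lia). nra. }
  assert (Hia : 0 < / al) by (apply Rinv_0_lt_compat; lra).
  assert (V1 : bnd (fun k => w k * Cmod (hv k)) mu).
  { eapply bnd_mono; [exact Hb|]. intros k. cbv beta. fold (w k). apply Rmult_le_compat_l; auto.
    assert (0 <= al * Cmod (b k)) by (pos). specialize (Hhv k). lra. }
  assert (V2 : bnd (fun k => zabs k * w k * Cmod (hv k)) D).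
  { eapply bnd_mono; [exact HD|]. intros k. cbv beta. fold (w k). rewrite Rmult_assoc. apply Rmult_le_compat_l; [apply IZR_abs_pos|]. apply Rmult_le_compat_l; auto.
    assert (0 <= al * Cmod (b k)) by (pos). specialize (Hhv k). lra. }
  assert (B1 : bnd (fun k => w k * Cmod (beta k)) (/ al * mu)).
  { eapply bnd_mono; [apply (bnd_scal _ _ (/ al) ltac:(lra) Hb)|]. intros k. cbv beta. fold (w k). rewrite Hbeta.
    pose proof (Cmod_ge_0 (v k)). apply Rle_trans with (/ al * (w k * (al * Cmod (b k)))); [right; field; lra|].
    apply Rmult_le_compat_l; [lra|]. apply Rmult_le_compat_l; auto. lra. }
  assert (B2 : bnd (fun k => zabs k * w k * Cmod (beta k)) (/ al * D)).
  { eapply bnd_mono; [apply (bnd_scal _ _ (/ al) ltac:(lra) HD)|]. intros k. cbv beta. fold (w k). rewrite Hbeta.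
    pose proof (Cmod_ge_0 (v k)). apply Rle_trans with (/ al * (zabs k * (w k * (al * Cmod (b k))))); [right; field; lra|].
    apply Rmult_le_compat_l; [lra|]. apply Rmult_le_compat_l; [apply IZR_abs_pos|]. apply Rmult_le_compat_l; auto. lra. }
  assert (Sv : forall k, summable (fun j => hv j * hv (k - j)%Z)%C).
  { pose proof (W_summable rho _ _ ltac:(lra) WH) as X. apply (summable_conv hv hv M M); auto. intros j. apply (bnd_term _ _ j X). }
  assert (Sb : forall k, summable (fun j => beta j * beta (k - j)%Z)%C).
  { pose proof (W_kcoef rho _ _ Hr Hh) as X. apply (summable_conv beta beta (M / rho) (M / rho)).
    - eapply bnd_ext; [exact X|]. intros j. unfold beta. now rewrite Cmod_kmod.
    - intros j. unfold beta. rewrite Cmod_kmod. apply (bnd_term _ _ j X). }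
  destruct (conv_weight w _ hv hv mu mu D D Hw IZR_abs_pos Hsub zabs_sub Sv V1 V1 V2 V2) as [_ X1].
  destruct (conv_weight w _ beta beta (/ al * mu) (/ al * mu) (/ al * D) (/ al * D) Hw IZR_abs_pos Hsub zabs_sub Sb B1 B1 B2 B2) as [_ X2].
  eapply bnd_le; [eapply bnd_ext; [exact (bnd_plus _ _ _ _ X1 (bnd_scal _ _ (2 * g) ltac:(lra) X2))|]|].
  - intros k. cbv beta. rewrite (cft_mult_R rho (Hilbert p) (Hilbert p) M M k) by (auto; lra). fold hv. fold (w k). ring.
  - apply Rle_trans with ((2 * mu + 4 * g * mu / (al * al)) * D); [|nra]. right. field. lra.
Qed.


(** Continuity in time on a compact interval; the bound is used qualitatively only. *)
Lemma in_CX_bound : forall tau T u, 0 < T -> in_CX tau T u -> exists M, forall t, time_interval T t -> W tau (rc (u t)) M.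
Proof.
  intros tau T u HT Hu.
  assert (HW : forall t, time_interval T t -> W tau (rc (u t)) (nrm tau (u t))).
  { intros t Ht. destruct (in_X_W _ _ (proj1 (Hu t Ht))) as (A & HA & _). eapply nrm_W; eauto. }
  destruct (continuity_ab_maj (fun s => nrm tau (u (clamp T s))) 0 T ltac:(lra)) as (m & Hm & _).
  - intros c Hc. assert (Hct : time_interval T c) by (unfold time_interval; lra).
    intros eps Heps. destruct (in_CX_near tau T u c Hu Hct (eps / 2) ltac:(lra)) as (d & Hd & HN).
    exists d. split; auto. intros s [_ Hs]. simpl in *. unfold R_dist in *.
    pose proof (clamp_in T s ltac:(lra)) as Hcs. rewrite (clamp_id T c) by auto.
    pose proof (clamp_dist T s c Hct).
    eapply Rle_lt_trans; [eapply nrm_dist; eauto; apply HN; auto; lra|lra].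
  - exists (nrm tau (u (clamp T m))). intros t Ht. eapply W_mono; [apply Rle_refl| |apply HW; auto].
    specialize (Hm t Ht). cbv beta in Hm. now rewrite (clamp_id T t) in Hm.
Qed.

Definition qm_acc (g : R) (h p : R -> R) (x : R) : R := - g * Lambda h x + qm_rem g h p x.

Definition qm_on (g T : R) (h p : R -> R -> R) : Prop := forall t x, time_interval T t ->
  tder T (fun s => h s x) t (p t x) /\ tder T (fun s => p s x) t (qm_acc g (h t) (p t) x).

Lemma qm_acc_W : forall g rho h p M, 0 <= g -> 1 / 5 <= rho -> W rho (rc h) M -> W rho (rc p) M ->
  W (rho - 1 / 10) (rc (qm_acc g h p)) (10 * g * M + (20 + 800 * g) * M ^ 2) /\
  forall k, cft (rc (qm_acc g h p)) k = (- (RtoC g * (RtoC (zabs k) * cft (rc h) k)) + cft (rc (qm_rem g h p)) k)%C.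
Proof.
  intros g rho h p M Hg Hr Hh Hp. destruct (qm_rem_W g rho h p M Hg Hr Hh Hp) as [WR _].
  destruct (Lambda_W rho (rho - 1 / 10) h M ltac:(lra) Hh) as [L1 L1c].
  assert (E : forall x, (RtoC (- g) * rc (Lambda h) x + rc (qm_rem g h p) x)%C = rc (qm_acc g h p) x).
  { intros x. unfold rc, qm_acc. now rewrite <- RtoC_mult, <- RtoC_plus. }
  split.
  - apply (W_ext _ _ _ _ E). eapply W_mono; [apply Rle_refl| |exact (W_plus _ _ _ _ _ (W_scal _ (RtoC (- g)) _ _ L1) WR)].
    rewrite Cmod_R, Rabs_Ropp, Rabs_pos_eq by lra. right. field. lra.
  - intros k. rewrite <- (cft_ext _ _ E). assert (C1 := W_cc _ _ _ L1). assert (C2 := W_cc _ _ _ WR).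
    rewrite (cft_plus _ _ k (ccont_mult _ _ (ccont_const _) C1) C2), cft_scal by auto. rewrite L1c, RtoC_opp. ring.
Qed.

Lemma qm_udiff : forall g T rho h p M t, 0 <= g -> 1 / 5 <= rho -> 0 < T -> qm_on g T h p ->
  (forall s, time_interval T s -> W rho (rc (h s)) M /\ W rho (rc (p s)) M) -> time_interval T t ->
  udiff T t (fun s => rc (h s)) (rc (p t)) /\ udiff T t (fun s => rc (p s)) (rc (qm_acc g (h t) (p t))).
Proof.
  intros g T rho h p M t Hg Hr HT Hon HW Ht.
  assert (HM : 0 <= M) by (eapply W_ge0, (HW t Ht)).
  assert (HA : forall s, time_interval T s -> W (rho - 1 / 10) (rc (qm_acc g (h s) (p s))) (10 * g * M + (20 + 800 * g) * M ^ 2)).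
  { intros s Hs. apply qm_acc_W; auto; apply (HW s Hs). }
  assert (0 < / rho) by (apply Rinv_0_lt_compat; lra). assert (0 < / (rho - 1 / 10)) by (apply Rinv_0_lt_compat; lra).
  assert (HA0 : 0 <= 10 * g * M + (20 + 800 * g) * M ^ 2) by (eapply W_ge0, (HA t Ht)).
  split.
  - apply (udiff_pointwise T t h p (M / rho) 1); auto; try lra.
    + intros s x Hs. apply (Hon s x Hs).
    + intros s x Hs. apply (W_per rho _ M), (HW s Hs).
    + apply (W_per rho _ M), (HW t Ht).
    + pos.
    + intros s Hs _. apply W_lip; [lra|]. apply (HW s Hs).
  - apply (udiff_pointwise T t p (fun s => qm_acc g (h s) (p s)) ((10 * g * M + (20 + 800 * g) * M ^ 2) / (rho - 1 / 10)) 1); auto; try lra.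
    + intros s x Hs. apply (Hon s x Hs).
    + intros s x Hs. apply (W_per rho _ M), (HW s Hs).
    + eapply W_per, HA, Ht.
    + pos.
    + intros s Hs _. apply W_lip; [lra|]. now apply HA.
Qed.

(** [propagate_decay] in the unknowns of [qm_nl].  No bootstrap is needed, since [propagate]
    already contains the smallness in its norm. *)
Lemma qm_prop : forall g T h p M e al Tm, 0 < g -> 0 < T <= Tm -> qm_on g T h p ->
  (forall s, time_interval T s -> W (1 / 2) (rc (h s)) M /\ W (1 / 2) (rc (p s)) M) ->
  0 < al <= 1 -> 2 * al * Tm <= 1 / 10 -> W 3 (rc (h 0)) e -> W 3 (rc (p 0)) e ->
  2 * e * exp (g / al * Tm) < al ^ 3 / (16 * (1 + g)) ->
  forall t k, time_interval T t ->
    al * (zabs k * Cmod (cft (rc (h t)) k)) + Cmod (cft (rc (p t)) k) <=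
      2 * e * exp (g / al * Tm) * exp (- (19 / 10) * zabs k) /\
    cft (rc (p t)) 0 = cft (rc (p 0)) 0.
Proof.
  intros g T h p M e al Tm Hg HT Hon HW Hal HalT Wh0 Wp0 Hsm t k Ht.
  pose proof (W_ge0 _ _ _ Wh0) as He0.
  assert (HM : 0 <= M) by (eapply W_ge0, (HW t Ht)).
  assert (HgT : exp (g / al * T) <= exp (g / al * Tm)).
  { apply exp_mono, Rmult_le_compat_l; [|lra]. pos. }
  set (b := fun k s => (RtoC (zabs k) * cft (rc (h s)) k)%C). set (v := fun k s => cft (rc (p s)) k).
  set (v' := fun k s => cft (rc (qm_acc g (h s) (p s))) k).
  set (q := fun k s => Cmod (cft (rc (fun y => Hilbert (p s) y * Hilbert (p s) y)) k) + 2 * g * Cmod (conv (kmod (cft (rc (h s)))) (kmod (cft (rc (h s)))) k)).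
  assert (Hb : forall j s, Cmod (b j s) = zabs j * Cmod (cft (rc (h s)) j)).
  { intros j s. unfold b. rewrite Cmod_mult, Cmod_R, Rabs_pos_eq; auto. apply IZR_abs_pos. }
  assert (Ch : forall s, time_interval T s -> ccont (rc (h s))) by (intros s Hs; exact (W_cc _ _ _ (proj1 (HW s Hs)))).
  assert (Cp : forall s, time_interval T s -> ccont (rc (p s))) by (intros s Hs; exact (W_cc _ _ _ (proj2 (HW s Hs)))).
  assert (Ca : forall s, time_interval T s -> ccont (rc (qm_acc g (h s) (p s)))).
  { intros s Hs. destruct (HW s Hs) as [W1 W2].
    exact (W_cc _ _ _ (proj1 (qm_acc_W g (1 / 2) (h s) (p s) M ltac:(lra) ltac:(lra) W1 W2))). }
  assert (Dv : forall j s, time_interval T s -> ctder T (b j) s (RtoC (zabs j) * v j s)%C /\ ctder T (v j) s (v' j s)).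
  { intros j s Hs. destruct (qm_udiff g T (1 / 2) h p M s ltac:(lra) ltac:(lra) ltac:(lra) Hon HW Hs) as [U1 U2].
    split; [apply ctder_scal|]; apply ctder_cft; auto. }
  assert (Hv' : forall j s, time_interval T s -> Cmod (v' j s) <= g * Cmod (b j s) + zabs j * q j s).
  { intros j s Hs. destruct (HW s Hs) as [W1 W2]. unfold v'.
    destruct (qm_acc_W g (1 / 2) (h s) (p s) M ltac:(lra) ltac:(lra) W1 W2) as [_ ->].
    destruct (qm_rem_W g (1 / 2) (h s) (p s) M ltac:(lra) ltac:(lra) W1 W2) as [_ ->]. fold (b j s).
    rewrite (qm_sym_eq (1 / 2) (h s) M j ltac:(lra) W1).
    pose proof (qm_sym_bound (cft (rc (h s))) M (M / (1 / 2)) j (W_summable (1 / 2) _ _ ltac:(lra) W1) (W_kcoef (1 / 2) _ _ ltac:(lra) W1)) as Q.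
    eapply Rle_trans; [apply Cmod_triangle|]. rewrite Cmod_opp, Cmod_mult, Cmod_R, (Rabs_pos_eq g) by lra.
    eapply Rle_trans; [apply Rplus_le_compat_l, Cmod_triangle|].
    rewrite Cmod_opp, !Cmod_mult, !Cmod_R, (Rabs_pos_eq g), (Rabs_pos_eq (IZR _)) by (try lra; apply IZR_abs_pos).
    unfold q. assert (g * Cmod (qm_sym (cft (rc (h s))) j) <= g * (2 * zabs j * Cmod (conv (kmod (cft (rc (h s)))) (kmod (cft (rc (h s)))) j))) by (apply Rmult_le_compat_l; lra).
    lra. }
  split.
  2:{ apply (ctder_const T (v 0%Z)); auto; [lra|]. intros s Hs. eapply ctder_eq; [intros; reflexivity| |apply (Dv 0%Z s Hs)].
      apply Cmod_eq_0, Rle_antisym; [|apply Cmod_ge_0]. eapply Rle_trans; [apply Hv'; auto|]. rewrite Hb. simpl. lra. }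
  set (mu := al ^ 3 / (16 * (1 + g))) in *.
  assert (Hmu0 : 0 < mu) by (unfold mu; apply Rmult_lt_0_compat; [apply pow_lt; lra|apply Rinv_0_lt_compat; lra]).
  assert (Hmu : 2 * mu + 4 * g * mu / (al * al) <= al).
  { assert (E : mu * (1 + g) = al ^ 3 / 16) by (unfold mu; field; lra).
    assert (X2 : mu <= al ^ 3 / 16) by nra.
    assert (X3 : 4 * g * mu / (al * al) <= al / 4).
    { apply Rmult_le_reg_r with (al * al); [nra|]. unfold Rdiv at 1. rewrite Rmult_assoc, Rinv_l by nra. nra. }
    assert (al ^ 3 <= al) by (replace (al ^ 3) with (al * (al * al)) by ring; nra). lra. }
  assert (Hp : forall N, 0 <= N -> propagating ctder T g al (2 * al) mu (9 / 20) (20 * M) (phiN (2 / 5) N) b v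
    (fun k s => RtoC (zabs k) * v k s)%C v' q).
  { intros N HN. split; [|split; [|split; [|split]]]; auto.
    - intros j s Hs. rewrite Cmod_mult, Cmod_R, Rabs_pos_eq by apply IZR_abs_pos. lra.
    - intros j s Hs. destruct (HW s Hs) as [W1 W2]. pose proof (IZR_abs_pos j) as Hj.
      pose proof (W_term _ _ _ j W1) as T1. pose proof (W_term _ _ _ j W2) as T2.
      rewrite Hb. pose proof (x_exp (1 / 20) (zabs j) ltac:(lra)) as X.
      assert (Ee : exp (1 / 20 * zabs j) * exp (- (1 / 2 * zabs j)) = exp (- (9 / 20) * zabs j)).
      { rewrite <- exp_plus. f_equal. field. }
      split.
      + eapply Rle_trans; [apply Rmult_le_compat_l; [auto|exact T1]|]. rewrite <- Ee.
        apply Rle_trans with (20 * exp (1 / 20 * zabs j) * (M * exp (- (1 / 2 * zabs j)))); [|right; ring].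
        apply Rmult_le_compat_r; [|lra]. pos.
      + unfold v. eapply Rle_trans; [exact T2|]. apply Rmult_le_compat; [auto|epos|lra|apply exp_mono; lra].
    - intros s Hs Hm D HD. replace (2 * al / 2) with al by field. destruct (HW s Hs) as [W1 W2].
      assert (0 <= s <= Tm) by (unfold time_interval in Hs; lra).
      apply (qm_nl g (1 / 2) (h s) (p s) M N (2 * al) s al mu D); auto; try lra. nra. }
  assert (H0 : bnd (fun k => exp (2 * zabs k) * (al * Cmod (b k 0) + Cmod (v k 0))) (2 * e)).
  { replace (2 * e) with (e + e) by ring.
    eapply bnd_mono; [apply (bnd_plus _ _ _ _ (proj2 (proj2 Wh0)) (proj2 (proj2 Wp0)))|]. intros j. cbv beta.
    pose proof (IZR_abs_pos j) as Hj. rewrite Hb. unfold v.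
    pose proof (Cmod_ge_0 (cft (rc (h 0)) j)) as C1. pose proof (Cmod_ge_0 (cft (rc (p 0)) j)) as C2.
    pose proof (x_exp 1 (zabs j) ltac:(lra)) as X. rewrite Rinv_1, Rmult_1_l in X.
    assert (E3 : exp (2 * zabs j) * exp (1 * zabs j) = exp (3 * zabs j)) by (rewrite <- exp_plus; f_equal; ring).
    assert (X3 : exp (2 * zabs j) <= exp (3 * zabs j)) by (apply exp_mono; lra).
    set (c1 := Cmod (cft (rc (h 0)) j)) in *. set (n := zabs j) in *.
    assert (Y1 : al * (n * c1) <= exp (1 * n) * c1).
    { apply Rle_trans with (1 * (n * c1)); [apply Rmult_le_compat_r; [apply Rmult_le_pos; auto|lra]|]. rewrite Rmult_1_l. apply Rmult_le_compat_r; auto. }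
    rewrite Rmult_plus_distr_l. apply Rplus_le_compat; [|apply Rmult_le_compat_r; auto].
    rewrite <- E3, Rmult_assoc. apply Rmult_le_compat_l; [epos|exact Y1]. }
  rewrite <- Hb. fold (v k t).
  assert (Hm : 2 * e * exp (g / al * T) <= 2 * e * exp (g / al * Tm)) by (apply Rmult_le_compat_l; lra).
  eapply Rle_trans; [|apply Rmult_le_compat_r; [epos|exact Hm]].
  apply (propagate_decay T g al mu (2 / 5) (9 / 20) (20 * M) (2 * e) b v _ _ _ ltac:(lra) ltac:(lra) ltac:(lra) ltac:(nra)
    ltac:(lra) ltac:(lra) ltac:(lra) Hp H0 ltac:(lra) t k Ht).
Qed.


Lemma qm_bound : forall g Tm, 0 < g -> 0 < Tm -> exists K e0, 0 < K /\ 0 < e0 /\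
  forall e hinit hdot T h, 0 < T <= Tm -> e <= e0 -> W 3 (rc hinit) e -> W 3 (rc hdot) e -> cft (rc hdot) 0 = RtoC 0 ->
  quadratic_model_solution g hinit hdot T h ->
  exists p, qm_on g T h p /\ (forall x, h 0 x = hinit x /\ p 0 x = hdot x) /\
    forall t, time_interval T t -> W (3 / 2) (rc (h t)) (K * e) /\ W (3 / 2) (rc (p t)) (K * e) /\
      cft (rc (p t)) 0 = RtoC 0 /\ cft (rc (h t)) 0 = cft (rc (h 0)) 0.
Proof.
  intros g Tm Hg HTm. destruct (small_rate Tm HTm) as (al & Hal & HalT).
  set (E := exp (g / al * Tm)). assert (HE : 0 < E) by apply exp_pos.
  set (mu := al ^ 3 / (16 * (1 + g))).
  assert (Hmu0 : 0 < mu) by (unfold mu; apply Rmult_lt_0_compat; [apply pow_lt; lra|apply Rinv_0_lt_compat; lra]).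
  assert (Hia : 1 <= / al) by (rewrite <- Rinv_1; apply Rinv_le_contravar; lra).
  assert (HEa : E <= E * / al) by nra.
  exists (6 * (1 + 2 * E * / al)), (mu / (4 * E)). split; [lra|].
  split; [apply Rmult_lt_0_compat; [lra|apply Rinv_0_lt_compat; lra]|].
  intros e hinit hdot T h HT He Whi Whd Hd0 (Ch & p & htt & Cp & Heq & Hini).
  pose proof (W_ge0 _ _ _ Whi) as He0.
  assert (Hsm : 2 * e * E < mu).
  { apply Rle_lt_trans with (2 * (mu / (4 * E)) * E); [apply Rmult_le_compat_r; lra|].
    replace (2 * (mu / (4 * E)) * E) with (mu / 2) by (field; lra). lra. }
  assert (Wh0 : W 3 (rc (h 0)) e).
  { apply (W_ext _ (rc hinit)); auto. intros x. unfold rc. now rewrite (proj1 (Hini x)). }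
  assert (Wp0 : W 3 (rc (p 0)) e).
  { apply (W_ext _ (rc hdot)); auto. intros x. unfold rc. now rewrite (proj2 (Hini x)). }
  assert (Hp00 : cft (rc (p 0)) 0 = RtoC 0).
  { rewrite <- Hd0. apply cft_ext. intros x. unfold rc. now rewrite (proj2 (Hini x)). }
  assert (Hon : qm_on g T h p).
  { intros t x Ht. destruct (Heq t x Ht) as (D1 & D2 & EQ). split; [now apply time_derive_tder|].
    replace (qm_acc g (h t) (p t) x) with (htt t x); [now apply time_derive_tder|].
    unfold qm_acc, qm_rem. lra. }
  destruct (in_CX_bound (1 / 2) T h ltac:(lra) Ch) as [M1 HM1]. destruct (in_CX_bound (1 / 2) T p ltac:(lra) Cp) as [M2 HM2].
  assert (HW : forall s, time_interval T s -> W (1 / 2) (rc (h s)) (Rmax M1 M2) /\ W (1 / 2) (rc (p s)) (Rmax M1 M2)).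
  { intros s Hs. split; [eapply W_mono; [apply Rle_refl|apply Rmax_l|auto]|eapply W_mono; [apply Rle_refl|apply Rmax_r|auto]]. }
  assert (HP := fun t k => qm_prop g T h p (Rmax M1 M2) e al Tm Hg HT Hon HW Hal HalT Wh0 Wp0 Hsm t k). fold E in HP.
  exists p. split; [auto|]. split; [auto|]. intros t Ht.
  assert (Zp : forall s, time_interval T s -> cft (rc (p s)) 0 = RtoC 0) by (intros s Hs; now rewrite (proj2 (HP s 0%Z Hs))).
  assert (Zh : cft (rc (h t)) 0 = cft (rc (h 0)) 0).
  { apply (ctder_const T (fun s => cft (rc (h s)) 0)); auto; [lra|]. intros s Hs. rewrite <- (Zp s Hs).
    apply ctder_cft; auto.
    - apply (qm_udiff g T (1 / 2) h p (Rmax M1 M2) s); auto; lra.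
    - intros r Hr. exact (W_cc _ _ _ (proj1 (HW r Hr))).
    - exact (W_cc _ _ _ (proj2 (HW s Hs))). }
  set (A := e + 2 * e * E * / al).
  assert (H2E : 0 <= 2 * e * E) by nra. assert (H2Ea : 2 * e * E <= 2 * e * E * / al) by nra.
  assert (HA : A * (1 + 2 / (2 / 5)) = 6 * (1 + 2 * E * / al) * e) by (unfold A; field; lra).
  assert (fin : forall u, ccont (rc u) -> cper (rc u) -> (forall k, Cmod (cft (rc u) k) <= A * exp (- (19 / 10) * zabs k)) ->
    W (3 / 2) (rc u) (6 * (1 + 2 * E * / al) * e)).
  { intros u Cu Pu Hu. apply W_of_bnd; auto. rewrite <- HA.
    eapply bnd_mono; [apply (bnd_decay A (2 / 5)); unfold A; lra|]. intros k. cbv beta.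
    eapply Rle_trans; [apply Rmult_le_compat_l; [epos|apply Hu]|]. right.
    replace (- (2 / 5) * zabs k) with (3 / 2 * zabs k + - (19 / 10) * zabs k) by field.
    rewrite exp_plus. ring. }
  destruct (HW t Ht) as [W1 W2].
  split; [|split; [|auto]].
  - apply fin; try apply W1. intros k. destruct (Z.eq_dec k 0) as [->|Hk].
    + rewrite Zh. simpl. rewrite Rmult_0_r, exp_0, Rmult_1_r.
      pose proof (bnd_term _ e 0%Z (W_summable 3 _ e ltac:(lra) Wh0)) as X. cbv beta in X. unfold A. lra.
    + destruct (HP t k Ht) as [X _]. pose proof (Cmod_ge_0 (cft (rc (p t)) k)). pose proof (Cmod_ge_0 (cft (rc (h t)) k)) as C1.
      assert (1 <= zabs k) by (apply IZR_le; lia). pose proof (exp_pos (- (19 / 10) * zabs k)) as Ex.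
      set (c := Cmod (cft (rc (h t)) k)) in *. set (ex := exp (- (19 / 10) * zabs k)) in *.
      assert (X1 : al * c <= 2 * e * E * ex).
      { apply Rle_trans with (al * (zabs k * c)); [|lra]. apply Rmult_le_compat_l; [lra|]. nra. }
      apply Rle_trans with (2 * e * E * / al * ex).
      * apply Rmult_le_reg_l with al; [lra|]. replace (al * (2 * e * E * / al * ex)) with (2 * e * E * ex) by (field; lra). auto.
      * apply Rmult_le_compat_r; [lra|]. unfold A. lra.
  - apply fin; try apply W2. intros k. destruct (HP t k Ht) as [X _].
    pose proof (Cmod_ge_0 (cft (rc (h t)) k)) as C1. pose proof (IZR_abs_pos k).
    assert (0 <= al * (zabs k * Cmod (cft (rc (h t)) k))) by (pos).
    eapply Rle_trans; [|apply Rmult_le_compat_r; [epos|]]; [|unfold A; instantiate (1 := 2 * e * E); lra]. lra.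
Qed.


(** * Comparison of the two models *)

Lemma W_exp1 : forall rho h d c, 0 <= rho -> W rho (rc h) d -> W rho (rc (fun x => exp (c * h x) - 1)) (exp (Rabs c * d) - 1).
Proof.
  intros rho h d c Hr Hh. apply (W_ext _ (fun x => RtoC (exp (c * h x)) - 1)%C); [|now apply W_exp].
  intros x. unfold rc. now rewrite RtoC_minus.
Qed.

Lemma W_etail_le : forall m rho h d c, 0 <= rho -> W rho (rc h) d ->
  W rho (rc (fun x => etail m (c * h x))) ((Rabs c * d) ^ m * exp (Rabs c * d)).
Proof.
  intros m rho h d c Hr Hh. eapply W_mono; [apply Rle_refl| |exact (W_etail rho h d c m Hr Hh)].
  apply etail_le. pose proof (W_ge0 _ _ _ Hh). pos.
Qed.

Lemma kpow_exp : forall k (j : nat) a, (0 < k)%Z -> 0 < a -> IZR k ^ j <= (/ a) ^ j * exp (INR j * a * IZR k).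
Proof.
  intros k j a Hk Ha. replace (INR j * a * IZR k) with (INR j * (a * IZR k)) by ring. rewrite exp_nat, <- Rpow_mult_distr.
  apply pow_incr. split; [apply IZR_le; lia|]. apply x_exp; auto.
Qed.

Lemma cft_minus_R : forall u v k, ccont (rc u) -> ccont (rc v) -> cft (rc (fun x => u x - v x)) k = (cft (rc u) k - cft (rc v) k)%C.
Proof.
  intros u v k Hu Hv. rewrite <- cft_minus by auto. apply cft_ext. intros x. unfold rc. now rewrite RtoC_minus.
Qed.

(** Expand [e^{k h}]; the powers of [k] in the remainder cost a little of the decay. *)
Lemma sig_expand : forall d h k, d <= 1 / 100 -> W 1 (rc h) d -> (0 < k)%Z ->
  Cmod (sig h k - (RtoC (2 * IZR k) * cft (rc h) k + RtoC (IZR k ^ 2) * cft (rc (fun x => h x * h x)%R) k)) <=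
  128000 * d ^ 3 * exp (- (9 / 10) * IZR k).
Proof.
  intros d h k Hd Hh Hk. pose proof (W_ge0 _ _ _ Hh) as Hd0. assert (Hk1 : 1 <= IZR k) by (apply IZR_le; lia).
  pose proof (W_etail_le 3 1 h d (IZR k) ltac:(lra) Hh) as W3. rewrite Rabs_pos_eq in W3 by lra.
  pose proof (W_term _ _ _ k W3) as T. rewrite Z.abs_eq in T by lia.
  assert (Hhh : W 1 (rc (fun x => h x * h x)) (d * d)) by (apply W_mult_R; auto; lra).
  assert (C3 := W_cc _ _ _ W3). assert (Ch := W_cc _ _ _ Hh). assert (Chh := W_cc _ _ _ Hhh).
  assert (E : (sig h k - (RtoC (2 * IZR k) * cft (rc h) k + RtoC (IZR k ^ 2) * cft (rc (fun x => h x * h x)%R) k) =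
    RtoC 2 * cft (rc (fun x => etail 3 (IZR k * h x))) k)%C).
  { unfold sig. destruct (Z.eqb_spec k 0); [lia|]. rewrite mom_cft.
    assert (K1 : cft (fun _ => RtoC 1) k = RtoC 0) by (rewrite cft_const; destruct (Z.eqb_spec k 0); [lia|auto]).
    rewrite (cft_ext (fun x => RtoC 1 * RtoC (exp (IZR k * h x)))%C
      (fun x => 1 * rc (fun x => etail 3 (IZR k * h x)) x + RtoC (IZR k) * rc h x + (RtoC (IZR k ^ 2 / 2) * rc (fun x => h x * h x)%R x + RtoC 1))%C).
    2:{ intros x. unfold rc. rewrite etail_3. rewrite <- !RtoC_mult, <- !RtoC_plus. f_equal. field. }
    rewrite cft_plus by cc. rewrite cft_plus by cc. rewrite (cft_plus _ (fun _ => RtoC 1)) by cc. rewrite !cft_scal, K1 by auto.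
    rewrite !RtoC_mult. replace (RtoC (IZR k ^ 2 / 2)) with (RtoC (IZR k ^ 2) * RtoC (/ 2))%C by (rewrite <- RtoC_mult; reflexivity).
    apply C_eq; unfold Re, Im; simpl; lra. }
  rewrite E, Cmod_mult, Cmod_R, Rabs_pos_eq by lra.
  pose proof (kpow_exp k 3 (1 / 40) Hk ltac:(lra)) as K3. simpl INR in K3.
  eapply Rle_trans; [apply Rmult_le_compat_l; [lra|exact T]|].
  replace (2 * ((IZR k * d) ^ 3 * exp (IZR k * d) * exp (- (1 * IZR k)))) with (2 * d ^ 3 * (IZR k ^ 3 * (exp (IZR k * d) * exp (- (1 * IZR k))))) by ring.
  replace (128000 * d ^ 3 * exp (- (9 / 10) * IZR k)) with (2 * d ^ 3 * (64000 * exp (- (9 / 10) * IZR k))) by ring.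
  apply Rmult_le_compat_l; [pos|]. rewrite <- exp_plus.
  eapply Rle_trans; [apply Rmult_le_compat_r; [epos|exact K3]|].
  replace ((/ (1 / 40)) ^ 3) with 64000 by field. exps; [lra|nra].
Qed.

Lemma mom_expand2 : forall d h p k A, d <= 1 / 100 -> W 1 (rc h) d -> W 1 (rc p) A -> (0 < k)%Z ->
  Cmod (mom h (rc p) k - (cft (rc p) k + RtoC (IZR k) * cft (rc (fun x => h x * p x)%R) k)) <=
  1600 * d ^ 2 * A * exp (- (9 / 10) * IZR k).
Proof.
  intros d h p k A Hd Hh Hp Hk. pose proof (W_ge0 _ _ _ Hp) as HA. assert (Hk1 : 1 <= IZR k) by (apply IZR_le; lia).
  pose proof (W_etail_le 2 1 h d (IZR k) ltac:(lra) Hh) as W2. rewrite Rabs_pos_eq in W2 by lra.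
  assert (Wp : W 1 (rc (fun x => p x * etail 2 (IZR k * h x))) (A * ((IZR k * d) ^ 2 * exp (IZR k * d)))) by (apply W_mult_R; auto; lra).
  pose proof (W_term _ _ _ k Wp) as T. rewrite Z.abs_eq in T by lia.
  assert (Hhp : W 1 (rc (fun x => h x * p x)) (d * A)) by (apply W_mult_R; auto; lra).
  assert (C2 := W_cc _ _ _ Wp). assert (Ch := W_cc _ _ _ Hp). assert (Chp := W_cc _ _ _ Hhp).
  assert (E : (mom h (rc p) k - (cft (rc p) k + RtoC (IZR k) * cft (rc (fun x => h x * p x)%R) k) =
    cft (rc (fun x => p x * etail 2 (IZR k * h x))%R) k)%C).
  { rewrite mom_cft.
    rewrite (cft_ext (fun x => rc p x * RtoC (exp (IZR k * h x)))%C
      (fun x => 1 * rc (fun x => p x * etail 2 (IZR k * h x))%R x + 1 * rc p x + RtoC (IZR k) * rc (fun x => h x * p x)%R x)%C).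
    2:{ intros x. unfold rc. rewrite etail_2. rewrite <- !RtoC_mult, <- !RtoC_plus. f_equal. ring. }
    rewrite cft_lin3 by auto. ring. }
  rewrite E.
  pose proof (kpow_exp k 2 (1 / 40) Hk ltac:(lra)) as K2. simpl INR in K2.
  eapply Rle_trans; [exact T|].
  replace (A * ((IZR k * d) ^ 2 * exp (IZR k * d)) * exp (- (1 * IZR k))) with (d ^ 2 * A * (IZR k ^ 2 * (exp (IZR k * d) * exp (- (1 * IZR k))))) by ring.
  replace (1600 * d ^ 2 * A * exp (- (9 / 10) * IZR k)) with (d ^ 2 * A * (1600 * exp (- (9 / 10) * IZR k))) by ring.
  apply Rmult_le_compat_l; [pos|]. rewrite <- exp_plus.
  eapply Rle_trans; [apply Rmult_le_compat_r; [epos|exact K2]|].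
  replace ((/ (1 / 40)) ^ 2) with 1600 by field. exps; [lra|nra].
Qed.

Lemma mom_expand1 : forall d h F k A, d <= 1 / 100 -> W 1 (rc h) d -> W (4 / 5) F A ->
  Cmod (mom h F k - cft F k) <= 40 * d * A * exp (- (7 / 10) * zabs k).
Proof.
  intros d h F k A Hd Hh HF. pose proof (W_ge0 _ _ _ Hh) as Hd0. pose proof (W_ge0 _ _ _ HF) as HA. pose proof (IZR_abs_pos k) as Hk.
  assert (Hh8 : W (4 / 5) (rc h) d) by (eapply W_mono; [| |exact Hh]; lra).
  pose proof (W_mult (4 / 5) F _ A _ ltac:(lra) HF (W_exp1 (4 / 5) h d (IZR k) ltac:(lra) Hh8)) as X.
  rewrite <- abs_IZR in X. pose proof (W_term _ _ _ k X) as T. assert (CX := W_cc _ _ _ X). assert (CF := W_cc _ _ _ HF).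
  assert (E : (mom h F k - cft F k = cft (fun x => F x * rc (fun x => exp (IZR k * h x) - 1)%R x) k)%C).
  { rewrite mom_cft.
    rewrite (cft_ext (fun x => F x * RtoC (exp (IZR k * h x)))%C (fun x => F x * rc (fun x => exp (IZR k * h x) - 1)%R x + F x)%C).
    2:{ intros x. unfold rc. rewrite RtoC_minus. ring. }
    rewrite cft_plus by auto. ring. }
  rewrite E. eapply Rle_trans; [exact T|].
  pose proof (x_exp (1 / 40) (zabs k) ltac:(lra)) as K1.
  pose proof (exp_m1 (zabs k * d) ltac:(nra)) as K2.
  apply Rle_trans with (A * (40 * exp (1 / 40 * zabs k) * d * exp (zabs k * d)) * exp (- (4 / 5 * zabs k))).
  - apply Rmult_le_compat_r; [epos|]. apply Rmult_le_compat_l; auto. eapply Rle_trans; [exact K2|].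
    apply Rmult_le_compat_r; [epos|]. apply Rmult_le_compat_r; [auto|lra].
  - exps; nra.
Qed.


Definition prd (u v : R -> R) (x : R) : R := u x * v x.
Lemma W_prd : forall rho u v A B, 0 <= rho -> W rho (rc u) A -> W rho (rc v) B -> W rho (rc (prd u v)) (A * B).
Proof. exact W_mult_R. Qed.

(** The part of [conj f] linear in the velocity is [i zq], as [mom_tr] shows on the flat
    curve: it has no negative modes. *)
Definition zq (p : R -> R) (x : R) : C := (rc p x + Ci * rc (Hilbert p) x)%C.
(** [sq] and [gq] are the Taylor polynomials of degree two of [sigma] and [G] in the height
    and the normal velocity, see [sig_expand] and [mom_expand2]; [fq] is the forcing they
    satisfy along the model. *)
Definition sq (h : R -> R) (k : Z) : C := (RtoC (2 * IZR k) * cft (rc h) k + RtoC (IZR k ^ 2) * cft (rc (prd h h)) k)%C.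
Definition gq (h p : R -> R) (k : Z) : C := (RtoC 2 * Ci * (cft (rc p) k + RtoC (IZR k) * cft (rc (prd h p)) k))%C.
Definition fq (g : R) (h p : R -> R) (k : Z) : C :=
  (cft (fun x => zq p x * zq p x)%C k + RtoC 2 * cft (rc (prd h (qm_rem g h p))) k)%C.

Lemma Zser_0 : forall u, (forall k, u k = RtoC 0) -> Zser u = RtoC 0.
Proof.
  intros u Hu. apply Cmod_eq_0, Rle_antisym; [|apply Cmod_ge_0]. apply Zser_Cmod.
  eapply bnd_ext; [apply bnd_zero|]. intros k. cbv beta. now rewrite Hu, Cmod_0.
Qed.

Lemma zq_W : forall rho p M, 0 <= rho -> W rho (rc p) M ->
  W rho (zq p) (2 * M) /\ forall k, cft (zq p) k = (RtoC (1 + IZR (Z.sgn k)) * cft (rc p) k)%C.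
Proof.
  intros rho p M Hr Hp. destruct (Hilbert_W rho p M Hr Hp) as [WH Hc]. split.
  - replace (2 * M) with (M + Cmod Ci * M) by (rewrite Cmod_Ci; ring). apply (W_plus _ _ _ _ _ Hp (W_scal _ Ci _ _ WH)).
  - intros k. unfold zq. assert (C1 := W_cc _ _ _ Hp). assert (C2 := W_cc _ _ _ WH).
    rewrite (cft_plus _ _ k C1 (ccont_mult _ _ (ccont_const Ci) C2)), cft_scal, Hc by auto. apply C_eq; unfold Re, Im; simpl; ring.
Qed.

(** [conj Z] has no positive modes, hence neither has its square; so on those modes [Z^2]
    coincides with [2 Re Z^2]. *)
Lemma zq_sq : forall rho p M k, 0 <= rho -> W rho (rc p) M -> (0 < k)%Z ->
  cft (fun x => zq p x * zq p x)%C k = (RtoC 2 * (cft (rc (prd p p)) k - cft (rc (fun y => Hilbert p y * Hilbert p y)%R) k))%C.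
Proof.
  intros rho p M k Hr Hp Hk. destruct (zq_W rho p M Hr Hp) as [WZ Zc]. destruct (Hilbert_W rho p M Hr Hp) as [WH Hc].
  assert (Wc := W_conj _ _ _ WZ). assert (C1 := W_cc _ _ _ WZ). assert (C2 := W_cc _ _ _ Wc).
  assert (C3 := W_cc _ _ _ (W_prd _ _ _ _ _ Hr Hp Hp)). assert (C4 := W_cc _ _ _ (W_mult_R _ _ _ _ _ Hr WH WH)).
  assert (N : cft (fun x => Cconj (zq p x) * Cconj (zq p x))%C k = RtoC 0).
  { rewrite cft_mult; auto; try apply Wc; [|eexists; eapply (W_summable rho); eauto].
    apply Zser_0. intros j. rewrite !(cft_conj (zq p)) by auto. rewrite !Zc.
    destruct (Z.le_gt_cases j 0).
    - replace (Z.sgn (- (k - j))) with (-1)%Z by lia. rewrite !Cconj_mul. replace (1 + -1) with 0 by ring.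
      apply C_eq; unfold Re, Im; simpl; ring.
    - replace (Z.sgn (- j)) with (-1)%Z by lia. rewrite !Cconj_mul. replace (1 + -1) with 0 by ring.
      apply C_eq; unfold Re, Im; simpl; ring. }
  rewrite <- (Cplus_0_r (cft _ k)), <- N, <- (cft_plus _ _ k (ccont_mult _ _ C1 C1) (ccont_mult _ _ C2 C2)).
  rewrite <- cft_minus, <- cft_scal by (auto; apply ccont_minus; auto).
  apply cft_ext. intros x. apply C_eq; unfold zq, rc, prd; simpl; ring.
Qed.

Section QmMoments.
Variables (g T d : R) (h p : R -> R -> R) (t : R) (k : Z).
Hypothesis Hg : 0 <= g.
Hypothesis HT : 0 < T.
Hypothesis Hon : qm_on g T h p.
Hypothesis HW : forall s, time_interval T s -> W (3 / 2) (rc (h s)) d /\ W (3 / 2) (rc (p s)) d.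
Hypothesis Ht : time_interval T t.

Let acc := qm_acc g (h t) (p t).

Lemma qm_facts : W (7 / 5) (rc acc) (10 * g * d + (20 + 800 * g) * d ^ 2) /\ W (7 / 5) (rc (qm_rem g (h t) (p t))) ((20 + 800 * g) * d ^ 2) /\
  udiff T t (fun s => rc (h s)) (rc (p t)) /\ udiff T t (fun s => rc (p s)) (rc acc).
Proof.
  destruct (HW t Ht) as [W1 W2].
  replace (7 / 5) with (3 / 2 - 1 / 10) by field.
  split; [apply (qm_acc_W g (3 / 2) (h t) (p t) d); auto; lra|]. split; [apply (qm_rem_W g (3 / 2) (h t) (p t) d); auto; lra|].
  apply (qm_udiff g T (3 / 2) h p d t); auto; lra.
Qed.

Lemma prd_udiff : forall (u v : R -> R -> R) u' v' A B A' B' rho, 0 <= rho ->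
  udiff T t (fun s => rc (u s)) (rc u') -> udiff T t (fun s => rc (v s)) (rc v') ->
  W rho (rc (u t)) A -> W rho (rc (v t)) B -> W rho (rc u') A' -> W rho (rc v') B' ->
  udiff T t (fun s => rc (prd (u s) (v s))) (rc (fun x => prd u' (v t) x + prd (u t) v' x)).
Proof.
  intros u v u' v' A B A' B' rho Hr Hu Hv WA WB WA' WB'.
  eapply udiff_ext; [| |apply (udiff_mult T t _ _ _ _ Hu Hv); eapply W_bounded; eauto].
  - intros s x. unfold rc, prd. now rewrite RtoC_mult.
  - intros x. unfold rc, prd. now rewrite RtoC_plus, !RtoC_mult.
Qed.

Lemma sq_dot : ctder T (fun s => sq (h s) k) t (- (Ci * RtoC (IZR k)) * gq (h t) (p t) k)%C.
Proof.
  destruct (HW t Ht) as [W1 W2]. destruct qm_facts as (_ & _ & U1 & _).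
  pose proof (prd_udiff h h (p t) (p t) d d d d (3 / 2) ltac:(lra) U1 U1 W1 W1 W2 W2) as U2.
  assert (Whp : W (3 / 2) (rc (prd (h t) (p t))) (d * d)) by (apply W_prd; auto; lra).
  assert (Cm : ccont (rc (fun x => prd (p t) (h t) x + prd (h t) (p t) x))).
  { eapply W_cc, (W_plus_R (3 / 2)); [apply W_prd; eauto; lra|exact Whp]. }
  eapply ctder_eq; [reflexivity| |apply ctder_plus; apply ctder_scal; apply ctder_cft; [exact U1|auto| | |exact U2|auto| |exact Cm]].
  - rewrite (cft_ext (rc (fun x => prd (p t) (h t) x + prd (h t) (p t) x)) (fun x => RtoC 2 * rc (prd (h t) (p t)) x)%C).
    2:{ intros x. unfold rc, prd. rewrite <- RtoC_mult. f_equal. ring. }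
    rewrite cft_scal by (eapply W_cc; eauto). unfold gq. apply C_eq; unfold Re, Im; simpl; ring.
  - intros s Hs. eapply W_cc, (proj1 (HW s Hs)).
  - eapply W_cc, W2.
  - intros s Hs. eapply W_cc, (W_prd (3 / 2)); [lra|apply (HW s Hs)|apply (HW s Hs)].
Qed.

(** In [2 i ((d_t^2 h)_k + k (h d_t^2 h)_k + k ((d_t h)^2)_k)] the two terms in [h Lambda h]
    cancel, the one in [d_1 (h d_1 h)] is [- k^2 / 2] times [h^2] and completes [sq], and the
    squares of [d_t h] and [H d_t h] combine into [zq^2].  This is where the specific form of
    the model enters. *)
Lemma gq_dot : (0 < k)%Z -> ctder T (fun s => gq (h s) (p s) k) t
  (- (Ci * RtoC g) * sq (h t) k + Ci * RtoC (IZR k) * fq g (h t) (p t) k)%C.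
Proof.
  intros Hk. destruct (HW t Ht) as [W1 W2]. destruct qm_facts as (WA & WR & U1 & U2).
  assert (V1 : W (7 / 5) (rc (h t)) d) by (eapply W_mono; [| |exact W1]; lra).
  assert (V2 : W (7 / 5) (rc (p t)) d) by (eapply W_mono; [| |exact W2]; lra).
  pose proof (prd_udiff h p (p t) acc _ _ _ _ (7 / 5) ltac:(lra) U1 U2 V1 V2 V2 WA) as U3.
  assert (Wpp := W_prd (7 / 5) _ _ _ _ ltac:(lra) V2 V2). assert (WhA := W_prd (7 / 5) _ _ _ _ ltac:(lra) V1 WA).
  assert (WhR := W_prd (7 / 5) _ _ _ _ ltac:(lra) V1 WR). assert (Whh := W_prd (7 / 5) _ _ _ _ ltac:(lra) V1 V1).
  destruct (Lambda_W (3 / 2) (7 / 5) (h t) d ltac:(lra) W1) as [WL _]. assert (WhL := W_mult_R (7 / 5) _ _ _ _ ltac:(lra) V1 WL).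
  assert (Cpp := W_cc _ _ _ Wpp). assert (ChA := W_cc _ _ _ WhA). assert (ChR := W_cc _ _ _ WhR). assert (ChL := W_cc _ _ _ WhL).
  assert (Esum : forall j, cft (rc (fun x => prd (p t) (p t) x + prd (h t) acc x)) j = (cft (rc (prd (p t) (p t))) j + cft (rc (prd (h t) acc)) j)%C).
  { intros j. rewrite <- (cft_plus _ _ j Cpp ChA). apply cft_ext. intros x. unfold rc. now rewrite RtoC_plus. }
  eapply ctder_eq; [reflexivity| |apply ctder_scal, ctder_plus; [|apply ctder_scal]; apply ctder_cft; [exact U2|auto| | |exact U3|auto| |]].
  - rewrite Esum.
    assert (E1 : cft (rc (prd (h t) acc)) k = (- (RtoC g * cft (rc (fun y => h t y * Lambda (h t) y)%R) k) + cft (rc (prd (h t) (qm_rem g (h t) (p t)))) k)%C).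
    { rewrite (cft_ext (rc (prd (h t) acc)) (fun x => RtoC (- g) * rc (fun y => h t y * Lambda (h t) y)%R x + rc (prd (h t) (qm_rem g (h t) (p t))) x)%C).
      2:{ intros x. unfold rc, prd, acc, qm_acc. rewrite <- RtoC_mult, <- RtoC_plus. f_equal. ring. }
      rewrite (cft_plus _ _ k (ccont_mult _ _ (ccont_const _) ChL) ChR), cft_scal, RtoC_opp by auto. ring. }
    assert (E2 : cft (rc (fun y => h t y * Derive (h t) y)%R) k = (RtoC (/ 2) * (Ci * RtoC (IZR k) * cft (rc (prd (h t) (h t))) k))%C).
    { destruct (real_deriv (7 / 5) 1 (h t) d ltac:(lra) V1) as (D1 & WD & _).
      destruct (real_deriv (7 / 5) 1 (prd (h t) (h t)) _ ltac:(lra) Whh) as (D2 & _ & D3).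
      change (Ci * RtoC (IZR k) * cft (rc (prd (h t) (h t))) k)%C with (dcoef (cft (rc (prd (h t) (h t)))) k). rewrite <- D3.
      assert (EE : forall x, (RtoC (/ 2) * rc (Derive (prd (h t) (h t))) x)%C = rc (fun y => h t y * Derive (h t) y)%R x).
      { intros x. unfold rc. rewrite <- RtoC_mult. f_equal.
        assert (DD : Derive (prd (h t) (h t)) x = Derive (h t) x * h t x + h t x * Derive (h t) x) by exact (is_derive_unique _ _ _ (der_mult _ _ x _ _ (D1 x) (D1 x))).
        rewrite DD. field. }
      rewrite <- (cft_ext _ _ EE). rewrite cft_scal; auto.
      destruct (real_deriv (7 / 5) 1 (prd (h t) (h t)) _ ltac:(lra) Whh) as (_ & WW & _). eapply W_cc; eauto. }
    destruct (qm_acc_W g (3 / 2) (h t) (p t) d Hg ltac:(lra) W1 W2) as [_ E3].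
    destruct (qm_rem_W g (3 / 2) (h t) (p t) d Hg ltac:(lra) W1 W2) as [_ E4].
    unfold acc at 1. rewrite E3, E4, E1, E2. rewrite Z.abs_eq by lia.
    unfold sq, fq. rewrite (zq_sq (3 / 2) (p t) d k) by (auto; lra).
    set (x1 := cft (rc (h t)) k). set (x2 := cft (rc (fun y => Hilbert (p t) y * Hilbert (p t) y)%R) k).
    set (x3 := cft (rc (fun y => h t y * Lambda (h t) y)%R) k). set (x4 := cft (rc (prd (h t) (h t))) k).
    set (x5 := cft (rc (prd (h t) (qm_rem g (h t) (p t)))) k). set (x6 := cft (rc (prd (p t) (p t))) k).
    clearbody x1 x2 x3 x4 x5 x6. apply C_eq; unfold Re, Im; simpl; field.
  - intros s Hs. exact (W_cc _ _ _ (proj2 (HW s Hs))).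
  - exact (W_cc _ _ _ WA).
  - intros s Hs. destruct (HW s Hs) as [X1 X2]. exact (W_cc _ _ _ (W_prd (3 / 2) _ _ _ _ ltac:(lra) X1 X2)).
  - exact (W_cc _ _ _ (W_plus_R _ _ _ _ _ Wpp WhA)).
Qed.

End QmMoments.

(** Up to a fixed factor, a single mode grows at most like [e^{al k t}]; as [al Tm] is small, this costs only a small
    part of the decay rate. *)
Lemma mode_growth : forall g al T Tm k (x y : R -> C) F eta I, 0 < g -> 0 < al <= 1 -> 0 < T <= Tm -> 2 * al * Tm <= 1 / 10 ->
  (0 < k)%Z -> 0 <= eta ->
  (forall t, time_interval T t -> ctder T x t (- (Ci * RtoC (IZR k)) * y t)%C /\
     ctder T y t (- (Ci * RtoC g) * x t - Ci * RtoC (IZR k) * F t)%C) ->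
  (forall t, time_interval T t -> IZR k * Cmod (F t) <= eta) ->
  al * Cmod (x 0) + Cmod (y 0) <= I ->
  forall t, time_interval T t -> al * Cmod (x t) + Cmod (y t) <= (I + eta * Tm) * (exp (g / al * Tm) * exp (1 / 20 * IZR k)).
Proof.
  intros g al T Tm k x y F eta I Hg Hal HT HalT Hk Heta HD HF HI t Ht.
  assert (Hk1 : 1 <= IZR k) by (apply IZR_le; lia).
  assert (I0 : time_interval T 0) by (unfold time_interval; lra).
  destruct (ctder_extend T x (fun t => - (Ci * RtoC (IZR k)) * y t)%C ltac:(lra) (fun t Ht => proj1 (HD t Ht))) as (X & EX & DX).
  destruct (ctder_extend T y (fun t => - (Ci * RtoC g) * x t - Ci * RtoC (IZR k) * F t)%C ltac:(lra) (fun t Ht => proj2 (HD t Ht))) as (Y & EY & DY).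
  assert (Hga : 0 < g / al) by (apply Rmult_lt_0_compat; [lra|apply Rinv_0_lt_compat; lra]).
  pose proof (gronwall [k] T (al * IZR k + g / al) eta (fun _ _ => 1) (fun _ _ => 0) (fun _ => X) (fun _ => Y)
    (fun _ t => - (Ci * RtoC (IZR k)) * y t)%C (fun _ t => - (Ci * RtoC g) * x t - Ci * RtoC (IZR k) * F t)%C al) as GR.
  cbv beta in GR. unfold lsum in GR. simpl in GR.
  specialize (GR ltac:(nra) Heta ltac:(lra)). rewrite <- EX, <- EY by auto.
  pose proof (Cmod_ge_0 (x 0)). pose proof (Cmod_ge_0 (y 0)).
  eapply Rle_trans; [|eapply Rle_trans; [apply (fun a b c => GR a b c t Ht)|]].
  - lra.
  - intros _ s Hs. split; [lra|]. split; [lra|]. apply (is_derive_const 1 s).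
  - auto.
  - intros s Hs. rewrite EX, EY by auto. specialize (HF s Hs).
    pose proof (Cmod_triangle (- (Ci * RtoC g) * x s) (- (Ci * RtoC (IZR k) * F s))) as Q.
    rewrite !Cmod_opp, !Cmod_mult, Cmod_opp, !Cmod_mult, Cmod_Ci, !Cmod_R, (Rabs_pos_eq g), (Rabs_pos_eq (IZR k)) in Q by lra.
    unfold Cminus. rewrite Cmod_mult, Cmod_opp, Cmod_mult, Cmod_Ci, Cmod_R, (Rabs_pos_eq (IZR k)) by lra.
    pose proof (Cmod_ge_0 (x s)). pose proof (Cmod_ge_0 (y s)).
    assert (E : g / al * (al * Cmod (x s)) = g * Cmod (x s)) by (field; lra).
    assert (0 <= al * IZR k * (al * Cmod (x s))) by (pos).
    nra.
  - rewrite !EX, !EY by auto. unfold time_interval in Ht.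
    assert (EB : exp ((al * IZR k + g / al) * t) <= exp (g / al * Tm) * exp (1 / 20 * IZR k)).
    { rewrite <- exp_plus. apply exp_mono.
      assert (al * t <= 1 / 20) by nra. nra. }
    apply Rmult_le_compat; [nra|epos| |exact EB]. nra.
Qed.


Lemma exp_rate : forall A r r' k, (0 < k)%Z -> 0 <= A -> r' <= r -> A * exp (- r * IZR k) <= A * exp (- r' * IZR k).
Proof.
  intros A r r' k Hk HA Hr. assert (1 <= IZR k) by (apply IZR_le; lia). apply Rmult_le_compat_l; auto. apply exp_mono. nra.
Qed.

Lemma k_rate : forall A r k, (0 < k)%Z -> 0 <= A -> IZR k * (A * exp (- r * IZR k)) <= 100 * A * exp (- (r - 1 / 100) * IZR k).
Proof.
  intros A r k Hk HA. pose proof (kpow_exp k 1 (1 / 100) Hk ltac:(lra)) as X. simpl in X. rewrite !Rmult_1_r, Rmult_1_l in X.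
  replace (- (r - 1 / 100) * IZR k) with (1 / 100 * IZR k + - r * IZR k) by field. rewrite exp_plus.
  apply Rle_trans with (/ (1 / 100) * exp (1 / 100 * IZR k) * (A * exp (- r * IZR k))).
  - apply Rmult_le_compat_r; auto. pos.
  - right. field.
Qed.

(** A real function of mean zero is controlled by its positive modes. *)
Lemma W_of_modes : forall rho r u A, 0 <= A -> rho < r -> ccont (rc u) -> cper (rc u) -> cft (rc u) 0 = RtoC 0 ->
  (forall k, (0 < k)%Z -> Cmod (cft (rc u) k) <= A * exp (- r * IZR k)) -> W rho (rc u) (A * (1 + 2 / (r - rho))).
Proof.
  intros rho r u A HA Hr Cu Pu H0 Hu. apply W_of_bnd; auto.
  eapply bnd_mono; [apply (bnd_decay A (r - rho)); lra|]. intros k. cbv beta.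
  assert (X : Cmod (cft (rc u) k) <= A * exp (- r * zabs k)).
  { destruct (Z.lt_total k 0) as [Hk|[->|Hk]].
    - rewrite Z.abs_neq by lia. replace (cft (rc u) k) with (Cconj (cft (rc u) (- k))).
      + rewrite Cmod_conj. apply Hu. lia.
      + rewrite <- cft_conj by auto. apply cft_ext. intros x. unfold rc. apply C_eq; simpl; ring.
    - rewrite H0, Cmod_0. pos.
    - rewrite Z.abs_eq by lia. auto. }
  eapply Rle_trans; [apply Rmult_le_compat_l; [epos|exact X]|]. right.
  replace (- (r - rho) * zabs k) with (rho * zabs k + - r * zabs k) by ring. rewrite exp_plus. ring.
Qed.

Section Comparison.
Variables (g T Tm al d : R) (h w ht H P : R -> R -> R).
Hypothesis Hg : 0 < g.
Hypothesis HT : 0 < T <= Tm.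
Hypothesis Hal : 0 < al <= 1.
Hypothesis HalT : 2 * al * Tm <= 1 / 10.
Hypothesis Hd : d <= 1 / 200000.
Hypothesis Hww : ww_on g T d h w ht.
Hypothesis Hqm : qm_on g T H P.
Hypothesis HqW : forall t, time_interval T t -> W (3 / 2) (rc (H t)) d /\ W (3 / 2) (rc (P t)) d.
Hypothesis Hz : forall t, time_interval T t -> cft (rc (P t)) 0 = RtoC 0 /\ cft (rc (H t)) 0 = cft (rc (h t)) 0.
Hypothesis Hini : forall x, h 0 x = H 0 x /\ ht 0 x = P 0 x.

(** The growth factor of [mode_growth]. *)
Definition gain := exp (g / al * Tm).
Let ds k t := (sig (h t) k - sq (H t) k)%C.
Let dg k t := (gmom (h t) (w t) (ht t) k - gq (H t) (P t) k)%C.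
Let force k t := (qmom (h t) (w t) (ht t) k + fq g (H t) (P t) k)%C.

Lemma I0T : time_interval T 0.
Proof. unfold time_interval. lra. Qed.

Lemma d_pos : 0 <= d.
Proof. apply (W_ge0 (3 / 2) (rc (H 0))), (HqW 0 I0T). Qed.

Lemma gain_pos : 0 < gain.
Proof. apply exp_pos. Qed.

Lemma d_small : forall n : nat, 0 <= d ^ n /\ d ^ S n <= d ^ n / 200000.
Proof. intros n. pose proof d_pos. assert (0 <= d ^ n) by (apply pow_le; auto). split; auto. simpl. nra. Qed.

(** The data coincide, so only the Taylor remainders are left. *)
Lemma diff_initial : forall k, (0 < k)%Z -> al * Cmod (ds k 0) + Cmod (dg k 0) <= 140000 * d ^ 3 * exp (- (9 / 10) * IZR k).
Proof.
  intros k Hk. destruct (HqW 0 I0T) as [WH WP]. destruct (d_small 3) as [Hd3 _].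
  assert (Wh : W 1 (rc (h 0)) d) by apply (Hww 0 I0T).
  assert (Wp : W 1 (rc (ht 0)) d).
  { apply (W_ext _ (rc (P 0))); [intros x; unfold rc; now rewrite (proj2 (Hini x))|]. eapply W_mono; [| |exact WP]; lra. }
  pose proof (sig_expand d (h 0) k ltac:(lra) Wh Hk) as X1. pose proof (mom_expand2 d (h 0) (ht 0) k d ltac:(lra) Wh Wp Hk) as X2.
  destruct (wc g T d h w ht Hww Hd 0 I0T) as [Cw Cp].
  assert (E1 : sq (H 0) k = (RtoC (2 * IZR k) * cft (rc (h 0)) k + RtoC (IZR k ^ 2) * cft (rc (fun x => h 0 x * h 0 x)%R) k)%C).
  { unfold sq. f_equal; f_equal; apply cft_ext; intros x; unfold rc, prd; now rewrite (proj1 (Hini x)). }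
  assert (E2 : gq (H 0) (P 0) k = (RtoC 2 * Ci * (cft (rc (ht 0)) k + RtoC (IZR k) * cft (rc (fun x => h 0 x * ht 0 x)%R) k))%C).
  { unfold gq. f_equal. f_equal; [|f_equal]; apply cft_ext; intros x; unfold rc, prd; now rewrite ?(proj1 (Hini x)), ?(proj2 (Hini x)). }
  unfold ds, dg. rewrite E1, E2.
  rewrite (gmom_ht _ _ _ _ _ (w 0) (ht 0) k (ww_snap _ _ _ _ _ _ _ Hww Hd I0T) (fun x => eq_refl) ltac:(lia) Cw Cp).
  match goal with |- _ + Cmod (RtoC 2 * Ci * ?a - RtoC 2 * Ci * ?b) <= _ =>
    replace (RtoC 2 * Ci * a - RtoC 2 * Ci * b)%C with (RtoC 2 * Ci * (a - b))%C by ring end.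
  rewrite !Cmod_mult, Cmod_Ci, Cmod_R, (Rabs_pos_eq 2) by lra.
  replace (1600 * d ^ 2 * d) with (1600 * d ^ 3) in X2 by ring.
  match goal with |- al * ?u + _ <= _ => assert (al * u <= u) by (pose proof (Cmod_ge_0 (sig (h 0) k - (RtoC (2 * IZR k) * cft (rc (h 0)) k + RtoC (IZR k ^ 2) * cft (rc (fun x => h 0 x * h 0 x)%R) k))); nra) end.
  pose proof (exp_pos (- (9 / 10) * IZR k)). nra.
Qed.

(** Subtracting [sigma_dot], [G_dot] and [sq_dot], [gq_dot] leaves the linear system, forced by
    the difference of the forcings. *)
Lemma diff_growth : forall A r, 0 <= A -> r <= 79 / 100 ->
  (forall t k, time_interval T t -> (0 < k)%Z -> Cmod (force k t) <= A * exp (- r * IZR k)) ->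
  forall t k, time_interval T t -> (0 < k)%Z ->
    al * Cmod (ds k t) + Cmod (dg k t) <= (140000 * d ^ 3 + 100 * A * Tm) * gain * exp (- (r - 6 / 100) * IZR k).
Proof.
  intros A r HA Hr HF t k Ht Hk. destruct (d_small 3) as [Hd3 _].
  set (ex := exp (- (r - 1 / 100) * IZR k)).
  assert (Hex : 0 < ex) by apply exp_pos.
  pose proof (mode_growth g al T Tm k (ds k) (dg k) (force k) (100 * A * ex) (140000 * d ^ 3 * ex) Hg Hal HT HalT Hk) as MG.
  eapply Rle_trans; [apply MG; auto|].
  - pos.
  - intros s Hs.
    assert (Hop : forall f l, ctder T f s l -> ctder T (fun s => - (1) * f s)%C s (- (1) * l)%C) by (intros; now apply ctder_scal).
    split.
    + pose proof (ctder_plus _ _ _ _ _ _ (sigma_dot g T d h w ht s k Hww Hd ltac:(lra) Hs Hk)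
        (Hop _ _ (sq_dot g T d H P s k ltac:(lra) ltac:(lra) Hqm HqW Hs))) as X.
      eapply ctder_eq; [| |exact X]; [intros r0; unfold ds; ring|unfold dg; ring].
    + pose proof (ctder_plus _ _ _ _ _ _ (G_dot g T d h w ht s k Hww Hd ltac:(lra) Hs Hk)
        (Hop _ _ (gq_dot g T d H P s k ltac:(lra) ltac:(lra) Hqm HqW Hs Hk))) as X.
      eapply ctder_eq; [| |exact X]; [intros r0; unfold dg; ring|unfold ds, force; ring].
  - intros s Hs. eapply Rle_trans; [apply Rmult_le_compat_l; [apply IZR_le; lia|apply HF; auto]|]. now apply k_rate.
  - eapply Rle_trans; [now apply diff_initial|]. apply exp_rate; auto; [nra|lra].
  - right. unfold ex, gain. replace (- (r - 6 / 100) * IZR k) with (- (r - 1 / 100) * IZR k + 1 / 20 * IZR k) by field.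
    rewrite exp_plus. ring.
Qed.

(** Taylor expansion of [sigma], solved for the linear term [2 k h_k]. *)
Lemma diff_height : forall t A B r r' rho, time_interval T t -> 0 <= A -> 0 <= B -> rho < r -> r <= 9 / 10 -> r <= r' - 1 / 100 ->
  (forall k, (0 < k)%Z -> al * Cmod (ds k t) <= A * exp (- r * IZR k)) ->
  (forall k, (0 < k)%Z -> Cmod (cft (rc (prd (h t) (h t))) k - cft (rc (prd (H t) (H t))) k) <= B * exp (- r' * IZR k)) ->
  W rho (rc (fun x => h t x - H t x)) ((A / al + 64000 * d ^ 3 + 50 * B) * (1 + 2 / (r - rho))).
Proof.
  intros t A B r r' rho Ht HA HB Hr Hr9 Hr' HA' HB'. destruct (Hww t Ht) as (Wh & _). destruct (HqW t Ht) as [WH _].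
  assert (Ch := W_cc _ _ _ Wh). assert (CH := W_cc _ _ _ WH). destruct (d_small 3) as [Hd3 _].
  assert (Hia : 0 < / al) by (apply Rinv_0_lt_compat; lra). assert (HAa : 0 <= A / al) by (pos).
  apply W_of_modes; auto.
  - lra.
  - apply (ccont_ext (fun x => rc (h t) x - rc (H t) x)%C); [intros x; unfold rc; now rewrite <- RtoC_minus|]. now apply ccont_minus.
  - intros x. unfold rc. now rewrite (W_per _ _ _ Wh), (W_per _ _ _ WH).
  - rewrite cft_minus_R, (proj2 (Hz t Ht)) by auto. ring.
  - intros k Hk. assert (Hk1 : 1 <= IZR k) by (apply IZR_le; lia). rewrite cft_minus_R by auto.
    pose proof (sig_expand d (h t) k ltac:(lra) Wh Hk) as X1. specialize (HA' k Hk). specialize (HB' k Hk).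
    set (S := sig (h t) k) in *. unfold ds, sq in HA'. fold S in HA'.
    change (rc (fun x => h t x * h t x)%R) with (rc (prd (h t) (h t))) in X1.
    set (a1 := cft (rc (h t)) k) in *. set (a2 := cft (rc (H t)) k) in *.
    set (q1 := cft (rc (prd (h t) (h t))) k) in *. set (q2 := cft (rc (prd (H t) (H t))) k) in *.
    set (D := (S - (RtoC (2 * IZR k) * a2 + RtoC (IZR k ^ 2) * q2))%C) in *.
    set (X := (S - (RtoC (2 * IZR k) * a1 + RtoC (IZR k ^ 2) * q1))%C) in *.
    assert (Eq : (RtoC (2 * IZR k) * (a1 - a2) = D + (- X + - (RtoC (IZR k ^ 2) * (q1 - q2))))%C) by (unfold D, X; ring).
    apply (f_equal Cmod) in Eq. rewrite Cmod_mult, Cmod_R, (Rabs_pos_eq (2 * IZR k)) in Eq by lra.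
    pose proof (Cmod_triangle D (- X + - (RtoC (IZR k ^ 2) * (q1 - q2)))) as T1.
    pose proof (Cmod_triangle (- X) (- (RtoC (IZR k ^ 2) * (q1 - q2)))) as T2.
    rewrite !Cmod_opp, Cmod_mult, Cmod_R, (Rabs_pos_eq (IZR k ^ 2)) in T2 by (apply pow2_ge_0).
    pose proof (exp_rate (64000 * d ^ 3) (9 / 10) r k Hk ltac:(nra) Hr9) as R1.
    pose proof (k_rate B r' k Hk HB) as R2. pose proof (exp_rate (100 * B) (r' - 1 / 100) r k Hk ltac:(lra) Hr') as R3.
    assert (HDa : Cmod D <= A / al * exp (- r * IZR k)).
    { apply Rmult_le_reg_l with al; [lra|]. replace (al * (A / al * exp (- r * IZR k))) with (A * exp (- r * IZR k)) by (field; lra). auto. }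
    set (ex := exp (- r * IZR k)) in *. assert (Hex : 0 < ex) by apply exp_pos.
    assert (HAe : 0 <= A / al * ex) by (pos). assert (Hde : 0 <= 64000 * d ^ 3 * ex) by (pos).
    apply Rmult_le_reg_r with (2 * IZR k); [lra|]. nra.
Qed.

Definition rem_cst := 20 + 800 * g.

Lemma prod_rem_W : forall t, time_interval T t -> W (7 / 5) (rc (prd (H t) (qm_rem g (H t) (P t)))) (d * (rem_cst * d ^ 2)).
Proof.
  intros t Ht. destruct (HqW t Ht) as [W1 W2]. apply W_prd; [lra| |].
  - eapply W_mono; [| |exact W1]; lra.
  - replace (7 / 5) with (3 / 2 - 1 / 10) by field. apply qm_rem_W; auto; lra.
Qed.

Lemma snapt : forall t, time_interval T t ->
  snap (20 * d) (h t) (Derive (h t)) (tr (w t) (ht t)) (quot (h t) (tr (w t) (ht t))) (80 * d).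
Proof. intros t Ht. eapply ww_snap; eauto. Qed.

Lemma quad_W : forall t, time_interval T t ->
  W (4 / 5) (fun x => cj (quot (h t) (tr (w t) (ht t))) x * cj (tr (w t) (ht t)) x)%C (12800 * d ^ 2).
Proof.
  intros t Ht. pose proof (snapt t Ht) as Hs. destruct (snap_W _ _ _ _ _ _ Hs) as [_ Wcf]. destruct Hs as (_ & _ & _ & _ & HU & _).
  replace (12800 * d ^ 2) with (80 * d * (2 * (80 * d))) by ring. apply W_mult; [lra| |exact Wcf]. now apply W_conj.
Qed.

Definition cst1 := (1 + 100 * (12804 + 2 * rem_cst) * Tm) * gain.

(** No cancellation yet: each part of the force is quadratic. *)
Lemma stage1 : forall t k, time_interval T t -> (0 < k)%Z -> al * Cmod (ds k t) + Cmod (dg k t) <= cst1 * d ^ 2 * exp (- (73 / 100) * IZR k).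
Proof.
  intros t k Ht Hk. pose proof d_pos as Hd0. destruct (d_small 2) as [Hd2 Hd3]. pose proof gain_pos as HE.
  assert (HcR : 0 <= rem_cst) by (unfold rem_cst; lra).
  eapply Rle_trans; [apply (diff_growth ((12804 + 2 * rem_cst) * d ^ 2) (79 / 100)); auto; [nra|lra|]|].
  - clear t k Ht Hk. intros t k Ht Hk. destruct (HqW t Ht) as [_ WP].
    assert (Q1 : Cmod (qmom (h t) (w t) (ht t) k) <= 12800 * d ^ 2 * exp (- (79 / 100) * IZR k)).
    { unfold qmom. eapply Rle_trans; [apply (mom_bound (4 / 5) (h t) d _ (12800 * d ^ 2)); [lra| |now apply quad_W]|].
      - eapply W_mono; [| |apply (Hww t Ht)]; lra.
      - rewrite Z.abs_eq by lia. apply exp_rate; auto; nra. }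
    destruct (zq_W (3 / 2) (P t) d ltac:(lra) WP) as [WZ _].
    pose proof (W_term _ _ _ k (W_mult (3 / 2) _ _ _ _ ltac:(lra) WZ WZ)) as Q2.
    pose proof (W_term _ _ _ k (prod_rem_W t Ht)) as Q3. rewrite Z.abs_eq in Q2, Q3 by lia.
    rewrite Ropp_mult_distr_l in Q2, Q3.
    assert (P1 : 0 <= 2 * d * (2 * d)) by (pos).
    assert (P2 : 0 <= rem_cst * d ^ 2) by (pos).
    assert (P3 : 0 <= d * (rem_cst * d ^ 2)) by (pos).
    pose proof (exp_rate (2 * d * (2 * d)) (3 / 2) (79 / 100) k Hk P1 ltac:(lra)) as R2.
    pose proof (exp_rate (d * (rem_cst * d ^ 2)) (7 / 5) (79 / 100) k Hk P3 ltac:(lra)) as R3.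
    unfold force, fq. eapply Rle_trans; [apply Cmod_triangle|]. eapply Rle_trans; [apply Rplus_le_compat_l, Cmod_triangle|].
    rewrite Cmod_mult, Cmod_R, (Rabs_pos_eq 2) by lra.
    set (ex := exp (- (79 / 100) * IZR k)) in *. assert (Hex : 0 < ex) by apply exp_pos.
    assert (d * (rem_cst * d ^ 2) * ex <= rem_cst * d ^ 2 * ex) by (apply Rmult_le_compat_r; [lra|]; nra).
    replace ((12804 + 2 * rem_cst) * d ^ 2 * ex) with (12800 * d ^ 2 * ex + (2 * d * (2 * d) * ex + 2 * (rem_cst * d ^ 2 * ex))) by ring. lra.
  - replace (73 / 100) with (79 / 100 - 6 / 100) by field. apply Rmult_le_compat_r; [epos|]. unfold cst1.
    replace ((1 + 100 * (12804 + 2 * rem_cst) * Tm) * gain * d ^ 2) with ((d ^ 2 + 100 * ((12804 + 2 * rem_cst) * d ^ 2) * Tm) * gain) by ring.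
    apply Rmult_le_compat_r; [lra|]. lra.
Qed.

Lemma c1_pos : 0 <= cst1.
Proof. unfold cst1, rem_cst. pose proof gain_pos. apply Rmult_le_pos; [|lra]. assert (0 <= (12804 + 2 * (20 + 800 * g)) * Tm) by nra. lra. Qed.

Definition cst2 := (cst1 / al + 101) * (1 + 2 / (13 / 100)).

Lemma height1 : forall t, time_interval T t -> W (3 / 5) (rc (fun x => h t x - H t x)) (cst2 * d ^ 2).
Proof.
  intros t Ht. destruct (d_small 2) as [Hd2 Hd3]. pose proof c1_pos as Hc1.
  destruct (Hww t Ht) as (Wh & _). destruct (HqW t Ht) as [WH _].
  eapply W_mono; [apply Rle_refl| |apply (diff_height t (cst1 * d ^ 2) (2 * d ^ 2) (73 / 100) 1 (3 / 5)); auto; try lra; try nra].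
  - replace (73 / 100 - 3 / 5) with (13 / 100) by field. unfold cst2.
    replace ((cst1 / al + 101) * (1 + 2 / (13 / 100)) * d ^ 2) with ((cst1 * d ^ 2 / al + d ^ 2 + 100 * d ^ 2) * (1 + 2 / (13 / 100))) by (field; lra).
    apply Rmult_le_compat_r; [lra|]. lra.
  - intros k Hk. pose proof (stage1 t k Ht Hk). pose proof (Cmod_ge_0 (dg k t)). lra.
  - intros k Hk. pose proof (W_term _ _ _ k (W_prd 1 _ _ _ _ ltac:(lra) Wh Wh)) as X1.
    pose proof (W_term _ _ _ k (W_prd (3 / 2) _ _ _ _ ltac:(lra) WH WH)) as X2. rewrite Z.abs_eq in X1, X2 by lia.
    rewrite Ropp_mult_distr_l in X1, X2.
    pose proof (exp_rate (d * d) (3 / 2) 1 k Hk ltac:(nra) ltac:(lra)) as R2.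
    eapply Rle_trans; [apply Cmod_triangle|]. rewrite Cmod_opp.
    replace (2 * d ^ 2 * exp (- (1) * IZR k)) with (d * d * exp (- (1) * IZR k) + d * d * exp (- (1) * IZR k)) by ring. lra.
Qed.

Definition cst3 := 6403 + cst1.

(** The modes [k <= 0] of [conj f] are conjugates of modes of [f], which equal vanishing
    moments up to [O(d^2)], and [Z] has none; on [k > 0] use [stage1] for [G]. *)
Lemma trace_diff : forall t, time_interval T t ->
  W (13 / 20) (fun x => cj (tr (w t) (ht t)) x - Ci * zq (P t) x)%C (41 * cst3 * d ^ 2).
Proof.
  intros t Ht. pose proof c1_pos as Hc1.
  pose proof (snapt t Ht) as Hs. destruct (snap_W _ _ _ _ _ _ Hs) as [Wf Wcf]. pose proof Hs as (_ & _ & _ & _ & _ & H0).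
  destruct (HqW t Ht) as [WH WP]. destruct (zq_W (3 / 2) (P t) d ltac:(lra) WP) as [WZ ZC]. destruct (Hww t Ht) as (Wh & _).
  set (f := tr (w t) (ht t)) in *. replace (2 * (80 * d)) with (160 * d) in * by ring.
  assert (Ccf := W_cc _ _ _ Wcf). assert (CZ := W_cc _ _ _ WZ). assert (CiZ := ccont_mult _ _ (ccont_const Ci) CZ).
  replace (41 * cst3 * d ^ 2) with (cst3 * d ^ 2 * (1 + 2 / (7 / 10 - 13 / 20))) by field.
  apply W_of_bnd.
  - now apply ccont_minus.
  - intros x. destruct Wcf as (_ & Q1 & _). destruct WZ as (_ & Q2 & _). now rewrite Q1, Q2.
  - eapply bnd_mono; [apply (bnd_decay (cst3 * d ^ 2) (7 / 10 - 13 / 20)); [unfold cst3; nra|lra]|]. intros k. cbv beta.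
    rewrite (cft_minus _ _ k Ccf CiZ), cft_scal, ZC by auto.
    assert (X : Cmod (cft (cj f) k - Ci * (RtoC (1 + IZR (Z.sgn k)) * cft (rc (P t)) k)) <= cst3 * d ^ 2 * exp (- (7 / 10) * zabs k)).
    { set (ex := exp (- (7 / 10) * zabs k)). assert (Hex : 0 < ex) by apply exp_pos. assert (Hdx : 0 <= d ^ 2 * ex) by nra.
      destruct (Z.le_gt_cases k 0) as [Hk|Hk].
      - assert (Ez : (Ci * (RtoC (1 + IZR (Z.sgn k)) * cft (rc (P t)) k))%C = RtoC 0).
        { destruct (Z.eq_dec k 0) as [->|Hk0]; [rewrite (proj1 (Hz t Ht)); ring|].
          replace (Z.sgn k) with (-1)%Z by lia. replace (1 + -1) with 0 by ring. ring. }
        rewrite Ez. unfold cj. rewrite (cft_conj f) by exact (W_cc _ _ _ Wf).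
        replace (Cconj (cft f (- k)) - RtoC 0)%C with (Cconj (cft f (- k))) by ring. rewrite Cmod_conj.
        pose proof (mom_expand1 d (h t) f (- k) (160 * d) ltac:(lra) Wh Wf) as Q. rewrite H0, Z.abs_opp in Q by lia. fold ex in Q.
        replace (RtoC 0 - cft f (- k))%C with (- cft f (- k))%C in Q by ring. rewrite Cmod_opp in Q.
        unfold cst3. nra.
      - assert (Hk1 : 1 <= IZR k) by (apply IZR_le; lia).
        pose proof (mom_expand1 d (h t) (cj f) k (160 * d) ltac:(lra) Wh Wcf) as Q1. fold ex in Q1.
        pose proof (stage1 t k Ht Hk) as Q2. pose proof (Cmod_ge_0 (ds k t)) as Q0.
        assert (Q2' : Cmod (dg k t) <= cst1 * d ^ 2 * ex).
        { pose proof (exp_rate (cst1 * d ^ 2) (73 / 100) (7 / 10) k Hk ltac:(nra) ltac:(lra)) as Y.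
          replace (exp (- (7 / 10) * IZR k)) with ex in Y by (unfold ex; now rewrite Z.abs_eq by lia).
          assert (0 <= al * Cmod (ds k t)) by (pos). lra. }
        pose proof (W_term _ _ _ k (W_prd (3 / 2) _ _ _ _ ltac:(lra) WH WP)) as Q3. rewrite Z.abs_eq, Ropp_mult_distr_l in Q3 by lia.
        assert (Q3' : IZR k * Cmod (cft (rc (prd (H t) (P t))) k) <= 3 / 2 * (d ^ 2 * ex)).
        { eapply Rle_trans; [apply Rmult_le_compat_l; [lra|exact Q3]|].
          pose proof (x_exp (4 / 5) (IZR k) ltac:(lra)) as Y.
          apply Rle_trans with (/ (4 / 5) * exp (4 / 5 * IZR k) * (d * d * exp (- (3 / 2) * IZR k))).
          - apply Rmult_le_compat_r; [|auto]. apply Rmult_le_pos; [nra|epos].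
          - replace (/ (4 / 5) * exp (4 / 5 * IZR k) * (d * d * exp (- (3 / 2) * IZR k))) with (5 / 4 * (d ^ 2 * (exp (4 / 5 * IZR k) * exp (- (3 / 2) * IZR k)))) by field.
            rewrite <- exp_plus. replace (4 / 5 * IZR k + - (3 / 2) * IZR k) with (- (7 / 10) * zabs k) by (rewrite Z.abs_eq by lia; field).
            fold ex. lra. }
        replace (Z.sgn k) with 1%Z by lia.
        assert (Eq : (cft (cj f) k - Ci * (RtoC (1 + IZR 1) * cft (rc (P t)) k) =
          - (mom (h t) (cj f) k - cft (cj f) k) + (dg k t + RtoC 2 * Ci * (RtoC (IZR k) * cft (rc (prd (H t) (P t))) k)))%C).
        { unfold dg, gq, gmom. fold f. apply C_eq; unfold Re, Im; simpl; ring. }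
        rewrite Eq. eapply Rle_trans; [apply Cmod_triangle|]. rewrite Cmod_opp.
        eapply Rle_trans; [apply Rplus_le_compat_l, Cmod_triangle|].
        rewrite !Cmod_mult, Cmod_Ci, !Cmod_R, (Rabs_pos_eq 2), (Rabs_pos_eq (IZR k)) by lra.
        unfold cst3. nra. }
    eapply Rle_trans; [apply Rmult_le_compat_l; [epos|exact X]|]. right.
    replace (- (7 / 10 - 13 / 20) * zabs k) with (13 / 20 * zabs k + - (7 / 10) * zabs k) by ring. rewrite exp_plus. ring.
Qed.

Definition cst4 := 768000 + 6642 * cst3 + 2 * rem_cst.

(** [Q] is the moment of [(conj f)^2 / conj gamma']: replacing moments by Fourier
    coefficients and [gamma'] by [1] costs [O(d^3)], and then
    [(conj f)^2 + Z^2 = (conj f - i Z) (conj f + i Z)]. *)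
Lemma force_cubic : forall t k, time_interval T t -> (0 < k)%Z -> Cmod (force k t) <= cst4 * d ^ 3 * exp (- (13 / 20) * IZR k).
Proof.
  intros t k Ht Hk. destruct (d_small 3) as [Hd3 _].
  assert (HcR : 0 <= rem_cst) by (unfold rem_cst; lra).
  pose proof (snapt t Ht) as Hs. destruct (snap_W _ _ _ _ _ _ Hs) as [Wf Wcf]. destruct Hs as (Hsm & _ & _ & Hf & HU & _).
  destruct (HqW t Ht) as [WH WP]. destruct (zq_W (3 / 2) (P t) d ltac:(lra) WP) as [WZ ZC]. destruct (Hww t Ht) as (Wh & _).
  pose proof (quad_W t Ht) as WQ. pose proof (trace_diff t Ht) as WD.
  set (f := tr (w t) (ht t)) in *. set (U := quot (h t) f) in *. set (Z := zq (P t)) in *.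
  destruct (small_W _ _ _ (4 / 5) Hsm ltac:(lra)) as (_ & Wh1 & _).
  assert (Wsum : W (13 / 20) (fun x => cj f x + Ci * Z x)%C (162 * d)).
  { replace (162 * d) with (160 * d + Cmod Ci * (2 * d)) by (rewrite Cmod_Ci; ring). apply W_plus.
    - eapply W_mono; [| |exact Wcf]; lra.
    - apply W_scal. eapply W_mono; [| |exact WZ]; lra. }
  assert (W3 := W_mult (13 / 20) _ _ _ _ ltac:(lra) WD Wsum).
  assert (W2 : W (4 / 5) (fun x => cj U x * cj f x * (Ci * rc (Derive (h t)) x))%C (12800 * d ^ 2 * (Cmod Ci * (20 * d)))).
  { apply W_mult; [lra|exact WQ|]. now apply W_scal. }
  rewrite Cmod_Ci in W2.
  pose proof (mom_expand1 d (h t) _ k _ ltac:(lra) Wh WQ) as Q1.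
  pose proof (W_term _ _ _ k W2) as Q2. pose proof (W_term _ _ _ k W3) as Q3. pose proof (W_term _ _ _ k (prod_rem_W t Ht)) as Q4.
  rewrite Z.abs_eq in Q1, Q2, Q3, Q4 by lia. rewrite Ropp_mult_distr_l in Q2, Q3, Q4.
  assert (CQ := W_cc _ _ _ WQ). assert (C2 := W_cc _ _ _ W2). assert (C3 := W_cc _ _ _ W3). assert (CZ := W_cc _ _ _ WZ).
  set (Q := (fun x => cj U x * cj f x)%C) in *.
  assert (Eq : force k t = ((mom (h t) Q k - cft Q k) + (cft (fun x => cj U x * cj f x * (Ci * rc (Derive (h t)) x))%C k
     + (cft (fun x => (cj f x - Ci * Z x) * (cj f x + Ci * Z x))%C k + RtoC 2 * cft (rc (prd (H t) (qm_rem g (H t) (P t)))) k)))%C).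
  { unfold force, fq, qmom. fold f. fold U. fold Q. fold Z.
    assert (Es : (cft Q k + cft (fun x => Z x * Z x)%C k = cft (fun x => cj U x * cj f x * (Ci * rc (Derive (h t)) x))%C k
      + cft (fun x => (cj f x - Ci * Z x) * (cj f x + Ci * Z x))%C k)%C).
    { rewrite <- (cft_plus _ _ k CQ (ccont_mult _ _ CZ CZ)), <- (cft_plus _ _ k C2 C3). apply cft_ext. intros x.
      assert (Ef : cj f x = (cj U x * (1 - Ci * rc (Derive (h t)) x))%C).
      { unfold cj. rewrite (Hf x), Cconj_mul. f_equal. unfold gp, rc. apply C_eq; simpl; ring. }
      unfold Q. assert (Hi : (Ci * Ci + RtoC 1 = RtoC 0)%C) by (apply C_eq; simpl; ring).
      transitivity (cj U x * cj f x * (Ci * rc (Derive (h t)) x) + (cj f x * (cj U x * (1 - Ci * rc (Derive (h t)) x)) - Ci * Ci * (Z x * Z x)) + (Ci * Ci + RtoC 1) * (Z x * Z x))%C; [ring|].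
      rewrite <- Ef, Hi. ring. }
    transitivity (mom (h t) Q k - cft Q k + (cft Q k + cft (fun x => Z x * Z x)%C k) + RtoC 2 * cft (rc (prd (H t) (qm_rem g (H t) (P t)))) k)%C; [ring|].
    rewrite Es. ring. }
  rewrite Eq. clear Eq.
  pose proof (exp_rate (512000 * d ^ 3) (7 / 10) (13 / 20) k Hk ltac:(nra) ltac:(lra)) as R1.
  pose proof (exp_rate (256000 * d ^ 3) (4 / 5) (13 / 20) k Hk ltac:(nra) ltac:(lra)) as R2.
  pose proof (exp_rate (rem_cst * d ^ 3) (7 / 5) (13 / 20) k Hk ltac:(nra) ltac:(lra)) as R4.
  replace (40 * d * (12800 * d ^ 2)) with (512000 * d ^ 3) in Q1 by ring.
  replace (12800 * d ^ 2 * (1 * (20 * d))) with (256000 * d ^ 3) in Q2 by ring.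
  replace (41 * cst3 * d ^ 2 * (162 * d)) with (6642 * cst3 * d ^ 3) in Q3 by ring.
  replace (d * (rem_cst * d ^ 2)) with (rem_cst * d ^ 3) in Q4 by ring.
  eapply Rle_trans; [apply Cmod_triangle|]. eapply Rle_trans; [apply Rplus_le_compat_l, Cmod_triangle|].
  eapply Rle_trans; [apply Rplus_le_compat_l, Rplus_le_compat_l, Cmod_triangle|].
  rewrite Cmod_mult, Cmod_R, (Rabs_pos_eq 2) by lra.
  set (ex := exp (- (13 / 20) * IZR k)) in *. unfold cst4.
  replace ((768000 + 6642 * cst3 + 2 * rem_cst) * d ^ 3 * ex) with (512000 * d ^ 3 * ex + (256000 * d ^ 3 * ex + (6642 * cst3 * d ^ 3 * ex + 2 * (rem_cst * d ^ 3 * ex)))) by ring.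
  lra.
Qed.

Definition cst5 := (140000 + 100 * cst4 * Tm) * gain.
Definition cst6 := (cst5 / al + 64000 + 100 * cst2) * (1 + 2 / (9 / 100)).

(** The same argument as for [height1], with the cubic force and with the difference of
    the squares bounded by means of [height1]. *)
Lemma height2 : forall t, time_interval T t -> W (1 / 2) (rc (fun x => h t x - H t x)) (cst6 * d ^ 3).
Proof.
  intros t Ht. destruct (d_small 3) as [Hd3 _]. pose proof c1_pos as Hc1. pose proof gain_pos as HE.
  assert (Hia : 0 < / al) by (apply Rinv_0_lt_compat; lra).
  assert (HcR : 0 <= rem_cst) by (unfold rem_cst; lra). assert (Hc3 : 0 <= cst3) by (unfold cst3; lra). assert (Hc4 : 0 <= cst4) by (unfold cst4; lra).
  assert (Hc5 : 0 <= cst5).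
  { unfold cst5. apply Rmult_le_pos; [|lra]. assert (0 <= cst4 * Tm) by (pos). lra. }
  assert (Hc1a : 0 <= cst1 / al) by (pos). assert (Hc2 : 0 <= cst2) by (unfold cst2; pos).
  destruct (Hww t Ht) as (Wh & _). destruct (HqW t Ht) as [WH _].
  eapply W_mono; [apply Rle_refl| |apply (diff_height t (cst5 * d ^ 3) (2 * cst2 * d ^ 3) (59 / 100) (3 / 5) (1 / 2)); auto; try lra; try nra].
  - replace (59 / 100 - 1 / 2) with (9 / 100) by field. unfold cst6.
    replace ((cst5 / al + 64000 + 100 * cst2) * (1 + 2 / (9 / 100)) * d ^ 3) with ((cst5 * d ^ 3 / al + 64000 * d ^ 3 + 50 * (2 * cst2 * d ^ 3)) * (1 + 2 / (9 / 100))) by (field; lra).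
    lra.
  - intros k Hk. pose proof (diff_growth (cst4 * d ^ 3) (13 / 20) ltac:(nra) ltac:(lra) force_cubic t k Ht Hk) as X.
    pose proof (Cmod_ge_0 (dg k t)). replace (13 / 20 - 6 / 100) with (59 / 100) in X by field.
    replace ((140000 * d ^ 3 + 100 * (cst4 * d ^ 3) * Tm) * gain) with (cst5 * d ^ 3) in X by (unfold cst5; ring). lra.
  - intros k Hk.
    assert (Wh3 : W (3 / 5) (rc (h t)) d) by (eapply W_mono; [| |exact Wh]; lra).
    assert (WH3 : W (3 / 5) (rc (H t)) d) by (eapply W_mono; [| |exact WH]; lra).
    assert (C1 := W_cc _ _ _ (W_prd (3 / 5) _ _ _ _ ltac:(lra) Wh3 Wh3)). assert (C2 := W_cc _ _ _ (W_prd (3 / 5) _ _ _ _ ltac:(lra) WH3 WH3)).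
    pose proof (W_mult_R (3 / 5) _ _ _ _ ltac:(lra) (height1 t Ht) (W_plus_R _ _ _ _ _ Wh3 WH3)) as WW.
    pose proof (W_term _ _ _ k WW) as X. rewrite Z.abs_eq, Ropp_mult_distr_l in X by lia.
    replace (cst2 * d ^ 2 * (d + d)) with (2 * cst2 * d ^ 3) in X by ring.
    rewrite <- cft_minus_R by auto. erewrite cft_ext; [exact X|]. intros x. unfold rc, prd. f_equal. ring.
Qed.

End Comparison.


(** * Conclusion *)

Lemma W_trig : forall rho (c : Z -> C) l,
  W rho (fun x => csum l (fun k => c k * cis (IZR k * x))%C) (lsum l (fun k => Cmod (c k) * exp (rho * zabs k))).
Proof.
  intros rho c l. induction l as [|k l IH]; simpl.
  - eapply W_mono; [apply Rle_refl| |apply W_const]. rewrite Cmod_0. lra.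
  - apply W_plus; auto. apply W_scal, W_cis.
Qed.

Lemma cft_trig_0 : forall (c : Z -> C) l, c 0%Z = RtoC 0 -> cft (fun x => csum l (fun k => c k * cis (IZR k * x))%C) 0 = RtoC 0.
Proof.
  intros c l Hc. induction l as [|k l IH]; simpl.
  - rewrite cft_const. reflexivity.
  - assert (C1 := W_cc _ _ _ (W_cis 0 k)). assert (C2 := W_cc _ _ _ (W_trig 0 c l)).
    rewrite (cft_plus _ _ 0 (ccont_mult _ _ (ccont_const (c k)) C1) C2), IH, cft_scal, cft_cis by auto.
    destruct (Z.eqb_spec 0 k) as [<-|_]; [rewrite Hc|]; ring.
Qed.

(** The number of modes is fixed, so any radius is possible, with a norm linear in [eps]. *)
Lemma data_W : forall D (c : Z -> C) u eps, 0 <= eps -> (forall x, RtoC (u x) = (RtoC eps * trig_sum D c x)%C) ->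
  W 3 (rc u) (eps * lsum (win (Z.to_nat (Int_part D))) (fun k => Cmod (c k) * exp (3 * zabs k))) /\
  (c 0%Z = RtoC 0 -> cft (rc u) 0 = RtoC 0).
Proof.
  intros D c u eps Heps Hu. set (N := Z.to_nat (Int_part D)).
  assert (E : forall x, (RtoC eps * csum (win N) (fun k => c k * cis (IZR k * x)))%C = rc u x).
  { intros x. unfold rc. rewrite Hu. unfold trig_sum. now rewrite Zsum_csum. }
  split.
  - apply (W_ext _ _ _ _ E). eapply W_mono; [apply Rle_refl| |apply W_scal, W_trig]. rewrite Cmod_R, Rabs_pos_eq by auto. apply Rle_refl.
  - intros Hc. rewrite <- (cft_ext _ _ E), cft_scal, cft_trig_0 by (auto; eapply W_cc, (W_trig 0)). ring.
Qed.

Lemma CX_norm_le : forall tau T u A, (forall t, time_interval T t -> W tau (rc (u t)) A) -> Rbar_le (CX_norm tau T u) A.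
Proof.
  intros tau T u A HW. apply (proj2 (proj2_sig (Rbar_ex_lub _))).
  intros r (t & Ht & ->). apply W_X_norm. auto.
Qed.

Lemma ww_on_mono : forall g T d d' h w ht, d <= d' -> ww_on g T d h w ht -> ww_on g T d' h w ht.
Proof.
  intros g T d d' h w ht Hd H t Ht. destruct (H t Ht) as (A & B & C). split; [|split; auto]; eapply W_mono; eauto; lra.
Qed.

Theorem theorem6 :
  forall (g D : R) (a b : Z -> C),
    0 < g -> 1 < D ->
    forall Tmax : R, 0 < Tmax ->
    exists K eps0 : R, 0 < eps0 /\
      forall eps : R, 0 < eps < eps0 ->
      forall hinit hdot : R -> R,
        (forall x, RtoC (hinit x) = (RtoC eps * trig_sum D a x)%C) ->
        (forall x, RtoC (hdot x) =
           (RtoC eps *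
            trig_sum D (fun l => if Z.eqb l 0 then RtoC 0 else b l) x)%C) ->
      forall (T : R) (hww www hqm : R -> R -> R),
        0 < T <= Tmax ->
        water_waves_solution g hinit hdot T hww www ->
        quadratic_model_solution g hinit hdot T hqm ->
        Rbar_le (CX_norm (1 / 2) T (fun t x => hww t x - hqm t x))
                (Finite (K * eps ^ 3)).
Proof.
  intros g D a b Hg HD Tmax HTm. set (b0 := fun l => if Z.eqb l 0 then RtoC 0 else b l).
  destruct (small_rate Tmax HTm) as (al & Hal & HalT).
  destruct (ww_bound g Tmax Hg HTm) as (Kw & ew & HKw & Hew & _ & WW).
  destruct (qm_bound g Tmax Hg HTm) as (Kq & eq & HKq & Heq & QM).
  set (S := fun c : Z -> C => lsum (win (Z.to_nat (Int_part D))) (fun k => Cmod (c k) * exp (3 * zabs k))).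
  assert (HS : forall c, 0 <= S c).
  { intros c. apply lsum_nonneg. intros k. pos. }
  set (C0 := 1 + S a + S b0). assert (HC0 : 1 <= C0) by (unfold C0; pose proof (HS a); pose proof (HS b0); lra).
  (* [K0 * (C0 * eps)] bounds the data and both solutions. *)
  set (K0 := Kw + Kq).
  set (bd := Rmin (Rmin ew eq) (1 / 200000 / K0)).
  assert (HK0 : 0 < / K0) by (apply Rinv_0_lt_compat; unfold K0; lra).
  assert (Hbd : 0 < bd) by (unfold bd; repeat apply Rmin_glb_lt; auto; unfold Rdiv; nra).
  exists (cst6 g Tmax al * (K0 * C0) ^ 3), (bd / C0).
  split; [apply Rmult_lt_0_compat; [auto|apply Rinv_0_lt_compat; lra]|].
  intros eps Heps hinit hdot Hhi Hhd T hww www hqm HT Sww Sqm.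
  assert (He : C0 * eps <= bd).
  { apply Rle_trans with (C0 * (bd / C0)); [apply Rmult_le_compat_l; lra|]. right. field. lra. }
  assert (He1 : C0 * eps <= ew /\ C0 * eps <= eq /\ K0 * (C0 * eps) <= 1 / 200000).
  { pose proof (Rmin_l (Rmin ew eq) (1 / 200000 / K0)). pose proof (Rmin_r (Rmin ew eq) (1 / 200000 / K0)).
    pose proof (Rmin_l ew eq). pose proof (Rmin_r ew eq). change (bd <= Rmin ew eq) in H. change (bd <= 1 / 200000 / K0) in H0. split; [lra|]. split; [lra|].
    apply Rle_trans with (K0 * (1 / 200000 / K0)); [apply Rmult_le_compat_l; unfold K0 in *; lra|]. right. field. unfold K0. lra. }
  destruct He1 as (He1 & He2 & He3).
  destruct (data_W D a hinit eps ltac:(lra) Hhi) as [Wi _]. destruct (data_W D b0 hdot eps ltac:(lra) Hhd) as [Wd Zd].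
  fold (S a) in Wi. fold (S b0) in Wd. specialize (Zd eq_refl).
  assert (Wi' : W 3 (rc hinit) (C0 * eps)).
  { eapply W_mono; [apply Rle_refl| |exact Wi]. rewrite Rmult_comm. apply Rmult_le_compat_r; [lra|]. unfold C0. pose proof (HS b0). lra. }
  assert (Wd' : W 3 (rc hdot) (C0 * eps)).
  { eapply W_mono; [apply Rle_refl| |exact Wd]. rewrite Rmult_comm. apply Rmult_le_compat_r; [lra|]. unfold C0. pose proof (HS a). lra. }
  destruct (WW (C0 * eps) hinit hdot T hww www HT He1 Wi' Wd' Sww) as (ht & Hon & Hin & Hz).
  destruct (QM (C0 * eps) hinit hdot T hqm HT He2 Wi' Wd' Zd Sqm) as (P & Qon & Qin & Qz).
  apply CX_norm_le. intros t Ht.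
  assert (HCe : 0 <= C0 * eps) by nra.
  replace (cst6 g Tmax al * (K0 * C0) ^ 3 * eps ^ 3) with (cst6 g Tmax al * (K0 * (C0 * eps)) ^ 3) by ring.
  apply (height2 g T Tmax al (K0 * (C0 * eps)) hww www ht hqm P); auto.
  - eapply ww_on_mono; [|exact Hon]. unfold K0. nra.
  - intros s Hs. destruct (Qz s Hs) as (Q1 & Q2 & _). split; eapply W_mono; eauto; try lra; unfold K0; nra.
  - intros s Hs. destruct (Qz s Hs) as (_ & _ & Q3 & Q4). split; auto. rewrite Q4, (Hz s Hs). apply cft_ext.
    intros x. unfold rc. now rewrite (proj1 (Hin x)), (proj1 (Qin x)).
  - intros x. destruct (Qin x) as [-> ->]. auto.
Qed.
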